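(* Let $\mathcal X\subseteq\mathbb R^d$ be a compact convex set and $0<r\le R$ with $r\mathbb B_p^d\subseteq\mathcal X\subseteq R\mathbb B_p^d$. Let $f_1,\dots,f_T:\mathbb R^d\to\mathbb R$ be convex functions that satisfy $|f_t(x)-f_t(y)|\le G\|x-y\|_q$ for all $x,y\in\mathcal X$ and all $t$, where $G>0$. Let $\psi:\operatorname{int}(\mathcal X)\to\mathbb R$ be differentiable and $\lambda$-strongly convex with respect to $\|\cdot\|_p$, $\lambda>0$. Put $$\mu=\min\Big\{\frac{R\sqrt{\xi_{p,q}(d)}}{\sqrt{\lambda T}\,c_\mu(p,q,d)},\ \frac r2\Big\},\qquad \alpha=\mu/r,\qquad \gamma=\frac{1}{\sqrt{48}(1+\sqrt2)RG\sqrt{\xi_{p,q}(d)T}},$$ fix $y^1\in\mathcal X_\alpha$ and a constant $A_\psi^\alpha\ge F_\psi^\alpha+\sup_{v\in\mathcal X_\alpha}B_\psi(v;y^1)+\max\{1,\lambda\}R^2$, and set $$N=\Big\lceil\tfrac12\log_2\Big(1+\frac{2RG_\psi^\alpha T}{A_\psi^\alpha}\Big)\Big\rceil+1,\qquad \eta_{(k)}=2^{k-1}\sqrt{\frac{A_\psi^\alpha}{6(1+\sqrt2)^2G^2\xi_{p,q}(d)T/\lambda}},\quad k=1,\dots,N.$$ Run the algorithm PBMD with these parameters. Then there is an absolute constant $C$ such that for every comparator sequence $u^1,\dots,u^T\in\mathcal X$, with $\mathcal P_{T,p}=\sum_{t=1}^{T-1}\|u^{t+1}-u^t\|_p$, $$\mathbb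 E\Big[\sum_{t=1}^T\Big(\frac{f_t(x^{t,+})+f_t(x^{t,-})}{2}-f_t(u^t)\Big)\Big]\le C\,G\sqrt{\big(A_\psi^\alpha+G_\psi^\alpha\mathcal P_{T,p}\big)\,\xi_{p,q}(d)\,T/\lambda},$$ where the expectation is over $s^1,\dots,s^T$.
   Context: Integers $d\ge3$, $T\ge1$; $p,q\in[1,\infty]$; $p^*$ is the conjugate exponent, $1/p+1/p^*=1$ ($1/\infty=0$). $\mathbb B_p^d=\{x\in\mathbb R^d:\|x\|_p\le1\}$; $\partial\mathbb B_1^d=\{x:\|x\|_1=1\}$; $\log$ is the natural logarithm. $\operatorname{sign}$ acts componentwise, with $\operatorname{sign}(0)=1$. For $\alpha\in(0,1)$, $\mathcal X_\alpha=(1-\alpha)\mathcal X=\{(1-\alpha)x:x\in\mathcal X\}$ (contained in $\operatorname{int}(\mathcal X)$). The functions $f_t$ and comparators $u^t$ are fixed (do not depend on the random vectors $s^1,\dots,s^T$). Bregman divergence: $B_\psi(x;y)=\psi(x)-\psi(y)-\langle\nabla\psi(y),x-y\rangle$. $\lambda$-strong convexity with respect to $\|\cdot\|_p$: $B_\psi(x;y)\ge\frac\lambda2\|x-y\|_p^2$. $F_\psi^\alpha=\sup_{\mathcal X_\alpha}\psi-\inf_{\mathcal X_\alpha}\psi$, $G_\psi^\alpha=\sup_{y\in\mathcal X_\alpha}\|\nabla\psi(y)\|_{p^*}$. Constants: $\xi_{p,q}(d)=d^{1+2/\min\{q,2\}-2/p}$; $\upsilon_{p,q}(d)=d^{1/q-1/\max\{q,p\}}$;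 $\zeta_q(d)=q\,d^{1/q}/(d+1)$ if $1\le q<\log d$ and $\zeta_q(d)=e\log(d)/(d+1)$ if $q\ge\log d$; $c_\mu(p,q,d)=1+2\zeta_q(d)+\frac Rr\upsilon_{p,q}(d)$. Algorithm PBMD (inputs $\mu,\alpha,\gamma>0$, $N$, step sizes $\eta_{(1)},\dots,\eta_{(N)}>0$, $\psi$, $y^1\in\mathcal X_\alpha$). Initialize $y_{(k)}^1=y^1$ and $\omega_{(k)}^1=\frac{N+1}{N}\frac1{k(k+1)}$ for $k=1,\dots,N$. For $t=1,\dots,T$: set $y^t=\sum_{k=1}^N\omega_{(k)}^ty_{(k)}^t$; draw $s^t$ uniformly (normalized surface measure) on $\partial\mathbb B_1^d$, independently of the past; play $x^{t,\pm}=y^t\pm\mu s^t$; set $g^t=\frac{d}{2\mu}\big(f_t(x^{t,+})-f_t(x^{t,-})\big)\operatorname{sign}(s^t)$ and $\varphi^t(y)=\langle g^t,y-y^t\rangle$; update $$\omega_{(k)}^{t+1}=\frac{\omega_{(k)}^t\exp(-\gamma\varphi^t(y_{(k)}^t))}{\sum_{j=1}^N\omega_{(j)}^t\exp(-\gamma\varphi^t(y_{(j)}^t))},\qquad y_{(k)}^{t+1}=\operatorname*{argmin}_{y\in\mathcal X_\alpha}\ \langle g^t,y\rangle+\frac1{\eta_{(k)}}B_\psi(y;y_{(k)}^t).$$ *)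

(* Defs.v *)
From HB Require Import structures.
From mathcomp Require Import all_boot all_order all_algebra.
From mathcomp Require Import all_classical all_reals all_analysis.

Set Implicit Arguments.
Unset Strict Implicit.
Unset Printing Implicit Defensive.

Import Order.TTheory GRing.Theory Num.Theory.
Import numFieldNormedType.Exports.

Local Open Scope classical_set_scope.
Local Open Scope ring_scope.

(* Exponents are extended reals [p] with [1 <= p]; the [-oo] branch is junk. *)
Definition lpnorm (R : realType) (p : \bar R) (d : nat) (x : 'rV[R]_d) : R :=
  match p with
  | a%:E => (\sum_(i < d) `|x 0 i| `^ a) `^ a^-1
  | +oo%E => \big[Num.max/0]_(i < d) `|x 0 i|
  | -oo%E => 0
  end.

(* [1 / p] as a real number, with [1 / +oo = 0] *)
Definition recip (R : realType) (p : \bar R) : R := fine (p^-1)%E.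

Definition scale_set (R : realType) (d : nat) (c : R) (A : set 'rV[R]_d) :
  set 'rV[R]_d := [set c *: x | x in A].

Definition lp_ball (R : realType) (p : \bar R) (d : nat) : set 'rV[R]_d :=
  [set x | lpnorm p x <= 1].

Definition l1_sphere (R : realType) (d : nat) : set 'rV[R]_d :=
  [set x | lpnorm 1%E x = 1].

Definition dotp (R : realType) (d : nat) (x y : 'rV[R]_d) : R :=
  \sum_(i < d) x 0 i * y 0 i.

Definition signv (R : realType) (d : nat) (x : 'rV[R]_d) : 'rV[R]_d :=
  \row_(i < d) (if x 0 i < 0 then -1 else 1).

Definition grad (R : realType) (d : nat) (psi : 'rV[R]_d -> R)
  (y : 'rV[R]_d) : 'rV[R]_d := \row_(i < d) 'D_(delta_mx 0 i) psi y.

Definition bregman (R : realType) (d : nat) (psi : 'rV[R]_d -> R)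
  (x y : 'rV[R]_d) : R := psi x - psi y - dotp (grad psi y) (x - y).

Definition strongly_convex_on (R : realType) (d : nat) (p : \bar R)
  (lambda : R) (D : set 'rV[R]_d) (psi : 'rV[R]_d -> R) : Prop :=
  forall x y, D x -> D y ->
    lambda / 2 * lpnorm p (x - y) ^+ 2 <= bregman psi x y.

Definition argmin (R : realType) (d : nat) (D : set 'rV[R]_d)
  (F : 'rV[R]_d -> R) : set 'rV[R]_d :=
  [set y | D y /\ forall z, D z -> F y <= F z].

(* On Borel sets, Lebesgue measure on R^n, as the n-fold product of the
   one-dimensional one: the measure of [A] is the integral of the measures of
   its sections in the first coordinate. *)
Fixpoint lebesgue_volume (R : realType) (n : nat) :
    set 'rV[R]_n -> \bar R :=
  match n return set 'rV[R]_n -> \bar R with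
  | 0 => fun A => (\1_A 0)%:E
  | m.+1 => fun A => (\int[@lebesgue_measure R]_x
      lebesgue_volume [set v : 'rV[R]_m | A (row_mx (const_mx x : 'rV_1) v)])%E
  end.

(* Point of the unit l1-sphere of R^(n+1) lying over [x] in the unit l1-ball of
   R^n, in the upper ([e = 1]) or lower ([e = -1]) half. *)
Definition l1_graph (R : realType) (n : nat) (e : R) (x : 'rV[R]_n) :
  'rV[R]_(n.+1) :=
  \row_(i < n.+1) (if unlift ord_max i is Some j then x 0 j
                   else e * (1 - lpnorm 1%E x)).

(* Surface measure of the unit l1-sphere of R^(n+1), which is the union of the
   graphs of [h = 1 - |.|_1] and [-h] over the unit l1-ball of R^n. All partial
   derivatives of [h] are 1 or -1 almost everywhere, so the surface element
   sqrt (1 + |grad h|^2) dx equals sqrt (n + 1) dx. *)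
Definition l1_sphere_area (R : realType) (d : nat) : set 'rV[R]_d -> \bar R :=
  match d return set 'rV[R]_d -> \bar R with
  | 0 => fun=> 0%E
  | n.+1 => fun A =>
     ((Num.sqrt n.+1%:R)%:E *
       (lebesgue_volume [set x : 'rV[R]_n | lp_ball 1%E x /\ A (l1_graph 1 x)]
      + lebesgue_volume
          [set x : 'rV[R]_n | lp_ball 1%E x /\ A (l1_graph (- 1) x)]))%E
  end.

Definition borel_set (T : topologicalType) (A : set T) : Prop :=
  <<s @open T >> A.

Definition random_element (dO : measure_display) (Omega : measurableType dO)
  (T : topologicalType) (s : Omega -> T) : Prop :=
  forall A : set T, borel_set A -> measurable (s @^-1` A).

Definition uniform_on_l1_sphere (R : realType) (dO : measure_display)
  (Omega : measurableType dO) (P : probability Omega R) (d : nat)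
  (s : Omega -> 'rV[R]_d) : Prop :=
  forall A : set 'rV[R]_d, borel_set A ->
    P (s @^-1` A)
    = (l1_sphere_area A / l1_sphere_area (@l1_sphere R d))%E.

Definition mutually_independent (R : realType) (dO : measure_display)
  (Omega : measurableType dO) (P : probability Omega R) (T : topologicalType)
  (n : nat) (s : nat -> Omega -> T) : Prop :=
  forall (J : {set 'I_n}) (A : 'I_n -> set T),
    (forall t, borel_set (A t)) ->
    P [set w | forall t : 'I_n, t \in J -> A t (s t w)]
    = (\prod_(t in J) P (s t @^-1` A t))%E.

Definition xi (R : realType) (p q : \bar R) (d : nat) : R :=
  d%:R `^ (1 + 2 * recip (Order.min q 2%:E) - 2 * recip p).

Definition upsilon (R : realType) (p q : \bar R) (d : nat) : R :=
  d%:R `^ (recip q - recip (Order.max q p)).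

Definition zeta (R : realType) (q : \bar R) (d : nat) : R :=
  if (q < (ln d%:R)%:E)%E then fine q * d%:R `^ recip q / (d%:R + 1)
  else expR 1 * ln d%:R / (d%:R + 1).

Definition c_mu (R : realType) (p q : \bar R) (d : nat) (r rho : R) : R :=
  1 + 2 * zeta q d + rho / r * upsilon p q d.

(* If [psi] is convex and differentiable on a neighborhood of a nonempty compact
   [Xa], then [psi] and its gradient are continuous there, so the sets below are
   bounded and the total functions [sup] and [inf] have their usual meaning. *)
Definition F_psi (R : realType) (d : nat) (psi : 'rV[R]_d -> R)
  (Xa : set 'rV[R]_d) : R := sup (psi @` Xa) - inf (psi @` Xa).

Definition G_psi (R : realType) (p : \bar R) (d : nat) (psi : 'rV[R]_d -> R)
  (Xa : set 'rV[R]_d) : R :=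
  sup [set lpnorm (hoelder_conjugate p) (grad psi y) | y in Xa].

(* Rounds and experts are numbered from 0: round [t] and expert [k] here are
   round t+1 and expert k+1 in the usual numbering from 1. A state is the
   pair of the weights and the iterates of the [N] experts. *)
Definition pbmd_state (R : realType) (d N : nat) : Type :=
  ('I_N -> R) * ('I_N -> 'rV[R]_d).

Definition pbmd_init (R : realType) (d N : nat) (y1 : 'rV[R]_d) :
  pbmd_state R d N :=
  (fun k : 'I_N => (N%:R + 1) / N%:R * (1 / (k.+1%:R * k.+2%:R)), fun=> y1).

Definition pbmd_point (R : realType) (d N : nat) (st : pbmd_state R d N) :
  'rV[R]_d := \sum_(k < N) st.1 k *: st.2 k.

Definition grad_estimate (R : realType) (d : nat) (mu : R)
  (f : 'rV[R]_d -> R) (y s : 'rV[R]_d) : 'rV[R]_d :=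
  (d%:R / (2 * mu) * (f (y + mu *: s) - f (y - mu *: s))) *: signv s.

(* The default value of [xget] is used only if there is no minimizer. *)
Definition pbmd_step (R : realType) (d N : nat) (mu gamma : R)
  (eta : 'I_N -> R) (psi : 'rV[R]_d -> R) (Xa : set 'rV[R]_d)
  (f : 'rV[R]_d -> R) (s : 'rV[R]_d) (st : pbmd_state R d N) :
  pbmd_state R d N :=
  let y := pbmd_point st in
  let g := grad_estimate mu f y s in
  let phi z := dotp g (z - y) in
  let w k := st.1 k * expR (- gamma * phi (st.2 k)) in
  (fun k => w k / \sum_(j < N) w j,
   fun k => xget 0 (argmin Xa
     (fun z => dotp g z + (eta k)^-1 * bregman psi z (st.2 k)))).

Fixpoint pbmd (R : realType) (d N : nat) (mu gamma : R)
  (eta : 'I_N -> R) (psi : 'rV[R]_d -> R) (Xa : set 'rV[R]_d)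
  (y1 : 'rV[R]_d) (f : nat -> 'rV[R]_d -> R) (s : nat -> 'rV[R]_d)
  (t : nat) : pbmd_state R d N :=
  match t with
  | 0 => pbmd_init N y1
  | t'.+1 => pbmd_step mu gamma eta psi Xa (f t') (s t')
               (pbmd mu gamma eta psi Xa y1 f s t')
  end.

Definition pbmd_regret (R : realType) (d N : nat) (mu gamma : R)
  (eta : 'I_N -> R) (psi : 'rV[R]_d -> R) (Xa : set 'rV[R]_d)
  (y1 : 'rV[R]_d) (f : nat -> 'rV[R]_d -> R) (s : nat -> 'rV[R]_d)
  (T : nat) (u : nat -> 'rV[R]_d) : R :=
  \sum_(0 <= t < T)
    let y := pbmd_point (pbmd mu gamma eta psi Xa y1 f s t) in
    ((f t (y + mu *: s t) + f t (y - mu *: s t)) / 2 - f t (u t)).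

Definition path_length (R : realType) (p : \bar R) (d T : nat)
  (u : nat -> 'rV[R]_d) : R :=
  \sum_(0 <= t < T.-1) lpnorm p (u t.+1 - u t).

(* Main.v *)
(** Let the coordinates of [L] be independent with Laplace density exp(-|x|)/2.
The density of [L] depends on |L|_1 only, so the direction L/|L|_1 is independent
of |L|_1 and follows the normalized surface measure of the l1-sphere: moments of
[s] are quotients of moments of [L], and Fubini applies to [L].

One round, for a fixed [y] in X_alpha: Stokes' formula on the l1-ball says that
the mean of the estimator [g] is the gradient at [y] of the average of [f] over
y + mu B_1, so that f(y) - f(v) is at most E<g, y - v> up to 24 G mu zeta. The
second moment of [g] is controlled by the variance of f(y + mu s), and the
latter by the Poincare inequality of the product Laplace law, applied to the
smooth reparametrization L/(1 + |L|_1) of [s]. Both steps need a C^1 function,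
and [f] is first replaced by its Moreau envelope.

Mirror descent with step [eta k], against the comparators (1 - alpha) u^t, and
exponential weights bound sum_t <g^t, y^t - v^t> for every outcome.  Since y^t
depends on the past only and s^t is independent of it, the two one-round
estimates can be inserted under the expectation; it remains to choose the expert
[k] whose step is within a factor 2 of the optimal one. *)

(* A second moment of order G^2 xi requires a variance of f(y + mu s) of order mu^2 G2^2 / d^2,
   where G2 is the Euclidean Lipschitz constant. The Lipschitz bound alone gives only one factor
   1/d, because |s|_2^2 has mean of order 1/d. The Laplace law supplies the other: its Poincare
   constant 4 does not grow with the dimension, and |L|_1 is of order d, so the map from L to the
   direction has derivatives of order 1/d. That map is singular at the origin, hence the radius 1 +
   |L|_1; and |.|_1 has corners, hence one-dimensional inequalities on each half-line, centred at
   the value at 0. Areas and volumes are never evaluated. Their finiteness follows from the total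
   mass 1 of the Laplace law, and the constant in Stokes' formula is found by inserting linear
   functions. A second obstacle is that the iterates are selected minimizers and that the suprema
   over the domain are total functions: the iterates must be shown to be Borel functions of the past
   directions, and the suprema to be finite, before independence and the regret bound can be
   used. *)
Require Import Defs.
From HB Require Import structures.
From mathcomp Require Import all_boot all_order all_algebra all_fingroup.
From mathcomp Require Import all_classical all_reals all_analysis.
From mathcomp Require Import measurable_realfun ring lra.
Import Order.TTheory GRing.Theory Num.Theory.
Import numFieldNormedType.Exports.
Local Open Scope classical_set_scope.
Local Open Scope ring_scope.

Set Implicit Arguments.
Unset Strict Implicit.
Unset Printing Implicit Defensive.

(* Row vectors with their Borel sigma-algebra. *)
Notation rVB R n := (g_sigma_algebraType (@open 'rV[R]_n)).

(** * Borel sets of row vectors *)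

Section BorelRowVectors.
Variable R : realType.

Lemma rV_open_box n (U : set 'rV[R]_n) (x : 'rV[R]_n) : open U -> U x ->
  exists (q : 'rV[rat]_n) (k : nat),
    (forall i, `|x 0 i - ratr (q 0 i)| < k.+1%:R^-1) /\
    (forall y : 'rV[R]_n, (forall i, `|y 0 i - ratr (q 0 i)| < k.+1%:R^-1) -> U y).
Proof.
move=> oU Ux.
have [e /= e0 eU] : exists2 e : R, 0 < e & ball x e `<=` U.
  by apply/nbhs_ballP; apply: open_nbhs_nbhs; split.
pose k := Num.truncn (2 / e).
have ke : k.+1%:R^-1 < e / 2.
  rewrite -[X in _ < X]invrK invf_div ltf_pV2 ?posrE ?ltr0n// ?divr_gt0//.
  exact: truncnS_gt.
have /all_sig[q Hq] : forall i : 'I_n, {q : rat | `|x 0 i - ratr q| < k.+1%:R^-1}.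
  move=> i; apply: cid.
  have [q qi] : exists q : rat, (ratr q : R) \in `](x 0 i - k.+1%:R^-1), (x 0 i + k.+1%:R^-1)[.
    by apply: rat_in_itvoo; have k0 : 0 < k.+1%:R^-1 :> R; [rewrite invr_gt0|rewrite ltrBlDr -addrA ltrDl addr_gt0].
  exists q; move: qi; rewrite in_itv/= => /andP[h1 h2].
  by move: h1 h2; set a := _^-1; rewrite ltr_norml => h1 h2; apply/andP; split; lra.
exists (\row_i q i), k; split=> [i|y Hy]; first by rewrite mxE.
apply: eU; split=> // i j; rewrite ord1 -ball_normE /ball_/=.
have := Hy j; rewrite !mxE => h1; have h2 := Hq j.
have : `|x 0 j - y 0 j| <= `|x 0 j - ratr (q j)| + `|y 0 j - ratr (q j)|.
  by rewrite (distrC (y 0 j)) (le_trans _ (ler_normD _ _))// addrA subrK.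
by move: ke h1 h2; set a := _^-1 => ke h1 h2 h3; lra.
Qed.

Lemma measurable_rVP d (T : measurableType d) n (h : T -> 'rV[R]_n) :
  (forall i, measurable_fun setT (fun w => h w 0 i)) ->
  measurable_fun setT (h : T -> rVB R n).
Proof.
move=> mh; apply: (@measurability _ _ T (rVB R n) _ _ (@open 'rV[R]_n)) => //.
move=> _ [U oU <-]; rewrite setTI.
pose B (a : 'rV[rat]_n * nat) : set T :=
  [set w | forall i, `|h w 0 i - ratr (a.1 0 i)| < a.2.+1%:R^-1].
have mB a : measurable (B a).
  have -> : B a = \bigcap_(i in [set: 'I_n])
     ((fun w => h w 0 i) @^-1` ball (ratr (a.1 0 i) : R) a.2.+1%:R^-1).
    apply/seteqP; split=> w /= Hw i.
      by move=> _; rewrite /ball/= distrC.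
    by have := Hw i I; rewrite /ball/= distrC.
  apply: fin_bigcap_measurable; first exact: finite_finset.
  move=> i _; rewrite -[X in measurable X]setTI; apply: mh => //.
  by apply: open_measurable; exact: ball_open.
pose D := [set a | B a `<=` h @^-1` U].
have -> : h @^-1` U = \bigcup_(a in D) B a.
  apply/seteqP; split=> [w /= Uw|w [a Da Ba]]; last exact: Da.
  have [q [k [h1 h2]]] := rV_open_box oU Uw.
  by exists (q, k) => //= v Bv; exact: h2.
(* The boxes are enumerated through [unpickle]; a code that belongs to no box, or to a box outside
   [D], contributes the empty set. *)
pose C (m : nat) : set T := if unpickle m is Some a then
   (if `[< D a >] then B a else set0) else set0.
have -> : \bigcup_(a in D) B a = \bigcup_m C m.
  apply/seteqP; split=> [w [a Da Ba]|w [m _]].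
    by exists (pickle a) => //; rewrite /C pickleK asboolT.
  rewrite /C; case: unpickle => // a; case: ifPn => // /asboolP Da Ba.
  by exists a.
apply: bigcup_measurable => m _; rewrite /C; case: unpickle => // a.
by case: ifPn => // _; exact: mB.
Qed.

Lemma continuous_measurable_rV n (f : 'rV[R]_n -> R) : continuous f ->
  measurable_fun setT (f : rVB R n -> R).
Proof.
move=> cf; apply: (measurability _ (RGenOpens.measurableE R)).
move=> _ [U [a [b ->]] <-]; rewrite setTI; apply: sub_sigma_algebra.
by apply: open_comp => //; exact: interval_open.
Qed.

Lemma measurable_coord n (i : 'I_n) :
  measurable_fun setT (fun x : rVB R n => x 0 i : R).
Proof. by apply: continuous_measurable_rV; exact: coord_continuous. Qed.

Lemma continuous_measurable_rV2 n m (f : 'rV[R]_n -> 'rV[R]_m) : continuous f ->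
  measurable_fun setT (f : rVB R n -> rVB R m).
Proof.
move=> cf; apply: (@measurability _ _ (rVB R n) (rVB R m) _ _ (@open 'rV[R]_m)) => //.
move=> _ [U oU <-]; rewrite setTI; apply: sub_sigma_algebra.
by apply: open_comp.
Qed.

(** Functions are written on ['rV[R]_n], whereas the Borel sigma-algebra sits on the alias
    [rVB R n]; here the alias is supplied for the intermediate space. *)
Lemma measurable_compV d (T : measurableType d) d' (U : measurableType d') n
    (f : 'rV[R]_n -> U) (g : T -> 'rV[R]_n) :
  measurable_fun setT (f : rVB R n -> U) ->
  measurable_fun setT (g : T -> rVB R n) -> measurable_fun setT (fun w => f (g w)).
Proof. by move=> mf mg; exact: (@measurableT_comp _ _ _ T (rVB R n) U). Qed.

Lemma measurable_coordV d (T : measurableType d) n (g : T -> 'rV[R]_n) i :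
  measurable_fun setT (g : T -> rVB R n) -> measurable_fun setT (fun w => g w 0 i).
Proof. exact: (measurable_compV (measurable_coord i)). Qed.

End BorelRowVectors.

(** * Integration against a measure given by a density *)

Section Density.
Local Open Scope ereal_scope.
Import HBNNSimple.
Context d (T : measurableType d) (R : realType).
Variables (mu nu : {measure set T -> \bar R}) (g : T -> R).
Hypothesis mg : measurable_fun setT g.
Hypothesis g0 : forall x, (0 <= g x)%R.
Hypothesis nuE : forall A, measurable A -> nu A = \int[mu]_(x in A) (g x)%:E.

(** From indicators to simple functions by linearity, then by monotone convergence. It turns
    integrals under the Laplace law into Lebesgue integrals. *)
Lemma ge0_integral_density (f : T -> \bar R) :
  measurable_fun setT f -> (forall x, 0 <= f x) ->
  \int[nu]_x f x = \int[mu]_x (f x * (g x)%:E).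
Proof.
move=> mf f0; pose f_ := nnsfun_approx measurableT mf.
have cf x : (f_ n x)%:E @[n --> \oo] --> f x.
  by apply: cvg_nnsfun_approx => // *; exact: f0.
transitivity (limn (fun n => \int[nu]_x (f_ n x)%:E)).
  rewrite -monotone_convergence//.
  - by apply: eq_integral => y _; apply/esym/cvg_lim.
  - by move=> n; exact/measurable_EFinP/measurable_funP.
  - by move=> n y _; rewrite lee_fin.
  - by move=> y _ m n mn; rewrite lee_fin; exact/lefP/nd_nnsfun_approx.
rewrite [X in limn X](_ : _ = (fun n => \int[mu]_x ((f_ n x)%:E * (g x)%:E))); last first.
  apply/funext => n.
  under eq_integral do rewrite fimfunE -fsumEFin//.
  rewrite ge0_integral_fsum//; last 2 first.
  - by move=> y; exact/measurable_EFinP/measurable_funM.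
  - by move=> y x _; rewrite EFinM nnfun_muleindic_ge0.
  under [RHS]eq_integral => x _.
    rewrite fimfunE -fsumEFin// ge0_mule_fsuml; last first.
      by move=> r; rewrite EFinM nnfun_muleindic_ge0.
    over.
  rewrite ge0_integral_fsum//; last 2 first.
  - move=> r; apply: emeasurable_funM; last exact/measurable_EFinP.
    by apply/measurable_EFinP/measurable_funM.
  - by move=> r x _; rewrite mule_ge0 ?lee_fin// -lee_fin EFinM nnfun_muleindic_ge0.
  apply: eq_fsbigr => r _; rewrite integralZl_indic_nnsfun// integral_indic//.
  rewrite setIT nuE//.
  transitivity (\int[mu]_x (r%:E * (g x * \1_(f_ n @^-1` [set r]) x)%:E)); last first.
    by apply: eq_integral => x _; rewrite -!EFinM mulrAC mulrA.
  (* A nonnegative simple function has empty level sets at values r < 0, where both sides vanish. *)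
  have [r0|r0] := leP 0%R r.
    rewrite ge0_integralZl//.
    - congr (_ * _); rewrite [LHS]integral_mkcond; apply: eq_integral => x _.
      by rewrite patchE indicE; case: ifPn => _; rewrite ?mulr1 ?mulr0.
    - exact/measurable_EFinP/measurable_funM.
    - by move=> x _; rewrite lee_fin mulr_ge0.
  rewrite preimage_nnfun0//; rewrite integral_set0 mule0 integral0_eq// => x _.
  by rewrite indic0 mulr0 mule0.
rewrite -monotone_convergence//.
- apply: eq_integral => x _; apply/cvg_lim => //.
  by apply: cvgeZr.
- by move=> n; apply: emeasurable_funM; apply/measurable_EFinP.
- by move=> n x _; rewrite mule_ge0// lee_fin.
- move=> x _ m n mn; rewrite lee_wpmul2r ?lee_fin//.
  by exact/lefP/nd_nnsfun_approx.
Qed.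

End Density.

(** * The Laplace law *)

Section Laplace.
Variable R : realType.
Local Notation mu := (@lebesgue_measure R).

Lemma cvg_expRN_y (c : R) : 0 < c -> expR (- (c * x)) @[x --> +oo] --> (0 : R).
Proof.
move=> c0; apply: (@cvg_comp _ _ _ (fun x => c * x) (fun z => expR (- z)) _ (pinfty_nbhs R)).
  exact: gt0_cvgMry.
exact: cvgr_expR.
Qed.

Lemma integral_expRN (c : R) : 0 < c ->
  (\int[mu]_(x in `[0%R, +oo[) (expR (- (c * x)))%:E = (c^-1)%:E)%E.
Proof.
move=> c0.
have cexp : continuous (fun x : R => expR (- (c * x))).
  move=> x; apply: continuous_comp; last exact: continuous_expR.
  by apply: (@continuousN _ R^o); apply: (@continuousM _ R^o) => //; exact: cst_continuous.
rewrite (@ge0_continuous_FTC2y _ _ (fun x => - (c^-1 * expR (- (c * x)))) _ 0)//.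
- by rewrite mulr0 oppr0 expR0 mulr1 EFinN oppeK add0e.
- exact: continuous_subspaceT.
- rewrite -oppr0 -[in X in _ --> - X](mulr0 c^-1); apply: cvgN; apply: cvgMr.
  exact: cvg_expRN_y.
- by apply: cvgN; apply/cvg_at_right_filter; apply: cvgMr; exact: cexp.
- move=> x _; rewrite derive1E derive_val; rewrite /GRing.scale/=.
  by field; rewrite gt_eqF.
Qed.

Definition laplace_pdf (x : R) : R := expR (- `|x|) / 2.

Lemma laplace_pdf_ge0 x : 0 <= laplace_pdf x.
Proof. by rewrite divr_ge0// expR_ge0. Qed.

Lemma measurable_laplace_pdf : measurable_fun setT laplace_pdf.
Proof.
apply: continuous_measurable_fun => x.
apply: (@continuousM _ R^o (fun x => expR (- `|x|)) (fun=> 2^-1)); last exact: cst_continuous.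
apply: continuous_comp; last exact: continuous_expR.
by apply: (@continuousN _ R^o); exact: norm_continuous.
Qed.

Definition laplace := fun V => (\int[mu]_(x in V) (laplace_pdf x)%:E)%E.

Let lap0 : laplace set0 = 0%E.
Proof. by rewrite /laplace integral_set0. Qed.

Let laplace_ge0 A : (0 <= laplace A)%E.
Proof. by rewrite integral_ge0//= => x _; rewrite lee_fin laplace_pdf_ge0. Qed.

Let laplace_sigma_additive : semi_sigma_additive laplace.
Proof.
move=> /= F mF tF mUF; rewrite /laplace; apply: cvg_toP.
  apply: ereal_nondecreasing_is_cvgn => m n mn.
  apply: lee_sum_nneg_natr => // k _ _; apply: integral_ge0 => /= x Fkx.
  by rewrite lee_fin laplace_pdf_ge0.
rewrite ge0_integral_bigcup//=.
- by apply/measurable_funTS/measurable_EFinP; exact: measurable_laplace_pdf.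
- by move=> x _; rewrite lee_fin laplace_pdf_ge0.
Qed.

HB.instance Definition _ := isMeasure.Build _ _ _ laplace
  lap0 laplace_ge0 laplace_sigma_additive.

(** Both half-lines are brought to [[0, +oo[], on which |x| is smooth. *)
Lemma ge0_integral_even (f : R -> \bar R) : measurable_fun setT f ->
  (forall x, 0 <= f x)%E ->
  (\int[mu]_x f x = \int[mu]_(x in `[0%R, +oo[) f x +
                    \int[mu]_(x in `[0%R, +oo[) f (- x)%R)%E.
Proof.
move=> mf f0; rewrite -(setUv `[0%R, +oo[%classic) ge0_integral_setU//=; last 3 first.
  exact: measurableC.
  by rewrite setUv.
  exact/disj_setPCl.
congr (_ + _)%E; rewrite ge0_integration_by_substitution0//; last first.
  by apply: measurableT_comp => //; exact: measurable_oppr.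
rewrite setCitvr/= integral_itv_bndo_bndc//; last exact: measurable_funTS.
by apply: eq_integral => x _; rewrite opprK.
Qed.

Lemma ge0_integral_laplace (f : R -> \bar R) : measurable_fun setT f ->
  (forall x, 0 <= f x)%E ->
  (\int[laplace]_x f x = \int[mu]_x (f x * (laplace_pdf x)%:E))%E.
Proof.
move=> mf f0; rewrite (@ge0_integral_density _ _ _ mu laplace laplace_pdf)//.
- exact: measurable_laplace_pdf.
- exact: laplace_pdf_ge0.
Qed.

(** One formula for several purposes: c = 0 gives the total mass, c = -1 and c = 1/2 give the moment
    estimates further on. *)
Lemma integral_laplace_exp (c : R) : c < 1 ->
  (\int[laplace]_x (expR (c * `|x|))%:E = ((1 - c)^-1)%:E)%E.
Proof.
move=> c1.
have mE : measurable_fun setT (fun x : R => (expR (c * `|x|))%:E).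
  apply/measurable_EFinP; apply: continuous_measurable_fun => x.
  apply: continuous_comp; last exact: continuous_expR.
  by apply: (@continuousM _ R^o); [exact: cst_continuous|exact: norm_continuous].
rewrite ge0_integral_laplace//.
rewrite ge0_integral_even//=; last 2 first.
  apply: emeasurable_funM => //; by apply/measurable_EFinP; exact: measurable_laplace_pdf.
  by move=> x; rewrite mule_ge0// lee_fin ?expR_ge0 ?laplace_pdf_ge0.
have H : (\int[mu]_(x in `[0%R, +oo[) ((expR (c * `|x|))%:E * (laplace_pdf x)%:E)
    = (2^-1 * (1 - c)^-1)%:E)%E.
  rewrite EFinM -(@integral_expRN (1 - c)) ?subr_gt0// -ge0_integralZl//=.
  - apply: eq_integral => x; rewrite inE/= in_itv/= andbT => x0.
    rewrite -!EFinM /laplace_pdf ger0_norm// mulrA -expRD mulrC; congr (_ * expR _)%:E.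
    ring.
  - apply/measurable_EFinP; apply: measurable_funTS; apply: continuous_measurable_fun => x.
    apply: continuous_comp; last exact: continuous_expR.
    by apply: (@continuousN _ R^o); apply: (@continuousM _ R^o) => //; exact: cst_continuous.
rewrite H; under eq_integral do rewrite normrN /laplace_pdf normrN -/(laplace_pdf _).
by rewrite H -EFinD -mulrDl -[2^-1]mul1r -splitr mul1r.
Qed.

Let laplaceT : laplace setT = 1%E.
Proof.
have := @integral_laplace_exp 0 ltr01.
under eq_integral do rewrite mul0r expR0.
by rewrite integral_cst// mul1e subr0 invr1.
Qed.

HB.instance Definition _ := Measure_isProbability.Build _ _ _ laplace laplaceT.

End Laplace.

Section ProductProbability.
Local Open Scope ereal_scope.
Context d1 d2 (T1 : measurableType d1) (T2 : measurableType d2) (R : realType).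
Variables (P1 : probability T1 R) (P2 : probability T2 R).

(** Under a name of its own the product carries the probability structure from which [distribution]
    is formed. *)
Definition prod_prob := P1 \x P2.

HB.instance Definition _ := Measure.on prod_prob.

Let prod_probT : prod_prob setT = 1.
Proof.
rewrite -setXTT; apply: etrans (product_measure1E P1 P2 measurableT measurableT) _.
by rewrite -[RHS]mule1; congr (_ * _); exact: probability_setT.
Qed.

HB.instance Definition _ :=
  Measure_isProbability.Build _ _ _ prod_prob prod_probT.

End ProductProbability.

Section LaplaceVector.
Variable R : realType.

Definition cons_rV n (x : R) (v : 'rV[R]_n) : 'rV[R]_n.+1 :=
  row_mx (const_mx x : 'rV_1) v.

Lemma cons_rV0 n x (v : 'rV[R]_n) : cons_rV x v 0 ord0 = x.
Proof.
have -> : ord0 = lshift n (ord0 : 'I_1) by exact: val_inj.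
by apply: (etrans (@row_mxEl R 1 1 n (const_mx x) v 0 ord0)); rewrite mxE.
Qed.

Lemma cons_rVS n x (v : 'rV[R]_n) (i : 'I_n) : cons_rV x v 0 (lift ord0 i) = v 0 i.
Proof.
have -> : lift ord0 i = rshift 1 i by exact: val_inj.
exact: (@row_mxEr R 1 1 n (const_mx x) v 0 i).
Qed.

Lemma measurable_cons_rV n :
  measurable_fun setT (fun z : R * rVB R n => cons_rV z.1 z.2 : rVB R n.+1).
Proof.
apply: measurable_rVP => i; case: (unliftP ord0 i) => [j ->|->].
  under eq_fun do rewrite cons_rVS.
  exact: (measurableT_comp (measurable_coord j)).
by under eq_fun do rewrite cons_rV0; exact: measurable_fst.
Qed.

Definition cons_rVp n (z : measurableTypeR R * rVB R n) : rVB R n.+1 :=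
  cons_rV z.1 z.2.

HB.instance Definition _ n := isMeasurableFun.Build _ _ _ _
  (@cons_rVp n) (@measurable_cons_rV n).

(** Coordinates are prepended one at a time, exactly as in [lebesgue_volume], so that the two can be
    compared by induction on the dimension. *)
Fixpoint laplaceV n : probability (rVB R n) R :=
  match n return probability (rVB R n) R with
  | 0 => (\d_(0 : rVB R 0))
  | m.+1 => distribution (prod_prob (@laplace R) (laplaceV m)) (@cons_rVp m)
  end.

Lemma ge0_integral_laplaceVS n (f : 'rV[R]_n.+1 -> \bar R) :
  measurable_fun setT (f : rVB R n.+1 -> _) -> (forall u, 0 <= f u)%E ->
  (\int[laplaceV n.+1]_u f u = \int[@laplace R]_x \int[laplaceV n]_v f (cons_rV x v))%E.
Proof.
move=> mf f0; rewrite ge0_integral_distribution//.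
apply: etrans (fubini_tonelli1 (m1 := @laplace R) (m2 := laplaceV n) (f \o @cons_rVp n) _ _) _ => //.
  by apply: measurableT_comp => //; exact: measurable_cons_rV.
by move=> z; exact: f0.
Qed.

Lemma ge0_integral_laplaceVS_swap n (f : 'rV[R]_n.+1 -> \bar R) :
  measurable_fun setT (f : rVB R n.+1 -> _) -> (forall u, 0 <= f u)%E ->
  (\int[laplaceV n.+1]_u f u = \int[laplaceV n]_v \int[@laplace R]_x f (cons_rV x v))%E.
Proof.
move=> mf f0; rewrite ge0_integral_distribution//.
apply: etrans (fubini_tonelli2 (m1 := @laplace R) (m2 := laplaceV n) (f \o @cons_rVp n) _ _) _ => //.
  by apply: measurableT_comp => //; exact: measurable_cons_rV.
by move=> z; exact: f0.
Qed.

Definition rect n (A : 'I_n -> set R) : set 'rV[R]_n :=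
  [set u | forall i, A i (u 0 i)].

Lemma measurable_rect n (A : 'I_n -> set R) : (forall i, measurable (A i)) ->
  measurable (rect A : set (rVB R n)).
Proof.
move=> mA; have -> : rect A = \bigcap_(i in [set: 'I_n])
    ((fun u : rVB R n => u 0 i) @^-1` A i).
  by apply/seteqP; split=> u /= Hu i; [move=> _|]; exact: Hu.
apply: fin_bigcap_measurable; first exact: finite_finset.
by move=> i _; rewrite -[X in measurable X]setTI; exact: measurable_coord.
Qed.

Lemma laplaceV_rect n (A : 'I_n -> set R) : (forall i, measurable (A i)) ->
  laplaceV n (rect A) = (\prod_(i < n) laplace (A i))%E.
Proof.
elim: n A => [|n IH] A mA.
  by rewrite big_ord0 /= diracE mem_set// => -[].
rewrite big_ord_recl/= -(IH (fun i => A (lift ord0 i)))//.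
rewrite /distribution /pushforward/=.
rewrite (_ : _ @^-1` _ = A ord0 `*` rect (fun i => A (lift ord0 i))).
  apply: (product_measure1E (@laplace R) (laplaceV n) (mA _) (measurable_rect _)) => i; exact: mA.
apply/seteqP; split=> [[x v]/= H|[x v]/= [H1 H2] i].
  split=> [|i]/=; first by have := H ord0; rewrite cons_rV0.
  by have := H (lift ord0 i); rewrite cons_rVS.
by case: (unliftP ord0 i) => [j ->|->]; rewrite ?cons_rVS ?cons_rV0.
Qed.

Lemma rVB_rect n : @measurable _ (rVB R n) =
  <<s [set rect A | A in [set A : 'I_n -> set R | forall i, measurable (A i)]] >>.
Proof.
set G := [set rect A | A in _]; apply/seteqP; split=> [A|].
  pose T := g_sigma_algebraType G.
  (* The identity is measurable because its coordinates are: the preimage of a set under one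
     coordinate is a rectangle whose other sides are the whole line. *)
  have mid : measurable_fun setT (id : T -> rVB R n).
    apply: measurable_rVP => i _ Y mY; rewrite setTI; apply: sub_sigma_algebra.
    exists (fun j => if j == i then Y else setT) => [j|].
      by case: ifP.
    apply/seteqP; split=> u /= H; first by have := H i; rewrite eqxx.
    by move=> j; case: ifPn => // /eqP ->.
  by move=> mA; have := mid measurableT A mA; rewrite setTI.
apply: smallest_sub; first exact: (@sigma_algebra_measurable _ (rVB R n)).
by move=> _ [A mA <-]; exact: measurable_rect.
Qed.

(** Rectangles form a generating pi-system. The symmetries of the law (reflection, permutation of
    coordinates, splitting off the last coordinate instead of the first) are all read off from their
    effect on rectangles. *)
Lemma laplaceV_unique n (m : {measure set (rVB R n) -> \bar R}) :
  (forall A, (forall i, measurable (A i)) -> m (rect A) = (\prod_(i < n) laplace (A i))%E) ->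
  forall B, measurable B -> m B = laplaceV n B.
Proof.
move=> mE B mB.
pose G : set (set (rVB R n)) :=
  [set rect A | A in [set A : 'I_n -> set R | forall i, measurable (A i)]].
apply: (@measure_unique _ R (rVB R n) G (fun=> setT) (rVB_rect n) _ _ _ m (laplaceV n)) => //.
- move=> _ _ [A1 mA1 <-] [A2 mA2 <-]; exists (fun i => A1 i `&` A2 i).
    by move=> i; apply: measurableI.
  apply/seteqP; split=> u /= H; last by move=> i; split; apply H.
  by split=> i; have [] := H i.
- by move=> _; exists (fun=> setT) => //; apply/seteqP; split.
- by rewrite bigcup_const//; exists 0%N.
- by move=> _ [A mA <-]; rewrite mE//; exact/esym/laplaceV_rect.
- move=> _; have -> : [set: rVB R n] = rect (fun=> setT) by apply/seteqP; split.
  by rewrite mE// big1 ?ltry// => i _; exact: probability_setT.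
Qed.

Lemma ge0_integral_laplaceV_map n (h : 'rV[R]_n -> 'rV[R]_n)
    (mh : measurable_fun setT (h : rVB R n -> rVB R n)) (f : 'rV[R]_n -> \bar R) :
  (forall A, (forall i, measurable (A i)) ->
     laplaceV n (h @^-1` rect A) = (\prod_(i < n) laplace (A i))%E) ->
  measurable_fun setT (f : rVB R n -> _) -> (forall u, 0 <= f u)%E ->
  (\int[laplaceV n]_u f (h u) = \int[laplaceV n]_u f u)%E.
Proof.
move=> hE mf f0.
have := @ge0_integral_pushforward _ _ (rVB R n) (rVB R n) R h mh (laplaceV n) setT f measurableT mf.
rewrite preimage_setT => <-; last by move=> y _; exact: f0.
apply: eq_measure_integral => A mA _.
by apply: laplaceV_unique.
Qed.

Lemma laplace_opp (A : set R) : measurable A -> laplace (-%R @^-1` A) = laplace A.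
Proof.
move=> mA; rewrite {2}/laplace.
transitivity (\int[pushforward (@lebesgue_measure R) (-%R : _ -> measurableTypeR R)]_(x in A) (laplace_pdf x)%:E)%E.
  rewrite ge0_integral_pushforward//.
  - by apply: eq_integral => x _ /=; rewrite /laplace_pdf normrN.
  - by apply/measurable_EFinP; apply: measurable_funTS; exact: measurable_laplace_pdf.
  - by move=> x _; rewrite lee_fin laplace_pdf_ge0.
by apply: eq_measure_integral => B mB _; exact: lebesgue_measureN.
Qed.

Lemma ge0_integral_laplaceV_opp n (f : 'rV[R]_n -> \bar R) :
  measurable_fun setT (f : rVB R n -> _) -> (forall u, 0 <= f u)%E ->
  (\int[laplaceV n]_u f (- u)%R = \int[laplaceV n]_u f u)%E.
Proof.
apply: ge0_integral_laplaceV_map.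
  apply: measurable_rVP => i; under eq_fun do rewrite mxE.
  by apply: measurableT_comp => //; exact: measurable_coord.
move=> A mA; rewrite (_ : _ @^-1` _ = rect (fun i => -%R @^-1` A i)).
  rewrite laplaceV_rect => [|i]; last by rewrite -[X in measurable X]setTI; exact: oppr_measurable.
  by apply: eq_bigr => i _; exact: laplace_opp.
by apply/seteqP; split=> u /= H i; have := H i; rewrite mxE.
Qed.

Definition rV_perm n (s : 'S_n) (u : 'rV[R]_n) : 'rV[R]_n := col_perm s u.

Lemma measurable_rV_perm n (s : 'S_n) :
  measurable_fun setT (rV_perm s : rVB R n -> rVB R n).
Proof.
apply: measurable_rVP => i; under eq_fun do rewrite mxE.
exact: measurable_coord.
Qed.

Lemma ge0_integral_laplaceV_perm n (s : 'S_n) (f : 'rV[R]_n -> \bar R) :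
  measurable_fun setT (f : rVB R n -> _) -> (forall u, 0 <= f u)%E ->
  (\int[laplaceV n]_u f (rV_perm s u) = \int[laplaceV n]_u f u)%E.
Proof.
apply: ge0_integral_laplaceV_map; first exact: measurable_rV_perm.
move=> A mA; rewrite (_ : _ @^-1` _ = rect (fun i => A ((s^-1)%g i))).
  by rewrite laplaceV_rect// [RHS](reindex_inj (@perm_inj _ (s^-1)%g)).
apply/seteqP; split=> u /= H i.
  by have := H ((s^-1)%g i); rewrite mxE permKV.
by rewrite mxE; have := H (s i); rewrite permK.
Qed.

End LaplaceVector.

(** * Translation and scaling of Lebesgue measure *)

Section LebesgueInvariance.
Variable R : realType.
Local Notation mu := (@lebesgue_measure R).
Local Open Scope ereal_scope.

Lemma lebesgue_measureD (a : R) (A : set R) : measurable A ->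
  pushforward mu ((fun x => x + a)%R : _ -> measurableTypeR R) A = mu A.
Proof.
move=> mA.
have ma : measurable_fun setT ((fun x => x + a)%R : measurableTypeR R -> measurableTypeR R).
  exact: measurable_funD.
apply/esym/(@lebesgue_measure_unique _ (pushforward mu ((fun x => x + a)%R : measurableTypeR R -> measurableTypeR R))) => //= _ [[b c]] _ <-.
rewrite /pushforward.
rewrite (_ : _ @^-1` _ = `](b - a)%R, (c - a)%R]%classic); last first.
  by apply/seteqP; split=> x /=; rewrite !in_itv/= ltrBlDr lerBrDr.
rewrite /= !lebesgue_measure_itv/= !lte_fin ltrD2r -!EFinB.
by case: ifP => // _; congr EFin; ring.
Qed.

Lemma ge0_integral_shift (a : R) (f : R -> \bar R) : measurable_fun setT f ->
  (forall x, 0 <= f x) -> \int[mu]_x f (x + a)%R = \int[mu]_x f x.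
Proof.
move=> mf f0.
have ma : measurable_fun setT ((fun x => x + a)%R : measurableTypeR R -> measurableTypeR R).
  exact: measurable_funD.
have := @ge0_integral_pushforward _ _ _ _ R _ ma mu setT f measurableT mf.
rewrite preimage_setT => <-; last by move=> y _; exact: f0.
by apply: eq_measure_integral => B mB _; exact: lebesgue_measureD.
Qed.

Local Notation pfm m mf :=
  (measure_function_pushforward__canonical__measure_function_Measure m mf).

(** Lebesgue measure is determined by its values on half-open intervals, and c times its image under
    x -> c x has the same values. *)
Lemma ge0_integral_scale (c : R) (f : R -> \bar R) : (0 < c)%R ->
  measurable_fun setT f -> (forall x, 0 <= f x) ->
  c%:E * \int[mu]_x f (c * x)%R = \int[mu]_x f x.
Proof.
move=> c0 mf f0.
have ma : measurable_fun setT ((fun x => c * x)%R : measurableTypeR R -> measurableTypeR R).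
  exact: measurable_funM.
have := @ge0_integral_pushforward _ _ _ _ R _ ma mu setT f measurableT mf.
rewrite preimage_setT => <-; last by move=> y _; exact: f0.
pose k : {nonneg R} := NngNum (ltW c0).
transitivity (\int[mscale k (pfm mu ma)]_x f x).
  by rewrite ge0_integral_mscale.
apply: eq_measure_integral => A mA _; apply/esym.
apply: (@lebesgue_measure_unique _ (mscale k (pfm mu ma))) => //= _ [[a b]] _ <-.
rewrite /mscale/= /pushforward.
rewrite (_ : _ @^-1` _ = `](a / c)%R, (b / c)%R]%classic); last first.
  by apply/seteqP; split=> x /=; rewrite !in_itv/= ltr_pdivrMr// ler_pdivlMr// (mulrC c).
rewrite /= !lebesgue_measure_itv/= !lte_fin ltr_pM2r ?invr_gt0// -!EFinB.
case: ifP => // _; rewrite ?mule0// -EFinM; congr EFin.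
by field; rewrite gt_eqF.
Qed.

End LebesgueInvariance.

Section Ind.
Variable R : realType.
Local Open Scope ereal_scope.

Definition eind (b : bool) : \bar R := (b%:R)%:E.

Lemma eind_ge0 b : 0 <= eind b. Proof. by rewrite lee_fin. Qed.

Lemma measurable_eind d (T : measurableType d) (b : T -> bool) :
  measurable_fun setT b -> measurable_fun setT (fun x => eind (b x)).
Proof.
move=> mb; apply/measurable_EFinP.
by apply: (measurableT_comp (f := fun b : bool => b%:R : R)).
Qed.

Lemma ge0_integral_eind d (T : measurableType d) (m : {measure set T -> \bar R})
  (b : T -> bool) (f : T -> \bar R) :
  \int[m]_(x in [set x | b x]) f x = \int[m]_x (eind (b x) * f x).
Proof.
rewrite integral_mkcond; apply: eq_integral => x _; rewrite patchE /eind.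
case: ifPn; rewrite ?inE ?notin_setE/=; first by move->; rewrite mul1e.
by move/negP/negbTE ->; rewrite mul0e.
Qed.

End Ind.

Section L1.
Variable R : realType.

Definition l1 n (u : 'rV[R]_n) : R := \sum_(i < n) `|u 0 i|.

Lemma lpnorm1E n (u : 'rV[R]_n) : lpnorm 1%E u = l1 u.
Proof.
rewrite /lpnorm/= invr1 powRr1; last by apply: sumr_ge0 => i _; exact: powR_ge0.
by apply: eq_bigr => i _; rewrite powRr1.
Qed.

Lemma l1_ge0 n (u : 'rV[R]_n) : 0 <= l1 u.
Proof. by apply: sumr_ge0. Qed.

Lemma l1Z n c (u : 'rV[R]_n) : l1 (c *: u) = `|c| * l1 u.
Proof. by rewrite /l1 mulr_sumr; apply: eq_bigr => i _; rewrite mxE normrM. Qed.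

Lemma l1N n (u : 'rV[R]_n) : l1 (- u) = l1 u.
Proof. by apply: eq_bigr => i _; rewrite mxE normrN. Qed.

Lemma l1_cons n x (v : 'rV[R]_n) : l1 (cons_rV x v) = `|x| + l1 v.
Proof.
by rewrite /l1 big_ord_recl cons_rV0; congr (_ + _); apply: eq_bigr => i _; rewrite cons_rVS.
Qed.

Lemma l1_perm n s (v : 'rV[R]_n) : l1 (rV_perm s v) = l1 v.
Proof.
rewrite /l1 [RHS](reindex_inj (@perm_inj _ s)).
by apply: eq_bigr => i _; rewrite mxE.
Qed.

Lemma measurable_l1 n : measurable_fun setT (@l1 n : rVB R n -> R).
Proof.
apply: measurable_sum => i; apply: measurableT_comp => //.
exact: measurable_coord.
Qed.

Definition rcons_rV n (v : 'rV[R]_n) (t : R) : 'rV[R]_n.+1 :=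
  \row_(i < n.+1) (if unlift ord_max i is Some j then v 0 j else t).

Lemma rcons_rV_max n v t : @rcons_rV n v t 0 ord_max = t.
Proof. by rewrite mxE unlift_none. Qed.

Lemma rcons_rV_lift n v t j : @rcons_rV n v t 0 (lift ord_max j) = v 0 j.
Proof. by rewrite mxE liftK. Qed.

Lemma l1_rcons n (v : 'rV[R]_n) t : l1 (rcons_rV v t) = l1 v + `|t|.
Proof.
rewrite /l1 big_ord_recr/= rcons_rV_max; congr (_ + _); apply: eq_bigr => i _.
by rewrite -(rcons_rV_lift v t i); congr (`|_ _ _|); apply: val_inj; rewrite /= /bump leqNgt ltn_ord.
Qed.

Lemma rcons_rVZ n c (v : 'rV[R]_n) t : rcons_rV (c *: v) (c * t) = c *: rcons_rV v t.
Proof. by apply/rowP => i; rewrite !mxE; case: unliftP => [j _|_]; rewrite ?mxE. Qed.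

Lemma l1_graphE n e (x : 'rV[R]_n) : l1_graph e x = rcons_rV x (e * (1 - l1 x)).
Proof. by apply/rowP => i; rewrite !mxE lpnorm1E. Qed.

Lemma measurable_rcons_rV d (T : measurableType d) n (v : T -> 'rV[R]_n) (t : T -> R) :
  (forall i, measurable_fun setT (fun w => v w 0 i)) -> measurable_fun setT t ->
  measurable_fun setT (fun w => rcons_rV (v w) (t w) : rVB R n.+1).
Proof.
move=> mv mt; apply: measurable_rVP => i; case: (unliftP ord_max i) => [j ->|->].
  rewrite (_ : (fun w => _) = (fun w => v w 0 j))//.
  by apply/funext => w; exact: rcons_rV_lift.
by under eq_fun do rewrite rcons_rV_max.
Qed.

Definition rcons_rVp n (z : rVB R n * measurableTypeR R) : rVB R n.+1 :=
  rcons_rV z.1 z.2.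

Lemma measurable_rcons_rVp n : measurable_fun setT (@rcons_rVp n).
Proof.
apply: measurable_rcons_rV => [i|]; last exact: measurable_snd.
by apply: (measurableT_comp (measurable_coord i)); exact: measurable_fst.
Qed.

HB.instance Definition _ n := isMeasurableFun.Build _ _ _ _
  (@rcons_rVp n) (@measurable_rcons_rVp n).

(** The recursion of [laplaceV] peels off the first coordinate, but [l1_graph] singles out the last
    one. The two iterated laws agree on rectangles. *)
Lemma ge0_integral_laplaceV_rcons n (f : 'rV[R]_n.+1 -> \bar R) :
  measurable_fun setT (f : rVB R n.+1 -> _) -> (forall u, 0 <= f u)%E ->
  (\int[laplaceV R n.+1]_u f u = \int[laplaceV R n]_v \int[@laplace R]_t f (rcons_rV v t))%E.
Proof.
move=> mf f0.
transitivity (\int[distribution (prod_prob (laplaceV R n) (@laplace R)) (@rcons_rVp n)]_u f u)%E.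
  apply: eq_measure_integral => B mB _; apply/esym; apply: laplaceV_unique => // A mA.
  rewrite big_ord_recr/= /distribution /pushforward.
  rewrite (_ : _ @^-1` _ = rect (fun i => A (widen_ord (leqnSn n) i)) `*` A ord_max).
    rewrite -laplaceV_rect//.
    by apply: (product_measure1E (laplaceV R n) (@laplace R) (measurable_rect _) (mA _)) => i; exact: mA.
  have E i : widen_ord (leqnSn n) i = lift ord_max i.
    by apply: val_inj; rewrite /= /bump leqNgt ltn_ord.
  apply/seteqP; split=> [[v x]/= H|[v x]/= [H1 H2] i].
    split=> [i|]/=; first by have := H (lift ord_max i); rewrite rcons_rV_lift E.
    by have := H ord_max; rewrite rcons_rV_max.
  case: (unliftP ord_max i) => [j ->|->]; last by rewrite rcons_rV_max.
  by rewrite rcons_rV_lift -E; exact: H1.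
rewrite ge0_integral_distribution//.
apply: etrans (fubini_tonelli1 (m1 := laplaceV R n) (m2 := @laplace R) (f \o @rcons_rVp n) _ _) _ => //.
  by apply: measurableT_comp => //; exact: measurable_rcons_rVp.
by move=> z; exact: f0.
Qed.

End L1.

(** * Polar decomposition for the l1-norm *)

Section Polar.
Variable R : realType.
Local Notation mu := (@lebesgue_measure R).
Local Open Scope ereal_scope.

Definition exp_l1 n (u : 'rV[R]_n) : \bar R := (expR (l1 u))%:E.

Lemma exp_l1_ge0 n (u : 'rV[R]_n) : 0 <= exp_l1 u.
Proof. by rewrite lee_fin expR_ge0. Qed.

Lemma measurable_exp_l1 n : measurable_fun setT (@exp_l1 n : rVB R n -> _).
Proof.
by apply/measurable_EFinP; apply: measurableT_comp => //; exact: measurable_l1.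
Qed.

Lemma exp_l1_cons n x (v : 'rV[R]_n) : exp_l1 (cons_rV x v) = (expR `|x|)%:E * exp_l1 v.
Proof. by rewrite /exp_l1 l1_cons expRD EFinM. Qed.

Lemma cons_rVZ n c x (v : 'rV[R]_n) :
  (c *: cons_rV x v)%R = cons_rV (c * x) (c *: v).
Proof.
apply/rowP => i; case: (unliftP ord0 i) => [j ->|->].
  by rewrite mxE (cons_rVS x v j) (cons_rVS (c * x) (c *: v) j) mxE.
by rewrite mxE !cons_rV0.
Qed.

Lemma measurable_rVZ d (T : measurableType d) n (c : T -> R) (v : T -> 'rV[R]_n) :
  measurable_fun setT c -> (forall i, measurable_fun setT (fun w => v w 0%R i)) ->
  measurable_fun setT (fun w => (c w *: v w)%R : rVB R n).
Proof.
move=> mc mv; apply: measurable_rVP => i; under eq_fun do rewrite mxE.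
exact: measurable_funM.
Qed.

Lemma measurable_cons2 d (T : measurableType d) n (c : T -> R) (v : T -> 'rV[R]_n) :
  measurable_fun setT c -> measurable_fun setT (v : T -> rVB R n) ->
  measurable_fun setT (fun w => cons_rV (c w) (v w) : rVB R n.+1).
Proof.
move=> mc mv; apply: measurable_rVP => i; case: (unliftP ord0 i) => [j ->|->].
  rewrite (_ : (fun w => _) = (fun w => v w 0%R j)); last first.
    by apply/funext => w; exact: cons_rVS.
  exact: measurable_coordV.
rewrite (_ : (fun w => _) = c)//; apply/funext => w; exact: cons_rV0.
Qed.

Lemma integral_laplace_expR (k : R -> \bar R) : measurable_fun setT k ->
  (forall x, 0 <= k x) ->
  \int[@laplace R]_x ((expR `|x|)%:E * k x) = 2^-1%:E * \int[mu]_x k x.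
Proof.
move=> mk k0.
have mexp : measurable_fun setT (fun x : R => (expR `|x|)%:E).
  by apply/measurable_EFinP; apply: measurableT_comp => //; exact: measurableT_comp.
rewrite ge0_integral_laplace => [||x]; last 2 first.
- exact: emeasurable_funM.
- by rewrite mule_ge0// lee_fin expR_ge0.
rewrite -ge0_integralZl//; apply: eq_integral => x _.
rewrite muleAC -EFinM /laplace_pdf expRN mulrA divff ?mul1r// gt_eqF ?expR_gt0.
Qed.

(** This is the homogeneity of n-dimensional Lebesgue measure: relative to the Laplace law that
    measure has a density proportional to [exp_l1]. Each coordinate contributes one factor t. *)
Lemma integral_laplaceV_scale n (t : R) (H : 'rV[R]_n -> \bar R) : (0 < t)%R ->
  measurable_fun setT (H : rVB R n -> _) -> (forall u, 0 <= H u) ->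
  \int[laplaceV R n]_u (exp_l1 u * H (t^-1 *: u)%R) = (t ^+ n)%:E * \int[laplaceV R n]_u (exp_l1 u * H u).
Proof.
move=> t0; elim: n H => [|n IH] H mH H0.
  rewrite expr0 mul1e; apply: eq_integral => u _; congr (_ * H _).
  by apply/rowP => -[].
pose G (z : R * rVB R n) := exp_l1 z.2 * H (cons_rV z.1 z.2).
pose K y := \int[laplaceV R n]_v (exp_l1 v * H (cons_rV y v)).
have mHc y : measurable_fun setT (fun v : rVB R n => H (cons_rV y v)).
  by apply: measurable_compV => //; apply: measurable_cons2.
have mG : measurable_fun setT G.
  apply: emeasurable_funM.
    by apply: measurableT_comp; [exact: measurable_exp_l1|exact: measurable_snd].
  by apply: measurable_compV => //; exact: measurable_cons_rV.
have G0 z : 0 <= G z by rewrite mule_ge0// exp_l1_ge0.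
have mK : measurable_fun setT K.
  by have := @measurable_fun_fubini_tonelli_F _ _ _ _ R (laplaceV R n) G mG G0.
have K0 y : 0 <= K y by apply: integral_ge0 => v _; rewrite mule_ge0// exp_l1_ge0.
have mexp : measurable_fun setT (fun x : R => (expR `|x|)%:E).
  by apply/measurable_EFinP; apply: measurableT_comp => //; exact: measurableT_comp.
have mKt : measurable_fun setT (fun x => K (t^-1 * x)%R).
  by apply: measurableT_comp => //; exact: measurable_funM.
transitivity (\int[@laplace R]_x ((expR `|x|)%:E * ((t ^+ n)%:E * K (t^-1 * x)%R))).
  rewrite ge0_integral_laplaceVS => [||u]; last 2 first.
  - apply: emeasurable_funM; first exact: measurable_exp_l1.
    apply: measurable_compV => //; apply: measurable_rVZ => // i.
    exact: measurable_coord.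
  - by rewrite mule_ge0// exp_l1_ge0.
  apply: eq_integral => x _; rewrite -IH//.
  rewrite -ge0_integralZl//=.
  - by apply: eq_integral => v _; rewrite exp_l1_cons cons_rVZ muleA.
  - apply: emeasurable_funM; first exact: measurable_exp_l1.
    apply: (measurable_compV (mHc _)).
    by apply: measurable_rVZ => // i; exact: measurable_coord.
  - by move=> v _; rewrite mule_ge0// exp_l1_ge0.
  - exact: mHc.
have -> : \int[laplaceV R n.+1]_u (exp_l1 u * H u) = \int[@laplace R]_x ((expR `|x|)%:E * K x).
  rewrite ge0_integral_laplaceVS => [||u]; last 2 first.
  - by apply: emeasurable_funM => //; exact: measurable_exp_l1.
  - by rewrite mule_ge0// exp_l1_ge0.
  apply: eq_integral => x _; rewrite -ge0_integralZl//=.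
  - by apply: eq_integral => v _; rewrite exp_l1_cons muleA.
  - by apply: emeasurable_funM => //; exact: measurable_exp_l1.
  - by move=> v _; rewrite mule_ge0// exp_l1_ge0.
have tn0 : 0 <= (t ^+ n)%:E by rewrite lee_fin exprn_ge0// ltW.
apply: etrans (integral_laplace_expR _ _) _.
- exact: emeasurable_funM.
- by move=> x; rewrite mule_ge0.
rewrite (integral_laplace_expR mK K0) (ge0_integralZl mu measurableT mKt (fun x _ => K0 _) tn0).
have tV0 : (0 < t^-1)%R by rewrite invr_gt0.
rewrite -(ge0_integral_scale tV0 mK K0) !muleA; congr (_ * _).
by rewrite -!EFinM; congr EFin; rewrite exprSr; field; rewrite gt_eqF.
Qed.

(* Lebesgue measure has density 2^n exp(|x|_1) with respect to the product
   Laplace law, which replaces it from here on. *)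
Lemma lebesgue_volumeE n (A : set 'rV[R]_n) : measurable (A : set (rVB R n)) ->
  lebesgue_volume A = (2 ^+ n)%:E * \int[laplaceV R n]_u (exp_l1 u * (\1_A u)%:E).
Proof.
elim: n A => [|n IH] A mA.
  rewrite expr0 mul1e integral_dirac//; last first.
    by apply: emeasurable_funM; [exact: measurable_exp_l1|apply/measurable_EFinP].
  by rewrite diracT mul1e /exp_l1 /l1 big_ord0 expR0 mul1e.
have m1 x : measurable ([set v | A (cons_rV x v)] : set (rVB R n)).
  rewrite -[X in measurable X]setTI.
  exact: (@measurable_cons2 _ (rVB R n) n (fun=> x) id).
have mG : measurable_fun setT (fun z : R * rVB R n => exp_l1 z.2 * (\1_A (cons_rV z.1 z.2))%:E).
  apply: emeasurable_funM.
    by apply: measurableT_comp; [exact: measurable_exp_l1|exact: measurable_snd].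
  apply/measurable_EFinP; apply: (measurableT_comp (f := \1_A : rVB R n.+1 -> R)) => //.
  exact: measurable_cons_rV.
have G0 z : 0 <= exp_l1 z.2 * (\1_A (cons_rV z.1 z.2))%:E :> \bar R.
  by rewrite mule_ge0// ?exp_l1_ge0// lee_fin.
rewrite /=; under eq_integral => x _.
  rewrite -[X in lebesgue_volume X]/([set v | A (cons_rV x v)]) IH//.
  over.
rewrite ge0_integralZl//=; last 2 first.
- exact: (@measurable_fun_fubini_tonelli_F _ _ _ _ R (laplaceV R n) _ mG G0).
- by move=> x _; apply: integral_ge0 => v _; exact: (G0 (x, v)).
rewrite ge0_integral_laplaceVS => [||u]; last 2 first.
- by apply: emeasurable_funM; [exact: measurable_exp_l1|apply/measurable_EFinP].
- by rewrite mule_ge0// ?exp_l1_ge0// lee_fin.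
rewrite exprS EFinM -muleA (muleC 2%:E) -muleA; congr (_ * _).
transitivity (\int[@laplace R]_x ((expR `|x|)%:E * \int[laplaceV R n]_v (exp_l1 v * (\1_A (cons_rV x v))%:E)) * 2%:E).
  rewrite integral_laplace_expR; last 2 first.
  - exact: (@measurable_fun_fubini_tonelli_F _ _ _ _ R (laplaceV R n) _ mG G0).
  - by move=> x; apply: integral_ge0 => v _; exact: (G0 (x, v)).
  rewrite muleAC -EFinM mulVf// mul1e.
  by apply: eq_integral => x _; apply: eq_integral => v _; rewrite !indicE.
congr (_ * _); apply: eq_integral => x _; rewrite -ge0_integralZl//=.
- by apply: eq_integral => v _; rewrite exp_l1_cons muleA.
- apply: emeasurable_funM; first exact: measurable_exp_l1.
  apply/measurable_EFinP; apply: (measurableT_comp (f := \1_A : rVB R n.+1 -> R)) => //.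
  exact: (@measurable_cons2 _ (rVB R n) n (fun=> x) id).
- by move=> v _; exact: (G0 (x, v)).
Qed.

Definition l1unit n (u : 'rV[R]_n) : 'rV[R]_n := ((l1 u)^-1 *: u)%R.

Lemma measurable_l1unit n : measurable_fun setT (@l1unit n : rVB R n -> rVB R n).
Proof.
apply: measurable_rVZ => [|i]; last exact: measurable_coord.
rewrite (_ : (fun w => _) = (fun u : rVB R n => l1 u `^ (-1))%R).
  by apply: (measurableT_comp (measurable_powR _)); exact: measurable_l1.
by apply/funext => u; rewrite powR_inv1// l1_ge0.
Qed.

(* Up to a constant, the surface integral of [Phi] over the upper ([e = 1]) or
   lower ([e = -1]) half of the l1-sphere. *)
Definition graph_integral n (Phi : 'rV[R]_n.+1 -> \bar R) (e : R) : \bar R :=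
  \int[laplaceV R n]_x (exp_l1 x * (eind R (l1 x <= 1)%R * Phi (l1_graph e x))).

(** Up to a constant, the mean of [rho] under the Gamma law of |L|_1 for L in R^(n+1), whose density
    is proportional to t^n exp(-t). *)
Definition radial_integral n (rho : R -> \bar R) : \bar R :=
  \int[mu]_t (eind R (0 < t)%R * (rho t * (t ^+ n * (expR (- t) / 2))%:E)).

Section polar.
Variables (n : nat) (Phi : 'rV[R]_n.+1 -> \bar R) (rho : R -> \bar R).
Hypotheses (mPhi : measurable_fun setT (Phi : rVB R n.+1 -> _))
  (Phi0 : forall u, 0 <= Phi u).
Hypotheses (mrho : measurable_fun setT rho) (rho0 : forall t, 0 <= rho t).

(** The integrand in the variables (v, t), where v collects the first n coordinates and t is the
    radius: the last coordinate is e (t - |v|_1), so the whole point has l1-norm t. The power -1 is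
    the inverse in a form that is known to be measurable. *)
Let B (e : R) (z : rVB R n * measurableTypeR R) : \bar R :=
  eind R (l1 z.1 <= z.2)%R *
  (Phi (z.2 `^ (-1) *: rcons_rV z.1 (e * (z.2 - l1 z.1)))%R * rho z.2 *
   (expR (l1 z.1 - z.2) / 2)%:E).

Let ml1 : measurable_fun setT (fun z : rVB R n * measurableTypeR R => l1 z.1).
Proof. by apply: measurableT_comp; [exact: measurable_l1|exact: measurable_fst]. Qed.

Let mB e : measurable_fun setT (B e).
Proof.
have ms : measurable_fun setT (fun z : rVB R n * measurableTypeR R => z.2 : R).
  exact: measurable_snd.
apply: emeasurable_funM.
  by apply: measurable_eind; apply: measurable_fun_ler.
apply: emeasurable_funM; last first.
  apply/measurable_EFinP; apply: measurable_funM => //.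
  by apply: measurableT_comp => //; exact: measurable_funB.
apply: emeasurable_funM; last exact: measurableT_comp.
apply: (measurableT_comp (f := Phi : rVB R n.+1 -> _)) => //.
apply: measurable_rVZ.
  by apply: (measurableT_comp (measurable_powR _)).
move=> i.
apply: measurable_coordV.
apply: measurable_rcons_rV => [j|].
  by apply: measurable_coordV; exact: measurable_fst.
by apply: measurable_funM => //; exact: measurable_funB.
Qed.

Let B0 e z : 0 <= B e z.
Proof.
by rewrite /B !mule_ge0// ?eind_ge0// lee_fin divr_ge0// expR_ge0.
Qed.

(** Translating the absolute value of the last coordinate by |v|_1 makes the radius the variable of
    integration. *)
Let half (e : R) (v : 'rV[R]_n) : (`|e| = 1)%R ->
  \int[mu]_(t in `[0%R, +oo[) (Phi (l1unit (rcons_rV v (e * t)%R)) *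
     rho (l1 (rcons_rV v (e * t)%R)) * (laplace_pdf (e * t))%:E)
  = \int[mu]_t B e (v, t).
Proof.
move=> e1; rewrite -(@ge0_integral_shift _ (l1 v) (fun t => B e (v, t)))//; last first.
  by apply: (measurableT_comp (mB e)); exact: measurable_fun_pair.
rewrite (_ : `[0%R, +oo[%classic = [set t : R | (0 <= t)%R]); last first.
  by apply/seteqP; split=> t /=; rewrite in_itv/= andbT.
rewrite ge0_integral_eind; apply: eq_integral => t _; rewrite /B/= lerDr.
have [t0|t0] := leP 0%R t; last by rewrite /eind !mul0e.
have N : l1 (rcons_rV v (e * t)) = (t + l1 v)%R.
  by rewrite l1_rcons normrM e1 mul1r ger0_norm// addrC.
rewrite /l1unit N addrK powR_inv1 ?addr_ge0 ?l1_ge0// /laplace_pdf.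
by rewrite normrM e1 mul1r ger0_norm// opprD addrCA subrr addr0.
Qed.

(** With the radius t outermost, the substitution v = t x puts x into the unit l1-ball and yields
    the factor t^n; what remains is a function of t times a function of [l1_graph e x]. *)
Let swap (e : R) : (`|e| = 1)%R ->
  \int[laplaceV R n]_v \int[mu]_t B e (v, t) = radial_integral n rho * graph_integral Phi e.
Proof.
move=> e1.
rewrite (fubini_tonelli (m1 := laplaceV R n) (m2 := mu) (B e))//.
pose J t := \int[laplaceV R n]_v B e (v, t).
have mJ : measurable_fun setT J.
  exact: (@measurable_fun_fubini_tonelli_G _ _ _ _ R (laplaceV R n) (B e) (mB e) (B0 e)).
have J0 t : 0 <= J t by apply: integral_ge0.
(* The null set t = 0 is removed because the substitution divides by t. *)
transitivity (\int[mu]_(t in `]0%R, +oo[) J t).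
  rewrite integral_itv_obnd_cbnd//; last exact: measurable_funTS.
  rewrite (_ : `[0%R, +oo[%classic = [set t : R | (0 <= t)%R]); last first.
    by apply/seteqP; split=> t /=; rewrite in_itv/= andbT.
  rewrite ge0_integral_eind; apply: eq_integral => t _.
  have [t0|t0] := leP 0%R t; first by rewrite mul1e.
  rewrite mul0e; apply: integral0_eq => v _; rewrite /B/=.
  by rewrite leNgt (lt_le_trans t0)//= ?l1_ge0// mul0e.
rewrite (_ : `]0%R, +oo[%classic = [set t : R | (0 < t)%R]); last first.
  by apply/seteqP; split=> t /=; rewrite in_itv/= andbT.
have S0 : 0 <= graph_integral Phi e.
  by apply: integral_ge0 => x _; rewrite !mule_ge0// ?exp_l1_ge0// eind_ge0.
rewrite ge0_integral_eind /radial_integral muleC -ge0_integralZl//; last 2 first.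
- apply: emeasurable_funM; first by apply: measurable_eind; exact: measurable_fun_ltr.
  apply: emeasurable_funM => //; apply/measurable_EFinP.
  by apply: measurable_funM => //; apply: measurable_funM => //; exact: measurableT_comp.
- move=> t _; have [t0|t0] := ltP 0%R t; last by rewrite mul0e.
  by rewrite !mule_ge0// ?eind_ge0// lee_fin mulr_ge0 ?divr_ge0 ?expR_ge0 ?exprn_ge0// ltW.
apply: eq_integral => t _; have [t0|t0] := ltP 0%R t; last by rewrite /eind !mul0e mule0.
rewrite !mul1e.
pose H (x : 'rV[R]_n) := eind R (l1 x <= 1)%R * Phi (l1_graph e x).
have mH : measurable_fun setT (H : rVB R n -> _).
  apply: emeasurable_funM.
    by apply: measurable_eind; apply: measurable_fun_ler => //; exact: measurable_l1.
  apply: (measurableT_comp (f := Phi : rVB R n.+1 -> _)) => //.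
  rewrite (_ : l1_graph e = fun x => rcons_rV x (e * (1 - l1 x))); last first.
    by apply/funext => x; rewrite l1_graphE.
  apply: measurable_rcons_rV => [i|]; first exact: measurable_coord.
  by apply: measurable_funM => //; apply: measurable_funB => //; exact: measurable_l1.
have H0 x : 0 <= H x by rewrite mule_ge0// eind_ge0.
transitivity ((rho t * (expR (- t) / 2)%:E) * \int[laplaceV R n]_v (exp_l1 v * H (t^-1 *: v)%R)).
  rewrite -ge0_integralZl//=; last 3 first.
  - apply: emeasurable_funM; first exact: measurable_exp_l1.
    apply: (measurableT_comp (f := H : rVB R n -> _)) => //.
    by apply: measurable_rVZ => // i; exact: measurable_coord.
  - by move=> v _; rewrite mule_ge0// exp_l1_ge0.
  - by rewrite mule_ge0// lee_fin divr_ge0// expR_ge0.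
  apply: eq_integral => v _; rewrite /B /H/= l1Z ger0_norm ?invr_ge0 ?(ltW t0)//.
  rewrite [X in eind R (_ <= X)%R](_ : _ = t * 1)%R ?mulr1//.
  rewrite (mulrC t^-1%R) ler_pdivrMr// mul1r.
  case: (leP (l1 v) t) => [vt|vt]; last by rewrite /eind !mul0e !mule0.
  rewrite !mul1e powR_inv1 ?(ltW t0)// -rcons_rVZ.
  rewrite l1_graphE l1Z ger0_norm ?invr_ge0 ?(ltW t0)//.
  rewrite (_ : t^-1 * (e * (t - l1 v)) = e * (1 - t^-1 * l1 v))%R; last first.
    by field; rewrite gt_eqF.
  rewrite expRD -mulrA EFinM /exp_l1.
  rewrite -!muleA muleC -!muleA; congr (_ * _).
  by rewrite muleCA.
rewrite integral_laplaceV_scale//.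
have -> : \int[laplaceV R n]_u (exp_l1 u * H u) = graph_integral Phi e by [].
rewrite muleA [LHS]muleC -!muleA; congr (_ * (_ * _)).
by rewrite EFinM muleC.
Qed.

Lemma polar :
  \int[laplaceV R n.+1]_u (Phi (l1unit u) * rho (l1 u)) =
  radial_integral n rho * (graph_integral Phi 1 + graph_integral Phi (-1)).
Proof.
have mPr : measurable_fun setT (fun u : rVB R n.+1 => Phi (l1unit u) * rho (l1 u)).
  apply: emeasurable_funM.
    by apply: (measurableT_comp (f := Phi : rVB R n.+1 -> _)) => //; exact: measurable_l1unit.
  by apply: measurableT_comp => //; exact: measurable_l1.
have n1 : (`|1 : R| = 1)%R by rewrite normr1.
have nN1 : (`|- 1 : R| = 1)%R by rewrite normrN1.
rewrite ge0_integral_laplaceV_rcons => [||u]; last 2 first.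
- exact: mPr.
- exact: mule_ge0.
have mh e : measurable_fun setT (fun v : rVB R n => \int[mu]_t B e (v, t)).
  exact: (@measurable_fun_fubini_tonelli_F _ _ _ _ R mu (B e) (mB e) (B0 e)).
transitivity (\int[laplaceV R n]_v (\int[mu]_t B 1 (v, t) + \int[mu]_t B (-1) (v, t))).
  apply: eq_integral => v _.
  have mv : measurable_fun setT (fun t : R => Phi (l1unit (rcons_rV v t)) * rho (l1 (rcons_rV v t))).
    apply: (measurable_compV mPr).
    by apply: measurable_rcons_rV.
  rewrite ge0_integral_laplace//; last by move=> t; exact: mule_ge0.
  rewrite ge0_integral_even; last 2 first.
  - apply: emeasurable_funM => //; apply/measurable_EFinP; exact: measurable_laplace_pdf.
  - by move=> t; rewrite !mule_ge0// lee_fin laplace_pdf_ge0.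
  congr (_ + _); [apply: etrans (half v n1)|apply: etrans (half v nN1)].
    by apply: eq_integral => t _; rewrite mul1r.
  by apply: eq_integral => t _; rewrite mulN1r.
have i0 e v : 0 <= \int[mu]_t B e (v, t) by exact: integral_ge0.
have sg0 e : 0 <= graph_integral Phi e.
  by apply: integral_ge0 => x _; rewrite !mule_ge0// ?exp_l1_ge0// eind_ge0.
rewrite ge0_integralD//= (swap n1) (swap nN1).
exact: (esym (ge0_muleDr _ (sg0 1%R) (sg0 (-1)%R))).
Qed.

End polar.

End Polar.

(** * The uniform law on the l1-sphere as the law of L/|L|_1 *)

Section UniformLaw.
Variable R : realType.
Local Notation mu := (@lebesgue_measure R).
Local Open Scope ereal_scope.

(** Source of finiteness: the radial integral times the surface integral of 1 is the total mass 1 of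
    the Laplace law, so both are positive reals. *)
Lemma mule_eq1 (x y : \bar R) : 0 <= x -> 0 <= y -> x * y = 1 ->
  exists r : R, (0 < r)%R /\ x = r%:E /\ y = (r^-1)%:E.
Proof.
move: x y => [x| |] [y| |]//; rewrite ?lee_fin.
- move=> x0 y0 /eqP; rewrite -EFinM eqe => /eqP xy.
  have x1 : (x != 0)%R by apply: contra_eq_neq xy => ->; rewrite mul0r eq_sym oner_eq0.
  exists x; split; first by rewrite lt_neqAle eq_sym x1.
  by split=> //; congr EFin; rewrite -[y](mulKf x1) xy mulr1.
- move=> x0 _; have [->|xn] := eqVneq x 0%R; first by rewrite mul0e => -[/eqP]; rewrite eq_sym oner_eq0.
  by rewrite gt0_muley// lte_fin lt_neqAle eq_sym xn.
- move=> _ x0; have [->|xn] := eqVneq y 0%R; first by rewrite mule0 => -[/eqP]; rewrite eq_sym oner_eq0.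
  by rewrite gt0_mulye// lte_fin lt_neqAle eq_sym xn.
Qed.

Lemma lp_ball1E n (x : 'rV[R]_n) : lp_ball 1 x = (l1 x <= 1)%R :> Prop.
Proof. by rewrite /lp_ball /mkset lpnorm1E. Qed.

Lemma l1_sphereE n (x : 'rV[R]_n) : l1_sphere x = (l1 x = 1%R) :> Prop.
Proof. by rewrite /l1_sphere /mkset lpnorm1E. Qed.

Definition sphere_integral n (Phi : 'rV[R]_n.+1 -> \bar R) := graph_integral Phi 1 + graph_integral Phi (-1).

Lemma graph_integral_ge0 n (Phi : 'rV[R]_n.+1 -> \bar R) e : (forall u, 0 <= Phi u) ->
  0 <= graph_integral Phi e.
Proof.
by move=> Phi0; apply: integral_ge0 => x _; rewrite !mule_ge0// ?exp_l1_ge0// eind_ge0.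
Qed.

Lemma radial_integral_ge0 n (rho : R -> \bar R) : (forall t, 0 <= rho t) -> 0 <= radial_integral n rho.
Proof.
move=> rho0; apply: integral_ge0 => t _; have [t0|t0] := ltP 0%R t; last by rewrite mul0e.
by rewrite !mule_ge0// ?eind_ge0// lee_fin mulr_ge0 ?divr_ge0 ?expR_ge0 ?exprn_ge0// ltW.
Qed.

Lemma polar1 n (Phi : 'rV[R]_n.+1 -> \bar R) :
  measurable_fun setT (Phi : rVB R n.+1 -> _) -> (forall u, 0 <= Phi u) ->
  \int[laplaceV R n.+1]_u Phi (l1unit u) = radial_integral n (fun=> 1) * sphere_integral Phi.
Proof.
move=> mPhi Phi0.
rewrite -(@polar _ n Phi (fun=> 1))//.
by apply: eq_integral => u _; rewrite mule1.
Qed.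

Lemma radial_sphere_integral n : exists r : R, (0 < r)%R /\ radial_integral n (fun=> 1) = r%:E /\
  sphere_integral (fun _ : 'rV[R]_n.+1 => 1) = (r^-1)%:E.
Proof.
apply: mule_eq1.
- exact: radial_integral_ge0.
- by apply: adde_ge0; exact: graph_integral_ge0.
- rewrite -polar1//.
  by rewrite integral_cst// mul1e; exact: probability_setT.
Qed.

(** The polar formula is a product of a radial and a spherical integral. Applied three times it
    leaves the product of the two total integrals, which is 1. *)
Lemma polar_indep n (Phi : 'rV[R]_n.+1 -> \bar R) (rho : R -> \bar R) :
  measurable_fun setT (Phi : rVB R n.+1 -> _) -> (forall u, 0 <= Phi u) ->
  measurable_fun setT rho -> (forall t, 0 <= rho t) ->
  \int[laplaceV R n.+1]_u (Phi (l1unit u) * rho (l1 u)) =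
  \int[laplaceV R n.+1]_u Phi (l1unit u) * \int[laplaceV R n.+1]_u rho (l1 u).
Proof.
move=> mPhi Phi0 mrho rho0.
rewrite polar// polar1//.
have -> : \int[laplaceV R n.+1]_u rho (l1 u) = radial_integral n rho * sphere_integral (fun _ : 'rV[R]_n.+1 => 1).
  rewrite -polar//.
  by apply: eq_integral => u _; rewrite mul1e.
have [r [r0 [-> ->]]] := radial_sphere_integral n.
rewrite -/(sphere_integral Phi) [RHS]muleC -!muleA; congr (_ * _).
by rewrite muleA -EFinM mulVf ?mul1e// gt_eqF.
Qed.

Lemma lebesgue_volume_graph n (B : set 'rV[R]_n.+1) e : measurable (B : set (rVB R n.+1)) ->
  lebesgue_volume [set x : 'rV[R]_n | lp_ball 1%E x /\ B (l1_graph e x)] =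
  (2 ^+ n)%:E * graph_integral (fun u => (\1_B u)%:E) e.
Proof.
move=> mB; rewrite lebesgue_volumeE.
  congr (_ * _); apply: eq_integral => x _; congr (_ * _).
  rewrite /eind -EFinM; congr EFin.
  rewrite !indicE.
  have [xB|xB] := boolP (x \in _); move: xB; rewrite ?inE ?notin_setE /mkset lp_ball1E.
    by move=> [-> /mem_set ->]; rewrite mulr1.
  move=> /not_andP[/negP/negbTE ->|H]; first by rewrite mul0r.
  by rewrite [_ \in B]memNset// mulr0.
have -> : [set x : 'rV[R]_n | lp_ball 1%E x /\ B (l1_graph e x)] =
   (fun x : rVB R n => (l1 x <= 1)%R) @^-1` [set true] `&` (@l1_graph R n e : rVB R n -> rVB R n.+1) @^-1` B.
  by apply/seteqP; split=> x; rewrite /setI /preimage /mkset lp_ball1E.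
apply: measurableI.
  rewrite -[X in measurable X]setTI; apply: measurable_fun_ler => //.
  exact: measurable_l1.
rewrite -[X in measurable X]setTI.
have mg : measurable_fun setT (@l1_graph R n e : rVB R n -> rVB R n.+1).
  rewrite (_ : l1_graph e = fun x => rcons_rV x (e * (1 - l1 x))%R); last first.
    by apply/funext => x; rewrite l1_graphE.
  apply: measurable_rcons_rV => [i|]; first exact: measurable_coord.
  by apply: measurable_funM => //; apply: measurable_funB => //; exact: measurable_l1.
exact: mg.
Qed.

Lemma l1_l1_graph n e (x : 'rV[R]_n) : (`|e| = 1)%R -> (l1 x <= 1)%R -> l1 (l1_graph e x) = 1%R.
Proof.
move=> e1 x1; rewrite l1_graphE l1_rcons normrM e1 mul1r ger0_norm ?subr_ge0//.
by rewrite addrC subrK.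
Qed.

Lemma measurable_sphere n : measurable (@l1_sphere R n : set (rVB R n)).
Proof.
have -> : @l1_sphere R n = (fun x : rVB R n => l1 x) @^-1` [set 1%R].
  by apply/seteqP; split=> x; rewrite /preimage /mkset l1_sphereE.
rewrite -[X in measurable X]setTI.
by apply: (@measurable_l1 R n) => //; exact: measurable_set1.
Qed.

Lemma l1_sphere_areaE n (B : set 'rV[R]_n.+1) : measurable (B : set (rVB R n.+1)) ->
  l1_sphere_area B = ((Num.sqrt n.+1%:R * 2 ^+ n)%:E * sphere_integral (fun u => (\1_B u)%:E)).
Proof.
move=> mB; rewrite /l1_sphere_area !lebesgue_volume_graph// EFinM -muleA; congr (_ * _).
have s0 e : 0 <= graph_integral (fun u => (\1_B u)%:E) e by apply: graph_integral_ge0 => u; rewrite lee_fin.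
exact: (esym (ge0_muleDr _ (s0 1%R) (s0 (-1)%R))).
Qed.

Lemma law_l1unit dO (Omega : measurableType dO) (P : probability Omega R) n
    (s : Omega -> 'rV[R]_n.+1) (B : set 'rV[R]_n.+1) :
  uniform_on_l1_sphere P s -> borel_set B ->
  P (s @^-1` B) = laplaceV R n.+1 (@l1unit R n.+1 @^-1` B).
Proof.
move=> us mB; rewrite us// l1_sphere_areaE// l1_sphere_areaE; last exact: measurable_sphere.
have -> : sphere_integral (fun u => (\1_(@l1_sphere R n.+1) u)%:E) = sphere_integral (fun _ : 'rV[R]_n.+1 => 1).
  have H e : (`|e| = 1)%R -> graph_integral (fun u => (\1_(@l1_sphere R n.+1) u)%:E) e = graph_integral (fun _ : 'rV[R]_n.+1 => 1) e.
    move=> e1; apply: eq_integral => x _; congr (_ * _).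
    have [x1|x1] := leP (l1 x) 1%R; last by rewrite !mul0e.
    by rewrite indicE mem_set// l1_sphereE l1_l1_graph.
  by rewrite /sphere_integral !H// ?normrN ?normr1.
have [r [r0 [E1 ->]]] := radial_sphere_integral n.
have -> : laplaceV R n.+1 (@l1unit R n.+1 @^-1` B) = r%:E * sphere_integral (fun u => (\1_B u)%:E).
  rewrite -E1 -polar1; last 2 first.
  - by apply/measurable_EFinP; exact: measurable_indic.
  - by move=> u; rewrite lee_fin.
  have := @integral_indic _ _ _ (laplaceV R n.+1) setT measurableT (@l1unit R n.+1 @^-1` B).
  rewrite setIT => <-//.
  by rewrite -[X in measurable X]setTI; exact: measurable_l1unit.
(* [k] occurs in the area of [B] and in the area of the sphere, and cancels in the quotient. *)
set k := (_ * _)%R; have k0 : (0 < k)%R by rewrite mulr_gt0 ?exprn_gt0// sqrtr_gt0 ltr0n.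
rewrite -EFinM inver gt_eqF ?mulr_gt0 ?invr_gt0// muleAC -EFinM; congr (_ * _).
by congr EFin; field; rewrite !gt_eqF.
Qed.

Lemma ge0_integral_uniform dO (Omega : measurableType dO) (P : probability Omega R) n
    (s : Omega -> 'rV[R]_n.+1) (f : 'rV[R]_n.+1 -> \bar R) :
  random_element s -> uniform_on_l1_sphere P s ->
  measurable_fun setT (f : rVB R n.+1 -> _) -> (forall u, 0 <= f u) ->
  \int[P]_w f (s w) = \int[laplaceV R n.+1]_u f (l1unit u).
Proof.
move=> rs us mf f0.
have ms : measurable_fun setT (s : Omega -> rVB R n.+1).
  by move=> _ Y mY; rewrite setTI; exact: rs.
have := @ge0_integral_pushforward _ _ _ (rVB R n.+1) R s ms P setT f measurableT mf.
rewrite preimage_setT => <-; last by move=> y _; exact: f0.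
have := @ge0_integral_pushforward _ _ (rVB R n.+1) (rVB R n.+1) R (@l1unit R n.+1) (@measurable_l1unit R n.+1) (laplaceV R n.+1) setT f measurableT mf.
rewrite preimage_setT => <-; last by move=> y _; exact: f0.
apply: (@eq_measure_integral _ (rVB R n.+1) R setT
  (measure_function_pushforward__canonical__measure_function_Measure (laplaceV R n.+1) (@measurable_l1unit R n.+1))
  (measure_function_pushforward__canonical__measure_function_Measure P ms)) => B mB _.
exact: law_l1unit.
Qed.

End UniformLaw.

(** * Moreau envelope *)

Section ContinuousReal.
Variables (R : realType) (T : topologicalType).
Implicit Types f g : T -> R.

Lemma contD f g : continuous f -> continuous g -> continuous (fun x => f x + g x).
Proof. by move=> cf cg x; apply: cvgD; [exact: cf|exact: cg]. Qed.

Lemma contM f g : continuous f -> continuous g -> continuous (fun x => f x * g x).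
Proof. by move=> cf cg x; apply: cvgM; [exact: cf|exact: cg]. Qed.

Lemma contC (c : R) : continuous (fun _ : T => c).
Proof. by move=> x; exact: cvg_cst. Qed.

Lemma contN f : continuous f -> continuous (fun x => - f x).
Proof. by move=> cf x; apply: cvgN; exact: cf. Qed.

Lemma contB f g : continuous f -> continuous g -> continuous (fun x => f x - g x).
Proof. by move=> cf cg; apply: contD => //; exact: contN. Qed.

(** A criterion for maps whose increments are controlled through squares, as for the gradient of the
    Moreau envelope and for the minimizer as a function of its linear term. *)
Lemma cont_sqr_le g (h : T -> T -> R) : (forall x, continuous (h x)) ->
  (forall x, h x x = 0) -> (forall x y, (g y - g x) ^+ 2 <= h x y) -> continuous g.
Proof.
move=> ch h0 gh x; apply/cvgrPdist_le => e e0.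
have : h x y @[y --> x] --> 0 by rewrite -(h0 x); exact: ch.
move=> /cvgr_lt/(_ _ (exprn_gt0 2 e0)); apply: filterS => y Hy.
rewrite -(@ler_pXn2r _ 2)// ?nnegrE ?(ltW e0)// real_normK ?num_real//.
by apply: le_trans (ltW Hy); rewrite -sqrrN opprB.
Qed.

End ContinuousReal.

Section Dotp.
Variables (R : realType) (d : nat).
Implicit Types x y z : 'rV[R]_d.

Lemma dotpC x y : dotp x y = dotp y x.
Proof. by apply: eq_bigr => i _; rewrite mulrC. Qed.

Lemma dotpDl x y z : dotp (x + y) z = dotp x z + dotp y z.
Proof. by rewrite /dotp -big_split; apply: eq_bigr => i _; rewrite mxE mulrDl. Qed.

Lemma dotpZl c x y : dotp (c *: x) y = c * dotp x y.
Proof. by rewrite /dotp mulr_sumr; apply: eq_bigr => i _; rewrite mxE mulrA. Qed.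

Lemma dotpNl x y : dotp (- x) y = - dotp x y.
Proof. by rewrite -scaleN1r dotpZl mulN1r. Qed.

Lemma dotpBl x y z : dotp (x - y) z = dotp x z - dotp y z.
Proof. by rewrite dotpDl dotpNl. Qed.

Lemma dotpDr x y z : dotp x (y + z) = dotp x y + dotp x z.
Proof. by rewrite dotpC dotpDl !(dotpC x). Qed.

Lemma dotpZr c x y : dotp x (c *: y) = c * dotp x y.
Proof. by rewrite dotpC dotpZl (dotpC x). Qed.

Lemma dotpNr x y : dotp x (- y) = - dotp x y.
Proof. by rewrite dotpC dotpNl (dotpC x). Qed.

Lemma dotpBr x y z : dotp x (y - z) = dotp x y - dotp x z.
Proof. by rewrite dotpDr dotpNr. Qed.

Lemma dotp_ge0 x : 0 <= dotp x x.
Proof. by apply: sumr_ge0 => i _; rewrite -expr2 sqr_ge0. Qed.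

Lemma dotp_delta x i : dotp x (delta_mx 0 i) = x 0 i.
Proof.
rewrite /dotp (bigD1 i)//= big1 => [|j ji]; last by rewrite mxE (negbTE ji) andbF mulr0.
by rewrite mxE !eqxx mulr1 addr0.
Qed.

Lemma sqr_coord_le_dotp x i : x 0 i ^+ 2 <= dotp x x.
Proof.
rewrite /dotp (bigD1 i)//= -expr2 lerDl; apply: sumr_ge0 => j _.
by rewrite -expr2 sqr_ge0.
Qed.

Lemma cauchy_schwarz x y : dotp x y ^+ 2 <= dotp x x * dotp y y.
Proof.
have h : 0 <= dotp (dotp y y *: x - dotp x y *: y) (dotp y y *: x - dotp x y *: y) by exact: dotp_ge0.
move: h; rewrite !(dotpBl,dotpBr,dotpZl,dotpZr) (dotpC y x).
have [y0 _|y0] := eqVneq (dotp y y) 0; last first.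
  have yp : 0 < dotp y y by rewrite lt_neqAle eq_sym y0 dotp_ge0.
  move=> h; have {}h : 0 <= dotp y y * (dotp x x * dotp y y - dotp x y ^+ 2) by lra.
  by move: h; rewrite pmulr_rge0// subr_ge0.
have yi i : y 0 i = 0.
  have : y 0 i ^+ 2 <= 0 by rewrite -y0 sqr_coord_le_dotp.
  by move=> h; apply/eqP; rewrite -sqrf_eq0 eq_le h sqr_ge0.
suff -> : dotp x y = 0 by rewrite expr0n mulr_ge0// dotp_ge0.
by rewrite /dotp big1// => i _; rewrite yi mulr0.
Qed.

Lemma sqr_dotpB x y c : dotp (x - c *: y) (x - c *: y) =
  dotp x x - 2 * c * dotp x y + c ^+ 2 * dotp y y.
Proof.
by rewrite dotpBl !dotpBr !(dotpZl, dotpZr) (dotpC y x); ring.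
Qed.

Lemma cvg_coord (T : Type) (F : set_system T) {FF : Filter F} (a : T -> 'rV[R]_d) (A : 'rV[R]_d) i :
  a t @[t --> F] --> A -> a t 0 i @[t --> F] --> A 0 i.
Proof.
move=> ca; apply: (@cvg_comp _ _ _ a (fun x : 'rV[R]_d => x 0 i) F (nbhs A)) => //.
have /(_ A) := @coord_continuous R 1 d 0 i; exact.
Qed.

Lemma cvg_rV (T : Type) (F : set_system T) {FF : Filter F} (a : T -> 'rV[R]_d) (A : 'rV[R]_d) :
  (forall i, a t 0 i @[t --> F] --> A 0 i) -> a t @[t --> F] --> A.
Proof.
move=> ca; apply/cvg_ballP => e e0.
have H : \forall x \near F, forall i, ball (A 0 i) e (a x 0 i).
  by apply: filter_forall => i; have /cvg_ballP/(_ e e0) := ca i.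
apply: filterS H => x Hx; split=> // i j; rewrite ord1; exact: Hx.
Qed.

Lemma cvg_dotp (T : Type) (F : set_system T) {FF : Filter F} (a b : T -> 'rV[R]_d) (A B : 'rV[R]_d) :
  (forall i, a t 0 i @[t --> F] --> A 0 i) -> (forall i, b t 0 i @[t --> F] --> B 0 i) ->
  dotp (a t) (b t) @[t --> F] --> dotp A B.
Proof.
move=> ca cb; rewrite /dotp.
have ac : continuous (fun z : R * R => z.1 + z.2).
  by move=> z; apply: cvgD; [exact: cvg_fst|exact: cvg_snd].
by apply: (cvg_big ac) => i _; apply: cvgM.
Qed.

Lemma continuous_dotp (T : topologicalType) (a b : T -> 'rV[R]_d) :
  continuous a -> continuous b -> continuous (fun t => dotp (a t) (b t)).
Proof.
move=> ca cb t; apply: cvg_dotp => i; apply: cvg_coord; [exact: ca|exact: cb].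
Qed.

Lemma rV_continuousP (T : topologicalType) (a : T -> 'rV[R]_d) :
  (forall i, continuous (fun t => a t 0 i)) -> continuous a.
Proof. by move=> ca t; apply: cvg_rV => i; exact: ca. Qed.

End Dotp.

Section Moreau.
Variables (R : realType) (d : nat) (X : set 'rV[R]_d) (f : 'rV[R]_d -> R) (G2 delta : R).
Hypotheses (cX : compact X) (X0 : X !=set0).
Hypothesis vX : forall x y t, X x -> X y -> 0 <= t -> t <= 1 -> X (x + t *: (y - x)).
Hypothesis cf : continuous f.
Hypothesis vf : forall x y t, X x -> X y -> 0 <= t -> t <= 1 ->
  f (x + t *: (y - x)) <= f x + t * (f y - f x).
Hypotheses (G20 : 0 <= G2) (delta0 : 0 < delta).
Hypothesis lf : forall x y, X x -> X y -> `|f x - f y| <= G2 * Num.sqrt (dotp (x - y) (x - y)).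

Let env (x z : 'rV[R]_d) : R := f z + dotp (x - z) (x - z) / (2 * delta).

Let prox (x : 'rV[R]_d) : 'rV[R]_d := xget 0 (argmin X (env x)).

(** The infimum runs over the compact set [X] only, where the Lipschitz bound on [f] holds; the
    envelope is nevertheless convex and C^1 on the whole space. *)
Definition moreau (x : 'rV[R]_d) : R := env x (prox x).

Definition moreau_grad (x : 'rV[R]_d) : 'rV[R]_d := delta^-1 *: (x - prox x).

Let proxP x : argmin X (env x) (prox x).
Proof.
apply: xgetPex.
have ce : continuous (env x).
  have cB : continuous (fun z : 'rV[R]_d => x - z).
    by move=> z; apply: continuousB; [exact: cst_continuous|].
  apply: contD; first exact: cf.
  by apply: contM; [exact: continuous_dotp|exact: contC].
have [z Xz Hz] := EVT_min_rV X0 cX (continuous_subspaceT ce).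
by exists z; split; [exact: set_mem|move=> y Xy; apply: Hz; exact: mem_set].
Qed.

(** Minimality of [prox x] is tested at the points of the segment towards z, where convexity bounds
    f; after division by the parameter t of the segment, t -> 0 removes the quadratic remainder. *)
Let prox_opt (x z : 'rV[R]_d) : X z -> dotp (x - prox x) (z - prox x) / delta <= f z - f (prox x).
Proof.
have [Xp Hp] := proxP x; move=> Xz; set p := prox x in Xp Hp *.
set a := dotp (x - p) (z - p); set b := dotp (z - p) (z - p).
have b0 : 0 <= b by exact: dotp_ge0.
have H t : 0 < t -> t <= 1 -> a / delta <= f z - f p + t * (b / (2 * delta)).
  move=> t0 t1.
  have := Hp _ (vX Xp Xz (ltW t0) t1); rewrite /env => h1.
  have h2 := vf Xp Xz (ltW t0) t1.
  have h3 : dotp (x - (p + t *: (z - p))) (x - (p + t *: (z - p))) =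
     dotp (x - p) (x - p) - 2 * t * a + t ^+ 2 * b.
    by rewrite opprD addrA sqr_dotpB.
  rewrite h3 in h1.
  have h4 : 0 <= t * (f z - f p) + (- 2 * t * a + t ^+ 2 * b) / (2 * delta).
    have -> : (- 2 * t * a + t ^+ 2 * b) / (2 * delta) =
      (dotp (x - p) (x - p) - 2 * t * a + t ^+ 2 * b) / (2 * delta) - dotp (x - p) (x - p) / (2 * delta) by ring.
    lra.
  have h5 : t * (f z - f p) + (- 2 * t * a + t ^+ 2 * b) / (2 * delta) =
    t * (f z - f p + t * (b / (2 * delta)) - a / delta) by field; rewrite gt_eqF.
  by move: h4; rewrite h5 pmulr_rge0// subr_ge0.
rewrite leNgt; apply/negP => hlt.
set e := a / delta - (f z - f p).
have e0 : 0 < e by rewrite subr_gt0.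
set c := b / (2 * delta).
have c0 : 0 <= c by rewrite divr_ge0// mulr_ge0// ltW.
(* With this t the remainder t c is at most e / 2, half of the supposed violation e. *)
have t0 : 0 < Num.min 1 (e / (2 * (c + 1))).
  by rewrite lt_min ltr01/= divr_gt0// mulr_gt0// ltr_wpDl.
have := H _ t0; rewrite ge_min lexx => /(_ isT) hh.
have : Num.min 1 (e / (2 * (c + 1))) * c <= e / 2.
  apply: (@le_trans _ _ (e / (2 * (c + 1)) * c)).
    by rewrite ler_wpM2r// ge_min lexx orbT.
  have c1 : 0 < c + 1 by rewrite ltr_wpDl.
  have -> : e / (2 * (c + 1)) * c = e / 2 * (c / (c + 1)) by field; rewrite gt_eqF.
  by rewrite ler_piMr ?divr_ge0 ?(ltW e0)// ler_pdivrMr// mul1r lerDl.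
move: hh; rewrite -/c => hh h2; have := e0; rewrite /e in h2 *; lra.
Qed.

Let envB (a h D : 'rV[R]_d) (p p' : R) : dotp a D / delta <= p' - p ->
  p + dotp a a / (2 * delta) + delta^-1 * dotp a h +
    delta / 2 * (delta^-1 * (delta^-1 * dotp (h - D) (h - D))) <=
  p' + dotp (a + h - D) (a + h - D) / (2 * delta).
Proof.
move=> hp; rewrite -(scale1r D) !sqr_dotpB !dotpDl !dotpDr (dotpC h a).
have -> : p + dotp a a / (2 * delta) + delta^-1 * dotp a h +
    delta / 2 * (delta^-1 * (delta^-1 * (dotp h h - 2 * 1 * dotp h D + 1 ^+ 2 * dotp D D))) =
  p + (dotp a a + 2 * dotp a h + (dotp h h - 2 * dotp h D + dotp D D)) / (2 * delta).
  by field; rewrite gt_eqF.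
have -> : p' + (dotp a a + dotp a h + (dotp a h + dotp h h) - 2 * 1 * (dotp a D + dotp h D) +
     1 ^+ 2 * dotp D D) / (2 * delta) =
   p + (dotp a a + 2 * dotp a h + (dotp h h - 2 * dotp h D + dotp D D)) / (2 * delta) +
   (p' - p - dotp a D / delta).
  by field; rewrite gt_eqF.
by rewrite lerDl subr_ge0.
Qed.

(* Co-coercivity: together with its mirror image it gives both convexity of the
   envelope and the Lipschitz continuity of its gradient. *)
Let coco (x x' : 'rV[R]_d) : moreau x + dotp (moreau_grad x) (x' - x) +
  delta / 2 * dotp (moreau_grad x' - moreau_grad x) (moreau_grad x' - moreau_grad x) <= moreau x'.
Proof.
have [Xp _] := proxP x; have [Xp' _] := proxP x'.
have h := prox_opt x Xp'; rewrite /moreau /moreau_grad /env.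
rewrite -scalerBr !dotpZl dotpZr.
have -> : x' - prox x' - (x - prox x) = (x' - x) - (prox x' - prox x).
  by apply/rowP => i; rewrite !mxE; ring.
rewrite (_ : x' - prox x' = (x - prox x) + (x' - x) - (prox x' - prox x)); last first.
  by apply/rowP => i; rewrite !mxE; ring.
exact: envB.
Qed.

Lemma moreau_subgrad (x x' : 'rV[R]_d) : moreau x + dotp (moreau_grad x) (x' - x) <= moreau x'.
Proof.
apply: le_trans (coco x x'); rewrite lerDl mulr_ge0 ?dotp_ge0//.
by rewrite divr_ge0// ltW.
Qed.

(** The two co-coercivity inequalities add up to delta |D|^2 <= <D, h>, and Cauchy-Schwarz gives |D|
    <= |h| / delta. *)
Lemma moreau_grad_lip (x x' : 'rV[R]_d) :
  dotp (moreau_grad x' - moreau_grad x) (moreau_grad x' - moreau_grad x) <=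
  delta^-1 ^+ 2 * dotp (x' - x) (x' - x).
Proof.
have := coco x x'; have := coco x' x.
rewrite -(opprB x' x) -(opprB (moreau_grad x') (moreau_grad x)) !(dotpNl,dotpNr) opprK.
set D := moreau_grad x' - moreau_grad x; set h := x' - x => h1 h2.
have e : dotp D h = dotp (moreau_grad x') h - dotp (moreau_grad x) h := dotpBl _ _ _.
have h3 : delta * dotp D D <= dotp D h by rewrite e; lra.
have := cauchy_schwarz D h.
have D0 := dotp_ge0 D; have H0 := dotp_ge0 h.
have [->|Dn] := eqVneq (dotp D D) 0; first by rewrite mulr_ge0// sqr_ge0.
have Dp : 0 < dotp D D by rewrite lt_neqAle eq_sym Dn.
move=> cs; have h4 : (delta * dotp D D) ^+ 2 <= dotp D D * dotp h h.
  by apply: le_trans cs; rewrite lerXn2r// ?nnegrE ?mulr_ge0 ?(ltW delta0)//; apply: le_trans h3; rewrite mulr_ge0// ltW.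
have h5 : delta ^+ 2 * dotp D D <= dotp h h.
  by rewrite -(ler_pM2l Dp); apply: le_trans h4; rewrite le_eqVlt; apply/orP; left; apply/eqP; ring.
by rewrite exprVn ler_pdivlMl ?exprn_gt0.
Qed.

Lemma moreau_le x : X x -> moreau x <= f x.
Proof.
move=> Xx; have [_ /(_ _ Xx)] := proxP x; rewrite /moreau {2}/env subrr.
by rewrite (_ : dotp 0 0 = 0) ?mul0r ?addr0// /dotp big1// => i _; rewrite mxE mul0r.
Qed.

(** With r = |x - prox x| the loss is at most G2 r - r^2 / (2 delta), which is largest at r = delta
    G2. *)
Lemma moreau_ge x : X x -> f x - G2 ^+ 2 * delta / 2 <= moreau x.
Proof.
move=> Xx; have [Xp _] := proxP x; rewrite /moreau /env.
have := lf Xx Xp; set r := Num.sqrt _ => h.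
have rr : dotp (x - prox x) (x - prox x) = r ^+ 2 by rewrite sqr_sqrtr// dotp_ge0.
rewrite rr; have h1 : f x - f (prox x) <= G2 * r by apply: le_trans h; exact: ler_norm.
have h2 : 0 <= (r - delta * G2) ^+ 2 / (2 * delta) by rewrite divr_ge0 ?sqr_ge0// mulr_ge0// ltW.
have h3 : (r - delta * G2) ^+ 2 / (2 * delta) = r ^+ 2 / (2 * delta) - G2 * r + G2 ^+ 2 * delta / 2.
  by field; rewrite gt_eqF.
lra.
Qed.

(** Comparing the minimizer with z = x gives |x - prox x| <= 2 delta G2, whence the factor 4. *)
Lemma moreau_grad_le x : X x -> dotp (moreau_grad x) (moreau_grad x) <= 4 * G2 ^+ 2.
Proof.
move=> Xx; have [Xp _] := proxP x; have := moreau_le Xx; rewrite /moreau /env /moreau_grad.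
have := lf Xx Xp; set r := Num.sqrt _ => h.
have rr : dotp (x - prox x) (x - prox x) = r ^+ 2 by rewrite sqr_sqrtr// dotp_ge0.
rewrite dotpZl dotpZr rr => h0; have h1 : f x - f (prox x) <= G2 * r by apply: le_trans h; exact: ler_norm.
have r0 : 0 <= r by exact: sqrtr_ge0.
have h2 : r ^+ 2 / (2 * delta) <= G2 * r by lra.
have h3 : r <= 2 * delta * G2.
  have [->|rn] := eqVneq r 0; first by rewrite !mulr_ge0// ltW.
  have rp : 0 < r by rewrite lt_neqAle eq_sym rn.
  move: h2; rewrite ler_pdivrMr ?mulr_gt0// expr2 => h2.
  by rewrite -(ler_pM2r rp); apply: le_trans h2 _; rewrite le_eqVlt; apply/orP; left; apply/eqP; ring.
rewrite mulrA -expr2 exprVn ler_pdivrMl ?exprn_gt0//.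
apply: le_trans (_ : (2 * delta * G2) ^+ 2 <= _); first by rewrite lerXn2r// nnegrE !mulr_ge0// ltW.
by rewrite le_eqVlt; apply/orP; left; apply/eqP; ring.
Qed.

Lemma continuous_moreau_grad : continuous moreau_grad.
Proof.
apply: (@rV_continuousP R d 'rV[R]_d) => i.
apply: (@cont_sqr_le R 'rV[R]_d _ (fun x y => delta^-1 ^+ 2 * dotp (y - x) (y - x))) => [x|x|x y].
- apply: contM; first exact: contC.
  by apply: continuous_dotp => y; apply: continuousB => //; exact: cst_continuous.
- by rewrite subrr (_ : dotp 0 0 = 0) ?mulr0// /dotp big1// => j _; rewrite mxE mul0r.
- apply: le_trans (moreau_grad_lip x y).
  by have := sqr_coord_le_dotp (moreau_grad y - moreau_grad x) i; rewrite !mxE.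
Qed.

End Moreau.

Section ChainRule.
Variables (R : realType) (d : nat) (phi : 'rV[R]_d -> R) (gr : 'rV[R]_d -> 'rV[R]_d).
Hypothesis cgr : continuous gr.
Hypothesis sub : forall x y, phi x + dotp (gr x) (y - x) <= phi y.

(* A continuous subgradient is a gradient, by squeezing difference quotients. *)
Lemma is_derive_subgrad (c : R -> 'rV[R]_d) (c' : 'rV[R]_d) (t : R) :
  (forall i, is_derive t 1 (fun s => c s 0 i) (c' 0 i)) ->
  is_derive t 1 (fun s => phi (c s)) (dotp (gr (c t)) c').
Proof.
move=> dc; apply/is_derive1_caratheodory.
have /fin_all_exists[q Hq] : forall i, exists g : R -> R,
    [/\ forall z, c z 0 i - c t 0 i = g z * (z - t), {for t, continuous g} & g t = c' 0 i].
  by move=> i; apply/is_derive1_caratheodory.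
pose Q s := \row_i q i s.
have EQ s : c s - c t = (s - t) *: Q s.
  by apply/rowP => i; rewrite !mxE; have [-> _ _] := Hq i; rewrite mulrC.
pose l s := dotp (gr (c t)) (Q s).
pose u s := dotp (gr (c s)) (Q s).
pose k s := if s == t then dotp (gr (c t)) c' else (phi (c s) - phi (c t)) / (s - t).
have kt : k t = dotp (gr (c t)) c' by rewrite /k eqxx.
exists k.
have Qt : Q t = c' by apply/rowP => i; rewrite mxE; have [_ _ ->] := Hq i.
split.
- move=> z; rewrite /k; case: eqVneq => [->|zt]; first by rewrite !subrr mulr0.
  by rewrite divfK// subr_eq0.
- have cq i : q i s @[s --> t] --> c' 0 i by have [_ h <-] := Hq i.
  have cc i : c s 0 i @[s --> t] --> c t 0 i.
    by have [/derivable1_diffP/differentiable_continuous + _] := dc i.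
  have cgc i : gr (c s) 0 i @[s --> t] --> gr (c t) 0 i.
    apply: cvg_coord; apply: (@cvg_comp _ _ _ c gr (nbhs t) (nbhs (c t))); last exact: cgr.
    exact: cvg_rV.
  have cQ i : Q s 0 i @[s --> t] --> c' 0 i by rewrite (_ : (fun s => Q s 0 i) = q i)//; apply/funext => s; rewrite mxE.
  have cl : l s @[s --> t] --> dotp (gr (c t)) c'.
    by apply: cvg_dotp => // i; exact: cvg_cst.
  have cu : u s @[s --> t] --> dotp (gr (c t)) c' by exact: cvg_dotp.
  suff : k s @[s --> t] --> k t by [].
  rewrite kt.
  apply/cvgrPdist_le => e e0.
  have e4 : 0 < e / 4 by rewrite divr_gt0.
  have /cvgrPdist_le/(_ _ e4) Hl := cl; have /cvgrPdist_le/(_ _ e4) Hu := cu.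
  near=> s; set v := dotp _ c'.
  have Hls : `|v - l s| <= e / 4 by near: s.
  have Hus : `|v - u s| <= e / 4 by near: s.
  rewrite /k; case: eqVneq => [_|st]; first by rewrite subrr normr0 ltW.
  have h1 := sub (c t) (c s); have h2 := sub (c s) (c t).
  rewrite -(opprB (c s)) EQ dotpNr dotpZr -/(u s) in h2.
  rewrite EQ dotpZr -/(l s) in h1.
  set q' := _ / _; have hk : phi (c s) - phi (c t) = (s - t) * q' by rewrite mulrC divfK// subr_eq0.
  move: Hls Hus; rewrite !ler_norml => /andP[l1 l2] /andP[u1 u2].
  have [stp|stn] := ltP 0 (s - t).
    have k1 : l s <= q' by rewrite -(ler_pM2l stp) -hk; lra.
    have k2 : q' <= u s by rewrite -(ler_pM2l stp) -hk; lra.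
    by apply/andP; split; lra.
  have {}stn : s - t < 0 by rewrite lt_neqAle stn andbT subr_eq0.
  have k1 : q' <= l s by rewrite -(ler_nM2l stn) -hk; lra.
  have k2 : u s <= q' by rewrite -(ler_nM2l stn) -hk; lra.
  by apply/andP; split; lra.
- exact: kt.
Unshelve. all: by end_near. Qed.

End ChainRule.

(** * Variance under the Laplace law *)

Section BoundedExpectation.
Context d (T : measurableType d) (R : realType) (P : probability T R).
Implicit Types f g : T -> R.

(** Bounded measurable functions are closed under ring operations and integrable for every
    probability, so that [mean] is linear on them without further integrability conditions. *)
Definition bmfun f := measurable_fun setT f /\ exists M : R, forall x, `|f x| <= M.

Definition mean f : R := \int[P]_x f x.

Lemma bmfun_integrable f : bmfun f -> P.-integrable setT (EFin \o f).
Proof.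
move=> [mf [M HM]]; apply: measurable_bounded_integrable => //.
  exact: (eq_ind_r (fun z => (z < +oo)%E) (ltry 1) (probability_setT P)).
by exists M; split; [exact: num_real|move=> x Mx y _; apply: le_trans (ltW Mx)].
Qed.

Lemma bmfunD f g : bmfun f -> bmfun g -> bmfun (fun x => f x + g x).
Proof.
move=> [mf [M HM]] [mg [N HN]]; split; first exact: measurable_funD.
by exists (M + N) => x; apply: le_trans (ler_normD _ _) _; exact: lerD.
Qed.

Lemma bmfunM f g : bmfun f -> bmfun g -> bmfun (fun x => f x * g x).
Proof.
move=> [mf [M HM]] [mg [N HN]]; split; first exact: measurable_funM.
by exists (M * N) => x; rewrite normrM ler_pM.
Qed.

Lemma bmfunC (c : R) : bmfun (fun=> c).
Proof. by split; [exact: measurable_cst|exists `|c|]. Qed.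

Lemma bmfunN f : bmfun f -> bmfun (fun x => - f x).
Proof.
move=> [mf [M HM]]; split; first exact: measurableT_comp.
by exists M => x; rewrite normrN.
Qed.

Lemma bmfunB f g : bmfun f -> bmfun g -> bmfun (fun x => f x - g x).
Proof. by move=> bf bg; apply: bmfunD => //; exact: bmfunN. Qed.

Lemma bmfunX f n : bmfun f -> bmfun (fun x => f x ^+ n).
Proof.
move=> bf; elim: n => [|n IH]; first exact: bmfunC.
by under eq_fun do rewrite exprS; exact: bmfunM.
Qed.

Lemma mean_EFin f : bmfun f -> (\int[P]_x (f x)%:E)%E = (mean f)%:E.
Proof.
move=> /bmfun_integrable bf; rewrite /mean /Rintegral fineK//.
exact: integrable_fin_num.
Qed.

Lemma mean_ext f g : f =1 g -> mean f = mean g.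
Proof. by move=> fg; congr mean; apply/funext. Qed.

Lemma meanD f g : bmfun f -> bmfun g -> mean (fun x => f x + g x) = mean f + mean g.
Proof. by move=> bf bg; rewrite /mean RintegralD//; exact: bmfun_integrable. Qed.

Lemma meanC (c : R) : mean (fun=> c) = c.
Proof.
apply: EFin_inj; rewrite -mean_EFin; last exact: bmfunC.
rewrite integral_cst//.
exact: (eq_ind_r (fun z => (c%:E * z = c%:E)%E) (mule1 _) (probability_setT P)).
Qed.

Lemma meanZ c f : bmfun f -> mean (fun x => c * f x) = c * mean f.
Proof. by move=> bf; rewrite /mean RintegralZl//; exact: bmfun_integrable. Qed.

Lemma meanN f : bmfun f -> mean (fun x => - f x) = - mean f.
Proof. by move=> bf; rewrite -mulN1r -meanZ//; apply: mean_ext => x; rewrite mulN1r. Qed.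

Lemma meanB f g : bmfun f -> bmfun g -> mean (fun x => f x - g x) = mean f - mean g.
Proof. by move=> bf bg; rewrite meanD ?meanN//; exact: bmfunN. Qed.

Lemma mean_le f g : bmfun f -> bmfun g -> (forall x, f x <= g x) -> mean f <= mean g.
Proof. by move=> bf bg fg; apply: le_Rintegral => //; exact: bmfun_integrable. Qed.

Lemma mean_ge0 f : bmfun f -> (forall x, 0 <= f x) -> 0 <= mean f.
Proof. by move=> bf f0; rewrite -(meanC 0); apply: mean_le => //; exact: bmfunC. Qed.

Lemma mean_sum n (h : 'I_n -> T -> R) : (forall i, bmfun (h i)) ->
  bmfun (fun x => \sum_(i < n) h i x) /\ mean (fun x => \sum_(i < n) h i x) = \sum_(i < n) mean (h i).
Proof.
elim: n h => [|n IH] h bh.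
  rewrite (_ : (fun x => _) = fun=> 0); last by apply/funext => x; rewrite big_ord0.
  by rewrite big_ord0 meanC; split => //; exact: bmfunC.
have [b1 e1] := IH (fun i => h (lift ord0 i)) (fun i => bh _).
rewrite (_ : (fun x => _) = fun x => h ord0 x + \sum_(i < n) h (lift ord0 i) x); last first.
  by apply/funext => x; rewrite big_ord_recl.
by rewrite big_ord_recl meanD// e1; split => //; exact: bmfunD.
Qed.

(** The decomposition into variance and squared bias; it allows the mean to be replaced by another
    centre, in particular by the value at 0. *)
Lemma mean_sqr_dev f (a : R) : bmfun f ->
  mean (fun x => (f x - a) ^+ 2) = mean (fun x => (f x - mean f) ^+ 2) + (mean f - a) ^+ 2.
Proof.
move=> bf; set m := mean f.
have E : (fun x => (f x - a) ^+ 2) = fun x => (f x - m) ^+ 2 + (2 * (m - a) * f x + ((m - a) ^+ 2 - 2 * (m - a) * m)).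
  by apply/funext => x; ring.
have b1 : bmfun (fun x => (f x - m) ^+ 2) by apply: bmfunX; apply: bmfunB => //; exact: bmfunC.
have b2 : bmfun (fun x => 2 * (m - a) * f x) by apply: bmfunM => //; exact: bmfunC.
rewrite E meanD// ?meanD// ?meanC ?meanZ//; try exact: bmfunC; last by apply: bmfunD => //; exact: bmfunC.
by congr (_ + _); rewrite -/m; ring.
Qed.

Lemma mean_jensen2 f : bmfun f -> mean f ^+ 2 <= mean (fun x => f x ^+ 2).
Proof.
move=> bf; have := mean_sqr_dev 0 bf.
under mean_ext do rewrite subr0; rewrite subr0 => ->.
rewrite lerDr; apply: mean_ge0 => [|x]; last exact: sqr_ge0.
by apply: bmfunX; apply: bmfunB => //; exact: bmfunC.
Qed.

End BoundedExpectation.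

Lemma bmfun_comp d (T : measurableType d) d' (U : measurableType d') (R : realType)
    (f : T -> R) (g : U -> T) : measurable_fun setT g -> bmfun f -> bmfun (fun x => f (g x)).
Proof.
move=> mg [mf [M HM]]; split; first exact: (measurableT_comp mf mg).
by exists M.
Qed.

(** * Tensorization of the Poincare inequality *)

Section PoincareTensor.
Variable R : realType.

Definition set_coord n (u : 'rV[R]_n) (i : 'I_n) (x : R) : 'rV[R]_n :=
  \row_j (if j == i then x else u 0 j).

Local Open Scope ereal_scope.

Lemma set_coord_cons0 n x (v : 'rV[R]_n) z : set_coord (cons_rV x v) ord0 z = cons_rV z v.
Proof.
apply/rowP => i; rewrite mxE; case: (unliftP ord0 i) => [j ->|->].
  by rewrite (cons_rVS x v j) (cons_rVS z v j).
by rewrite eqxx cons_rV0.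
Qed.

Lemma set_coord_consS n x (v : 'rV[R]_n) (i : 'I_n) z :
  set_coord (cons_rV x v) (lift ord0 i) z = cons_rV x (set_coord v i z).
Proof.
apply/rowP => k; rewrite mxE; case: (unliftP ord0 k) => [j ->|->].
  rewrite (cons_rVS x v j) (cons_rVS x (set_coord v i z) j) mxE.
  by rewrite (inj_eq (@lift_inj _ ord0)).
by rewrite !cons_rV0.
Qed.

(** The variance is the mean of the conditional variances given the first coordinate plus the
    variance of the conditional mean [m]. The former is the induction hypothesis. For the latter,
    m(x) - m(0) is a mean of differences of F, so Jensen's inequality and Fubini reduce it to the
    one-dimensional hypothesis. Centring at the value at 0 is what the half-line inequality
    provides. *)
Lemma poincare_tensor n (F : 'rV[R]_n -> R) (D : 'I_n -> 'rV[R]_n -> R) :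
  bmfun (F : rVB R n -> R) ->
  (forall i, measurable_fun setT (D i : rVB R n -> R)) -> (forall i u, 0 <= D i u)%R ->
  (forall i u, \int[@laplace R]_x ((F (set_coord u i x) - F (set_coord u i 0)) ^+ 2)%:E <=
     4%:E * \int[@laplace R]_x (D i (set_coord u i x))%:E) ->
  \int[laplaceV R n]_u ((F u - mean (laplaceV R n) F) ^+ 2)%:E <=
    4%:E * \sum_(i < n) \int[laplaceV R n]_u (D i u)%:E.
Proof.
elim: n F D => [|n IH] F D bF mD D0 H.
  rewrite big_ord0 mule0 integral0_eq// => u _.
  have -> : F = cst (F u).
    by apply/funext => v; congr F; apply/rowP => -[].
  by rewrite meanC subrr expr0n.
have [mF [M HM]] := bF.
have mc (x : R) : measurable_fun setT (cons_rV x : rVB R n -> rVB R n.+1).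
  exact: (@measurable_cons2 _ _ (rVB R n) n (fun=> x) id).
have mcx (v : 'rV[R]_n) : measurable_fun setT (fun x : R => cons_rV x v : rVB R n.+1).
  by apply: (@measurable_cons2 R _ _ n id (fun=> v)).
have bFc x : bmfun (fun v : rVB R n => F (cons_rV x v)) by exact: (bmfun_comp (mc x) bF).
pose m x := mean (laplaceV R n) (fun v => F (cons_rV x v)).
have bm : bmfun (m : R -> R).
  split; last first.
    exists M => x; rewrite ler_norml; apply/andP; split.
      rewrite -[leLHS](meanC (laplaceV R n)); apply: mean_le => // [|v]; first exact: bmfunC.
      by have := HM (cons_rV x v); rewrite ler_norml => /andP[].
    rewrite -[leRHS](meanC (laplaceV R n)); apply: mean_le => // [|v]; first exact: bmfunC.
    by have := HM (cons_rV x v); rewrite ler_norml => /andP[].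
  (* Adding the bound M makes the function nonnegative, so that Tonelli's theorem yields
     measurability of its partial integrals. *)
  pose h (z : R * rVB R n) : \bar R := (F (cons_rV z.1 z.2) + M)%:E.
  have h0 z : 0 <= h z.
    rewrite lee_fin; have := HM (cons_rV z.1 z.2).
    by rewrite ler_norml => /andP[hM _]; rewrite -lerBlDr sub0r.
  have mh : measurable_fun setT h.
    apply/measurable_EFinP; apply: measurable_funD => //.
    by apply: (measurable_compV mF); exact: measurable_cons_rV.
  have mI := @measurable_fun_fubini_tonelli_F _ _ _ _ R (laplaceV R n) h mh h0.
  rewrite (_ : m = fun x => (fine (\int[laplaceV R n]_v h (x, v)) - M)%R).
    by apply: measurable_funB => //; apply: (measurableT_comp _ mI); exact: fine_measurable.
  apply/funext => x; rewrite /h/= mean_EFin/=; last by apply: bmfunD => //; exact: bmfunC.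
  by rewrite meanD// ?meanC ?addrK//; exact: bmfunC.
have bFu (a : R) : bmfun (fun u : rVB R n.+1 => ((F u - a) ^+ 2)%R).
  by apply: bmfunX; apply: bmfunB => //; exact: bmfunC.
(* Centring at c' is legitimate without comparing c' to the mean of F, since the variance is at most
   the mean square deviation from any constant. *)
pose c' := mean (@laplace R) m.
have step a : \int[laplaceV R n.+1]_u ((F u - a) ^+ 2)%:E =
   \int[@laplace R]_x \int[laplaceV R n]_v ((F (cons_rV x v) - m x) ^+ 2)%:E +
   \int[@laplace R]_x ((m x - a) ^+ 2)%:E.
  have mG : measurable_fun setT (fun z : R * rVB R n => ((F (cons_rV z.1 z.2) - m z.1) ^+ 2)%:E).
    apply/measurable_EFinP; apply: measurable_funX; apply: measurable_funB.
      by apply: (measurable_compV mF); exact: measurable_cons_rV.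
    by apply: (measurableT_comp bm.1); exact: measurable_fst.
  have mGx := @measurable_fun_fubini_tonelli_F _ _ _ _ R (laplaceV R n) _ mG.
  rewrite ge0_integral_laplaceVS => [||u]; last 2 first.
  - by apply/measurable_EFinP; have [] := bFu a.
  - by rewrite lee_fin sqr_ge0.
  rewrite -ge0_integralD//=; last 4 first.
  - by move=> x _; apply: integral_ge0 => v _; rewrite lee_fin sqr_ge0.
  - by apply: mGx => z; rewrite lee_fin sqr_ge0.
  - by move=> x _; rewrite lee_fin sqr_ge0.
  - by apply/measurable_EFinP; apply: measurable_funX; apply: measurable_funB => //; exact: bm.1.
  apply: eq_integral => x _.
  have b1 b : bmfun (fun v : rVB R n => ((F (cons_rV x v) - b) ^+ 2)%R).
    by apply: bmfunX; apply: bmfunB => //; exact: bmfunC.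
  by rewrite !mean_EFin// (mean_sqr_dev _ a (bFc x)) EFinD.
have mF2 : measurable_fun setT (fun z : R * rVB R n => ((F (cons_rV z.1 z.2) - F (cons_rV 0 z.2)) ^+ 2)%:E).
  apply/measurable_EFinP; apply: measurable_funX; apply: measurable_funB.
    by apply: (measurable_compV mF); exact: measurable_cons_rV.
  apply: (measurable_compV mF); apply: measurable_cons2 => //; exact: measurable_snd.
have F20 z : 0 <= ((F (cons_rV z.1 z.2) - F (cons_rV 0 z.2)) ^+ 2)%:E :> \bar R.
  by rewrite lee_fin sqr_ge0.
have mD0 i : measurable_fun setT (fun z : R * rVB R n => (D i (cons_rV z.1 z.2))%:E).
  by apply/measurable_EFinP; apply: (measurable_compV (mD i)); exact: measurable_cons_rV.
have DE0 i (u : 'rV[R]_n.+1) : 0 <= (D i u)%:E :> \bar R by rewrite lee_fin.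
apply: (@le_trans _ _ (\int[laplaceV R n.+1]_u ((F u - c') ^+ 2)%:E)).
  rewrite !mean_EFin ?bFu//.
  by rewrite (mean_sqr_dev _ c' bF) lee_fin lerDl sqr_ge0.
rewrite step big_ord_recl ge0_muleDr; last 2 first.
- exact: integral_ge0.
- by apply: sume_ge0 => i _; apply: integral_ge0.
rewrite addeC; apply: leeD.
  apply: (@le_trans _ _ (\int[@laplace R]_x ((m x - m 0) ^+ 2)%:E)).
    rewrite !mean_EFin; try by apply: bmfunX; apply: bmfunB => //; exact: bmfunC.
    have e := mean_sqr_dev (@laplace R) (m 0%R) bm.
    by rewrite lee_fin [leRHS]e lerDl sqr_ge0.
  apply: (@le_trans _ _ (\int[@laplace R]_x \int[laplaceV R n]_v ((F (cons_rV x v) - F (cons_rV 0 v)) ^+ 2)%:E)).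
    apply: ge0_le_integral => //.
    - by move=> x _; rewrite lee_fin sqr_ge0.
    - by apply/measurable_EFinP; apply: measurable_funX; apply: measurable_funB => //; exact: bm.1.
    - exact: (@measurable_fun_fubini_tonelli_F _ _ _ _ R (laplaceV R n) _ mF2 F20).
    - move=> x _; have b2 := bmfunB (bFc x) (bFc 0%R).
      rewrite mean_EFin; last exact: bmfunX.
      by rewrite lee_fin /m -meanB//; exact: mean_jensen2.
  rewrite (fubini_tonelli (m1 := @laplace R) (m2 := laplaceV R n) _ mF2 F20)/=.
  rewrite ge0_integral_laplaceVS_swap//; last by apply/measurable_EFinP.
  rewrite -ge0_integralZl//=; last 2 first.
  - exact: (@measurable_fun_fubini_tonelli_G _ _ _ _ R (@laplace R) _ (mD0 ord0) (fun z => DE0 _ _)).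
  - by move=> v _; exact: integral_ge0.
  apply: ge0_le_integral => //.
  - by move=> v _; apply: integral_ge0 => x _; rewrite lee_fin sqr_ge0.
  - exact: (@measurable_fun_fubini_tonelli_G _ _ _ _ R (@laplace R) _ mF2 F20).
  - apply: emeasurable_funM => //.
    exact: (@measurable_fun_fubini_tonelli_G _ _ _ _ R (@laplace R) _ (mD0 ord0) (fun z => DE0 _ _)).
  - move=> v _; have := H ord0 (cons_rV 0 v).
    by under eq_integral do rewrite !set_coord_cons0; under [X in _ <= _ * X]eq_integral do rewrite !set_coord_cons0.
apply: (@le_trans _ _ (\int[@laplace R]_x (4%:E * \sum_(i < n) \int[laplaceV R n]_v (D (lift ord0 i) (cons_rV x v))%:E))).
  apply: ge0_le_integral => //.
  - by move=> x _; apply: integral_ge0 => v _; rewrite lee_fin sqr_ge0.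
  - have mG : measurable_fun setT (fun z : R * rVB R n => ((F (cons_rV z.1 z.2) - m z.1) ^+ 2)%:E).
      apply/measurable_EFinP; apply: measurable_funX; apply: measurable_funB.
        by apply: (measurable_compV mF); exact: measurable_cons_rV.
      by apply: (measurableT_comp bm.1); exact: measurable_fst.
    by apply: (@measurable_fun_fubini_tonelli_F _ _ _ _ R (laplaceV R n) _ mG) => z; rewrite lee_fin sqr_ge0.
  - apply: emeasurable_funM => //; apply: emeasurable_sum => i.
    exact: (@measurable_fun_fubini_tonelli_F _ _ _ _ R (laplaceV R n) _ (mD0 _) (fun z => DE0 _ _)).
  - move=> x _; apply: (IH (fun v => F (cons_rV x v)) (fun i v => D (lift ord0 i) (cons_rV x v))) => //.
      by move=> i; exact: (measurable_compV (mD _) (mc x)).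
    move=> i v; have := H (lift ord0 i) (cons_rV x v).
    by under eq_integral do rewrite !set_coord_consS; under [X in _ <= _ * X]eq_integral do rewrite !set_coord_consS.
rewrite ge0_integralZl//=; last 2 first.
- apply: emeasurable_sum => i.
  exact: (@measurable_fun_fubini_tonelli_F _ _ _ _ R (laplaceV R n) _ (mD0 _) (fun z => DE0 _ _)).
- by move=> x _; apply: sume_ge0 => i _; exact: integral_ge0.
rewrite ge0_integral_sum//=; last 2 first.
- move=> i; exact: (@measurable_fun_fubini_tonelli_F _ _ _ _ R (laplaceV R n) _ (mD0 _) (fun z => DE0 _ _)).
- by move=> i x _; exact: integral_ge0.
rewrite le_eqVlt; apply/orP; left; apply/eqP; congr (_ * _); apply: eq_bigr => i _.
by rewrite ge0_integral_laplaceVS//; apply/measurable_EFinP.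
Qed.

End PoincareTensor.

(** * The one-dimensional Poincare inequality *)

Section Poincare1D.
Variable R : realType.
Local Notation mu := (@lebesgue_measure R).

(* With H = (F - F 0)^2 exp(-x), the integrand on the right exceeds the one on
   the left by 2 H' + (2 g - (F - F 0))^2 exp(-x), and H b >= 0 = H 0. *)
Lemma poincare_itv (F g : R -> R) (b : R) : 0 < b -> continuous F -> continuous g ->
  (forall x : R, 0 < x -> is_derive x 1 F (g x)) ->
  (\int[mu]_(x in `[0%R, b]) ((F x - F 0) ^+ 2 * expR (- x))%:E <=
   \int[mu]_(x in `[0%R, b]) (4 * g x ^+ 2 * expR (- x))%:E)%E.
Proof.
move=> b0 cF cg dF.
have cE : continuous (fun x : R => expR (- x)).
  by move=> x; apply: continuous_comp; [exact: continuousN|exact: continuous_expR].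
pose H x := (F x - F 0) ^+ 2 * expR (- x).
pose h x := (2 * (F x - F 0) * g x - (F x - F 0) ^+ 2) * expR (- x).
have cFB : continuous (fun x => F x - F 0) by apply: contB => //; exact: contC.
have cF2 : continuous (fun x => (F x - F 0) ^+ 2).
  by under eq_fun do rewrite expr2; exact: contM.
have cH : continuous H by exact: contM.
have ch : continuous h.
  apply: contM => //; apply: contB => //; apply: contM => //.
  by apply: contM => //; exact: contC.
have cg2 : continuous (fun x => 4 * g x ^+ 2 * expR (- x)).
  by apply: contM => //; apply: contM; [exact: contC|under eq_fun do rewrite expr2; exact: contM].
have dH (x : R) : 0 < x -> is_derive x 1 H (h x).
  move=> x0; have dFx := dF x x0; rewrite /H.
  apply: is_derive_eq; rewrite /GRing.scale/= /h; ring.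
have int (f : R -> R) : continuous f -> mu.-integrable `[0, b] (EFin \o f).
  move=> cf; apply: continuous_compact_integrable; first exact: segment_compact.
  exact: continuous_subspaceT.
have IH0 : (0 <= \int[mu]_(x in `[0%R, b]) (h x)%:E)%E.
  rewrite (@continuous_FTC2 _ h H 0 b)//.
  - by rewrite /H subrr expr0n mul0r sube0 lee_fin mulr_ge0 ?sqr_ge0 ?expR_ge0.
  - exact: continuous_subspaceT.
  - split.
    + by move=> x; rewrite in_itv/= => /andP[x0 _]; have [] := dH x x0.
    + by apply: cvg_at_right_filter; exact: cH.
    + by apply: cvg_at_left_filter; exact: cH.
  - move=> x; rewrite in_itv/= => /andP[x0 _].
    by rewrite derive1E; have [_ ->] := dH x x0.
rewrite -sube_ge0; last first.
  by apply/orP; left; apply: integrable_fin_num => //; apply: int; exact: cH.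
rewrite -integralB_EFin//; [|exact: int|by apply: int; exact: cH].
apply: (@le_trans _ _ (\int[mu]_(x in `[0%R, b]) (2 * h x)%:E)%E).
  under eq_integral do rewrite EFinM.
  by rewrite integralZl//; [exact: mule_ge0|exact: int].
apply: le_integral => //.
- by apply: int; apply: contM => //; exact: contC.
- by apply: int; exact: contB.
move=> x _; rewrite lee_fin /h -subr_ge0.
have -> : 4 * g x ^+ 2 * expR (- x) - (F x - F 0) ^+ 2 * expR (- x) -
  2 * ((2 * (F x - F 0) * g x - (F x - F 0) ^+ 2) * expR (- x)) =
  (2 * g x - (F x - F 0)) ^+ 2 * expR (- x) by ring.
by rewrite mulr_ge0 ?sqr_ge0 ?expR_ge0.
Qed.

(** The constant 4 does not depend on the length of the interval, so the half-line is exhausted by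
    the intervals [0, k + 1]. *)
Lemma poincare_halfline (F g : R -> R) : continuous F -> continuous g ->
  (forall x : R, 0 < x -> is_derive x 1 F (g x)) ->
  (\int[mu]_(x in `[0%R, +oo[) ((F x - F 0) ^+ 2 * expR (- x))%:E <=
   \int[mu]_(x in `[0%R, +oo[) (4 * g x ^+ 2 * expR (- x))%:E)%E.
Proof.
move=> cF cg dF.
have cE : continuous (fun x : R => expR (- x)).
  by move=> x; apply: continuous_comp; [exact: continuousN|exact: continuous_expR].
have c1 : continuous (fun x => (F x - F 0) ^+ 2 * expR (- x)).
  apply: contM => //; under eq_fun do rewrite expr2.
  by apply: contM; apply: contB => //; exact: contC.
have c2 : continuous (fun x => 4 * g x ^+ 2 * expR (- x)).
  by apply: contM => //; apply: contM; [exact: contC|under eq_fun do rewrite expr2; exact: contM].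
have mm (f : R -> R) D : continuous f -> measurable_fun D (fun x => (f x)%:E).
  by move=> cf; apply/measurable_EFinP; apply: measurable_funTS; exact: continuous_measurable_fun.
pose S (k : nat) : set (measurableTypeR R) := `[0%R, k.+1%:R]%classic.
rewrite (_ : `[0%R, +oo[%classic = \bigcup_k S k); last first.
  apply/seteqP; split=> x /=.
    rewrite in_itv/= andbT => x0; exists (Num.truncn x) => //=.
    by rewrite /S/= in_itv/= x0 ltW// truncnS_gt.
  by move=> [k _]; rewrite /S/= !in_itv/= andbT => /andP[].
have nd : {homo S : n m / (n <= m)%N >-> (n <= m)%O}.
  move=> n m nm; apply/subsetPset => x; rewrite /S/= !in_itv/= => /andP[-> h]/=.
  by apply: le_trans h _; rewrite ler_nat.
have v1 := @ge0_nondecreasing_set_cvg_integral _ _ R S (fun x => ((F x - F 0) ^+ 2 * expR (- x))%:E) mu nd.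
have v2 := @ge0_nondecreasing_set_cvg_integral _ _ R S (fun x => (4 * g x ^+ 2 * expR (- x))%:E) mu nd.
have {}v1 := v1 (fun=> measurable_itv _) (fun i => mm _ _ c1).
have {}v2 := v2 (fun=> measurable_itv _) (fun i => mm _ _ c2).
rewrite -(cvg_lim _ (v1 _))//; last by move=> i x _; rewrite lee_fin mulr_ge0 ?sqr_ge0 ?expR_ge0.
rewrite -(cvg_lim _ (v2 _))//; last by move=> i x _; rewrite lee_fin mulr_ge0 ?expR_ge0// mulr_ge0 ?sqr_ge0.
apply: lee_lim.
- by apply/cvg_ex; eexists; apply: v1 => i x _; rewrite lee_fin mulr_ge0 ?sqr_ge0 ?expR_ge0.
- by apply/cvg_ex; eexists; apply: v2 => i x _; rewrite lee_fin mulr_ge0 ?expR_ge0// mulr_ge0 ?sqr_ge0.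
- by apply: nearW => n; apply: poincare_itv.
Qed.

Lemma half_poincare (F g D : R -> R) : continuous F -> continuous g ->
  (forall x : R, 0 < x -> is_derive x 1 F (g x)) -> measurable_fun setT D ->
  (forall x, 0 <= D x) -> (forall x, 0 <= x -> g x ^+ 2 <= D x) ->
  (\int[mu]_(x in `[0%R, +oo[) (((F x - F 0) ^+ 2)%:E * (laplace_pdf x)%:E) <=
   4%:E * \int[mu]_(x in `[0%R, +oo[) ((D x)%:E * (laplace_pdf x)%:E))%E.
Proof.
move=> cF cg dF mD D0 gD.
have cE : continuous (fun x : R => expR (- x)).
  by move=> x; apply: continuous_comp; [exact: continuousN|exact: continuous_expR].
have c1 : continuous (fun x => (F x - F 0) ^+ 2 * expR (- x)).
  apply: contM => //; under eq_fun do rewrite expr2.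
  by apply: contM; apply: contB => //; exact: contC.
have c2 : continuous (fun x => 4 * g x ^+ 2 * expR (- x)).
  by apply: contM => //; apply: contM; [exact: contC|under eq_fun do rewrite expr2; exact: contM].
have mm (f : R -> R) S : continuous f -> measurable_fun S (fun x => (f x)%:E).
  by move=> cf; apply/measurable_EFinP; apply: measurable_funTS; exact: continuous_measurable_fun.
have mpdf : measurable_fun setT (fun x : R => (laplace_pdf x)%:E).
  by apply/measurable_EFinP; exact: measurable_laplace_pdf.
have mDE : measurable_fun setT (fun x : R => (D x)%:E) by apply/measurable_EFinP.
have mDp : measurable_fun setT (fun x : R => ((D x)%:E * (laplace_pdf x)%:E)%E).
  exact: emeasurable_funM.
apply: (@le_trans _ _ ((2^-1)%:E * \int[mu]_(x in `[0%R, +oo[) ((F x - F 0) ^+ 2 * expR (- x))%:E)%E).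
  rewrite -ge0_integralZl//=; last 2 first.
  - exact: mm.
  - by move=> x _; rewrite lee_fin mulr_ge0 ?sqr_ge0 ?expR_ge0.
  rewrite le_eqVlt; apply/orP; left; apply/eqP; apply: eq_integral => x.
  rewrite inE/= in_itv/= andbT => x0; rewrite -!EFinM; congr EFin.
  by rewrite /laplace_pdf ger0_norm//; field.
apply: (@le_trans _ _ ((2^-1)%:E * \int[mu]_(x in `[0%R, +oo[) (4 * g x ^+ 2 * expR (- x))%:E)%E).
  by rewrite lee_pmul2l ?lte_fin ?invr_gt0//; exact: poincare_halfline.
rewrite -!ge0_integralZl//=.
- apply: ge0_le_integral => //.
  + by move=> x _; rewrite -EFinM lee_fin mulr_ge0 ?invr_ge0// mulr_ge0 ?expR_ge0// mulr_ge0 ?sqr_ge0.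
  + by apply: emeasurable_funM => //; exact: mm.
  + by apply: emeasurable_funM => //; exact: measurable_funTS.
  + move=> x; rewrite /= in_itv/= andbT => x0; rewrite -!EFinM lee_fin /laplace_pdf ger0_norm//.
    have -> : 2^-1 * (4 * g x ^+ 2 * expR (- x)) = 4 * (g x ^+ 2 * (expR (- x) / 2)) by field.
    by rewrite ler_pM2l// ler_wpM2r// ?divr_ge0 ?expR_ge0//; exact: gD.
- exact: measurable_funTS.
- by move=> x _; rewrite -EFinM lee_fin mulr_ge0// laplace_pdf_ge0.
- exact: mm.
- by move=> x _; rewrite lee_fin mulr_ge0 ?expR_ge0// mulr_ge0 ?sqr_ge0.
Qed.

(** The intended F depends on |x| and has a corner at 0, hence separate derivatives on the two
    half-lines. Since both sides are centred at F 0, the half-lines are treated independently; [D]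
    dominates the square of either derivative. *)
Lemma laplace_poincare (F gp gm D : R -> R) : continuous F -> continuous gp -> continuous gm ->
  (forall x : R, 0 < x -> is_derive x 1 F (gp x)) ->
  (forall x : R, x < 0 -> is_derive x 1 F (gm x)) -> measurable_fun setT D ->
  (forall x, 0 <= D x) -> (forall x, 0 <= x -> gp x ^+ 2 <= D x) ->
  (forall x, x <= 0 -> gm x ^+ 2 <= D x) ->
  (\int[@laplace R]_x ((F x - F 0) ^+ 2)%:E <= 4%:E * \int[@laplace R]_x (D x)%:E)%E.
Proof.
move=> cF cgp cgm dp dm mD D0 gpD gmD.
have cN (f : R -> R) : continuous f -> continuous (fun x => f (- x)).
  by move=> cf x; apply: continuous_comp; [exact: continuousN|exact: cf].
have mpdf : measurable_fun setT (fun x : R => (laplace_pdf x)%:E).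
  by apply/measurable_EFinP; exact: measurable_laplace_pdf.
have mF2 : measurable_fun setT (fun x => ((F x - F 0) ^+ 2)%:E).
  apply/measurable_EFinP; apply: measurable_funX; apply: measurable_funB => //.
  exact: continuous_measurable_fun.
have mDE : measurable_fun setT (fun x : R => (D x)%:E) by apply/measurable_EFinP.
rewrite !ge0_integral_laplace//; last by move=> x; rewrite lee_fin sqr_ge0.
rewrite !ge0_integral_even//; first last.
- by move=> x; rewrite -EFinM lee_fin mulr_ge0 ?sqr_ge0 ?laplace_pdf_ge0.
- exact: emeasurable_funM.
- by move=> x; rewrite -EFinM lee_fin mulr_ge0 ?laplace_pdf_ge0.
- exact: emeasurable_funM.
rewrite ge0_muleDr; last 2 first.
- by apply: integral_ge0 => x _; rewrite -EFinM lee_fin mulr_ge0 ?laplace_pdf_ge0.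
- by apply: integral_ge0 => x _; rewrite -EFinM lee_fin mulr_ge0 ?laplace_pdf_ge0.
apply: leeD; first exact: (half_poincare cF cgp).
have pN (x : R) : laplace_pdf (- x) = laplace_pdf x by rewrite /laplace_pdf normrN.
under eq_integral do rewrite pN; under [X in (_ <= _ * X)%E]eq_integral do rewrite pN.
rewrite -{2}[0]oppr0.
apply: (half_poincare (F := fun x => F (- x)) (g := fun x => - gm (- x)) (D := fun x => D (- x))) => //.
- exact: cN.
- by apply: contN; exact: cN.
- move=> x x0; have dx := dm (- x); rewrite oppr_lt0 in dx; have {}dx := dx x0.
  have dN : is_derive x (1 : R) (fun y : R => - y) (- 1).
    exact: (is_deriveN (is_derive_id x (1 : R))).
  by apply: is_derive_eq (is_derive1_comp dx dN) _; rewrite mulrN1.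
- by apply: measurableT_comp => //; exact: oppr_measurable.
- by move=> x x0; rewrite sqrrN; apply: gmD; rewrite oppr_le0.
Qed.

End Poincare1D.

(** * Norms and moments *)

Section Norms.
Variable R : realType.
Implicit Types (p q : \bar R) (a b c : R).

Lemma powR_le a (x y : R) : 0 <= a -> 0 <= x -> x <= y -> x `^ a <= y `^ a.
Proof.
move=> a0 x0 xy; apply: ge0_ler_powR => //; rewrite nnegrE//; exact: le_trans xy.
Qed.

Lemma powR_le_inv a (x y : R) : 0 < a -> 0 <= x -> 0 <= y -> x `^ a <= y `^ a -> x <= y.
Proof.
move=> a0 x0 y0 h; rewrite leNgt; apply/negP => yx.
by move: h; rewrite leNgt gt0_ltr_powR// nnegrE.
Qed.

Lemma powRK a (x : R) : a != 0 -> 0 <= x -> (x `^ a) `^ a^-1 = x.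
Proof. by move=> a0 x0; rewrite -powRrM mulfV// powRr1. Qed.

Lemma powRVK a (x : R) : a != 0 -> 0 <= x -> (x `^ a^-1) `^ a = x.
Proof. by move=> a0 x0; rewrite -powRrM mulVf// powRr1. Qed.

Lemma powR_div a (x M : R) : 0 <= x -> 0 < M -> (x / M) `^ a = x `^ a / M `^ a.
Proof.
move=> x0 M0; have Mi : 0 <= M^-1 by rewrite invr_ge0 ltW.
by rewrite (powRM a x0 Mi) -(powR_inv1 (ltW M0)) -powRrM mulN1r powRN.
Qed.

Lemma ge1_case (Q : \bar R -> Prop) : (forall a, 1 <= a -> Q a%:E) -> Q +oo%E ->
  forall p, (1 <= p)%E -> Q p.
Proof. by move=> Qf Qy [a| |]// a1; apply: Qf. Qed.

(** The graph of the concave power lies below its tangent at t = 1, obtained here as Young's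
    inequality with second factor 1. It replaces Jensen's inequality for powers. *)
Lemma powR_tangent (th t : R) : 0 < th -> th <= 1 -> 0 <= t -> t `^ th <= th * t + (1 - th).
Proof.
move=> th0; rewrite le_eqVlt => /orP[/eqP ->|th1] t0.
  by rewrite powRr1// mul1r subrr addr0.
have th1' : 0 < 1 - th by rewrite subr_gt0.
have := @conjugate_powR R (t `^ th) 1 th^-1 (1 - th)^-1 (powR_ge0 _ _) ler01.
rewrite !invrK !invr_gt0 mulr1 powR1 mul1r powRK ?gt_eqF// => H.
apply: le_trans (H th0 th1' _) _; first by rewrite addrC subrK.
by rewrite mulrC.
Qed.

Section fixed_dim.
Variable d : nat.
Implicit Types x y g : 'rV[R]_d.

Lemma lpnormE a x : lpnorm a%:E x = (\sum_(i < d) `|x 0 i| `^ a) `^ a^-1.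
Proof. by []. Qed.

Lemma lpnormyE x : lpnorm +oo%E x = \big[Num.max/0]_(i < d) `|x 0 i|.
Proof. by []. Qed.

Local Opaque lpnorm.

Lemma lpnorm_powR a x : a != 0 -> lpnorm a%:E x `^ a = \sum_(i < d) `|x 0 i| `^ a.
Proof.
by move=> a0; rewrite lpnormE powRVK//; apply: sumr_ge0 => i _; exact: powR_ge0.
Qed.

Lemma lpnorm_ge0 p x : 0 <= lpnorm p x.
Proof.
case: p => [a| |]//; first exact: powR_ge0.
rewrite lpnormyE; apply: (@big_ind R (fun z => 0 <= z)) => // u v u0 v0.
by rewrite le_max u0.
Qed.

Lemma coord_le_lpnorm p x i : (1 <= p)%E -> `|x 0 i| <= lpnorm p x.
Proof.
move: p; apply: ge1_case => [a a1|]; last first.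
  by rewrite lpnormyE; exact: (le_bigmax 0 (fun i => `|x 0 i|)).
have a0 : 0 < a by exact: lt_le_trans a1.
apply: (powR_le_inv a0); [by []|exact: lpnorm_ge0|].
rewrite lpnorm_powR ?gt_eqF// (bigD1 i)//= lerDl; apply: sumr_ge0 => j _.
exact: powR_ge0.
Qed.

Lemma lpnorm_lePfin a x (M : R) : 0 < a -> 0 <= M ->
  (lpnorm a%:E x <= M) = (\sum_(i < d) `|x 0 i| `^ a <= M `^ a).
Proof.
move=> a0 M0; rewrite -lpnorm_powR ?gt_eqF//; apply/idP/idP.
  by apply: powR_le; rewrite ?(ltW a0)// lpnorm_ge0.
by move=> h; apply: (powR_le_inv a0); [exact: lpnorm_ge0| |].
Qed.

Lemma lpnormy_leP x (M : R) : 0 <= M -> (lpnorm +oo%E x <= M) <-> forall i, `|x 0 i| <= M.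
Proof.
move=> M0; rewrite lpnormyE; split=> [h i|h].
  by apply: le_trans h; exact: (le_bigmax 0 (fun i => `|x 0 i|)).
by apply: bigmax_le.
Qed.

Lemma lpnorm_mono p q x : (1 <= p)%E -> (p <= q)%E -> lpnorm q x <= lpnorm p x.
Proof.
move=> p1 pq; have q1 := le_trans p1 pq.
move: q q1 pq; apply: ge1_case => [b b1|_]; last first.
  by apply/lpnormy_leP => [|i]; [exact: lpnorm_ge0|exact: coord_le_lpnorm].
move: p p1; apply: ge1_case => [a a1|]; last by rewrite leye_eq.
rewrite lee_fin => ab.
have a0 : 0 < a by exact: lt_le_trans a1. have b0 : 0 < b by exact: lt_le_trans b1.
rewrite lpnorm_lePfin// ?lpnorm_ge0//.
have [N0|Nn] := eqVneq (lpnorm a%:E x) 0.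
  rewrite N0 big1 ?powR_ge0// => i _.
  have : `|x 0 i| <= 0 by rewrite -N0; apply: coord_le_lpnorm; rewrite lee_fin.
  by rewrite normr_le0 => /eqP ->; rewrite normr0 powR0// gt_eqF.
set N := lpnorm a%:E x in Nn *; have N0 : 0 < N by rewrite lt_neqAle eq_sym Nn lpnorm_ge0.
have -> : N `^ b = N `^ (b - a) * N `^ a by rewrite -powRD ?subrK//; apply/implyP => _.
rewrite /N lpnorm_powR ?gt_eqF// mulr_sumr; apply: ler_sum => i _.
have [->|xi] := eqVneq (x 0 i) 0.
  by rewrite normr0 !powR0 ?gt_eqF// mulr0.
have -> : `|x 0 i| `^ b = `|x 0 i| `^ (b - a) * `|x 0 i| `^ a.
  by rewrite -powRD ?subrK//; apply/implyP => _; rewrite normr_eq0.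
rewrite ler_wpM2r ?powR_ge0//; apply: powR_le; rewrite ?subr_ge0//.
by apply: coord_le_lpnorm; rewrite lee_fin.
Qed.

Lemma lpnormZ p (c : R) x : (1 <= p)%E -> lpnorm p (c *: x) = `|c| * lpnorm p x.
Proof.
move: p; apply: ge1_case => [a a1|].
  have a0 : 0 < a by exact: lt_le_trans a1.
  rewrite !lpnormE (_ : \sum_(i < d) _ = `|c| `^ a * \sum_(i < d) `|x 0 i| `^ a).
    by rewrite powRM ?powR_ge0 ?powRK ?gt_eqF//; apply: sumr_ge0 => i _; exact: powR_ge0.
  by rewrite mulr_sumr; apply: eq_bigr => i _; rewrite mxE normrM powRM.
have le (z : 'rV[R]_d) (e : R) : lpnorm +oo%E (e *: z) <= `|e| * lpnorm +oo%E z.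
  apply/lpnormy_leP => [|i]; first by rewrite mulr_ge0// lpnorm_ge0.
  by rewrite mxE normrM ler_wpM2l//; apply: coord_le_lpnorm; exact: leey.
apply/eqP; rewrite eq_le le/=.
have [->|c0] := eqVneq c 0; first by rewrite normr0 mul0r lpnorm_ge0.
have := le (c *: x) c^-1; rewrite scalerA mulVf// scale1r normfV.
by rewrite ler_pdivlMl// normr_gt0.
Qed.

Lemma lpnormN p x : (1 <= p)%E -> lpnorm p (- x) = lpnorm p x.
Proof. by move=> p1; rewrite -scaleN1r lpnormZ// normrN1 mul1r. Qed.

Lemma lpnorm_eq0 p x : (1 <= p)%E -> lpnorm p x = 0 -> x = 0.
Proof.
move=> p1 x0; apply/rowP => i; rewrite mxE; apply/eqP; rewrite -normr_le0 -x0.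
exact: coord_le_lpnorm.
Qed.

Lemma lpnorm0 p : (1 <= p)%E -> lpnorm p (0 : 'rV[R]_d) = 0.
Proof. by move=> p1; rewrite -(scale0r (0 : 'rV[R]_d)) lpnormZ// normr0 mul0r. Qed.

(** A substitute for the triangle inequality: |x_i - y_i| is at most twice the larger of |x_i| and
    |y_i|, and the sum of two a-th powers costs at most another factor 2. The constant 4 is absorbed
    in the end. *)
Lemma lpnormB_le p x y (M : R) : (1 <= p)%E -> lpnorm p x <= M -> lpnorm p y <= M ->
  lpnorm p (x - y) <= 4 * M.
Proof.
move=> p1 xM yM; have M0 : 0 <= M by apply: le_trans xM; exact: lpnorm_ge0.
have xyi i : `|(x - y) 0 i| <= 2 * Num.max `|x 0 i| `|y 0 i|.
  rewrite !mxE; apply: le_trans (ler_normB _ _) _; rewrite mulr2n mulrDl !mul1r.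
  by apply: lerD; rewrite le_max lexx ?orbT.
move: p p1 xM yM; apply: ge1_case => [a a1 xM yM|]; last first.
  move=> /lpnormy_leP xM /lpnormy_leP yM; apply/lpnormy_leP => [|i]; first by rewrite mulr_ge0.
  apply: le_trans (xyi i) _; have : Num.max `|x 0 i| `|y 0 i| <= M.
    by rewrite ge_max xM// yM.
  by lra.
have a0 : 0 < a by exact: lt_le_trans a1.
have M4 : 0 <= 4 * M by rewrite mulr_ge0.
have {}xM : \sum_(i < d) `|x 0 i| `^ a <= M `^ a by rewrite -lpnorm_lePfin.
have {}yM : \sum_(i < d) `|y 0 i| `^ a <= M `^ a by rewrite -lpnorm_lePfin.
rewrite (lpnorm_lePfin _ a0 M4).
apply: (@le_trans _ _ (\sum_(i < d) (2 `^ a * (`|x 0 i| `^ a + `|y 0 i| `^ a)))).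
  apply: ler_sum => i _; apply: le_trans (powR_le (ltW a0) _ (xyi i)) _ => //.
  rewrite powRM ?le_max ?normr_ge0// ler_wpM2l ?powR_ge0//.
  by rewrite /Num.max; case: ifP => _; rewrite ?lerDl ?lerDr powR_ge0.
rewrite -mulr_sumr big_split/=.
have -> : 4 * M = 2 * (2 * M) by ring.
rewrite [leRHS]powRM ?mulr_ge0// ler_wpM2l ?powR_ge0//.
apply: le_trans (lerD xM yM) _; rewrite powRM// (_ : M `^ a + M `^ a = 2 * M `^ a); last by ring.
by rewrite ler_wpM2r ?powR_ge0// -[leLHS]powRr1// ler_powR// ler1n.
Qed.

Lemma hoelder_fin a b g x : 1 < a -> a^-1 + b^-1 = 1 -> 0 < b ->
  \sum_(i < d) `|g 0 i| * `|x 0 i| <= lpnorm b%:E g * lpnorm a%:E x.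
Proof.
move=> a1 ab b0; have a0 : 0 < a by exact: lt_trans a1.
have b1 : (1 <= b%:E)%E.
  rewrite lee_fin -[leLHS]invr1 -[leRHS]invrK lef_pV2 ?posrE ?invr_gt0//.
  by rewrite -ab lerDr invr_ge0 ltW.
have a1' : (1 <= a%:E)%E by rewrite lee_fin ltW.
have [N0|Nn] := eqVneq (lpnorm b%:E g) 0.
  by rewrite (lpnorm_eq0 b1 N0) big1 ?mulr_ge0 ?lpnorm_ge0// => i _; rewrite mxE normr0 mul0r.
have [M0|Mn] := eqVneq (lpnorm a%:E x) 0.
  by rewrite (lpnorm_eq0 a1' M0) big1 ?mulr_ge0 ?lpnorm_ge0// => i _; rewrite mxE normr0 mulr0.
have NE := lpnorm_powR g (lt0r_neq0 b0); have ME := lpnorm_powR x (lt0r_neq0 a0).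
have N0 : 0 < lpnorm b%:E g by rewrite lt_neqAle eq_sym Nn lpnorm_ge0.
have M0 : 0 < lpnorm a%:E x by rewrite lt_neqAle eq_sym Mn lpnorm_ge0.
move: NE ME N0 M0; move: (lpnorm _ g) (lpnorm _ x) => N M NE ME N0 M0 {Nn Mn}.
have H i : `|g 0 i| * `|x 0 i| <= N * M * (`|x 0 i| `^ a / M `^ a / a + `|g 0 i| `^ b / N `^ b / b).
  have h := conjugate_powR (divr_ge0 (normr_ge0 (x 0 i)) (ltW M0)) (divr_ge0 (normr_ge0 (g 0 i)) (ltW N0)) a0 b0 ab.
  have -> : `|g 0 i| * `|x 0 i| = N * M * (`|x 0 i| / M * (`|g 0 i| / N)).
    by move: `|_| `|_| => z w; field; rewrite !gt_eqF.
  rewrite ler_wpM2l ?mulr_ge0 ?(ltW M0) ?(ltW N0)//; apply: le_trans h _.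
  by rewrite !powR_div.
apply: le_trans (ler_sum _ (fun i _ => H i)) _.
rewrite -mulr_sumr big_split/= -!mulr_suml -NE -ME.
by rewrite !divff ?gt_eqF ?powR_gt0// !mul1r ab mulr1.
Qed.

Lemma hoelder_conjugate_fin a : 1 < a ->
  exists b : R, hoelder_conjugate a%:E = b%:E /\ a^-1 + b^-1 = 1 /\ 0 < b.
Proof.
move=> a1; have a0 : 0 < a by exact: lt_trans a1.
have a10 : 0 < a - 1 by rewrite subr_gt0.
exists (a / (a - 1)); split.
  by rewrite /hoelder_conjugate/= eqe gt_eqF// -EFinD inver subr_eq0 gt_eqF// -EFinM.
by split; [field; rewrite !gt_eqF|rewrite divr_gt0].
Qed.

Lemma hoelder_conjugate1 : hoelder_conjugate (1 : \bar R) = +oo%E.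
Proof.
by rewrite /hoelder_conjugate/= eqe oner_eq0 -EFinD subrr inver eqxx mul1e.
Qed.

Lemma hoelder p g x : (1 <= p)%E -> `|dotp g x| <= lpnorm (hoelder_conjugate p) g * lpnorm p x.
Proof.
move=> p1; apply: (@le_trans _ _ (\sum_(i < d) `|g 0 i| * `|x 0 i|)).
  by apply: le_trans (ler_norm_sum _ _ _) _; apply: ler_sum => i _; rewrite normrM.
have sup1 (y z : 'rV[R]_d) : \sum_(i < d) `|y 0 i| * `|z 0 i| <= lpnorm +oo%E y * lpnorm 1%:E z.
  rewrite lpnorm1E /l1 mulr_sumr; apply: ler_sum => i _.
  by rewrite ler_wpM2r//; apply: coord_le_lpnorm; exact: leey.
move: p p1; apply: ge1_case => [a|]; last first.
  rewrite /hoelder_conjugate eqxx mulrC; apply: le_trans (sup1 x g).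
  by apply: ler_sum => i _; rewrite mulrC.
rewrite le_eqVlt => /orP[/eqP <-|a1]; first by rewrite hoelder_conjugate1.
have [b [-> [ab b0]]] := hoelder_conjugate_fin a1.
exact: hoelder_fin.
Qed.

Lemma upsilon_ge0 p q : 0 <= upsilon p q d. Proof. exact: powR_ge0. Qed.

Lemma lpnorm_upsilon p q x : (0 < d)%N -> (1 <= p)%E -> (1 <= q)%E ->
  lpnorm q x <= upsilon p q d * lpnorm p x.
Proof.
move=> d0 p1 q1; have dR : 0 < d%:R :> R by rewrite ltr0n.
have [pq|qp] := leP p q.
  rewrite /upsilon (_ : Order.max q p = q); last by rewrite max_l.
  by rewrite subrr powRr0 mul1r; exact: lpnorm_mono.
rewrite /upsilon (_ : Order.max q p = p); last by rewrite max_r// ltW.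
move: q q1 qp; apply: ge1_case => [b b1|]; last by rewrite ltNge leey.
have b0 : 0 < b by exact: lt_le_trans b1.
have rb : recip b%:E = b^-1 by rewrite /recip inver gt_eqF.
move: p p1; apply: ge1_case => [a a1|]; last first.
  move=> _; rewrite rb /recip invey subr0 lpnorm_lePfin ?mulr_ge0 ?powR_ge0 ?lpnorm_ge0//.
  rewrite powRM ?powR_ge0 ?lpnorm_ge0// powRVK ?gt_eqF ?ler0n//.
  apply: le_trans (ler_sum _ (fun i _ => powR_le (ltW b0) (normr_ge0 _) (coord_le_lpnorm x i (leey _)))) _.
  by rewrite sumr_const card_ord mulr_natl.
rewrite lte_fin => ba; have a0 : 0 < a by exact: lt_le_trans a1.
have ra : recip a%:E = a^-1 by rewrite /recip inver gt_eqF.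
have [x0|xn] := eqVneq (lpnorm a%:E x) 0.
  by rewrite (lpnorm_eq0 _ x0) ?lee_fin// !lpnorm0 ?lee_fin// mulr0.
have N0 : 0 < lpnorm a%:E x by rewrite lt_neqAle eq_sym xn lpnorm_ge0.
have NE := lpnorm_powR x (lt0r_neq0 a0).
rewrite rb ra lpnorm_lePfin ?mulr_ge0 ?powR_ge0 ?(ltW N0)//.
move: NE N0 {xn}; move: (lpnorm _ x) => N NE N0.
(* [M] is the power mean of order a of the coordinates. The tangent inequality for the power b/a is
   applied to |x_i|^a / M^a, whose average over i is 1, so the sum of the tangents is exactly the
   claimed bound. *)
pose M := N * d%:R `^ (- a^-1); have M0 : 0 < M by rewrite /M mulr_gt0// powR_gt0.
have dn0 : (d%:R : R) != 0 by rewrite gt_eqF.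
have -> : (d%:R `^ (b^-1 - a^-1) * N) `^ b = d%:R * M `^ b.
  rewrite powRD; last by rewrite dn0 implybT.
  rewrite -mulrA (mulrC _ N) -/M powRM ?powR_ge0 ?(ltW M0)// powRVK ?gt_eqF ?ler0n//.
have Ma : M `^ a = N `^ a / d%:R.
  rewrite powRM ?powR_ge0 ?(ltW N0)// -powRrM mulNr mulVf ?gt_eqF// powR_inv1 ?ler0n//.
have H i : `|x 0 i| `^ b <= M `^ b * ((b / a) * (`|x 0 i| `^ a / M `^ a) + (1 - b / a)).
  have -> : `|x 0 i| `^ b = M `^ b * (`|x 0 i| `^ a / M `^ a) `^ (b / a).
    have e : `|x 0 i| `^ a / M `^ a = (`|x 0 i| / M) `^ a by rewrite powR_div.
    rewrite e -powRrM (mulrC b) mulrA divff ?gt_eqF// mul1r.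
    by rewrite -powRM ?divr_ge0 ?(ltW M0)// mulrC divfK ?gt_eqF.
  rewrite ler_wpM2l ?powR_ge0//; apply: powR_tangent; rewrite ?divr_gt0//.
    by rewrite ler_pdivrMr// mul1r ltW.
  by rewrite divr_ge0 ?powR_ge0.
apply: le_trans (ler_sum _ (fun i _ => H i)) _.
rewrite -mulr_sumr big_split/= -mulr_sumr -mulr_suml sumr_const card_ord.
rewrite -NE Ma -[(1 - b / a) *+ d]mulr_natl [leRHS]mulrC ler_wpM2l ?powR_ge0//.
have Na0 : N `^ a != 0 by rewrite gt_eqF// powR_gt0.
move: Na0; move: (N `^ a) => Na Na0; rewrite le_eqVlt; apply/orP; left; apply/eqP; field.
by rewrite dn0 Na0 gt_eqF.
Qed.

Lemma lpnorm2E x : lpnorm 2%:E x = Num.sqrt (dotp x x).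
Proof.
rewrite lpnormE -powR12_sqrt ?dotp_ge0//; congr (_ `^ _).
by apply: eq_bigr => i _; rewrite powR_mulrn// -normrX ger0_norm ?sqr_ge0// expr2.
Qed.

Lemma lpnorm_sign p (c : R) x : (0 < d)%N -> (1 <= p)%E ->
  lpnorm (hoelder_conjugate p) (c *: signv x) = `|c| * d%:R `^ (1 - recip p).
Proof.
move=> d0 p1; have dR : 0 < d%:R :> R by rewrite ltr0n.
have s1 i : `|signv x 0 i| = 1 by rewrite mxE; case: ifP; rewrite ?normrN normr1.
have sfin b : 0 < b -> lpnorm b%:E (signv x) = d%:R `^ b^-1.
  move=> b0; rewrite lpnormE; congr (_ `^ _).
  under eq_bigr do rewrite s1 powR1.
  by rewrite sumr_const card_ord.
move: p p1; apply: ge1_case => [a|]; last first.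
  rewrite /hoelder_conjugate eqxx lpnormZ// sfin// invr1.
  by rewrite /recip invey subr0.
rewrite le_eqVlt => /orP[/eqP <-|a1].
  rewrite hoelder_conjugate1 lpnormZ ?leey//; congr (_ * _).
  rewrite /recip inve1 subrr powRr0; apply/eqP; rewrite eq_le; apply/andP; split.
    by apply/lpnormy_leP => // i; rewrite s1.
  have := coord_le_lpnorm (signv x) (Ordinal d0) (leey 1); rewrite s1//.
have [b [-> [ab b0]]] := hoelder_conjugate_fin a1.
have a0 : 0 < a by exact: lt_trans a1.
rewrite lpnormZ ?sfin//; last first.
  rewrite lee_fin -[leLHS]invr1 -[leRHS]invrK lef_pV2 ?posrE ?invr_gt0//.
  by rewrite -ab lerDr invr_ge0 ltW.
by rewrite /recip inver gt_eqF//= -ab addrAC subrr add0r.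
Qed.

Lemma recip2 : recip (2%:E : \bar R) = 2^-1.
Proof. by rewrite /recip inver gt_eqF. Qed.

(** The two sources of [xi]: the dual norm of a sign vector, and the passage from the Lipschitz
    condition in the q-norm to one in the Euclidean norm. *)
Lemma xiE p q : (0 < d)%N -> (1 <= q)%E ->
  xi p q d = d%:R `^ (1 - recip p) ^+ 2 * upsilon 2%:E q d ^+ 2.
Proof.
move=> d0 q1; have dR : (d%:R : R) != 0 by rewrite gt_eqF// ltr0n.
rewrite /xi /upsilon -!powR_mulrn ?powR_ge0// -!powRrM -powRD ?dR ?implybT//; congr (_ `^ _).
have -> : recip q - recip (Order.max q 2%:E) = recip (Order.min q 2%:E) - 2^-1 :> R.
  by have [q2|q2] := leP q 2%:E; rewrite ?recip2 ?subrr.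
by field.
Qed.

End fixed_dim.

End Norms.

(** * Moments of the Laplace vector and of its direction *)

Section Moments.
Variable R : realType.
Local Open Scope ereal_scope.

Lemma integral_laplaceV_coord n (i : 'I_n) (f : R -> \bar R) :
  measurable_fun setT f -> (forall x, 0 <= f x) ->
  \int[laplaceV R n]_u f (u 0%R i) = \int[@laplace R]_x f x.
Proof.
case: n i => [[]//|n] i mf f0.
have mc (j : 'I_n.+1) : measurable_fun setT (fun u : rVB R n.+1 => f (u 0%R j)).
  by apply: measurableT_comp => //; exact: measurable_coord.
rewrite -(ge0_integral_laplaceV_perm (tperm ord0 i) (mc i))//.
under eq_integral => u _ do rewrite /rV_perm mxE tpermR.
rewrite (ge0_integral_laplaceVS (mc ord0))//; apply: eq_integral => x _.
under eq_integral => v _ do rewrite cons_rV0.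
by rewrite integral_cst//= -[RHS]mule1; congr (_ * _); exact: probability_setT.
Qed.

Lemma integral_laplaceV_expN n :
  \int[laplaceV R n]_u (expR (- l1 u))%:E = ((2^-1) ^+ n)%:E.
Proof.
have mE m : measurable_fun setT (fun u : rVB R m => (expR (- l1 u))%:E).
  apply/measurable_EFinP; apply: measurableT_comp => //.
  by apply: measurableT_comp => //; exact: measurable_l1.
elim: n => [|n IH].
  under eq_integral => u _ do rewrite /l1 big_ord0 oppr0 expR0.
  by rewrite integral_cst//= mul1e; exact: probability_setT.
rewrite (ge0_integral_laplaceVS (mE n.+1))//.
transitivity (\int[@laplace R]_x ((2^-1 ^+ n)%:E * (expR (-1 * `|x|))%:E)).
  apply: eq_integral => x _.
  under eq_integral => v _ do rewrite l1_cons opprD expRD EFinM.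
  rewrite ge0_integralZl//.
  by rewrite IH mulN1r muleC.
rewrite ge0_integralZl//; last first.
- by apply/measurable_EFinP; apply: measurableT_comp => //; apply: measurable_funM.
rewrite integral_laplace_exp; last by lra.
by rewrite -EFinM exprSr opprK.
Qed.

(** Only n^2 <= 10 (3/2)^n is of interest; the lower-order terms make the induction close, since 3/2
    of the polynomial at n dominates its value at n + 1. *)
Lemma sqr_le_exp (n : nat) : (n%:R ^+ 2 + 4 * n%:R + 10 <= 10 * (3 / 2) ^+ n :> R)%R.
Proof.
elim: n => [|n IH]; first by rewrite expr0; lra.
rewrite [in leRHS]exprSr -natr1; have n0 : (0 <= n%:R :> R)%R by [].
nra.
Qed.

(* The second term has mean (exp(1/4)/2)^d when d = n, negligible against 1/d^2. *)
Lemma inv_sqr_le (d t : R) : (0 < d -> 0 <= t ->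
  ((1 + t) ^+ 2)^-1 <= 16 / d ^+ 2 + expR (d / 4) * expR (- t))%R.
Proof.
move=> d0 t0; rewrite -expRD; have [dt|td] := leP (d / 4)%R t.
  apply: (@le_trans _ _ (16 / d ^+ 2)%R); last by rewrite lerDl expR_ge0.
  have t1 : (0 < (1 + t) ^+ 2)%R by rewrite exprn_gt0//; lra.
  rewrite -[leLHS]mul1r ler_pdivrMr// mulrAC ler_pdivlMr ?exprn_gt0//; nra.
apply: (@le_trans _ _ 1%R).
  have t1 : (0 < (1 + t) ^+ 2)%R by rewrite exprn_gt0//; lra.
  by rewrite invf_le1//; nra.
rewrite -[leLHS]add0r lerD ?divr_ge0 ?exprn_ge0 ?(ltW d0)//.
by apply: le_trans (expR_ge1Dx _); lra.
Qed.

(** 26 = 16 + 10: the exponential term of [inv_sqr_le] has mean at most (2/3)^n, which is at most 10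
    / n^2. *)
Lemma integral_laplaceV_inv_sqr n : (0 < n)%N ->
  \int[laplaceV R n]_u (((1 + l1 u) ^+ 2)^-1)%:E <= (26 / n%:R ^+ 2)%:E.
Proof.
move=> n0; have d0 : (0 < n%:R :> R)%R by rewrite ltr0n.
have mE : measurable_fun setT (fun u : rVB R n => (expR (n%:R / 4) * expR (- l1 u))%:E).
  apply/measurable_EFinP; apply: measurable_funM => //; apply: measurableT_comp => //.
  by apply: measurableT_comp => //; exact: measurable_l1.
apply: (@le_trans _ _ (\int[laplaceV R n]_u ((16 / n%:R ^+ 2)%:E + (expR (n%:R / 4) * expR (- l1 u))%:E))).
  apply: ge0_le_integral => //.
  - by move=> u _; rewrite lee_fin invr_ge0 sqr_ge0.
  - apply/measurable_EFinP.
    rewrite (_ : (fun u => _) = fun u : rVB R n => ((1 + l1 u) `^ (- 2%:R))%R); last first.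
      apply/funext => u; rewrite powRN powR_mulrn//.
      by rewrite addr_ge0// l1_ge0.
    apply: (measurableT_comp (measurable_powR _)).
    by apply: measurable_funD => //; exact: measurable_l1.
  - by apply: emeasurable_funD.
  - by move=> u _; rewrite lee_fin; apply: inv_sqr_le => //; exact: l1_ge0.
rewrite ge0_integralD//.
rewrite integral_cst//= (_ : laplaceV R n setT = 1); last exact: probability_setT.
rewrite mule1.
under eq_integral => u _ do rewrite EFinM.
rewrite ge0_integralZl//; last first.
- apply/measurable_EFinP; apply: measurableT_comp => //.
  by apply: measurableT_comp => //; exact: measurable_l1.
rewrite integral_laplaceV_expN -EFinM -EFinD lee_fin.
(* exp(1/4) <= 4/3 follows from exp(-1/4) >= 3/4. *)
have e4 : (expR (n%:R / 4) <= (4 / 3) ^+ n :> R)%R.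
  rewrite mulrC expRM_natr; apply: lerXn2r; rewrite ?nnegrE ?expR_ge0//.
  rewrite -[(4^-1)%R]opprK expRN -[leRHS]invrK lef_pV2 ?posrE ?expR_gt0 ?invr_gt0//.
  by apply: le_trans (expR_ge1Dx _); lra.
have : (expR (n%:R / 4) * 2^-1 ^+ n <= 10 / n%:R ^+ 2 :> R)%R; last first.
  by move=> h; rewrite (_ : 26 / n%:R ^+ 2 = 16 / n%:R ^+ 2 + 10 / n%:R ^+ 2)%R ?lerD2l//; ring.
apply: (@le_trans _ _ ((2 / 3) ^+ n)%R).
  have -> : ((2 / 3 : R) = 4 / 3 * 2^-1)%R by field.
  by rewrite exprMn ler_wpM2r// exprn_ge0.
have -> : ((2 / 3 : R) = (3 / 2)^-1)%R by field.
rewrite exprVn -[leLHS]mul1r ler_pdivrMr ?exprn_gt0// mulrAC ler_pdivlMr ?exprn_gt0// mul1r.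
have := sqr_le_exp n; lra.
Qed.

Let laplaceT : @laplace R setT = 1. Proof. exact: probability_setT. Qed.
Let laplaceVT n : laplaceV R n setT = 1. Proof. exact: probability_setT. Qed.

Let mabs : measurable_fun setT (fun x : R => `|x|%:E).
Proof. by apply/measurable_EFinP. Qed.

Let mexpN (c : R) : measurable_fun setT (fun x : R => (expR (c * `|x|))%:E).
Proof. by apply/measurable_EFinP; apply: measurableT_comp => //; apply: measurable_funM. Qed.

(** Integration of 1 <= |x| + exp(-|x|), whose last term has mean 1/2. *)
Lemma integral_laplace_abs_ge : (2^-1)%:E <= \int[@laplace R]_x `|x|%:E.
Proof.
have : 1 <= \int[@laplace R]_x `|x|%:E + (2^-1)%:E.
  rewrite (_ : (2^-1)%:E = \int[@laplace R]_x (expR (-1 * `|x|))%:E); last first.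
    by rewrite integral_laplace_exp ?opprK//; lra.
  rewrite -ge0_integralD//; last exact: (mexpN (-1)).
  rewrite -[leLHS]laplaceT -[leLHS]mul1e -integral_cst//.
  apply: ge0_le_integral => //; first by apply: emeasurable_funD; [exact: mabs|exact: (mexpN (-1))].
  move=> x _; rewrite -EFinD lee_fin; have := @expR_ge1Dx R (-1 * `|x|)%R; lra.
rewrite -leeBlDr// -EFinB; congr (_%:E <= _); lra.
Qed.

(** From z <= exp z at z = |x| / (2 q), raised to the power q: |x|^q <= (2 q)^q exp(|x| / 2), and
    the exponential has mean 2. *)
Lemma integral_laplace_powR_le (q : R) : (1 <= q)%R ->
  \int[@laplace R]_x (`|x| `^ q)%:E <= (2 * (2 * q) `^ q)%:E.
Proof.
move=> q1; have q0 : (0 < 2 * q)%R by lra.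
have mp : measurable_fun setT (fun x : R => (`|x| `^ q)%:E).
  by apply/measurable_EFinP; apply: (measurableT_comp (measurable_powR _)).
apply: (@le_trans _ _ (\int[@laplace R]_x (((2 * q) `^ q)%:E * (expR (2^-1 * `|x|))%:E))).
  apply: ge0_le_integral => //.
  - by apply: emeasurable_funM => //; exact: mexpN.
  move=> x _; rewrite -EFinM lee_fin.
  have -> : (expR (2^-1 * `|x|) = (expR ((2 * q)^-1 * `|x|)) `^ q)%R.
    by rewrite -expRM; congr expR; field; lra.
  rewrite -powRM ?expR_ge0 ?(ltW q0)//; apply: powR_le => //; first by lra.
  have := @expR_ge1Dx R ((2 * q)^-1 * `|x|)%R => h.
  rewrite mulrC -ler_pdivrMr// mulrC; lra.
rewrite ge0_integralZl//; last 2 first.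
- exact: mexpN.
- by rewrite lee_fin powR_ge0.
rewrite integral_laplace_exp; last by lra.
by rewrite -EFinM (_ : (1 - 2^-1)^-1 = 2 :> R)%R 1?mulrC//; field.
Qed.

Lemma integral_laplaceV_sum n (f : R -> \bar R) :
  measurable_fun setT f -> (forall x, 0 <= f x) ->
  \int[laplaceV R n]_u (\sum_(i < n) f (u 0%R i)) = n%:R%:E * \int[@laplace R]_x f x.
Proof.
move=> mf f0; rewrite ge0_integral_sum//; last first.
  by move=> i; apply: measurableT_comp => //; exact: measurable_coord.
under eq_bigr do rewrite integral_laplaceV_coord//.
by rewrite mule_natl big_const_ord; elim: n => //= n ->; rewrite [RHS]mulrS.
Qed.

Lemma integral_laplaceV_l1_ge n : (n%:R / 2)%:E <= \int[laplaceV R n]_u (l1 u)%:E.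
Proof.
under eq_integral => u _ do rewrite /l1 -sumEFin.
rewrite (@integral_laplaceV_sum n (fun x => `|x|%:E))// EFinM lee_wpmul2l ?lee_fin//.
exact: integral_laplace_abs_ge.
Qed.

Lemma lpnorm_l1unit q n (u : 'rV[R]_n) : 1 <= q -> lpnorm q u = (lpnorm q (l1unit u) * l1 u)%R.
Proof.
move=> q1; rewrite /l1unit lpnormZ// ger0_norm ?invr_ge0 ?l1_ge0//.
have [l0|l0] := eqVneq (l1 u) 0%R; last by field.
by rewrite -lpnorm1E in l0; rewrite (lpnorm_eq0 _ l0) ?lpnorm0 ?mulr0 ?mul0r.
Qed.

Lemma measurable_lpnorm (q : \bar R) n : measurable_fun setT (@lpnorm R q n : rVB R n -> R).
Proof.
have ma (i : 'I_n) : measurable_fun setT (fun u : rVB R n => `|u 0%R i|%R).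
  by apply: measurableT_comp => //; exact: measurable_coord.
case: q => [a| |].
- apply: (measurableT_comp (measurable_powR _)).
  apply: measurable_sum => i.
  by apply: (measurableT_comp (measurable_powR _)).
- rewrite /lpnorm; elim: (index_enum _) => [|i s IH].
    by under eq_fun do rewrite big_nil; exact: measurable_cst.
  by under eq_fun do rewrite big_cons; apply: measurable_maxr.
- exact: measurable_cst.
Qed.

(** Jensen's inequality for the power 1/q in tangent form. The tangent is taken at B^q = (2 q)^q n;
    the sum S of the |u_i|^q has mean at most 2 B^q, so the total is at most B + 2 B = 6 q
    n^(1/q). *)
Lemma integral_laplaceV_lpnorm n (q : R) : (0 < n)%N -> (1 <= q)%R ->
  \int[laplaceV R n]_u (lpnorm q%:E u)%:E <= (6 * q * n%:R `^ q^-1)%:E.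
Proof.
move=> n0 q1; have d0 : (0 < n%:R :> R)%R by rewrite ltr0n.
have q0 : (0 < q)%R by lra.
pose B : R := (2 * q * n%:R `^ q^-1)%R.
have B0 : (0 < B)%R by rewrite /B !mulr_gt0// powR_gt0.
have Bq : (B `^ q = (2 * q) `^ q * n%:R)%R.
  by rewrite /B powRM ?powR_ge0 ?powRVK ?gt_eqF//; lra.
have ms : measurable_fun setT (fun x : R => (`|x| `^ q)%:E).
  by apply/measurable_EFinP; apply: (measurableT_comp (measurable_powR _)).
have mS : measurable_fun setT (fun u : rVB R n => \sum_(i < n) (`|u 0%R i| `^ q)%:E).
  by apply: emeasurable_sum => i; apply: (measurableT_comp ms); exact: measurable_coord.
apply: (@le_trans _ _ (\int[laplaceV R n]_u (B%:E + (B / B `^ q)%:E * \sum_(i < n) (`|u 0%R i| `^ q)%:E))).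
  apply: ge0_le_integral => //.
  - by move=> u _; rewrite lee_fin lpnorm_ge0.
  - by apply/measurable_EFinP; exact: measurable_lpnorm.
  - by apply: emeasurable_funD => //; apply: emeasurable_funM.
  move=> u _; rewrite sumEFin -EFinM -EFinD lee_fin lpnormE.
  set S := (\sum_(i < n) _)%R; have S0 : (0 <= S)%R by apply: sumr_ge0 => i _; exact: powR_ge0.
  have Bq0 : (0 < B `^ q)%R by rewrite powR_gt0.
  have e : ((S / B `^ q) `^ q^-1 = S `^ q^-1 / B)%R by rewrite powR_div// powRK ?gt_eqF ?ltW.
  have := @powR_tangent R q^-1 (S / B `^ q); rewrite invr_gt0 => /(_ q0).
  rewrite invf_le1// => /(_ q1 (divr_ge0 S0 (ltW Bq0))); rewrite e ler_pdivrMr// => h.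
  apply: le_trans h _; rewrite mulrDl addrC lerD//.
    by rewrite ler_piMl ?(ltW B0)// lerBlDr lerDl invr_ge0 ltW.
  rewrite mulrC mulrCA mulrA mulrC -[leRHS]mul1r mulrC.
  rewrite (_ : B / B `^ q * S = B * (S / B `^ q))%R; last by ring.
  rewrite mul1r -mulrA ler_piMl// ?invf_le1//.
  by rewrite !mulr_ge0// ?invr_ge0 ltW.
rewrite ge0_integralD//; last 3 first.
- by move=> u _; rewrite lee_fin ltW.
- by move=> u _; rewrite mule_ge0 ?lee_fin ?divr_ge0 ?powR_ge0 ?(ltW B0)// sume_ge0.
- by apply: emeasurable_funM.
rewrite integral_cst//= laplaceVT mule1 ge0_integralZl//; last 2 first.
- by move=> u _; rewrite sume_ge0.
- by rewrite lee_fin divr_ge0 ?powR_ge0 ?(ltW B0).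
rewrite (@integral_laplaceV_sum n (fun x => (`|x| `^ q)%:E))//.
apply: (@le_trans _ _ (B%:E + (B / B `^ q)%:E * (n%:R%:E * (2 * (2 * q) `^ q)%:E))).
  rewrite leeD2l// lee_wpmul2l ?lee_fin ?divr_ge0 ?powR_ge0 ?(ltW B0)//.
  by rewrite lee_wpmul2l ?lee_fin//; exact: integral_laplace_powR_le.
rewrite -!EFinM -EFinD lee_fin Bq.
have p0 : ((2 * q) `^ q != 0)%R by rewrite gt_eqF// powR_gt0//; lra.
move: p0; move: ((2 * q) `^ q)%R => pq p0.
rewrite le_eqVlt; apply/orP; left; apply/eqP; rewrite /B.
by move: (n%:R `^ q^-1)%R => z; field; rewrite p0 gt_eqF.
Qed.

Lemma integral_l1unit_le n (Phi : 'rV[R]_n.+1 -> \bar R) (rho : R -> \bar R) (a b : R) :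
  measurable_fun setT (Phi : rVB R n.+1 -> _) -> (forall u, 0 <= Phi u) ->
  measurable_fun setT rho -> (forall t, 0 <= rho t) -> (0 < a)%R ->
  a%:E <= \int[laplaceV R n.+1]_u rho (l1 u) ->
  \int[laplaceV R n.+1]_u (Phi (l1unit u) * rho (l1 u)) <= b%:E ->
  \int[laplaceV R n.+1]_u Phi (l1unit u) <= (b / a)%:E.
Proof.
move=> mP P0 mr r0 a0 ha; rewrite polar_indep// => hb.
rewrite EFinM -[(a^-1)%:E]/((a^-1)%:E) lee_pdivlMr//.
apply: le_trans hb; rewrite lee_wpmul2l//.
by apply: integral_ge0 => u _; exact: P0.
Qed.

Lemma recip_fin (q : R) : (0 < q)%R -> recip q%:E = q^-1%R.
Proof. by move=> q0; rewrite /recip inver gt_eqF. Qed.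

Lemma integral_l1unit_lpnorm_fin n (q : R) : (1 <= q)%R ->
  \int[laplaceV R n.+1]_u (lpnorm q%:E (l1unit u))%:E <= (12 * (q * n.+1%:R `^ q^-1 / n.+1%:R))%:E.
Proof.
move=> q1; have d0 : (0 < n.+1%:R :> R)%R by rewrite ltr0n.
rewrite (_ : 12 * _ = (6 * q * n.+1%:R `^ q^-1) / (n.+1%:R / 2))%R; last by field; rewrite gt_eqF.
apply: (@integral_l1unit_le n (fun u => (lpnorm q%:E u)%:E) (fun t => `|t|%:E)) => //.
- by apply/measurable_EFinP; exact: measurable_lpnorm.
- by move=> u; rewrite lee_fin lpnorm_ge0.
- under eq_integral => u _ do rewrite ger0_norm ?l1_ge0//.
  exact: integral_laplaceV_l1_ge.
under eq_integral => u _ do rewrite -EFinM ger0_norm ?l1_ge0// -lpnorm_l1unit//.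
exact: integral_laplaceV_lpnorm.
Qed.

(** It gives ln d >= 1 for d >= 3, which makes ln d an admissible exponent for the norm. The
    estimate is e <= (6/5)^6 < 3. *)
Lemma expR1_lt3 : (expR 1 < 3 :> R)%R.
Proof.
have e6 : (expR (6^-1) <= 6 / 5 :> R)%R.
  rewrite -[(6^-1)%R]opprK expRN -[leRHS]invrK lef_pV2 ?posrE ?expR_gt0 ?invr_gt0//.
  by apply: le_trans (expR_ge1Dx _); lra.
have -> : expR 1 = (expR (6^-1) ^+ 6 :> R)%R by rewrite -expRM_natr mulVf.
apply: le_lt_trans (lerXn2r 6 _ _ e6) _; rewrite ?nnegrE ?expR_ge0//.
by rewrite !exprS expr0; lra.
Qed.

(** The constant 24 is twice the 12 of the finite case, because 1/d <= 2/(d + 1) and [zeta] has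
    denominator d + 1. *)
Lemma integral_l1unit_lpnorm n q : (2 <= n)%N -> 1 <= q ->
  \int[laplaceV R n.+1]_u (lpnorm q (l1unit u))%:E <= (24 * zeta q n.+1)%:E.
Proof.
move=> n2 q1; have d0 : (0 < n.+1%:R :> R)%R by rewrite ltr0n.
have d1 : (1 <= n.+1%:R :> R)%R by rewrite ler1n.
have ln1 : (1 <= ln n.+1%:R :> R)%R.
  rewrite -ler_expR lnK ?posrE//; apply: le_trans (ltW expR1_lt3) _.
  by rewrite ler_nat.
have half (x : R) : (0 <= x -> 12 * (x / n.+1%:R) <= 24 * (x / (n.+1%:R + 1)))%R.
  move=> x0; have -> : (24 * (x / (n.+1%:R + 1)) = 12 * (x * (2 / (n.+1%:R + 1))))%R by ring.
  rewrite ler_wpM2l// ler_wpM2l// ler_pdivlMr ?addr_gt0// mulrC ler_pdivrMr//; lra.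
rewrite /zeta; case: ltP => [ql|lq].
  move: q q1 ql; apply: ge1_case => [a a1 _|]; last by rewrite ltNge leey.
  rewrite recip_fin; last by lra.
  apply: le_trans (integral_l1unit_lpnorm_fin n a1) _; rewrite lee_fin; apply: half.
  by rewrite mulr_ge0 ?powR_ge0//; lra.
(* For q >= ln d the q-norm is at most the norm with exponent ln d, and d^(1 / ln d) = e turns the
   finite bound into the second case of [zeta]. *)
apply: (@le_trans _ _ (\int[laplaceV R n.+1]_u (lpnorm (ln n.+1%:R)%:E (l1unit u))%:E)).
  apply: ge0_le_integral => //.
  - by move=> u _; rewrite lee_fin lpnorm_ge0.
  - by apply/measurable_EFinP; apply: measurable_compV; [exact: measurable_lpnorm|exact: measurable_l1unit].
  - by apply/measurable_EFinP; apply: measurable_compV; [exact: measurable_lpnorm|exact: measurable_l1unit].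
  - by move=> u _; rewrite lee_fin; apply: lpnorm_mono; rewrite ?lee_fin.
apply: le_trans (integral_l1unit_lpnorm_fin n ln1) _; rewrite lee_fin.
have -> : (n.+1%:R `^ (ln n.+1%:R)^-1 = expR 1 :> R)%R.
  by rewrite /powR gt_eqF// mulVf// gt_eqF//; lra.
rewrite (mulrC (ln _)); apply: half; rewrite mulr_ge0 ?expR_ge0//; lra.
Qed.

Lemma measurable_dotpp n : measurable_fun setT (fun u : rVB R n => dotp u u).
Proof.
by apply: measurable_sum => i; apply: measurable_funM; exact: measurable_coord.
Qed.

(** Quotient of the bounds 32 d for the mean of |L|_2^2 and d^2 / 4 for that of |L|_1^2. *)
Lemma integral_l1unit_dotp n :
  \int[laplaceV R n.+1]_u (dotp (l1unit u) (l1unit u))%:E <= (128 / n.+1%:R)%:E.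
Proof.
have d0 : (0 < n.+1%:R :> R)%R by rewrite ltr0n.
rewrite (_ : 128 / n.+1%:R = (32 * n.+1%:R) / (n.+1%:R ^+ 2 / 4))%R; last by field; rewrite gt_eqF.
have ml : measurable_fun setT (fun u : rVB R n.+1 => (l1 u)%:E).
  by apply/measurable_EFinP; exact: measurable_l1.
apply: (@integral_l1unit_le n (fun u => (dotp u u)%:E) (fun t => (t ^+ 2)%:E)).
- by apply/measurable_EFinP; exact: measurable_dotpp.
- by move=> u; rewrite lee_fin dotp_ge0.
- by apply/measurable_EFinP; exact: measurable_funX.
- by move=> t; rewrite lee_fin sqr_ge0.
- by rewrite divr_gt0 ?exprn_gt0.
(* Jensen's inequality for the square in tangent form: 2 a t <= t^2 + a^2 at t = |L|_1, whose mean
   is at least a. *)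
- pose a : R := (n.+1%:R / 2)%R; have a0 : (0 <= a)%R by rewrite divr_ge0.
  have ml2 : measurable_fun setT (fun u : rVB R n.+1 => (l1 u ^+ 2)%:E).
    by apply/measurable_EFinP; apply: measurable_funX; exact: measurable_l1.
  have : (2 * a * a)%:E <= \int[laplaceV R n.+1]_u (l1 u ^+ 2)%:E + (a ^+ 2)%:E.
    rewrite -[(a ^+ 2)%:E]mule1 -(laplaceVT n.+1) -integral_cst// -ge0_integralD//; last 2 first.
    - by move=> u _; rewrite lee_fin sqr_ge0.
    - by move=> u _; rewrite lee_fin sqr_ge0.
    apply: (@le_trans _ _ (\int[laplaceV R n.+1]_u ((2 * a)%:E * (l1 u)%:E))).
      rewrite ge0_integralZl//; last 2 first.
      - by move=> u _; rewrite lee_fin l1_ge0.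
      - by rewrite lee_fin mulr_ge0.
      rewrite EFinM lee_wpmul2l ?lee_fin ?mulr_ge0//; exact: integral_laplaceV_l1_ge.
    apply: ge0_le_integral => //.
    - by move=> u _; rewrite mule_ge0 ?lee_fin ?mulr_ge0// l1_ge0.
    - by apply: emeasurable_funM.
    - by apply: emeasurable_funD.
    by move=> u _; rewrite -EFinM -EFinD lee_fin; have := sqr_ge0 (l1 u - a)%R; nra.
  rewrite -leeBlDr// -EFinB; apply: le_trans; rewrite lee_fin /a le_eqVlt; apply/orP; left.
  by apply/eqP; field.
under eq_integral => u _.
  rewrite -EFinM (_ : _ * _ = dotp u u)%R; last first.
    rewrite /l1unit dotpZl dotpZr mulrA; have [l0|l0] := eqVneq (l1 u) 0%R; last by field.
    rewrite -lpnorm1E in l0; rewrite (lpnorm_eq0 _ l0)// /dotp big1 ?mulr0 ?mul0r// => i _.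
    by rewrite mxE mulr0.
  rewrite /dotp -sumEFin; under eq_bigr => i _ do rewrite -expr2 -real_normK ?num_real// -powR_mulrn//.
  over.
rewrite (@integral_laplaceV_sum n.+1 (fun x => (`|x| `^ 2%:R)%:E)); last 2 first.
- by apply/measurable_EFinP; apply: (measurableT_comp (measurable_powR _)).
- by move=> x; rewrite lee_fin powR_ge0.
rewrite mulrC EFinM lee_wpmul2l ?lee_fin//.
apply: le_trans (@integral_laplace_powR_le 2%:R _) _; first by rewrite ler1n.
rewrite lee_fin powR_mulrn; lra.
Qed.

End Moments.

Section Contractions.
Variables (R : realType).

Lemma continuous_l1 d : continuous (@l1 R d).
Proof.
rewrite /l1; elim: (index_enum _) => [|i s IH].
  by under eq_fun do rewrite big_nil; exact: contC.
under eq_fun do rewrite big_cons; apply: contD => // x.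
apply: (@continuous_comp _ _ _ (fun u : 'rV[R]_d => u 0 i) (fun z : R => `|z|)).
  exact: coord_continuous.
exact: norm_continuous.
Qed.

Lemma contV (T : topologicalType) (g : T -> R) : continuous g -> (forall x, 0 < g x) ->
  continuous (fun x => (g x)^-1).
Proof. by move=> cg g0 x; apply: cvgV; [rewrite gt_eqF|exact: cg]. Qed.

Lemma continuous_scale (T : topologicalType) d (c : T -> R) (v : T -> 'rV[R]_d) :
  continuous c -> continuous v -> continuous (fun x => c x *: v x).
Proof. by move=> cc cv x; apply: cvgZ; [exact: cc|exact: cv]. Qed.

Lemma continuous_addv (T : topologicalType) d (u v : T -> 'rV[R]_d) :
  continuous u -> continuous v -> continuous (fun x => u x + v x).
Proof. by move=> cu cv x; apply: cvgD; [exact: cu|exact: cv]. Qed.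

Lemma dotp_le_l1 d (u : 'rV[R]_d) : dotp u u <= l1 u ^+ 2.
Proof.
rewrite /dotp expr2 {1}/l1 mulr_suml; apply: ler_sum => i _.
rewrite -expr2 -real_normK ?num_real// expr2 ler_wpM2l// /l1 (bigD1 i)//= lerDl.
by apply: sumr_ge0.
Qed.

Lemma l1_l1unit_le d (u : 'rV[R]_d) : l1 (l1unit u) <= 1.
Proof.
rewrite /l1unit l1Z ger0_norm ?invr_ge0 ?l1_ge0//.
by have [->|l0] := eqVneq (l1 u) 0; rewrite ?mulr0// mulVf.
Qed.

Lemma dotp_l1unit d (u : 'rV[R]_d) : dotp u u = l1 u ^+ 2 * dotp (l1unit u) (l1unit u).
Proof.
rewrite /l1unit dotpZl dotpZr; have [l0|l0] := eqVneq (l1 u) 0; last by field.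
rewrite l0 expr2 !mul0r; apply/eqP; rewrite eq_le dotp_ge0 andbT.
by apply: le_trans (dotp_le_l1 u) _; rewrite l0 expr2 mul0r.
Qed.

(* A continuous replacement of [l1unit]; the two differ by l1unit u / (1 + |u|_1),
   which is of order 1/d. *)
Definition shrink d (u : 'rV[R]_d) : 'rV[R]_d := (1 + l1 u)^-1 *: u.

Lemma l1D1_gt0 d (u : 'rV[R]_d) : 0 < 1 + l1 u.
Proof. by have := l1_ge0 u; lra. Qed.

Lemma l1_shrink d (u : 'rV[R]_d) : l1 (shrink u) <= 1.
Proof.
rewrite /shrink l1Z ger0_norm ?invr_ge0 ?(ltW (l1D1_gt0 _))//.
by rewrite ler_pdivrMl ?l1D1_gt0// mulr1; lra.
Qed.

Lemma continuous_shrink d : continuous (@shrink d).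
Proof.
rewrite /shrink; apply: continuous_scale => [|x]; last exact: cvg_id.
apply: contV => [|u]; last exact: l1D1_gt0.
by apply: contD; [exact: contC|exact: continuous_l1].
Qed.

Lemma l1unit_sub_shrink d (u : 'rV[R]_d) : l1unit u - shrink u = (1 + l1 u)^-1 *: l1unit u.
Proof.
rewrite /l1unit /shrink scalerA -scalerBl; have [l0|l0] := eqVneq (l1 u) 0.
  by rewrite -lpnorm1E in l0; rewrite (lpnorm_eq0 _ l0) ?lexx// !scaler0.
by congr (_ *: _); field; rewrite l0 gt_eqF// l1D1_gt0.
Qed.

End Contractions.

Section Subgradient.
Variables (R : realType) (d : nat) (phi : 'rV[R]_d -> R) (gr : 'rV[R]_d -> 'rV[R]_d).
Hypothesis cgr : continuous gr.
Hypothesis sub : forall x y, phi x + dotp (gr x) (y - x) <= phi y.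

Lemma subgrad_continuous : continuous phi.
Proof.
move=> x; have cB : continuous (fun z : 'rV[R]_d => z - x).
  by move=> z; apply: continuousB => //; exact: cst_continuous.
have c1 : dotp (gr x) (z - x) @[z --> x] --> dotp (gr x) (x - x).
  have C : continuous (fun z : 'rV[R]_d => dotp (gr x) (z - x)).
    apply: (@continuous_dotp R d _ (fun=> gr x) (fun z : 'rV[R]_d => z - x)); last exact: cB.
    exact: cst_continuous.
  exact: C.
have c2 : dotp (gr z) (z - x) @[z --> x] --> dotp (gr x) (x - x).
  have C : continuous (fun z : 'rV[R]_d => dotp (gr z) (z - x)) by exact: continuous_dotp.
  exact: C.
rewrite subrr dotpC (_ : dotp 0 (gr x) = 0) in c1 c2; last first.
- by rewrite /dotp big1// => i _; rewrite mxE mul0r.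
have h : phi z - phi x @[z --> x] --> (0 : R).
  apply: squeeze_cvgr c1 c2; near=> z.
  have := sub x z; have := sub z x.
  rewrite -(opprB z x) dotpNr => h1 h2; apply/andP; split; lra.
exact: (iffLR (@subr_cvg0 R R^o _ (nbhs x) _ phi (phi x)) h).
Unshelve. all: by end_near. Qed.

Lemma subgrad_lip (K : R) x y : 0 <= K -> dotp (gr x) (gr x) <= K ^+ 2 ->
  dotp (gr y) (gr y) <= K ^+ 2 -> `|phi x - phi y| <= K * Num.sqrt (dotp (x - y) (x - y)).
Proof.
move=> K0 hx hy.
have cs z : dotp (gr z) (gr z) <= K ^+ 2 -> `|dotp (gr z) (x - y)| <= K * Num.sqrt (dotp (x - y) (x - y)).
  move=> hz; rewrite -(@ler_pXn2r _ 2)// ?nnegrE ?mulr_ge0 ?sqrtr_ge0//.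
  rewrite real_normK ?num_real// exprMn sqr_sqrtr ?dotp_ge0//.
  by apply: le_trans (cauchy_schwarz _ _) _; rewrite ler_wpM2r ?dotp_ge0.
have := cs _ hx; have := cs _ hy; rewrite !ler_norml => /andP[a1 a2] /andP[b1 b2].
have := sub x y; have := sub y x; rewrite -(opprB x y) dotpNr => h1 h2.
apply/andP; split; lra.
Qed.

End Subgradient.

(** * Variance of a C^1 convex function of the shrunken Laplace vector *)

Section Variance.
Variables (R : realType) (n : nat) (phi : 'rV[R]_n.+1 -> R) (gr : 'rV[R]_n.+1 -> 'rV[R]_n.+1).
Variables (y : 'rV[R]_n.+1) (mu K : R).
Hypothesis cgr : continuous gr.
Hypothesis sub : forall x z, phi x + dotp (gr x) (z - x) <= phi z.
Hypotheses (K0 : 0 <= K) (mu0 : 0 < mu).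
Hypothesis bK : forall u, l1 u <= 1 -> dotp (gr (y + mu *: u)) (gr (y + mu *: u)) <= K ^+ 2.

Let z u := y + mu *: shrink u.
Let F u := phi (z u).
Let w (u : 'rV[R]_n.+1) := (1 + l1 u)^-1.

Let w0 u : 0 < w u. Proof. by rewrite invr_gt0 l1D1_gt0. Qed.

Let cw : continuous w.
Proof.
apply: contV => [|u]; last exact: l1D1_gt0.
by apply: contD; [exact: contC|exact: continuous_l1].
Qed.

Let cz : continuous z.
Proof.
apply: continuous_addv; first exact: cst_continuous.
by apply: continuous_scale; [exact: cst_continuous|exact: continuous_shrink].
Qed.

Let cF : continuous F.
Proof. by move=> u; apply: continuous_comp; [exact: cz|exact: (subgrad_continuous cgr sub)]. Qed.

Let cgz : continuous (fun u => gr (z u)).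
Proof. by move=> u; apply: continuous_comp; [exact: cz|exact: cgr]. Qed.

Lemma bmfun_shrink : bmfun (F : rVB R n.+1 -> R).
Proof.
split; first exact: continuous_measurable_rV.
exists (`|phi y| + K * mu) => u.
rewrite -[F u](subrK (phi y)) addrC; apply: le_trans (ler_normD _ _) _; rewrite lerD2l.
have h0 : dotp (gr y) (gr y) <= K ^+ 2.
  have := @bK 0; rewrite scaler0 addr0; apply; rewrite -(scale0r (0 : 'rV[R]_n.+1)) l1Z normr0 mul0r//.
apply: le_trans (subgrad_lip sub K0 (bK (l1_shrink u)) h0) _; rewrite ler_wpM2l//.
rewrite addrC addKr dotpZl dotpZr mulrA -expr2 sqrtrM ?sqr_ge0// sqrtr_sqr gtr0_norm//.
rewrite ler_piMr ?(ltW mu0)// -sqrtr1 ler_wsqrtr//.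
apply: le_trans (dotp_le_l1 _) _; rewrite expr_le1 ?l1_ge0//; exact: l1_shrink.
Qed.

(** The i-th partial derivative of F is mu w (g_i - e w <g, u>), with g the gradient and e the sign
    of u_i. Bounding (a - b)^2 by 2 a^2 + 2 b^2 removes e, so that one [D] serves both
    half-lines. *)
Let D (i : 'I_n.+1) u := 2 * mu ^+ 2 * w u ^+ 2 *
  ((gr (z u)) 0 i ^+ 2 + w u ^+ 2 * dotp (gr (z u)) u ^+ 2).

Let D_ge0 i u : 0 <= D i u.
Proof. apply: mulr_ge0; first by apply: mulr_ge0; [apply: mulr_ge0|]; rewrite ?sqr_ge0.
by apply: addr_ge0; [|apply: mulr_ge0]; rewrite ?sqr_ge0. Qed.

Let cX (T : topologicalType) (g : T -> R) : continuous g -> continuous (fun x => g x ^+ 2).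
Proof. by move=> cg; rewrite /=; under eq_fun do rewrite expr2; exact: contM. Qed.

Let cD i : continuous (D i).
Proof.
apply: contM; first by apply: contM; [exact: contC|exact: cX].
apply: contD.
  apply: cX => u; apply: (@continuous_comp _ _ _ (fun u => gr (z u)) (fun x : 'rV[R]_n.+1 => x 0 i)).
    exact: cgz.
  exact: coord_continuous.
apply: contM; first exact: cX.
by apply: cX; apply: continuous_dotp => // u; exact: cvg_id.
Qed.

Let l1_set_coord (u : 'rV[R]_n.+1) i x : l1 (set_coord u i x) = \sum_(j < n.+1 | j != i) `|u 0 j| + `|x|.
Proof.
rewrite /l1 (bigD1 i)//= mxE eqxx addrC; congr (_ + _).
by apply: eq_bigr => j ji; rewrite mxE (negPf ji).
Qed.

Let continuous_set_coord (u : 'rV[R]_n.+1) i : continuous (set_coord u i).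
Proof.
apply: (@rV_continuousP R n.+1 R^o) => j; rewrite /set_coord.
under eq_fun do rewrite mxE.
by case: (j == i) => x; [exact: cvg_id|exact: cst_continuous].
Qed.

(** While e t > 0, the l1-norm is affine in the i-th coordinate t with slope e, so the curve has
    rational coordinates. *)
Let curve_derive (u : 'rV[R]_n.+1) i (e x : R) : e ^+ 2 = 1 -> 0 < e * x ->
  is_derive x 1 (fun t : R => F (set_coord u i t))
    (mu * w (set_coord u i x) * (gr (z (set_coord u i x)) 0 i
       - e * w (set_coord u i x) * dotp (gr (z (set_coord u i x))) (set_coord u i x))).
Proof.
move=> e2 ex; set v := set_coord u i x.
have -> : mu * w v * (gr (z v) 0 i - e * w v * dotp (gr (z v)) v) =
    dotp (gr (z v)) (mu *: (w v *: delta_mx 0 i - (e * w v ^+ 2) *: v)).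
  by rewrite dotpZr dotpBr !dotpZr dotp_delta; ring.
apply: (is_derive_subgrad cgr sub) => j.
pose s := 1 + \sum_(k < n.+1 | k != i) `|u 0 k|.
have s0 : 0 < s + e * x.
  have : 0 <= \sum_(k < n.+1 | k != i) `|u 0 k| by apply: sumr_ge0.
  by rewrite /s; lra.
have absE (t : R) : 0 < e * t -> `|t| = e * t.
  move=> et; rewrite -[RHS]gtr0_norm// normrM.
  suff -> : `|e| = 1 by rewrite mul1r.
  by apply/eqP; rewrite -sqrp_eq1// -normrX e2 normr1.
have wE (t : R) : 0 < e * t -> w (set_coord u i t) = (s + e * t)^-1.
  by move=> et; rewrite /w l1_set_coord (absE t et) /s addrA.
apply: (@near_eq_is_derive _ _ _ (fun t : R => y 0 j + mu * ((s + e * t)^-1 * set_coord u i t 0 j))).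
  near=> t; rewrite !mxE -/(w (set_coord u i t)) wE//.
  near: t; have : e * t @[t --> x] --> e * x by apply: cvgM; [exact: cvg_cst|exact: cvg_id].
  by move=> /cvgr_gt/(_ _ ex).
have dl : is_derive x 1 (fun t : R => s + e * t) e.
  apply: is_derive_eq (is_deriveD (is_derive_cst s x 1) (is_deriveZ e (is_derive_id x 1))) _.
  by rewrite add0r /GRing.scale/= mulr1.
have dV := @is_deriveV _ (fun t : R => s + e * t) x _ _ (lt0r_neq0 s0) dl.
have du : is_derive x 1 (fun t : R => set_coord u i t 0 j) ((j == i)%:R : R).
  rewrite /set_coord; under eq_fun do rewrite mxE; case: (j == i); first exact: is_derive_id.
  exact: is_derive_cst.
apply: is_derive_eq (is_deriveD (is_derive_cst (y 0 j) x 1) (is_deriveZ mu (is_deriveM dV du))) _.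
rewrite /v wE// !mxE -!/(set_coord u i x) add0r /GRing.scale/= ?eqxx/=.
have -> : (if j == i then x else u 0 j) = set_coord u i x 0 j by rewrite mxE.
by move: (set_coord u i x 0 j) (j == i)%:R => a b; field; rewrite gt_eqF.
Unshelve. all: by end_near. Qed.

Let D_bound (u : 'rV[R]_n.+1) i (e : R) : e ^+ 2 = 1 ->
  (mu * w u * (gr (z u) 0 i - e * w u * dotp (gr (z u)) u)) ^+ 2 <= D i u.
Proof.
move=> e2; rewrite /D; set a := gr (z u) 0 i; set b := dotp _ _; set c := w u.
have -> : c ^+ 2 * b ^+ 2 = (e * c * b) ^+ 2 by rewrite !exprMn e2 mul1r.
move: (e * c * b) => g; rewrite -subr_ge0.
rewrite (_ : _ - _ = (mu * c * (a + g)) ^+ 2) ?sqr_ge0//; ring.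
Qed.

Lemma shrink_poincare :
  (\int[laplaceV R n.+1]_u ((F u - mean (laplaceV R n.+1) F) ^+ 2)%:E <=
    4%:E * \sum_(i < n.+1) \int[laplaceV R n.+1]_u (D i u)%:E)%E.
Proof.
apply: poincare_tensor => [|i|i u|i u].
- exact: bmfun_shrink.
- exact: continuous_measurable_rV.
- exact: D_ge0.
have cup (T : topologicalType) (g : 'rV[R]_n.+1 -> T) : continuous g -> continuous (fun x : R => g (set_coord u i x)).
  by move=> cg x; apply: continuous_comp; [exact: continuous_set_coord|exact: cg].
pose gp (e : R) v := mu * w v * (gr (z v) 0 i - e * w v * dotp (gr (z v)) v).
have cgp e : continuous (gp e).
  apply: contM; first by apply: contM; [exact: contC|].
  apply: contB.
    move=> v; apply: (@continuous_comp _ _ _ (fun u => gr (z u)) (fun x : 'rV[R]_n.+1 => x 0 i)).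
      exact: cgz.
    exact: coord_continuous.
  apply: contM; first by apply: contM; [exact: contC|].
  by apply: continuous_dotp => // v; exact: cvg_id.
apply: (@laplace_poincare R (fun x => F (set_coord u i x)) (fun x => gp 1 (set_coord u i x))
  (fun x => gp (-1) (set_coord u i x)) (fun x => D i (set_coord u i x))).
- exact: (cup _ F).
- exact: (cup _ (gp 1)).
- exact: (cup _ (gp (-1))).
- by move=> x x0; apply: curve_derive; rewrite ?expr1n ?mul1r.
- by move=> x x0; apply: curve_derive; rewrite ?sqrrN ?expr1n// mulN1r oppr_gt0.
- by apply: continuous_measurable_fun; exact: (cup _ (D i)).
- by move=> x; exact: D_ge0.
- by move=> x _; apply: D_bound; rewrite expr1n.
- by move=> x _; apply: D_bound; rewrite sqrrN expr1n.
Qed.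

(** The bound is a function of the direction times a function of the radius, as [polar_indep]
    requires. The absolute value extends the radial factor to a continuous function on the line. *)
Let sumD u : \sum_(i < n.+1) D i u <=
  2 * mu ^+ 2 * K ^+ 2 * ((1 + n.+1%:R * dotp (l1unit u) (l1unit u)) * ((1 + `|l1 u|) ^+ 2)^-1).
Proof.
rewrite ger0_norm ?l1_ge0// -exprVn -/(w u) /D -mulr_sumr big_split/= sumr_const card_ord.
have -> : \sum_(i < n.+1) gr (z u) 0 i ^+ 2 = dotp (gr (z u)) (gr (z u)).
  by apply: eq_bigr => i _; rewrite expr2.
have h1 := bK (l1_shrink u); rewrite -/(z u) in h1.
have h2 := cauchy_schwarz (gr (z u)) u.
have h3 : w u ^+ 2 * l1 u ^+ 2 <= 1.
  rewrite -exprMn expr_le1// ?mulr_ge0 ?l1_ge0// ?(ltW (w0 _))//.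
  by rewrite ler_pdivrMl ?l1D1_gt0// mulr1; lra.
have N0 := dotp_ge0 (l1unit u).
have h4 : w u ^+ 2 * dotp (gr (z u)) u ^+ 2 <= K ^+ 2 * dotp (l1unit u) (l1unit u).
  apply: (@le_trans _ _ (w u ^+ 2 * (K ^+ 2 * dotp u u))).
    rewrite ler_wpM2l ?sqr_ge0//; apply: le_trans h2 _; by rewrite ler_wpM2r ?dotp_ge0.
  rewrite dotp_l1unit mulrCA ler_wpM2l ?sqr_ge0// mulrA -[leRHS]mul1r ler_wpM2r//.
rewrite (_ : 2 * mu ^+ 2 * K ^+ 2 * _ = 2 * mu ^+ 2 * w u ^+ 2 *
  (K ^+ 2 + (K ^+ 2 * dotp (l1unit u) (l1unit u)) *+ n.+1)); last by ring.
have c0 : 0 <= 2 * mu ^+ 2 * w u ^+ 2.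
  by apply: mulr_ge0; [apply: mulr_ge0|]; rewrite ?sqr_ge0.
by rewrite (ler_wpM2l c0)// lerD// lerMn2r h4 orbT.
Qed.

(** The constant: 4 from Poincare, 2 from [D], 129 = 1 + 128 for the direction, and 26 / d^2 for the
    radius. *)
Lemma shrink_variance :
  mean (laplaceV R n.+1) (fun u => (F u - mean (laplaceV R n.+1) F) ^+ 2) <=
  8 * 129 * 26 * mu ^+ 2 * K ^+ 2 / n.+1%:R ^+ 2.
Proof.
have d0 : 0 < n.+1%:R :> R by rewrite ltr0n.
have bF := bmfun_shrink.
have bFF : bmfun ((fun u => (F u - mean (laplaceV R n.+1) F) ^+ 2) : rVB R n.+1 -> R).
  by apply: bmfunX; apply: bmfunB => //; exact: bmfunC.
rewrite -lee_fin -mean_EFin//; apply: le_trans shrink_poincare _.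
have mD i : measurable_fun setT (fun u : rVB R n.+1 => (D i u)%:E).
  by apply/measurable_EFinP; exact: continuous_measurable_rV.
rewrite -ge0_integral_sum//; last by move=> i u _; rewrite lee_fin D_ge0.
pose Phi (u : 'rV[R]_n.+1) := (1 + n.+1%:R * dotp u u)%:E.
pose rho (t : R) := (((1 + `|t|) ^+ 2)^-1)%:E.
have mP : measurable_fun setT (Phi : rVB R n.+1 -> _).
  apply/measurable_EFinP; apply: measurable_funD => //; apply: measurable_funM => //.
  exact: measurable_dotpp.
have P0 u : (0 <= Phi u)%E by rewrite lee_fin addr_ge0// mulr_ge0 ?dotp_ge0.
have mr : measurable_fun setT rho.
  apply/measurable_EFinP; apply: continuous_measurable_fun; apply: contV => [|t].
    by apply: cX; apply: contD; [exact: contC|exact: norm_continuous].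
  by rewrite exprn_gt0// ltr_pwDl.
have r0 t : (0 <= rho t)%E by rewrite lee_fin invr_ge0 sqr_ge0.
have mPn : measurable_fun setT (fun u : rVB R n.+1 => Phi (l1unit u)).
  by apply: measurable_compV => //; exact: measurable_l1unit.
have mrl : measurable_fun setT (fun u : rVB R n.+1 => rho (l1 u)).
  by apply: measurableT_comp => //; exact: measurable_l1.
have IP : (\int[laplaceV R n.+1]_u Phi (l1unit u) <= 129%:E)%E.
  have -> : (129%:E = 1%:E + n.+1%:R%:E * (128 / n.+1%:R)%:E :> \bar R)%E.
    by rewrite -EFinM -EFinD; congr (_%:E); field; rewrite gt_eqF.
  rewrite /Phi; under eq_integral => u _ do rewrite EFinD EFinM.
  have md : measurable_fun setT (fun u : rVB R n.+1 => (dotp (l1unit u) (l1unit u))%:E).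
    apply/measurable_EFinP; apply: (@measurable_compV _ _ _ _ _ _ (fun u => dotp u u)).
      exact: measurable_dotpp.
    exact: measurable_l1unit.
  have dd u : (0 <= (dotp (l1unit u) (l1unit u))%:E)%E by rewrite lee_fin dotp_ge0.
  rewrite ge0_integralD//; last 2 first.
  - by move=> u _; rewrite mule_ge0.
  - by apply: emeasurable_funM.
  have -> : (\int[laplaceV R n.+1]_(u in setT) 1%:E = 1)%E.
    by rewrite integral_cst// mul1e; exact: probability_setT.
  rewrite leeD2l// ge0_integralZl// lee_wpmul2l ?lee_fin//.
  exact: integral_l1unit_dotp.
have Ir : (\int[laplaceV R n.+1]_u rho (l1 u) <= (26 / n.+1%:R ^+ 2)%:E)%E.
  rewrite /rho; under eq_integral => u _ do rewrite ger0_norm ?l1_ge0//.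
  exact: integral_laplaceV_inv_sqr.
apply: (@le_trans _ _ (4%:E * \int[laplaceV R n.+1]_u
    ((2 * mu ^+ 2 * K ^+ 2)%:E * (Phi (l1unit u) * rho (l1 u))))%E).
  rewrite lee_wpmul2l ?lee_fin//; apply: ge0_le_integral => //.
  - by move=> u _; rewrite sume_ge0// => i _; rewrite lee_fin D_ge0.
  - by apply: emeasurable_sum.
  - by apply: emeasurable_funM => //; apply: emeasurable_funM.
  by move=> u _; rewrite sumEFin -!EFinM lee_fin; exact: sumD.
rewrite ge0_integralZl//; last 3 first.
- by apply: emeasurable_funM.
- by move=> u _; rewrite mule_ge0.
- by rewrite lee_fin mulr_ge0 ?sqr_ge0// mulr_ge0 ?sqr_ge0.
rewrite polar_indep//.
have -> : (8 * 129 * 26 * mu ^+ 2 * K ^+ 2 / n.+1%:R ^+ 2)%:E =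
   (4%:E * ((2 * mu ^+ 2 * K ^+ 2)%:E * (129%:E * (26 / n.+1%:R ^+ 2)%:E)))%E :> \bar R.
  by rewrite -!EFinM; congr (_%:E); field; rewrite gt_eqF.
rewrite lee_wpmul2l ?lee_fin// lee_wpmul2l//.
  by rewrite lee_fin; apply: mulr_ge0; [apply: mulr_ge0|]; rewrite ?sqr_ge0.
apply: lee_pmul => //; apply: integral_ge0 => u _; [exact: P0|exact: r0].
Qed.

End Variance.

Lemma sqr_four_le (R : realDomainType) (p1 p2 p3 p4 p5 : R) : p2 ^+ 2 <= p5 -> p1 ^+ 2 <= p5 ->
  (p1 + p3 - p4 - p2) ^+ 2 <= 4 * (2 * p5 + p3 ^+ 2 + p4 ^+ 2).
Proof.
have := sqr_ge0 (p1 - p3); have := sqr_ge0 (p1 + p4); have := sqr_ge0 (p1 + p2).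
have := sqr_ge0 (p3 + p4); have := sqr_ge0 (p3 + p2); have := sqr_ge0 (p4 - p2); nra.
Qed.

(** * Second moment of the two-point difference *)

Section Variation.
Variables (R : realType) (n : nat) (X : set 'rV[R]_n.+1) (f : 'rV[R]_n.+1 -> R).
Variables (y : 'rV[R]_n.+1) (mu G2 : R).
Hypotheses (cX : compact X).
Hypothesis vX : forall x y t, X x -> X y -> 0 <= t -> t <= 1 -> X (x + t *: (y - x)).
Hypothesis cf : continuous f.
Hypothesis vf : forall x y t, X x -> X y -> 0 <= t -> t <= 1 ->
  f (x + t *: (y - x)) <= f x + t * (f y - f x).
Hypotheses (G20 : 0 <= G2) (mu0 : 0 < mu).
Hypothesis lf : forall x y, X x -> X y -> `|f x - f y| <= G2 * Num.sqrt (dotp (x - y) (x - y)).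
Hypothesis yX : forall u, l1 u <= 1 -> X (y + mu *: u).

Local Notation L := (laplaceV R n.+1).

Lemma bmfun_l1unit (c : R) : `|c| <= mu -> bmfun ((fun u => f (y + c *: l1unit u)) : rVB R n.+1 -> R).
Proof.
move=> cmu; split.
  apply: (@measurable_compV _ _ _ _ _ _ (fun v => f (y + c *: v))).
    apply: continuous_measurable_rV => u; apply: continuous_comp; last exact: cf.
    have C : continuous (fun v : 'rV[R]_n.+1 => y + c *: v).
      apply: continuous_addv; first exact: cst_continuous.
      by apply: continuous_scale; [exact: cst_continuous|move=> v; exact: cvg_id].
    exact: C.
  exact: measurable_l1unit.
exists (`|f y| + G2 * mu) => u.
have Xy : X y by rewrite -(addr0 y) -(scaler0 _ mu); apply: yX; rewrite -(scale0r (0 : 'rV[R]_n.+1)) l1Z normr0 mul0r.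
have Xc : X (y + c *: l1unit u).
  rewrite (_ : c = mu * (mu^-1 * c)) -?scalerA; last by rewrite mulrA mulfV ?mul1r// gt_eqF.
  apply: yX; rewrite 2!l1Z gtr0_norm ?invr_gt0// ler_pdivrMl// mulr1.
  by apply: le_trans cmu; rewrite ler_piMr// l1_l1unit_le.
rewrite -[f (y + _)](subrK (f y)) addrC; apply: le_trans (ler_normD _ _) _; rewrite lerD2l.
apply: le_trans (lf Xc Xy) _; rewrite ler_wpM2l// addrC addKr dotpZl dotpZr mulrA -expr2.
rewrite sqrtrM ?sqr_ge0// sqrtr_sqr; apply: le_trans cmu; rewrite ler_piMr//.
rewrite -sqrtr1 ler_wsqrtr//; apply: le_trans (dotp_le_l1 _) _.
by rewrite expr_le1 ?l1_ge0//; exact: l1_l1unit_le.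
Qed.

Lemma mean_laplaceV_opp (g : 'rV[R]_n.+1 -> R) : bmfun (g : rVB R n.+1 -> R) -> (forall u, 0 <= g u) ->
  mean L (fun u => g (- u)) = mean L g.
Proof.
move=> bg g0.
have mo : measurable_fun setT ((fun u => - u) : rVB R n.+1 -> rVB R n.+1).
  apply: measurable_rVP => i; under eq_fun do rewrite mxE.
  by apply: measurableT_comp => //; exact: measurable_coord.
have bgo : bmfun ((fun u => g (- u)) : rVB R n.+1 -> R).
  by apply: (@bmfun_comp _ _ _ _ _ (g : rVB R n.+1 -> R) _ mo bg).
apply: EFin_inj; rewrite -!mean_EFin//.
rewrite (@ge0_integral_laplaceV_opp R n.+1 (fun u => (g u)%:E))//.
by apply/measurable_EFinP; case: bg.
Qed.

Lemma mean_inv_sqr : bmfun ((fun u => ((1 + l1 u) ^+ 2)^-1) : rVB R n.+1 -> R) /\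
  mean L (fun u => ((1 + l1 u) ^+ 2)^-1) <= 26 / n.+1%:R ^+ 2.
Proof.
have b : bmfun ((fun u => ((1 + l1 u) ^+ 2)^-1) : rVB R n.+1 -> R).
  split.
    apply: continuous_measurable_rV; apply: contV => [|u]; last by rewrite exprn_gt0// l1D1_gt0.
    under eq_fun do rewrite expr2.
    by apply: contM; apply: contD; (exact: contC || exact: continuous_l1).
  exists 1 => u; rewrite ger0_norm ?invr_ge0 ?sqr_ge0//.
  rewrite invf_le1 ?exprn_gt0 ?l1D1_gt0//; have := l1_ge0 u; nra.
by split=> //; rewrite -lee_fin -mean_EFin//; exact: integral_laplaceV_inv_sqr.
Qed.

(** By symmetry of the law both evaluations are compared with the same mean m of the smooth function
    F. The two deviations of F from m have the same second moment. The errors from replacing f by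
    its envelope and [l1unit] by [shrink] are of the same order mu G2 / d, and 4^10 exceeds the sum
    of all constants. *)
Lemma variation_bound :
  mean L (fun u => (f (y + mu *: l1unit u) - f (y - mu *: l1unit u)) ^+ 2) <=
  4 ^+ 10 * mu ^+ 2 * G2 ^+ 2 / n.+1%:R ^+ 2.
Proof.
have d0 : 0 < n.+1%:R :> R by rewrite ltr0n.
have X0 : X !=set0.
  by exists (y + mu *: 0); apply: yX; rewrite -(scale0r (0 : 'rV[R]_n.+1)) l1Z normr0 mul0r.
(* The accuracy of the envelope is the order of the standard deviation aimed at. *)
pose eps := G2 * mu / n.+1%:R; have eps0 : 0 <= eps by rewrite divr_ge0// mulr_ge0// ltW.
have G21 : 0 < G2 + 1 by rewrite ltr_wpDl.
(* G2 + 1 in place of G2 keeps the parameter defined when G2 = 0. *)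
pose delta := 2 * mu / (n.+1%:R * (G2 + 1)).
have delta0 : 0 < delta by rewrite divr_gt0// mulr_gt0.
have epsE : G2 ^+ 2 * delta / 2 <= eps.
  rewrite (_ : _ / 2 = eps * (G2 / (G2 + 1))); last by rewrite /eps /delta; field; rewrite !gt_eqF.
  by rewrite ler_piMr// ler_pdivrMr//; lra.
pose phi := moreau X f delta; pose gr := moreau_grad X f delta.
have cgr : continuous gr by exact: (continuous_moreau_grad cX X0 vX cf vf).
have sub x z : phi x + dotp (gr x) (z - x) <= phi z by exact: (moreau_subgrad cX X0 vX cf vf).
have bK u : l1 u <= 1 -> dotp (gr (y + mu *: u)) (gr (y + mu *: u)) <= (2 * G2) ^+ 2.
  move=> u1; rewrite (_ : (2 * G2) ^+ 2 = 4 * G2 ^+ 2); last by ring.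
  by apply: (moreau_grad_le cX X0 cf) => //; exact: yX.
have K0 : 0 <= 2 * G2 by rewrite mulr_ge0.
pose F u := phi (y + mu *: shrink u).
have bF : bmfun (F : rVB R n.+1 -> R) by exact: bmfun_shrink cgr sub K0 mu0 bK.
have vF := shrink_variance cgr sub K0 mu0 bK; rewrite -/F in vF.
set m := mean L F in vF.
have near_phi u : l1 u <= 1 -> `|f (y + mu *: u) - phi (y + mu *: u)| <= eps.
  move=> u1; have Xu := yX u1.
  have h1 := moreau_le delta cX X0 cf Xu; have h2 := moreau_ge cX X0 cf delta0 lf Xu.
  rewrite -/phi in h1 h2; rewrite ger0_norm ?subr_ge0//; lra.
(* [W] bounds the squared distance between [l1unit u] and [shrink u], and has mean at most 26 /
   d^2. *)
pose W (u : 'rV[R]_n.+1) := ((1 + l1 u) ^+ 2)^-1.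
have dev u : (f (y + mu *: l1unit u) - F u) ^+ 2 <= 2 * (G2 * mu) ^+ 2 * W u + 2 * eps ^+ 2.
  have w0 : 0 <= (1 + l1 u)^-1 by rewrite invr_ge0 ltW// l1D1_gt0.
  have h1 : `|f (y + mu *: l1unit u) - f (y + mu *: shrink u)| <= G2 * mu * (1 + l1 u)^-1.
    apply: le_trans (lf (yX (l1_l1unit_le u)) (yX (l1_shrink u))) _.
    rewrite -mulrA ler_wpM2l// opprD addrACA subrr add0r -scalerBr l1unit_sub_shrink scalerA.
    rewrite dotpZl dotpZr mulrA -expr2 sqrtrM ?sqr_ge0// sqrtr_sqr ger0_norm ?mulr_ge0 ?(ltW mu0)//.
    rewrite ler_piMr ?mulr_ge0 ?(ltW mu0)// -sqrtr1 ler_wsqrtr//.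
    by apply: le_trans (dotp_le_l1 _) _; rewrite expr_le1 ?l1_ge0//; exact: l1_l1unit_le.
  have h2 := near_phi _ (l1_shrink u).
  rewrite /W -exprVn -[X in 2 * X]mul1r.
  have -> : 2 * (1 * (G2 * mu) ^+ 2) * (1 + l1 u)^-1 ^+ 2 = 2 * (G2 * mu * (1 + l1 u)^-1) ^+ 2 by ring.
  move: h1 h2; rewrite /F; set a := f _; set b := f _; set c := phi _; set e := G2 * mu * _ => h1 h2.
  have k1 : (a - b) ^+ 2 <= e ^+ 2 by rewrite -real_normK ?num_real// lerXn2r ?nnegrE//; exact: le_trans h1.
  have k2 : (b - c) ^+ 2 <= eps ^+ 2 by rewrite -real_normK ?num_real// lerXn2r ?nnegrE//.
  have := sqr_ge0 ((a - b) - (b - c)); nra.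
have [bW EW] := mean_inv_sqr; rewrite -/W in bW EW.
pose V u := (F u - m) ^+ 2.
have bV : bmfun (V : rVB R n.+1 -> R) by apply: bmfunX; apply: bmfunB => //; exact: bmfunC.
have mo : measurable_fun setT ((fun u => - u) : rVB R n.+1 -> rVB R n.+1).
  apply: measurable_rVP => i; under eq_fun do rewrite mxE.
  by apply: measurableT_comp => //; exact: measurable_coord.
have bVo : bmfun ((fun u => V (- u)) : rVB R n.+1 -> R).
  by apply: (@bmfun_comp _ _ _ _ _ (V : rVB R n.+1 -> R) _ mo bV).
pose E u := 2 * (G2 * mu) ^+ 2 * W u + 2 * eps ^+ 2.
have bE : bmfun (E : rVB R n.+1 -> R).
  by apply: bmfunD; [apply: bmfunM => //; exact: bmfunC|exact: bmfunC].
have EoE u : E (- u) = E u by rewrite /E /W l1N.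
have l1unitN (u : 'rV[R]_n.+1) : l1unit (- u) = - l1unit u by rewrite /l1unit l1N scalerN.
(* u and -u are used together: the evaluation at y - mu s is the one at y + mu s for the vector -u,
   and [E] is even. *)
have pw u : (f (y + mu *: l1unit u) - f (y - mu *: l1unit u)) ^+ 2 <= 4 * (2 * E u + V u + V (- u)).
  have := dev u; have := dev (- u); rewrite -/(E u) -/(E (- u)) EoE l1unitN scalerN /V.
  set a := f _; set b := f _; set c := F _; set e := F _ => h1 h2.
  have -> : b - a = (b - e) + (e - m) - (c - m) - (a - c) by ring.
  clearbody a b c e; clear -h1 h2; exact: (@sqr_four_le R (b - e) (a - c) (e - m) (c - m) (E u) h1 h2).
have b1 := bmfun_l1unit (c := mu); have b2 := bmfun_l1unit (c := - mu).
rewrite normrN gtr0_norm ?lexx// in b1 b2.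
have bd : bmfun ((fun u => (f (y + mu *: l1unit u) - f (y - mu *: l1unit u)) ^+ 2) : rVB R n.+1 -> R).
  apply: bmfunX; apply: bmfunB; first exact: b1.
  by under eq_fun do rewrite -scaleNr; exact: b2.
have b2E : bmfun ((fun u => 2 * E u) : rVB R n.+1 -> R) by apply: bmfunM; [exact: bmfunC|exact: bE].
have bEV := bmfunD b2E bV.
have bS : bmfun ((fun u => 4 * (2 * E u + V u + V (- u))) : rVB R n.+1 -> R).
  by apply: bmfunM; [exact: bmfunC|exact: bmfunD bEV bVo].
apply: le_trans (mean_le L bd bS pw) _.
have EVo : mean L (fun u => V (- u)) = mean L V by apply: mean_laplaceV_opp bV _ => u; exact: sqr_ge0.
have EEe : mean L E = 2 * (G2 * mu) ^+ 2 * mean L W + 2 * eps ^+ 2.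
  rewrite /E meanD; [|by apply: bmfunM; [exact: bmfunC|exact: bW]|exact: bmfunC].
  by rewrite (meanZ L _ bW) meanC.
have {}vF : mean L V <= 8 * 129 * 26 * mu ^+ 2 * (2 * G2) ^+ 2 / n.+1%:R ^+ 2 by exact: vF.
clearbody V E W.
have -> : mean L (fun u => 4 * (2 * E u + V u + V (- u))) = 4 * (2 * mean L E + mean L V + mean L V).
  rewrite (meanZ L 4 (bmfunD bEV bVo)) (meanD L bEV bVo) EVo; congr (4 * (_ + _)).
  by rewrite (meanD L b2E bV) (meanZ L 2 bE).
rewrite EEe.
have : 2 * (G2 * mu) ^+ 2 * mean L W <= 2 * (G2 * mu) ^+ 2 * (26 / n.+1%:R ^+ 2).
  by rewrite ler_wpM2l// mulr_ge0 ?sqr_ge0.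
move: vF; rewrite /eps.
have -> : 8 * 129 * 26 * mu ^+ 2 * (2 * G2) ^+ 2 / n.+1%:R ^+ 2 =
  8 * 129 * 26 * 4 * (mu ^+ 2 * G2 ^+ 2 / n.+1%:R ^+ 2) by ring.
have -> : 2 * (G2 * mu) ^+ 2 * (26 / n.+1%:R ^+ 2) = 52 * (mu ^+ 2 * G2 ^+ 2 / n.+1%:R ^+ 2) by ring.
have -> : (G2 * mu / n.+1%:R) ^+ 2 = mu ^+ 2 * G2 ^+ 2 / n.+1%:R ^+ 2.
  by rewrite !exprMn exprVn; ring.
have -> : 4 ^+ 10 * mu ^+ 2 * G2 ^+ 2 / n.+1%:R ^+ 2 = 4 ^+ 10 * (mu ^+ 2 * G2 ^+ 2 / n.+1%:R ^+ 2) by ring.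
have : 0 <= mu ^+ 2 * G2 ^+ 2 / n.+1%:R ^+ 2 by rewrite divr_ge0 ?sqr_ge0// mulr_ge0 ?sqr_ge0.
move: (mu ^+ 2 * G2 ^+ 2 / n.+1%:R ^+ 2) (2 * (G2 * mu) ^+ 2 * mean L W) (mean L V) => z e v.
by rewrite !exprS expr0; lra.
Qed.

End Variation.

(** * Stokes' formula on the l1-ball *)

Section Stokes.
Variable R : realType.
Local Notation mu := (@lebesgue_measure R).

(** Up to the factor 2^n, the density relative to the Laplace law of Lebesgue measure on the unit
    l1-ball. Means of [graph_weight] times k are thus volume integrals of k over the ball or, for k
    composed with [l1_graph], surface integrals. *)
Definition graph_weight n (x : 'rV[R]_n) : R := expR (l1 x) * (l1 x <= 1)%R%:R.

Lemma graph_weight_ge0 n (x : 'rV[R]_n) : 0 <= graph_weight x.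
Proof. by rewrite mulr_ge0 ?expR_ge0. Qed.

Lemma graph_weight_gt1 n (x : 'rV[R]_n) : 1 < l1 x -> graph_weight x = 0.
Proof. by rewrite /graph_weight ltNge => /negbTE ->; rewrite mulr0. Qed.

Lemma measurable_graph_weight n : measurable_fun setT (@graph_weight n : rVB R n -> R).
Proof.
apply: measurable_funM; first by apply: measurableT_comp => //; exact: measurable_l1.
apply/measurable_EFinP.
apply: (@measurable_eind R _ (rVB R n) (fun u => l1 u <= 1)).
by apply: measurable_fun_ler => //; exact: measurable_l1.
Qed.

Lemma bmfun_graph_weightM n (k : 'rV[R]_n -> R) (M : R) : measurable_fun setT (k : rVB R n -> R) ->
  (forall u, l1 u <= 1 -> `|k u| <= M) -> bmfun ((fun u => graph_weight u * k u) : rVB R n -> R).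
Proof.
move=> mk kM; split; first by apply: measurable_funM => //; exact: measurable_graph_weight.
exists (expR 1 * M) => u; rewrite normrM (ger0_norm (graph_weight_ge0 u)).
have M0 : 0 <= M by apply: le_trans (kM 0 _); rewrite // -(scale0r (0 : 'rV[R]_n)) l1Z normr0 mul0r.
have [u1|u1] := leP (l1 u) 1; last by rewrite (graph_weight_gt1 u1) mul0r mulr_ge0 ?expR_ge0.
by rewrite ler_pM ?graph_weight_ge0 ?kM// /graph_weight u1 mulr1 ler_expR.
Qed.

Lemma bmfun_graph_weight n : bmfun (@graph_weight n : rVB R n -> R).
Proof.
have := @bmfun_graph_weightM n (fun=> 1) 1 (@measurable_cst _ _ _ _ _ _) (fun _ _ => _).
rewrite (_ : (fun u : 'rV[R]_n => graph_weight u * 1) = @graph_weight n); last by apply/funext => u; rewrite mulr1.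
by apply; rewrite normr1.
Qed.

Lemma measurable_graph n (e : R) :
  measurable_fun setT (@l1_graph R n e : rVB R n -> rVB R n.+1).
Proof.
rewrite (_ : l1_graph e = fun x => rcons_rV x (e * (1 - l1 x))); last first.
  by apply/funext => x; rewrite l1_graphE.
apply: measurable_rcons_rV => [i|]; first exact: measurable_coord.
by apply: measurable_funM => //; apply: measurable_funB => //; exact: measurable_l1.
Qed.

Lemma graph_integral_weight n (Phi : 'rV[R]_n.+1 -> R) e : bmfun (Phi : rVB R n.+1 -> R) ->
  graph_integral (fun u => (Phi u)%:E) e = (mean (laplaceV R n) (fun x => graph_weight x * Phi (l1_graph e x)))%:E.
Proof.
move=> bPhi; rewrite -mean_EFin; last first.
  apply: bmfunM; first exact: bmfun_graph_weight.
  by apply: (@bmfun_comp _ _ _ _ _ (Phi : rVB R n.+1 -> R) _ (measurable_graph e) bPhi).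
by apply: eq_integral => x _; rewrite /graph_weight /exp_l1 /eind !EFinM muleA.
Qed.

Definition radial_const n : R := fine (radial_integral n (fun=> 1%E : \bar R)).

Lemma radial_constP n : 0 < radial_const n /\ radial_integral n (fun=> 1%E : \bar R) = (radial_const n)%:E.
Proof. by rewrite /radial_const; have [r [r0 [-> _]]] := radial_sphere_integral R n. Qed.

Lemma bmfun_l1unit_comp n (Phi : 'rV[R]_n.+1 -> R) : bmfun (Phi : rVB R n.+1 -> R) ->
  bmfun ((fun u => Phi (l1unit u)) : rVB R n.+1 -> R).
Proof. by move=> b; apply: (@bmfun_comp _ _ _ _ _ (Phi : rVB R n.+1 -> R) _ (@measurable_l1unit R n.+1) b). Qed.

Lemma mean_polar n (Phi : 'rV[R]_n.+1 -> R) : bmfun (Phi : rVB R n.+1 -> R) ->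
  mean (laplaceV R n.+1) (fun u => Phi (l1unit u)) =
  radial_const n * (mean (laplaceV R n) (fun x => graph_weight x * Phi (l1_graph 1 x)) +
              mean (laplaceV R n) (fun x => graph_weight x * Phi (l1_graph (-1) x))).
Proof.
have [r0 rE] := radial_constP n.
have pos (Psi : 'rV[R]_n.+1 -> R) : bmfun (Psi : rVB R n.+1 -> R) -> (forall u, 0 <= Psi u) ->
  mean (laplaceV R n.+1) (fun u => Psi (l1unit u)) =
  radial_const n * (mean (laplaceV R n) (fun x => graph_weight x * Psi (l1_graph 1 x)) +
              mean (laplaceV R n) (fun x => graph_weight x * Psi (l1_graph (-1) x))).
  move=> bP P0; apply: EFin_inj; rewrite -mean_EFin; last exact: bmfun_l1unit_comp.
  rewrite (@polar1 R n (fun u => (Psi u)%:E)); last 2 first.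
  - by apply/measurable_EFinP; case: bP.
  - by move=> u; rewrite lee_fin.
  by rewrite /sphere_integral !graph_integral_weight// rE EFinM EFinD.
move=> bP; case: (bP) => mP [M HM].
have bM : bmfun ((fun=> `|M|) : rVB R n.+1 -> R) by exact: bmfunC.
(* The polar formula is known for nonnegative integrands: it is applied to Phi + |M| and to the
   constant |M|, and the difference is taken. *)
have nn u : 0 <= Phi u + `|M|.
  by have := HM u; rewrite ler_norml => /andP[]; have := ler_norm M; lra.
have h2 := pos (fun u => Phi u + `|M|) (bmfunD bP bM) nn.
have := pos (fun=> `|M|) bM (fun=> normr_ge0 M).
rewrite meanC => h1.
have cg e : bmfun ((fun x => Phi (l1_graph e x)) : rVB R n -> R).
  exact: (@bmfun_comp _ _ _ _ _ (Phi : rVB R n.+1 -> R) _ (measurable_graph e) bP).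
have b1 e : bmfun ((fun x => graph_weight x * Phi (l1_graph e x)) : rVB R n -> R).
  by apply: bmfunM; [exact: bmfun_graph_weight|exact: cg].
have b2 : bmfun ((fun x => graph_weight x * `|M|) : rVB R n -> R).
  by apply: bmfunM; [exact: bmfun_graph_weight|exact: bmfunC].
have eD e : mean (laplaceV R n) (fun x => graph_weight x * (Phi (l1_graph e x) + `|M|)) =
    mean (laplaceV R n) (fun x => graph_weight x * Phi (l1_graph e x)) + mean (laplaceV R n) (fun x => graph_weight x * `|M|).
  by rewrite -(meanD _ (b1 e) b2); apply: mean_ext => x; rewrite mulrDr.
move: h2 h1; rewrite !eD (meanD _ (bmfun_l1unit_comp bP) bM) meanC.
by move=> h2 h1; lra.
Qed.

Lemma measurable_l1_eq n (a : R) : measurable ([set u | l1 u == a] : set (rVB R n)).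
Proof.
have := @measurable_fun_eqr _ (rVB R n) R setT (@l1 R n) (fun=> a) (@measurable_l1 R n) (measurable_cst _) measurableT [set true] I.
by rewrite setTI.
Qed.

(** By the polar formula the mass of a sphere is a radial integral over one point. In dimension 0
    the law is the point mass at 0, which explains the side condition. *)
Lemma laplaceV_l1_eq n (a : R) : (a != 0) || (0 < n)%N -> laplaceV R n [set u | l1 u == a] = 0%E.
Proof.
move=> an.
have -> : laplaceV R n [set u | l1 u == a] = (\int[laplaceV R n]_u eind R (l1 u == a)%R)%E.
  transitivity (\int[laplaceV R n]_(u in [set u | (l1 u == a)%R]) (1%:E))%E.
    by rewrite integral_cst ?mul1e//; exact: measurable_l1_eq.
  by rewrite ge0_integral_eind; apply: eq_integral => u _; rewrite mule1.
case: n an => [|n] an.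
  rewrite integral0_eq// => u _; rewrite /l1 big_ord0 eq_sym.
  by rewrite orbF in an; rewrite (negbTE an).
have mr : measurable_fun setT (fun t : R => eind R (t == a)).
  by apply: measurable_eind; apply: measurable_fun_eqr.
have := @polar R n (fun=> 1%E) (fun t => eind R (t == a)) (@measurable_cst _ _ _ _ _ _) (fun=> lee01) mr (fun t => eind_ge0 _ _).
under eq_integral => u _ do rewrite mul1e.
move=> ->; rewrite (_ : radial_integral n _ = 0%E) ?mul0e//.
rewrite /radial_integral.
transitivity (\int[mu]_(t in [set a]) (eind R (0 < t)%R * (t ^+ n * (expR (- t) / 2))%:E))%E; last exact: integral_set1.
rewrite (_ : [set a] = [set t : R | t == a]); last by apply/seteqP; split=> t /eqP.
rewrite ge0_integral_eind; apply: eq_integral => t _.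
by rewrite muleCA.
Qed.

Lemma mean_l1_ext n (a : R) (f g : 'rV[R]_n -> R) : (a != 0) || (0 < n)%N ->
  bmfun (f : rVB R n -> R) -> bmfun (g : rVB R n -> R) -> (forall x, l1 x != a -> f x = g x) ->
  mean (laplaceV R n) f = mean (laplaceV R n) g.
Proof.
move=> an bf bg fg; apply: EFin_inj; rewrite -!mean_EFin//.
apply: ae_eq_integral => //.
- by apply/measurable_EFinP; case: bf.
- by apply/measurable_EFinP; case: bg.
exists [set u | l1 u == a]; split.
- exact: measurable_l1_eq.
- exact: laplaceV_l1_eq.
by move=> x /= h; apply/negPn/negP => x1; apply: h => _; rewrite fg.
Qed.

(** The boundary of the ball, where the last coordinate of [l1_graph] is 0 and its sign is a
    convention, is a null set. *)
Lemma mean_graph_weight_ext n (f g : 'rV[R]_n -> R) : bmfun (f : rVB R n -> R) -> bmfun (g : rVB R n -> R) ->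
  (forall x, l1 x < 1 -> f x = g x) ->
  mean (laplaceV R n) (fun x => graph_weight x * f x) = mean (laplaceV R n) (fun x => graph_weight x * g x).
Proof.
move=> bf bg fg.
have bM k : bmfun (k : rVB R n -> R) -> bmfun ((fun x => graph_weight x * k x) : rVB R n -> R).
  by apply: bmfunM; exact: bmfun_graph_weight.
apply: (@mean_l1_ext n 1); rewrite ?oner_eq0//; [exact: bM|exact: bM|].
move=> x; case: (ltgtP (l1 x) 1) => // [x1|x1] _; first by rewrite fg.
by rewrite graph_weight_gt1// !mul0r.
Qed.

Lemma FTC_itv (H H' : R -> R) (a b : R) : a <= b -> continuous H' ->
  (forall t : R, is_derive t 1 H (H' t)) ->
  (\int[mu]_(t in `[a, b]) (H' t)%:E = (H b - H a)%:E)%E.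
Proof.
rewrite le_eqVlt => /orP[/eqP <- _ _|ab cH dH].
  by rewrite set_itv1 integral_set1 subrr.
have cHH : continuous H.
  move=> t; apply: differentiable_continuous; apply/derivable1_diffP.
  exact: (@ex_derive _ _ _ _ _ _ _ (dH t)).
rewrite (@continuous_FTC2 _ H' H a b)//.
- exact: continuous_subspaceT.
- split.
  + by move=> t _; exact: (@ex_derive _ _ _ _ _ _ _ (dH t)).
  + exact/cvg_at_right_filter/cHH.
  + exact/cvg_at_left_filter/cHH.
- by move=> t _; rewrite derive1E; exact: (@derive_val _ _ _ _ _ _ _ (dH t)).
Qed.

Lemma cont_rcons n (v : 'rV[R]_n) : continuous (fun t : R => rcons_rV v t).
Proof.
apply: (@rV_continuousP R n.+1 R^o) => j; rewrite /rcons_rV.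
under eq_fun do rewrite mxE.
by case: (unlift _ _) => [i|] t; [exact: cst_continuous|exact: cvg_id].
Qed.

Section last_coordinate.
Variables (n : nat) (h h' : 'rV[R]_n.+1 -> R).
Hypotheses (ch : continuous h) (ch' : continuous h').
Hypothesis dh : forall v (t : R), is_derive t 1 (fun s => h (rcons_rV v s)) (h' (rcons_rV v t)).
Variable M : R.
Hypothesis hM : forall u, l1 u <= 1 -> `|h u| <= M.

Let L e (x : 'rV[R]_n) := l1_graph e x.

Let l1L e (x : 'rV[R]_n) : `|e| = 1 -> l1 x <= 1 -> l1 (L e x) <= 1.
Proof. by move=> e1 x1; rewrite l1_l1_graph. Qed.

Let bL e : `|e| = 1 -> bmfun ((fun x => graph_weight x * h (L e x)) : rVB R n -> R).
Proof.
move=> e1; apply: (@bmfun_graph_weightM _ _ M) => [|x x1]; last exact/hM/l1L.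
apply: (@measurable_compV _ _ _ _ _ _ h); first exact: continuous_measurable_rV.
exact: measurable_graph.
Qed.

(** For fixed x the last coordinate runs over a segment of the ball whose ends are the points of the
    two graphs over x. The weight cancels the exponential of the Laplace density and leaves 1/2, so
    the inner integral is that of a derivative; its sign permits integrating coordinate by
    coordinate. *)
Lemma mean_graph_weight_derive_ge0 (M' : R) : (forall u, l1 u <= 1 -> 0 <= h' u) -> (forall u, l1 u <= 1 -> h' u <= M') ->
  mean (laplaceV R n.+1) (fun u => graph_weight u * h' u) =
  2^-1 * (mean (laplaceV R n) (fun x => graph_weight x * h (L 1 x)) - mean (laplaceV R n) (fun x => graph_weight x * h (L (-1) x))).
Proof.
move=> h0 hM'.
have mh' : measurable_fun setT (h' : rVB R n.+1 -> R) by exact: continuous_measurable_rV.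
have b' : bmfun ((fun u => graph_weight u * h' u) : rVB R n.+1 -> R).
  by apply: (bmfun_graph_weightM mh' (M := M')) => u u1; rewrite ger0_norm ?hM' ?h0.
have n1 : `|1 : R| = 1 by rewrite normr1.
have nm1 : `|-1 : R| = 1 by rewrite normrN1.
rewrite -(meanB _ (bL n1) (bL nm1)) -meanZ; last exact: bmfunB (bL n1) (bL nm1).
apply: EFin_inj; rewrite -!mean_EFin//; last by apply: bmfunM; [exact: bmfunC|exact: bmfunB (bL n1) (bL nm1)].
rewrite ge0_integral_laplaceV_rcons; last 2 first.
- by apply/measurable_EFinP; case: b'.
- move=> u; rewrite lee_fin; have [u1|u1] := leP (l1 u) 1; last by rewrite graph_weight_gt1// mul0r.
  by rewrite mulr_ge0 ?graph_weight_ge0 ?h0.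
apply: eq_integral => x _.
transitivity (\int[@laplace R]_t ((expR `|t|)%:E * (eind R (`|t| <= 1 - l1 x)%R * (expR (l1 x) * h' (rcons_rV x t))%:E)))%E.
  apply: eq_integral => t _; rewrite /graph_weight l1_rcons expRD /eind -!EFinM lerBrDl.
  by congr EFin; ring.
rewrite integral_laplace_expR; last 2 first.
- apply: emeasurable_funM.
    by apply: measurable_eind; apply: measurable_fun_ler.
  apply/measurable_EFinP; apply: measurable_funM => //.
  apply: continuous_measurable_fun => t.
  by apply: (@continuous_comp _ _ _ (rcons_rV x) h'); [exact: cont_rcons|exact: ch'].
- move=> t; rewrite /eind; case: (leP `|t| (1 - l1 x)) => xt; last by rewrite mul0e.
  by rewrite mul1e lee_fin mulr_ge0 ?expR_ge0// h0// l1_rcons -lerBrDl.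
rewrite EFinM; congr (_ * _)%E.
have [x1|x1] := leP (l1 x) 1; last first.
  rewrite graph_weight_gt1// !mul0r subr0; apply: integral0_eq => t _.
  rewrite [X in eind R X](_ : _ = false) ?mul0e//; apply/negbTE; rewrite -ltNge.
  by apply: lt_le_trans (normr_ge0 t); rewrite subr_lt0.
have xx : - (1 - l1 x) <= 1 - l1 x by lra.
rewrite -ge0_integral_eind (_ : [set t : R | `|t| <= 1 - l1 x] = `[- (1 - l1 x), 1 - l1 x]%classic); last first.
  by apply/seteqP; split=> t /=; rewrite in_itv/= ler_norml.
rewrite (@FTC_itv (fun t => expR (l1 x) * h (rcons_rV x t)) (fun t => expR (l1 x) * h' (rcons_rV x t)))//.
- by rewrite /graph_weight x1 mulr1 /L !l1_graphE mul1r mulN1r.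
- apply: contM; first exact: contC.
  by move=> t; apply: (@continuous_comp _ _ _ (rcons_rV x) h'); [exact: cont_rcons|exact: ch'].
Qed.

End last_coordinate.

Lemma is_derive_max_coord n (v : 'rV[R]_n) (c t : R) :
  is_derive t 1 (fun s => c * rcons_rV v s 0 ord_max) c.
Proof.
under eq_fun do rewrite rcons_rV_max.
apply: is_derive_eq (is_deriveZ c (is_derive_id t 1)) _.
by rewrite /GRing.scale/= mulr1.
Qed.

(** Adding K times the last coordinate to h makes the derivative nonnegative on the ball; the
    identity for the added linear function is then subtracted. *)
Lemma mean_graph_weight_derive n (h h' : 'rV[R]_n.+1 -> R) (M M' : R) : continuous h -> continuous h' ->
  (forall v (t : R), is_derive t 1 (fun s => h (rcons_rV v s)) (h' (rcons_rV v t))) ->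
  (forall u, l1 u <= 1 -> `|h u| <= M) -> (forall u, l1 u <= 1 -> `|h' u| <= M') ->
  mean (laplaceV R n.+1) (fun u => graph_weight u * h' u) =
  2^-1 * (mean (laplaceV R n) (fun x => graph_weight x * h (l1_graph 1 x)) - mean (laplaceV R n) (fun x => graph_weight x * h (l1_graph (-1) x))).
Proof.
move=> ch ch' dh hM hM'; pose K := `|M'|.
have K0 u : l1 u <= 1 -> `|h' u| <= K by move=> /hM' h1; apply: le_trans h1 (ler_norm _).
have cm : continuous (fun u : 'rV[R]_n.+1 => K * u 0 ord_max).
  by apply: contM; [exact: contC|move=> u; exact: coord_continuous].
have cmax (u : 'rV[R]_n.+1) : l1 u <= 1 -> `|K * u 0 ord_max| <= K.
  move=> u1; rewrite normrM normr_id ler_piMr// (le_trans _ u1)// -lpnorm1E.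
  exact: coord_le_lpnorm.
have e1 := @mean_graph_weight_derive_ge0 n (fun u => h u + K * u 0 ord_max) (fun u => h' u + K)
  (contD ch cm) (contD ch' (@contC _ _ K)) _ (M + K) _ (K + K) _ _.
have e2 := @mean_graph_weight_derive_ge0 n (fun u => K * u 0 ord_max) (fun u => K)
  cm (@contC _ _ K) (fun v t => @is_derive_max_coord n v K t) K cmax K (fun _ _ => normr_ge0 _) (fun _ _ => lexx _).
have mb (k : 'rV[R]_n.+1 -> R) : continuous k -> measurable_fun setT (k : rVB R n.+1 -> R).
  exact: continuous_measurable_rV.
have bw (k : 'rV[R]_n.+1 -> R) B : continuous k -> (forall u, l1 u <= 1 -> `|k u| <= B) ->
    bmfun ((fun u => graph_weight u * k u) : rVB R n.+1 -> R).
  by move=> ck kB; exact: bmfun_graph_weightM (mb _ ck) kB.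
have bL (k : 'rV[R]_n.+1 -> R) B e : continuous k -> (forall u, l1 u <= 1 -> `|k u| <= B) ->
    `|e| = 1 -> bmfun ((fun x => graph_weight x * k (l1_graph e x)) : rVB R n -> R).
  move=> ck kB e1'; apply: (@bmfun_graph_weightM _ _ B) => [|x x1]; last by apply: kB; rewrite l1_l1_graph.
  apply: (@measurable_compV _ _ _ _ _ _ k); first exact: mb.
  exact: measurable_graph.
have n1 : `|1 : R| = 1 by rewrite normr1.
have nm1 : `|-1 : R| = 1 by rewrite normrN1.
have spl e : `|e| = 1 -> mean (laplaceV R n) (fun x => graph_weight x * (h (l1_graph e x) + K * l1_graph e x 0 ord_max)) =
    mean (laplaceV R n) (fun x => graph_weight x * h (l1_graph e x)) + mean (laplaceV R n) (fun x => graph_weight x * (K * l1_graph e x 0 ord_max)).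
  move=> e1'; rewrite -(meanD _ (bL _ _ _ ch hM e1') (bL _ _ _ cm cmax e1')).
  by apply: mean_ext => x; rewrite mulrDr.
have spl' : mean (laplaceV R n.+1) (fun u => graph_weight u * (h' u + K)) =
    mean (laplaceV R n.+1) (fun u => graph_weight u * h' u) + mean (laplaceV R n.+1) (fun u => graph_weight u * K).
  rewrite -(meanD _ (bw _ _ ch' K0) (bw _ K (@contC _ _ K) _)); last by move=> u _; rewrite normr_id.
  by apply: mean_ext => x; rewrite mulrDr.
rewrite spl' !spl// e2 in e1.
have {e1} : mean (laplaceV R n.+1) (fun u => graph_weight u * h' u) + 2^-1 * _ = _ := e1 _ _ _ _.
move=> {spl spl' e2}; set a := mean _ _; set b := mean _ _; set c := mean _ _; set d := mean _ _; set e := mean _ _.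
move=> H; have : a + 2^-1 * (b - c) = 2^-1 * (d + b - (e + c)).
  apply: H => [v t|u u1|u u1|u u1].
  - exact: (is_deriveD (dh v t) (@is_derive_max_coord n v K t)).
  - by apply: le_trans (ler_normD _ _) _; rewrite lerD ?hM ?cmax.
  - by have := K0 u u1; rewrite ler_norml => /andP[]; lra.
  - by rewrite lerD2r; apply: le_trans (ler_norm _) _; exact: K0.
lra.
Qed.

Lemma measurable_signv n (i : 'I_n) : measurable_fun setT (fun u : rVB R n => signv u 0 i : R).
Proof.
under eq_fun do rewrite mxE.
apply: measurable_fun_ifT => //; apply: measurable_fun_ltr => //.
exact: measurable_coord.
Qed.

Lemma signv1 n (u : 'rV[R]_n) i : `|signv u 0 i| = 1.
Proof. by rewrite mxE; case: ifP; rewrite ?normrN normr1. Qed.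

(** The functions at hand are bounded on the ball only; cut off, they satisfy [bmfun] and keep their
    values at all points [l1unit u]. *)
Definition l1_cutoff n (k : 'rV[R]_n -> R) (u : 'rV[R]_n) : R := (l1 u <= 1)%R%:R * k u.

Lemma l1_cutoff_le1 n (k : 'rV[R]_n -> R) u : l1 u <= 1 -> l1_cutoff k u = k u.
Proof. by rewrite /l1_cutoff => ->; rewrite mul1r. Qed.

Lemma bmfun_l1_cutoff n (k : 'rV[R]_n -> R) (M : R) : measurable_fun setT (k : rVB R n -> R) ->
  (forall u, l1 u <= 1 -> `|k u| <= M) -> bmfun (l1_cutoff k : rVB R n -> R).
Proof.
move=> mk kM; split.
  apply: measurable_funM => //; apply/measurable_EFinP.
  apply: (@measurable_eind R _ (rVB R n) (fun u => l1 u <= 1)).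
  by apply: measurable_fun_ler => //; exact: measurable_l1.
exists M => u; rewrite /l1_cutoff; case: (leP (l1 u) 1) => u1; first by rewrite mul1r kM.
by rewrite mul0r normr0; apply: le_trans (kM 0 _); rewrite // -(scale0r (0 : 'rV[R]_n)) l1Z normr0 mul0r.
Qed.

(* The fundamental theorem of calculus along the last coordinate: on the
   graphs of 1 - |x|_1 and |x|_1 - 1 the last component of the sign is 1 and -1. *)
Lemma stokes_max n (h h' : 'rV[R]_n.+1 -> R) (M M' : R) : continuous h -> continuous h' ->
  (forall v (t : R), is_derive t 1 (fun s => h (rcons_rV v s)) (h' (rcons_rV v t))) ->
  (forall u, l1 u <= 1 -> `|h u| <= M) -> (forall u, l1 u <= 1 -> `|h' u| <= M') ->
  mean (laplaceV R n.+1) (fun u => h (l1unit u) * signv (l1unit u) 0 ord_max) =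
  2 * radial_const n * mean (laplaceV R n.+1) (fun u => graph_weight u * h' u).
Proof.
move=> ch ch' dh hM hM'.
have mh : measurable_fun setT (h : rVB R n.+1 -> R) by exact: continuous_measurable_rV.
pose Phi := l1_cutoff (fun u : 'rV[R]_n.+1 => h u * signv u 0 ord_max).
have bPhi : bmfun (Phi : rVB R n.+1 -> R).
  apply: (@bmfun_l1_cutoff _ _ M) => [|u u1]; last by rewrite normrM signv1 mulr1 hM.
  by apply: measurable_funM => //; exact: measurable_signv.
have -> : mean (laplaceV R n.+1) (fun u => h (l1unit u) * signv (l1unit u) 0 ord_max) = mean (laplaceV R n.+1) (fun u => Phi (l1unit u)).
  by apply: mean_ext => u; rewrite /Phi l1_cutoff_le1// l1_l1unit_le.
rewrite (mean_polar bPhi) (mean_graph_weight_derive ch ch' dh hM hM').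
have bh : bmfun (l1_cutoff h : rVB R n.+1 -> R) by exact: bmfun_l1_cutoff mh hM.
have main e : `|e| = 1 -> (forall c, 0 < c -> (if e * c < 0 then -1 else 1) = e :> R) ->
    mean (laplaceV R n) (fun x => graph_weight x * Phi (l1_graph e x)) = e * mean (laplaceV R n) (fun x => graph_weight x * h (l1_graph e x)).
  move=> e1 es.
  have bg (k : 'rV[R]_n.+1 -> R) : bmfun (k : rVB R n.+1 -> R) -> bmfun ((fun x => k (l1_graph e x)) : rVB R n -> R).
    by move=> b; apply: (@bmfun_comp _ _ _ _ _ (k : rVB R n.+1 -> R) _ (measurable_graph e) b).
  have bt := bg _ bh.
  have be : bmfun ((fun x => e * l1_cutoff h (l1_graph e x)) : rVB R n -> R) by apply: bmfunM; [exact: bmfunC|exact: bt].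
  rewrite (mean_graph_weight_ext (bg _ bPhi) be); last first.
    move=> x x1; have g1 : l1 (l1_graph e x) <= 1 by rewrite l1_l1_graph// ltW.
    rewrite /Phi !l1_cutoff_le1// mulrC; congr (_ * _); rewrite mxE l1_graphE rcons_rV_max es//.
    by rewrite subr_gt0.
  have bw : bmfun ((fun x => graph_weight x * l1_cutoff h (l1_graph e x)) : rVB R n -> R) by apply: bmfunM; [exact: bmfun_graph_weight|exact: bt].
  transitivity (e * mean (laplaceV R n) (fun x => graph_weight x * l1_cutoff h (l1_graph e x))).
    by rewrite -(meanZ _ e bw); apply: mean_ext => x; rewrite mulrCA.
  congr (_ * _); apply: mean_ext => x; have [x1|x1] := leP (l1 x) 1; last by rewrite graph_weight_gt1// !mul0r.
  by rewrite l1_cutoff_le1// l1_l1_graph.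
rewrite (main 1) ?normr1//; last by move=> c c0; rewrite mul1r ltNge (ltW c0).
rewrite (main (-1)) ?normrN1//; last by move=> c c0; rewrite mulN1r oppr_lt0 c0.
by set a := mean _ _; set b := mean _ _; field.
Qed.

Lemma mean_laplaceV_perm n (s : 'S_n) (g : 'rV[R]_n -> R) : bmfun (g : rVB R n -> R) ->
  mean (laplaceV R n) (fun u => g (rV_perm s u)) = mean (laplaceV R n) g.
Proof.
move=> bg; case: (bg) => mg [M HM].
have bp k : bmfun (k : rVB R n -> R) -> bmfun ((fun u => k (rV_perm s u)) : rVB R n -> R).
  by move=> b; apply: (@bmfun_comp _ _ _ _ _ (k : rVB R n -> R) _ (measurable_rV_perm s) b).
have bM : bmfun ((fun=> `|M|) : rVB R n -> R) by exact: bmfunC.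
have nn u : 0 <= g u + `|M|.
  by have := HM u; rewrite ler_norml => /andP[]; have := ler_norm M; lra.
have H : mean (laplaceV R n) (fun u => g (rV_perm s u) + `|M|) = mean (laplaceV R n) (fun u => g u + `|M|).
  apply: EFin_inj; rewrite -!mean_EFin; [|exact: bmfunD bg bM|exact: (bp (fun u => g u + `|M|) (bmfunD bg bM))].
  rewrite (@ge0_integral_laplaceV_perm R n s (fun u => (g u + `|M|)%:E))//.
  by apply/measurable_EFinP; apply: measurable_funD.
by move: H; rewrite (meanD _ bg bM) (meanD _ (bp _ bg) bM) => /addIr.
Qed.

Lemma l1unit_perm n (s : 'S_n) (u : 'rV[R]_n) : l1unit (rV_perm s u) = rV_perm s (l1unit u).
Proof. by rewrite /l1unit l1_perm; apply/rowP => i; rewrite !mxE. Qed.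

(** The transposition of i and the last coordinate leaves the Laplace law and the weight invariant
    and commutes with [l1unit]. *)
Lemma stokes n (i : 'I_n.+1) (h h' : 'rV[R]_n.+1 -> R) (M M' : R) : continuous h -> continuous h' ->
  (forall u (t : R), is_derive t 1 (fun s => h (set_coord u i s)) (h' (set_coord u i t))) ->
  (forall u, l1 u <= 1 -> `|h u| <= M) -> (forall u, l1 u <= 1 -> `|h' u| <= M') ->
  mean (laplaceV R n.+1) (fun u => h (l1unit u) * signv (l1unit u) 0 i) =
  2 * radial_const n * mean (laplaceV R n.+1) (fun u => graph_weight u * h' u).
Proof.
move=> ch ch' dh hM hM'; pose s : 'S_n.+1 := tperm i ord_max.
have cp (k : 'rV[R]_n.+1 -> R) : continuous k -> continuous (fun u => k (rV_perm s u)).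
  move=> ck u; apply: (@continuous_comp _ _ _ (@rV_perm R n.+1 s) k); last exact: ck.
  apply: (@rV_continuousP R n.+1 'rV[R]_n.+1) => j; rewrite /rV_perm; under eq_fun do rewrite mxE.
  by move=> v; exact: coord_continuous.
have rp (v : 'rV[R]_n) (t : R) : rV_perm s (rcons_rV v t) = set_coord (rV_perm s (rcons_rV v 0)) i t.
  apply/rowP => j; rewrite !mxE; case: eqP => [->|/eqP ji]; first by rewrite tpermL unlift_none.
  case: unliftP => // sj; have := congr1 s sj; rewrite tpermK tpermR => e.
  by rewrite e eqxx in ji.
have mh : measurable_fun setT (h : rVB R n.+1 -> R) by exact: continuous_measurable_rV.
have bs : bmfun (l1_cutoff (fun u : 'rV[R]_n.+1 => h u * signv u 0 i) : rVB R n.+1 -> R).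
  apply: (@bmfun_l1_cutoff _ _ M) => [|u u1]; last by rewrite normrM signv1 mulr1 hM.
  by apply: measurable_funM => //; exact: measurable_signv.
transitivity (mean (laplaceV R n.+1) (fun u => l1_cutoff (fun u : 'rV[R]_n.+1 => h u * signv u 0 i) (l1unit u))).
  by apply: mean_ext => u; rewrite l1_cutoff_le1// l1_l1unit_le.
rewrite -(mean_laplaceV_perm s (bmfun_l1unit_comp bs)).
transitivity (mean (laplaceV R n.+1) (fun u => h (rV_perm s (l1unit u)) * signv (l1unit u) 0 ord_max)).
  by apply: mean_ext => u; rewrite l1unit_perm l1_cutoff_le1 ?l1_perm ?l1_l1unit_le// !mxE tpermL.
have dh2 (v : 'rV[R]_n) (t : R) : is_derive t 1 (fun x => h (rV_perm s (rcons_rV v x))) (h' (rV_perm s (rcons_rV v t))).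
  by rewrite rp; under eq_fun do rewrite rp; exact: dh.
rewrite (@stokes_max n (fun u => h (rV_perm s u)) (fun u => h' (rV_perm s u)) M M' (cp _ ch) (cp _ ch') dh2).
- congr (_ * _); rewrite -(mean_laplaceV_perm s (bmfun_graph_weightM _ hM')); last exact: continuous_measurable_rV.
  by apply: mean_ext => u; rewrite /graph_weight l1_perm.
- by move=> u u1; rewrite hM// l1_perm.
- by move=> u u1; rewrite hM'// l1_perm.
Qed.

(** Stokes' formula for h(u) = u_i, summed over i: the left-hand sides add up to the mean of |s|_1 =
    1. This eliminates [radial_const]. *)
Lemma radial_const_graph_weight n : 2 * radial_const n * n.+1%:R * mean (laplaceV R n.+1) (@graph_weight n.+1) = 1.
Proof.
have b1 i : mean (laplaceV R n.+1) (fun u => l1unit u 0 i * signv (l1unit u) 0 i) = 2 * radial_const n * mean (laplaceV R n.+1) (@graph_weight n.+1).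
  have dc u (t : R) : is_derive t 1 (fun s => set_coord u i s 0 i) (1 : R).
    by under eq_fun do rewrite mxE eqxx; exact: is_derive_id.
  have ci : continuous (fun u : 'rV[R]_n.+1 => u 0 i) by move=> u; exact: coord_continuous.
  rewrite (@stokes n i (fun u => u 0 i) (fun=> 1) 1 1 ci (@contC _ _ 1) dc).
  - by congr (_ * _); apply: mean_ext => u; rewrite mulr1.
  - by move=> u; rewrite -lpnorm1E; apply: le_trans; exact: coord_le_lpnorm.
  - by move=> u _; rewrite normr1.
have sg (x : R) : x * (if x < 0 then -1 else 1) = `|x|.
  by case: ltP => x0; [rewrite mulrN1 ltr0_norm|rewrite mulr1 ger0_norm].
have bc i : bmfun ((fun u => l1unit u 0 i * signv (l1unit u) 0 i) : rVB R n.+1 -> R).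
  split.
    apply: (@measurable_compV _ _ _ _ _ _ (fun v => v 0 i * signv v 0 i)); last exact: measurable_l1unit.
    by apply: measurable_funM; [exact: measurable_coord|exact: measurable_signv].
  exists 1 => u; rewrite normrM signv1 mulr1.
  by apply: le_trans (l1_l1unit_le u); rewrite -lpnorm1E; exact: coord_le_lpnorm.
have [bS] := mean_sum (laplaceV R n.+1) bc.
under eq_bigr do rewrite b1.
rewrite sumr_const card_ord => e.
rewrite mulrAC mulr_natr -e.
transitivity (mean (laplaceV R n.+1) (fun=> 1)); last by rewrite meanC.
apply: (@mean_l1_ext n.+1 0) => //; first by rewrite orbT.
  exact: bmfunC.
move=> u u0; under eq_bigr do rewrite [signv _ _ _]mxE sg.
by rewrite -/(l1 (l1unit u)) /l1unit l1Z ger0_norm ?invr_ge0 ?l1_ge0// mulVf.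
Qed.

End Stokes.

(** * Bias and second moment of the gradient estimator *)

Section Estimator.
Variables (R : realType) (n : nat) (X : set 'rV[R]_n.+1) (f : 'rV[R]_n.+1 -> R).
Variables (y : 'rV[R]_n.+1) (mu G : R) (q : \bar R).
Hypotheses (cX : compact X).
Hypothesis vX : forall x y t, X x -> X y -> 0 <= t -> t <= 1 -> X (x + t *: (y - x)).
Hypothesis cf : continuous f.
Hypothesis vf : forall x y t, X x -> X y -> 0 <= t -> t <= 1 ->
  f (x + t *: (y - x)) <= f x + t * (f y - f x).
Hypotheses (G0 : 0 < G) (mu0 : 0 < mu) (q1 : (1 <= q)%E) (n2 : (2 <= n)%N).
Hypothesis lf : forall x y, X x -> X y -> `|f x - f y| <= G * lpnorm q (x - y).
Hypothesis yX : forall u, l1 u <= 1 -> X (y + mu *: u).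

Local Notation L := (laplaceV R n.+1).
(** The Lipschitz constant in the Euclidean norm, the norm of the envelope and of the variance
    bound. *)
Let G2 := G * upsilon 2%:E q n.+1.

Let G20 : 0 <= G2. Proof. by rewrite mulr_ge0 ?(ltW G0)// upsilon_ge0. Qed.

Let lf2 x x' : X x -> X x' -> `|f x - f x'| <= G2 * Num.sqrt (dotp (x - x') (x - x')).
Proof.
move=> Xx Xy; apply: le_trans (lf Xx Xy) _; rewrite /G2 -mulrA ler_wpM2l ?(ltW G0)//.
by rewrite -lpnorm2E; apply: lpnorm_upsilon => //; rewrite lee_fin ler1n.
Qed.

Let d0 : 0 < n.+1%:R :> R. Proof. by rewrite ltr0n. Qed.

Lemma l1_0 m : l1 (0 : 'rV[R]_m) = 0.
Proof. by rewrite -(scale0r (0 : 'rV[R]_m)) l1Z normr0 mul0r. Qed.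

Let Xy : X y.
Proof. by rewrite -(addr0 y) -(scaler0 _ mu); apply: yX; rewrite l1_0. Qed.

Let yNX u : l1 u <= 1 -> X (y - mu *: u).
Proof. by move=> u1; rewrite -scalerN; apply: yX; rewrite l1N. Qed.

Let b1 : bmfun ((fun u => f (y + mu *: l1unit u)) : rVB R n.+1 -> R).
Proof. by apply: (bmfun_l1unit cf G20 mu0 lf2 yX); rewrite gtr0_norm. Qed.

Let b2 : bmfun ((fun u => f (y - mu *: l1unit u)) : rVB R n.+1 -> R).
Proof.
under eq_fun do rewrite -scaleNr.
by apply: (bmfun_l1unit cf G20 mu0 lf2 yX); rewrite normrN gtr0_norm.
Qed.

Lemma lpnorm_l1unit_le1 (u : 'rV[R]_n.+1) : lpnorm q (l1unit u) <= 1.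
Proof.
apply: le_trans (l1_l1unit_le u); rewrite -lpnorm1E; exact: lpnorm_mono.
Qed.

Let bq : bmfun ((fun u => lpnorm q (l1unit u)) : rVB R n.+1 -> R).
Proof.
split; last by exists 1 => u; rewrite ger0_norm ?lpnorm_ge0 ?lpnorm_l1unit_le1.
by apply: measurable_compV; [exact: measurable_lpnorm|exact: measurable_l1unit].
Qed.

Let Eq : mean L (fun u => lpnorm q (l1unit u)) <= 24 * zeta q n.+1.
Proof. by rewrite -lee_fin -mean_EFin//; exact: integral_l1unit_lpnorm. Qed.

Let bavg : bmfun ((fun u => (f (y + mu *: l1unit u) + f (y - mu *: l1unit u)) / 2) : rVB R n.+1 -> R).
Proof. by apply: bmfunM; [exact: bmfunD b1 b2|exact: bmfunC]. Qed.

Lemma mean_average_le :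
  bmfun ((fun u => (f (y + mu *: l1unit u) + f (y - mu *: l1unit u)) / 2) : rVB R n.+1 -> R) /\
  mean L (fun u => (f (y + mu *: l1unit u) + f (y - mu *: l1unit u)) / 2) <= f y + 24 * G * mu * zeta q n.+1.
Proof.
split=> //; have bb : bmfun ((fun u => G * mu * lpnorm q (l1unit u)) : rVB R n.+1 -> R).
  by apply: bmfunM; [exact: bmfunC|exact: bq].
have bc : bmfun ((fun=> f y) : rVB R n.+1 -> R) by exact: bmfunC.
apply: (@le_trans _ _ (mean L (fun u => f y + G * mu * lpnorm q (l1unit u)))).
  apply: (mean_le L bavg (bmfunD bc bb)) => u.
  have h1 := lf (yX (l1_l1unit_le u)) Xy; have h2 := lf (yNX (l1_l1unit_le u)) Xy.
  rewrite [y + _ - y]addrC addKr in h1; rewrite [y - _ - y]addrC addKr in h2.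
  rewrite lpnormZ// (gtr0_norm mu0) in h1; rewrite lpnormN// lpnormZ// (gtr0_norm mu0) in h2.
  move: h1 h2; rewrite -mulrA; set z := G * _.
  move=> /(le_trans (ler_norm _)) h1 /(le_trans (ler_norm _)) h2; lra.
rewrite (meanD L bc bb) meanC lerD2l (meanZ L _ bq).
have -> : 24 * G * mu * zeta q n.+1 = G * mu * (24 * zeta q n.+1) by ring.
by rewrite ler_wpM2l// mulr_ge0 ?(ltW G0)// ltW.
Qed.

(** The scale cancels: (d / (2 mu))^2 times 4^10 mu^2 G2^2 / d^2 is 4^9 G2^2, and the squared dual
    norm of the sign vector completes [xi]. *)
Lemma mean_estimate_sqr p : (1 <= p)%E ->
  bmfun ((fun u => lpnorm (hoelder_conjugate p) (grad_estimate mu f y (l1unit u)) ^+ 2) : rVB R n.+1 -> R) /\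
  mean L (fun u => lpnorm (hoelder_conjugate p) (grad_estimate mu f y (l1unit u)) ^+ 2) <=
  4 ^+ 9 * G ^+ 2 * xi p q n.+1.
Proof.
move=> p1; pose D := n.+1%:R `^ (1 - recip p) : R.
pose k : R := (n.+1%:R / (2 * mu)) ^+ 2 * D ^+ 2.
pose V u := (f (y + mu *: l1unit u) - f (y - mu *: l1unit u)) ^+ 2.
have bV : bmfun (V : rVB R n.+1 -> R) by apply: bmfunX; exact: bmfunB b1 b2.
have eE : (fun u => lpnorm (hoelder_conjugate p) (grad_estimate mu f y (l1unit u)) ^+ 2) = fun u => k * V u.
  apply/funext => u; rewrite /grad_estimate lpnorm_sign// exprMn real_normK ?num_real//.
  by rewrite exprMn /k /V -/D; ring.
rewrite eE; split; first by apply: bmfunM; [exact: bmfunC|exact: bV].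
rewrite (meanZ L k bV).
have := variation_bound cX vX cf vf G20 mu0 lf2 yX; rewrite -/V => hV.
have k0 : 0 <= k by rewrite mulr_ge0 ?sqr_ge0.
apply: le_trans (ler_wpM2l k0 hV) _; rewrite xiE// -/D /k /G2.
move: (upsilon _ _ _) => U; rewrite le_eqVlt; apply/orP; left; apply/eqP.
by rewrite !exprS expr0; field; rewrite !gt_eqF.
Qed.

(** In the ball the radius is at most 1 and is dropped; the q-norm of the direction is then
    independent of the weight, a function of the radius. *)
Lemma mean_graph_weight_lpnorm :
  mean L (fun u => graph_weight u * lpnorm q u) <= mean L (@graph_weight R n.+1) * (24 * zeta q n.+1).
Proof.
have bn : bmfun ((fun u => graph_weight u * lpnorm q (l1unit u)) : rVB R n.+1 -> R).
  by apply: bmfunM; [exact: bmfun_graph_weight|exact: bq].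
apply: (@le_trans _ _ (mean L (fun u => graph_weight u * lpnorm q (l1unit u)))).
  apply: mean_le => //.
    apply: (@bmfun_graph_weightM _ _ _ 1) => [|u u1]; first exact: measurable_lpnorm.
    rewrite ger0_norm ?lpnorm_ge0//; apply: le_trans u1; rewrite -lpnorm1E; exact: lpnorm_mono.
  move=> u; have [u1|u1] := leP (l1 u) 1; last by rewrite graph_weight_gt1// !mul0r.
  by rewrite ler_wpM2l ?graph_weight_ge0// (lpnorm_l1unit u q1) ler_piMr ?lpnorm_ge0.
suff -> : mean L (fun u => graph_weight u * lpnorm q (l1unit u)) = mean L (fun u => lpnorm q (l1unit u)) * mean L (@graph_weight R n.+1).
  rewrite mulrC ler_wpM2l//; apply: mean_ge0 => [|u]; [exact: bmfun_graph_weight|exact: graph_weight_ge0].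
apply: EFin_inj; rewrite EFinM -!mean_EFin//; last exact: bmfun_graph_weight.
rewrite -(@polar_indep R n (fun u => (lpnorm q u)%:E) (fun t => (expR t * (t <= 1)%R%:R)%:E)).
- by apply: eq_integral => u _; rewrite -EFinM mulrC.
- by apply/measurable_EFinP; exact: measurable_lpnorm.
- by move=> u; rewrite lee_fin lpnorm_ge0.
- apply/measurable_EFinP; apply: measurable_funM => //; apply/measurable_EFinP.
  by apply: (@measurable_eind R _ _ (fun t : R => t <= 1)); apply: measurable_fun_ler.
- by move=> t; rewrite lee_fin mulr_ge0 ?expR_ge0.
Qed.

Variable v : 'rV[R]_n.+1.
Hypothesis vvX : forall u, l1 u <= 1 -> X (v + mu *: u).

Let w := y - v.

Let best : bmfun ((fun u => dotp (grad_estimate mu f y (l1unit u)) w) : rVB R n.+1 -> R).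
Proof.
have eE : (fun u => dotp (grad_estimate mu f y (l1unit u)) w) =
  fun u => (n.+1%:R / (2 * mu) * (f (y + mu *: l1unit u) - f (y - mu *: l1unit u))) * dotp (signv (l1unit u)) w.
  by apply/funext => u; rewrite /grad_estimate dotpZl.
rewrite eE; apply: bmfunM; first by apply: bmfunM; [exact: bmfunC|exact: bmfunB b1 b2].
split.
  apply: measurable_sum => i; apply: measurable_funM => //.
  by apply: (@measurable_compV _ _ _ _ _ _ (fun u => signv u 0 i)); [exact: measurable_signv|exact: measurable_l1unit].
exists (l1 w) => u; apply: le_trans (ler_norm_sum _ _ _) _.
by apply: ler_sum => i _; rewrite normrM signv1 mul1r.
Qed.

(** The envelope is taken with an arbitrary accuracy eps. The estimator magnifies its error by d /
    mu, which is harmless because eps tends to 0 while everything else is fixed. *)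
Let approx (eps : R) : 0 < eps ->
  f y - f v - 24 * G * mu * zeta q n.+1 <=
  mean L (fun u => dotp (grad_estimate mu f y (l1unit u)) w) + eps * (1 + n.+1%:R / (2 * mu) * l1 w).
Proof.
move=> eps0; have X0 : X !=set0 by exists y.
pose delta := 2 * eps / (G2 ^+ 2 + 1).
have G21 : 0 < G2 ^+ 2 + 1 by rewrite ltr_wpDl ?sqr_ge0.
have delta0 : 0 < delta by rewrite divr_gt0// mulr_gt0.
have epsE : G2 ^+ 2 * delta / 2 <= eps.
  rewrite (_ : _ / 2 = eps * (G2 ^+ 2 / (G2 ^+ 2 + 1))); last by rewrite /delta; field; rewrite gt_eqF.
  by rewrite ler_piMr ?(ltW eps0)// ler_pdivrMr// mul1r lerDl.
pose phi := moreau X f delta; pose gr := moreau_grad X f delta.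
have cgr : continuous gr by exact: (continuous_moreau_grad cX X0 vX cf vf).
have sub x z : phi x + dotp (gr x) (z - x) <= phi z by exact: (moreau_subgrad cX X0 vX cf vf).
have cphi := subgrad_continuous cgr sub.
pose K := 2 * G2; have K0 : 0 <= K by rewrite mulr_ge0.
have bK x : X x -> dotp (gr x) (gr x) <= K ^+ 2.
  move=> Xx; rewrite (_ : K ^+ 2 = 4 * G2 ^+ 2); last by rewrite /K; ring.
  by apply: (moreau_grad_le cX X0 cf).
have phile x : X x -> phi x <= f x by move=> Xx; exact: (moreau_le delta cX X0 cf Xx).
have phige x : X x -> f x - eps <= phi x.
  by move=> Xx; have := moreau_ge cX X0 cf delta0 lf2 Xx; rewrite -/phi; lra.
clearbody phi gr.
(* The difference of the two evaluations is itself a C^1 function of the direction; Stokes' formula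
   applies to it as a whole, and [h' i] is its i-th partial derivative. *)
pose h (u : 'rV[R]_n.+1) := phi (y + mu *: u) - phi (y - mu *: u).
pose h' i (u : 'rV[R]_n.+1) := mu * (gr (y + mu *: u) 0 i + gr (y - mu *: u) 0 i).
have cc (e : R) : continuous (fun u : 'rV[R]_n.+1 => y + e *: u).
  apply: continuous_addv; first exact: cst_continuous.
  by apply: continuous_scale; [exact: cst_continuous|move=> z; exact: cvg_id].
have cph e : continuous (fun u : 'rV[R]_n.+1 => phi (y + e *: u)).
  by move=> u; apply: continuous_comp; [exact: cc|exact: cphi].
have cgi e i : continuous (fun u : 'rV[R]_n.+1 => gr (y + e *: u) 0 i).
  move=> u; apply: (@continuous_comp _ _ _ (fun u : 'rV[R]_n.+1 => gr (y + e *: u)) (fun x : 'rV[R]_n.+1 => x 0 i)).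
    by apply: continuous_comp; [exact: cc|exact: cgr].
  exact: coord_continuous.
have ch : continuous h.
  rewrite /h; apply: contB; first exact: cph.
  by under eq_fun do rewrite -scaleNr; exact: cph.
have ch' i : continuous (h' i).
  rewrite /h'; apply: contM; first exact: contC.
  apply: contD; first exact: cgi.
  by under eq_fun do rewrite -scaleNr; exact: cgi.
have dphi e u i (t : R) : is_derive t 1 (fun s : R => phi (y + e *: set_coord u i s)) (e * gr (y + e *: set_coord u i t) 0 i).
  have -> : e * gr (y + e *: set_coord u i t) 0 i = dotp (gr (y + e *: set_coord u i t)) (e *: delta_mx 0 i).
    by rewrite dotpZr dotp_delta.
  apply: (is_derive_subgrad cgr sub (c := fun s : R => y + e *: set_coord u i s)) => j.
  have du : is_derive t 1 (fun s : R => set_coord u i s 0 j) ((j == i)%:R : R).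
    rewrite /set_coord; under eq_fun do rewrite mxE; case: (j == i); first exact: is_derive_id.
    exact: is_derive_cst.
  rewrite !mxE eqxx/=; under eq_fun do rewrite mxE [X in _ + X]mxE.
  apply: is_derive_eq (is_deriveD (is_derive_cst (y 0 j) t 1) (is_deriveZ e du)) _.
  by rewrite add0r.
have dh i u (t : R) : is_derive t 1 (fun s : R => h (set_coord u i s)) (h' i (set_coord u i t)).
  rewrite /h; under eq_fun do rewrite -scaleNr.
  apply: is_derive_eq (is_deriveB (dphi mu u i t) (dphi (- mu) u i t)) _.
  by rewrite /h' scaleNr; ring.
have hM u : l1 u <= 1 -> `|h u| <= K * (2 * mu).
  move=> u1; rewrite /h; apply: le_trans (subgrad_lip sub K0 (bK _ (yX u1)) (bK _ (yNX u1))) _.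
  rewrite ler_wpM2l// (_ : y + mu *: u - (y - mu *: u) = (2 * mu) *: u); last first.
    by apply/rowP => j; rewrite !mxE; ring.
  have m2 : 0 <= 2 * mu by rewrite mulr_ge0// ltW.
  rewrite dotpZl dotpZr mulrA -expr2 sqrtrM ?sqr_ge0// sqrtr_sqr ger0_norm// ler_piMr//.
  rewrite -sqrtr1 ler_wsqrtr//; apply: le_trans (dotp_le_l1 _) _.
  by rewrite expr_le1 ?l1_ge0.
have grK x i : X x -> `|gr x 0 i| <= K.
  move=> Xx; rewrite -(@ler_pXn2r _ 2)// ?nnegrE// real_normK ?num_real//.
  by apply: le_trans (bK _ Xx); exact: sqr_coord_le_dotp.
have h'M i u : l1 u <= 1 -> `|h' i u| <= mu * (K + K).
  move=> u1; rewrite /h' normrM gtr0_norm// ler_wpM2l ?(ltW mu0)//.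
  by apply: le_trans (ler_normD _ _) _; rewrite lerD// grK//; [exact: yX|exact: yNX].
have St i := stokes ch (ch' i) (dh i) hM (h'M i).
have bhn : bmfun ((fun u => h (l1unit u)) : rVB R n.+1 -> R).
  split; last by exists (K * (2 * mu)) => u; exact/hM/l1_l1unit_le.
  by apply: measurable_compV; [exact: continuous_measurable_rV|exact: measurable_l1unit].
have bsg i : bmfun ((fun u => signv (l1unit u) 0 i) : rVB R n.+1 -> R).
  split; last by exists 1 => u; rewrite signv1.
  by apply: (@measurable_compV _ _ _ _ _ _ (fun u => signv u 0 i)); [exact: measurable_signv|exact: measurable_l1unit].
have bhs i : bmfun ((fun u => h (l1unit u) * signv (l1unit u) 0 i) : rVB R n.+1 -> R).
  exact: bmfunM bhn (bsg i).
have bws i : bmfun ((fun u => w 0 i * (h (l1unit u) * signv (l1unit u) 0 i)) : rVB R n.+1 -> R).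
  by apply: bmfunM; [exact: bmfunC|exact: bhs].
have bwh i : bmfun ((fun u => graph_weight u * h' i u) : rVB R n.+1 -> R).
  by apply: (bmfun_graph_weightM _ (h'M i)); exact: continuous_measurable_rV.
have bwwh i : bmfun ((fun u => w 0 i * (graph_weight u * h' i u)) : rVB R n.+1 -> R).
  by apply: bmfunM; [exact: bmfunC|exact: bwh].
pose S u := mu * (dotp (gr (y + mu *: u)) w + dotp (gr (y - mu *: u)) w).
have hsE : (fun u => h (l1unit u) * dotp (signv (l1unit u)) w) =
    fun u => \sum_(i < n.+1) w 0 i * (h (l1unit u) * signv (l1unit u) 0 i).
  by apply/funext => u; rewrite /dotp mulr_sumr; apply: eq_bigr => i _; ring.
have wSE : (fun u => graph_weight u * S u) = fun u => \sum_(i < n.+1) w 0 i * (graph_weight u * h' i u).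
  apply/funext => u; rewrite /S /dotp -big_split/= !mulr_sumr; apply: eq_bigr => i _.
  by rewrite /h'; ring.
have [bhs' e1] := mean_sum L bws; have [bwS e2] := mean_sum L bwwh.
rewrite -hsE in bhs' e1; rewrite -wSE in bwS e2.
have E1 : mean L (fun u => h (l1unit u) * dotp (signv (l1unit u)) w) = 2 * radial_const R n * mean L (fun u => graph_weight u * S u).
  rewrite e1 e2 mulr_sumr; apply: eq_bigr => i _.
  by rewrite (meanZ L _ (bhs i)) (meanZ L _ (bwh i)) St mulrCA.
pose c := f y - f v - eps.
pose W := mean L (@graph_weight R n.+1); pose Q := mean L (fun u => graph_weight u * lpnorm q u).
have bwq : bmfun ((fun u => graph_weight u * lpnorm q u) : rVB R n.+1 -> R).
  apply: (@bmfun_graph_weightM _ _ _ 1) => [|u u1]; first exact: measurable_lpnorm.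
  rewrite ger0_norm ?lpnorm_ge0//; apply: le_trans u1; rewrite -lpnorm1E; exact: lpnorm_mono.
(* The subgradient inequalities go from y + mu u to v + mu u and from y - mu u to v - mu u, both
   along -w. On the side of v the shift costs at most G mu |u|_q; on the side of y midpoint
   convexity makes it free. *)
have lower : 2 * mu * (c * W - G * mu * Q) <= mean L (fun u => graph_weight u * S u).
  have ba : bmfun ((fun u => c * graph_weight u) : rVB R n.+1 -> R) by apply: bmfunM; [exact: bmfunC|exact: bmfun_graph_weight].
  have bb : bmfun ((fun u => G * mu * (graph_weight u * lpnorm q u)) : rVB R n.+1 -> R).
    by apply: bmfunM; [exact: bmfunC|exact: bwq].
  rewrite /W /Q -(meanZ L c (bmfun_graph_weight _ _)) -(meanZ L (G * mu) bwq) -(meanB L ba bb) -(meanZ L _ (bmfunB ba bb)).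
  apply: mean_le; [by apply: bmfunM; [exact: bmfunC|exact: bmfunB ba bb]|exact: bwS|].
  move=> u; have [u1|u1] := leP (l1 u) 1; last by rewrite graph_weight_gt1// !(mul0r,mulr0) subr0 mulr0.
  have -> : 2 * mu * (c * graph_weight u - G * mu * (graph_weight u * lpnorm q u)) = graph_weight u * (mu * (2 * (c - G * mu * lpnorm q u))) by ring.
  rewrite ler_wpM2l ?graph_weight_ge0// /S ler_wpM2l ?(ltW mu0)//.
  have vNX : X (v - mu *: u) by rewrite -scalerN; apply: vvX; rewrite l1N.
  have Xv : X v by rewrite -(addr0 v) -(scaler0 _ mu); apply: vvX; rewrite l1_0.
  have s1 := sub (y + mu *: u) (v + mu *: u); have s2 := sub (y - mu *: u) (v - mu *: u).
  rewrite (_ : v + mu *: u - (y + mu *: u) = - w) in s1; last by rewrite /w; apply/rowP => j; rewrite !mxE; ring.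
  rewrite (_ : v - mu *: u - (y - mu *: u) = - w) in s2; last by rewrite /w; apply/rowP => j; rewrite !mxE; ring.
  rewrite dotpNr in s1; rewrite dotpNr in s2.
  have p1 := phile _ (vvX u1); have p2 := phile _ vNX.
  have p3 := phige _ (yX u1); have p4 := phige _ (yNX u1).
  have l1' := lf (vvX u1) Xv; have l2' := lf vNX Xv.
  rewrite [v + _ - v]addrC addKr lpnormZ// (gtr0_norm mu0) mulrA in l1'.
  rewrite [v - _ - v]addrC addKr lpnormN// lpnormZ// (gtr0_norm mu0) mulrA in l2'.
  move: l1' l2' => /(le_trans (ler_norm _)) l1' /(le_trans (ler_norm _)) l2'.
  have half0 : 0 <= (2^-1 : R) by rewrite invr_ge0.
  have half1 : (2^-1 : R) <= 1 by rewrite invf_le1// ler1n.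
  have cv := vf (yX u1) (yNX u1) half0 half1.
  have yE : y + mu *: u + 2^-1 *: (y - mu *: u - (y + mu *: u)) = y.
    by apply/rowP => j; rewrite !mxE; field.
  rewrite yE in cv; rewrite /c; move: cv s1 s2 p1 p2 p3 p4 l1' l2'.
  move: (f (y + _)) (f (y - _)) (f (v + _)) (f (v - _)) (phi (y + _)) (phi (y - _)) (phi (v + _)) (phi (v - _)) => *.
  lra.
(* The differences of f and of its envelope deviate by at most eps, and the sign vector pairs with w
   to at most |w|_1. *)
have est : n.+1%:R / (2 * mu) * mean L (fun u => h (l1unit u) * dotp (signv (l1unit u)) w) <=
    mean L (fun u => dotp (grad_estimate mu f y (l1unit u)) w) + n.+1%:R / (2 * mu) * eps * l1 w.
  rewrite -(meanZ L _ bhs') -[X in _ + X](meanC L) -(meanD L best (bmfunC _ _)).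
  apply: mean_le; [by apply: bmfunM; [exact: bmfunC|exact: bhs']|by apply: bmfunD; [exact: best|exact: bmfunC]|].
  move=> u; rewrite /grad_estimate dotpZl.
  have kk : 0 <= n.+1%:R / (2 * mu) by rewrite divr_ge0// mulr_ge0// ltW.
  move: (n.+1%:R / (2 * mu)) kk => k kk.
  rewrite -[X in _ <= X + _]mulrA -[X in _ <= _ + X]mulrA -mulrDr (ler_wpM2l kk)//.
  have sl : `|dotp (signv (l1unit u)) w| <= l1 w.
    apply: le_trans (ler_norm_sum _ _ _) _.
    by apply: ler_sum => i _; rewrite normrM signv1 mul1r.
  have p1 := phile _ (yX (l1_l1unit_le u)); have p2 := phile _ (yNX (l1_l1unit_le u)).
  have p3 := phige _ (yX (l1_l1unit_le u)); have p4 := phige _ (yNX (l1_l1unit_le u)).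
  rewrite -lerBlDl -mulrBl; apply: le_trans (ler_norm _) _; rewrite normrM ler_pM// /h.
  move: p1 p2 p3 p4; move: (f _) (f _) (phi _) (phi _) => *.
  by rewrite ler_norml; apply/andP; split; lra.
(* This normalization turns volume integrals into averages, so that f(y) - f(v) appears with
   coefficient 1. *)
have nW := radial_const_graph_weight R n; rewrite -/W in nW.
have QW : Q <= W * (24 * zeta q n.+1) by exact: mean_graph_weight_lpnorm.
have r0 : 0 < radial_const R n by have [] := radial_constP R n.
rewrite E1 in est.
have k0 : 0 <= n.+1%:R / (2 * mu) * (2 * radial_const R n).
  by rewrite mulr_ge0 ?divr_ge0 ?mulr_ge0// ltW.
rewrite mulrA in est; have low := le_trans (ler_wpM2l k0 lower) est.
have e3 : n.+1%:R / (2 * mu) * (2 * radial_const R n) * (2 * mu * (c * W - G * mu * Q)) =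
   c - G * mu * (2 * radial_const R n * n.+1%:R * Q).
  transitivity (c * (2 * radial_const R n * n.+1%:R * W) - G * mu * (2 * radial_const R n * n.+1%:R * Q)).
    by field; rewrite gt_eqF.
  by rewrite nW mulr1.
rewrite e3 in low.
have rd0 : 0 <= G * mu * (2 * radial_const R n * n.+1%:R).
  by rewrite !mulr_ge0// ltW.
have := ler_wpM2l rd0 QW.
have -> : G * mu * (2 * radial_const R n * n.+1%:R) * (W * (24 * zeta q n.+1)) = 24 * G * mu * zeta q n.+1.
  transitivity (24 * G * mu * zeta q n.+1 * (2 * radial_const R n * n.+1%:R * W)); first by ring.
  by rewrite nW mulr1.
rewrite -(mulrA (G * mu)) => QW'; rewrite /c in low; move: low QW'; rewrite mulrDr mulr1.
move: (G * mu * (_ * Q)) => z.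
have -> : eps * (n.+1%:R / (2 * mu) * l1 w) = n.+1%:R / (2 * mu) * eps * l1 w by ring.
move: (n.+1%:R / (2 * mu) * eps * l1 w) => z2; lra.
Qed.

Lemma mean_estimate_ge :
  bmfun ((fun u => dotp (grad_estimate mu f y (l1unit u)) (y - v)) : rVB R n.+1 -> R) /\
  f y - f v - 24 * G * mu * zeta q n.+1 <=
  mean L (fun u => dotp (grad_estimate mu f y (l1unit u)) (y - v)).
Proof.
split; first exact: best.
have c0 : 0 < 1 + n.+1%:R / (2 * mu) * l1 w.
  by rewrite ltr_pwDl// mulr_ge0 ?l1_ge0// divr_ge0// mulr_ge0// ltW.
apply/ler_addgt0Pr => e e0; have := approx (divr_gt0 e0 c0).
by rewrite divfK ?gt_eqF.
Qed.

End Estimator.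

(** * Mirror descent and exponential weights *)

Section Mirror.
Variables (R : realType) (d : nat) (D Xa : set 'rV[R]_d) (psi : 'rV[R]_d -> R).
Variables (p : \bar R) (lambda : R).
Hypotheses (p1 : (1 <= p)%E) (lambda0 : 0 < lambda).
Hypothesis XaD : Xa `<=` D.
Hypotheses (cXa : compact Xa) (Xa0 : Xa !=set0).
Hypothesis vXa : forall x y t, Xa x -> Xa y -> 0 <= t -> t <= 1 -> Xa (x + t *: (y - x)).
Hypothesis dpsi : forall x, D x -> differentiable psi x.
Hypothesis sc : strongly_convex_on p lambda D psi.

Lemma derive_grad x h : D x -> 'D_h psi x = dotp (grad psi x) h.
Proof.
move=> Dx; have dx := dpsi Dx.
rewrite deriveE// {1}(row_sum_delta h) raddf_sum /dotp; apply: eq_bigr => i _.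
by rewrite /= linearZ/= mxE deriveE// mulrC.
Qed.

Lemma cvg_dir_derive x h : D x ->
  t^-1 * (psi (x + t *: h) - psi x) @[t --> (0 : R)^'+] --> dotp (grad psi x) h.
Proof.
move=> Dx; rewrite -derive_grad//; apply: cvg_dnbhs_at_right.
have := @diff_derivable _ _ _ psi x h (dpsi Dx).
rewrite /derivable /derive => H.
rewrite (_ : (fun t : R => _) = fun t : R => t^-1 *: ((psi \o shift x) (t *: h) - psi x)); first exact: H.
by apply/funext => t /=; rewrite [x + _]addrC.
Qed.

Lemma bregman_ge0 x y : D x -> D y -> 0 <= bregman psi x y.
Proof.
move=> Dx Dy; apply: le_trans (sc Dx Dy); rewrite mulr_ge0 ?sqr_ge0//.
by rewrite divr_ge0// ltW.
Qed.

Lemma psi_continuous x : D x -> {for x, continuous psi}.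
Proof. by move=> Dx; apply: differentiable_continuous; exact: dpsi. Qed.

Lemma continuous_bregman y x : D x -> {for x, continuous (fun z => bregman psi z y)}.
Proof.
move=> Dx; rewrite /bregman; have c2 : continuous (fun z : 'rV[R]_d => dotp (grad psi y) (z - y)).
  apply: (@continuous_dotp R d _ (fun=> grad psi y) (fun z : 'rV[R]_d => z - y)); first exact: cst_continuous.
  by move=> z; apply: continuousB => //; exact: cst_continuous.
have c1 : {for x, continuous (fun z => psi z - psi y)}.
  apply: (@cvgB R R^o 'rV[R]_d (nbhs x) _ psi (fun=> psi y) (psi x) (psi y)).
    exact: psi_continuous.
  exact: cvg_cst.
exact: (@cvgB R R^o 'rV[R]_d (nbhs x) _ _ _ _ _ c1 (c2 x)).
Qed.

Lemma argmin_exists (g y : 'rV[R]_d) (c : R) :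
  argmin Xa (fun z => dotp g z + c * bregman psi z y) !=set0.
Proof.
have [|m Xm hm] := @EVT_min_rV R d (fun z => dotp g z + c * bregman psi z y) Xa Xa0 cXa.
  apply: continuous_in_subspaceT => x /set_mem Xx.
  have c2 : continuous (fun z : 'rV[R]_d => dotp g z).
    apply: (@continuous_dotp R d _ (fun=> g) (fun z : 'rV[R]_d => z)); first exact: cst_continuous.
    by move=> z; exact: cvg_id.
  apply: (@cvgD R R^o 'rV[R]_d (nbhs x) _ (fun z => dotp g z) (fun z => c * bregman psi z y)); first exact: c2.
  apply: (@cvgM R 'rV[R]_d (nbhs x) _ (fun=> c) (fun z => bregman psi z y)); first exact: cvg_cst.
  by apply: continuous_bregman; exact: XaD.
exists m; split; first exact: set_mem.
by move=> z Xz; apply: hm; exact: mem_set.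
Qed.

(** Minimality is tested along the segment from y' to v, divided by the parameter t, and taken to
    the limit t -> 0+. Differentiability of [psi] suffices for the one-sided limit. *)
Lemma argmin_first_order (g y y' v : 'rV[R]_d) (c : R) :
  argmin Xa (fun z => dotp g z + c * bregman psi z y) y' -> Xa v ->
  0 <= dotp g (v - y') + c * dotp (grad psi y' - grad psi y) (v - y').
Proof.
move=> [Xy' hm] Xv; have Dy' := XaD Xy'.
have hX (t : R) : 0 <= t -> t <= 1 -> Xa (y' + t *: (v - y')) by exact: vXa.
move: hX; move: (v - y') => h hX.
have H : dotp g h + c * (t^-1 * (psi (y' + t *: h) - psi y') - dotp (grad psi y) h)
   @[t --> (0 : R)^'+] --> dotp g h + c * (dotp (grad psi y') h - dotp (grad psi y) h).
  apply: cvgD; first exact: cvg_cst.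
  apply: cvgM; first exact: cvg_cst.
  by apply: cvgB; [exact: cvg_dir_derive|exact: cvg_cst].
rewrite dotpBl; apply: (cvgr_to_ge H); near=> t.
have t0 : 0 < t by near: t; exact: nbhs_right_gt.
have t1 : t <= 1 by apply: ltW; near: t; exact: nbhs_right_lt.
have := hm _ (hX t (ltW t0) t1).
rewrite /bregman (addrAC y' (t *: h)) !dotpDr !dotpZr -(@ler_pM2l _ t^-1) ?invr_gt0// => hle.
rewrite -subr_ge0 in hle; apply: le_trans hle _; rewrite le_eqVlt; apply/orP; left; apply/eqP.
by move: (psi _) (psi _) (psi _) => *; field; rewrite gt_eqF.
Unshelve. all: by end_near. Qed.

Lemma three_point a b v : bregman psi v a - bregman psi v b - bregman psi b a =
  dotp (grad psi b - grad psi a) (v - b).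
Proof. by rewrite /bregman dotpBl !dotpBr; ring. Qed.

(** First-order optimality and the three-point identity leave <g, y - y'>, which Hoelder's
    inequality and strong convexity absorb by completing the square (eta a - lambda b)^2, where a
    and b are the norms of g and y' - y. *)
Lemma mirror_step (g y y' v : 'rV[R]_d) (eta : R) : 0 < eta -> Xa y -> Xa v ->
  argmin Xa (fun z => dotp g z + eta^-1 * bregman psi z y) y' ->
  dotp g (y - v) <= eta^-1 * (bregman psi v y - bregman psi v y')
    + eta / (2 * lambda) * lpnorm (hoelder_conjugate p) g ^+ 2.
Proof.
move=> eta0 Xy Xv am; have [Xy' _] := am.
have fo := argmin_first_order am Xv; rewrite -three_point in fo.
have hs := sc (XaD Xy') (XaD Xy).
have hh : dotp g (y - y') <= lpnorm (hoelder_conjugate p) g * lpnorm p (y' - y).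
  apply: le_trans (ler_norm _) _; rewrite -(opprB y y') lpnormN//; exact: hoelder.
have e1 : dotp g (y - v) = dotp g (y - y') - dotp g (v - y').
  by rewrite -dotpBr; congr dotp; rewrite opprB addrA subrK.
rewrite e1; move: fo hs hh.
move: (lpnorm _ g) (lpnorm p _) (bregman _ v y) (bregman _ v y') (bregman _ y' y) => a b B1 B2 B3.
move: (dotp _ _) (dotp _ _) => x1 x2 fo hs hh.
have ei : 0 < eta^-1 by rewrite invr_gt0.
have sq : a * b <= eta / (2 * lambda) * a ^+ 2 + eta^-1 * (lambda / 2 * b ^+ 2).
  rewrite -subr_ge0 (_ : _ - _ = (eta * a - lambda * b) ^+ 2 / (2 * lambda * eta)).
    by rewrite divr_ge0 ?sqr_ge0// !mulr_ge0// ltW.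
  by field; rewrite !gt_eqF.
have := ler_wpM2l (ltW ei) hs; lra.
Qed.

End Mirror.

(** * Exponential weights *)

Section Experts.
Variable R : realType.

(** The bound holds on the whole line, and its linear part averages to 0 over centred losses. For x
    <= 1/2 it follows from exp x <= 1 / (1 - x) <= 1 + x + 2 x^2, beyond from x <= 2 x^2. *)
Lemma expR_le_quad (x : R) : expR x <= x + expR (2 * x ^+ 2).
Proof.
have [x2|x2] := leP x 2^-1; last first.
  apply: (@le_trans _ _ (expR (2 * x ^+ 2))); last by lra.
  by rewrite ler_expR; nra.
have h1 : expR x <= (1 - x)^-1.
  rewrite -[x]opprK expRN opprK lef_pV2 ?posrE ?expR_gt0//; last by lra.
  exact: expR_ge1Dx.
have h2 := @expR_ge1Dx R (2 * x ^+ 2).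
apply: le_trans h1 _; apply: (@le_trans _ _ (x + (1 + 2 * x ^+ 2))); last by rewrite lerD2l.
rewrite -[leLHS]mul1r ler_pdivrMr; last by lra.
rewrite -subr_ge0 (_ : _ - _ = x ^+ 2 * (1 - 2 * x)); last by ring.
by rewrite mulr_ge0 ?sqr_ge0//; lra.
Qed.

(** The losses are centred because the point of the algorithm is the weighted mean of its experts;
    so only the quadratic part enters the normalizing sum. *)
Lemma expert_step (N : nat) (w l : 'I_N -> R) (gamma b : R) (k : 'I_N) :
  (forall j, 0 < w j) -> \sum_(j < N) w j = 1 -> \sum_(j < N) w j * l j = 0 ->
  (forall j, `|l j| <= b) ->
  w k * expR (- (gamma * l k) - 2 * gamma ^+ 2 * b ^+ 2) <=
  w k * expR (- gamma * l k) / \sum_(j < N) (w j * expR (- gamma * l j)).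
Proof.
move=> w0 w1 wl lb; have b0 : 0 <= b by exact: le_trans (lb k).
have Z0 : 0 < \sum_(j < N) (w j * expR (- gamma * l j)).
  rewrite (bigD1 k)//= ltr_pwDl ?mulr_gt0 ?expR_gt0//.
  by apply: sumr_ge0 => j _; rewrite mulr_ge0 ?expR_ge0// ltW.
have Zle : \sum_(j < N) (w j * expR (- gamma * l j)) <= expR (2 * gamma ^+ 2 * b ^+ 2).
  apply: (@le_trans _ _ (\sum_(j < N) (- gamma * (w j * l j) + w j * expR (2 * gamma ^+ 2 * b ^+ 2)))).
    apply: ler_sum => j _; have := ler_wpM2l (ltW (w0 j)) (expR_le_quad (- gamma * l j)).
    rewrite mulrDr => /le_trans; apply; rewrite mulrCA lerD2l ler_wpM2l ?(ltW (w0 j))// ler_expR.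
    rewrite exprMn sqrrN mulrA (ler_wpM2l (mulr_ge0 (ler0n _ 2) (sqr_ge0 gamma)))//.
    by rewrite -real_normK ?num_real// lerXn2r ?nnegrE.
  by rewrite big_split/= -mulr_sumr -mulr_suml wl w1 mulr0 add0r mul1r.
rewrite mulNr expRD mulrA ler_wpM2l ?mulr_ge0 ?expR_ge0 ?(ltW (w0 k))//.
by rewrite expRN lef_pV2 ?posrE ?expR_gt0// -mulNr.
Qed.

End Experts.

Section ConvexCombination.
Variables (R : realType) (V : lmodType R) (X : set V).
Hypothesis vX : forall x y t, X x -> X y -> 0 <= t -> t <= 1 -> X (x + t *: (y - x)).

(** Unnormalized weights suit the induction. The module is arbitrary because the lemma serves both
    for iterates and for the epigraph of a convex function. *)
Lemma convex_comb n (w : 'I_n.+1 -> R) (y : 'I_n.+1 -> V) :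
  (forall k, 0 < w k) -> (forall k, X (y k)) ->
  X ((\sum_(k < n.+1) w k)^-1 *: \sum_(k < n.+1) w k *: y k).
Proof.
elim: n w y => [|n IH] w y w0 Xy.
  by rewrite !big_ord1 scalerA mulVf ?scale1r// gt_eqF.
rewrite [X in X^-1]big_ord_recr [X in _ *: X]big_ord_recr/=.
set S := \sum_(k < n.+1) _; set U := \sum_(k < n.+1) _ *: _; set a := w ord_max; set z := y ord_max.
have S0 : 0 < S.
  rewrite /S big_ord_recr/= ltr_wpDl//; apply: sumr_ge0 => i _; exact: ltW.
have a0 : 0 < a by exact: w0.
have XU : X (S^-1 *: U) by apply: IH.
have := vX (t := a / (S + a)) XU (Xy ord_max).
rewrite divr_ge0 ?addr_ge0 ?(ltW S0) ?(ltW a0)// ler_pdivrMr ?addr_gt0// mul1r lerDr (ltW S0).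
move=> /(_ isT isT); rewrite -/z; congr X.
rewrite scalerBr addrCA addrC scalerA -scalerBl scalerDr scalerA; congr (_ *: _ + _ *: _).
  by field; rewrite !gt_eqF// addr_gt0.
by rewrite mulrC.
Qed.

End ConvexCombination.

(** * Regret of the algorithm for each outcome of the directions *)

Section Pbmd.
Variables (R : realType) (d N' : nat) (D Xa : set 'rV[R]_d) (psi : 'rV[R]_d -> R).
Variables (p : \bar R) (lambda mu gamma rho : R) (y1 : 'rV[R]_d).
Let N := N'.+1.
Variables (eta : 'I_N -> R) (f : nat -> 'rV[R]_d -> R) (s : nat -> 'rV[R]_d).
Hypotheses (p1 : (1 <= p)%E) (lambda0 : 0 < lambda) (gamma0 : 0 < gamma).
Hypothesis eta0 : forall k, 0 < eta k.
Hypothesis XaD : Xa `<=` D.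
Hypotheses (cXa : compact Xa) (Xy1 : Xa y1).
Hypothesis vXa : forall x y t, Xa x -> Xa y -> 0 <= t -> t <= 1 -> Xa (x + t *: (y - x)).
Hypothesis dpsi : forall x, D x -> differentiable psi x.
Hypothesis sc : strongly_convex_on p lambda D psi.
Hypothesis Xrho : forall x, Xa x -> lpnorm p x <= rho.

Let Xa0 : Xa !=set0. Proof. by exists y1. Qed.

Let st := pbmd mu gamma eta psi Xa y1 f s.
Let y t := pbmd_point (st t).
Let g t := grad_estimate mu (f t) (y t) (s t).
Local Notation dual := (lpnorm (hoelder_conjugate p)).

(** A minimizer exists at every step, so the default value of [xget] never enters. *)
Lemma pbmd_argmin t k : argmin Xa (fun z => dotp (g t) z + (eta k)^-1 * bregman psi z ((st t).2 k))
  ((st t.+1).2 k).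
Proof.
rewrite [(st t.+1).2 k]/=; apply: xgetPex; exact: (argmin_exists XaD cXa Xa0 dpsi).
Qed.

Lemma pbmd_mem t k : Xa ((st t).2 k).
Proof. by case: t => [|t]//; have [] := pbmd_argmin t k. Qed.

Lemma init_weight_sum : \sum_(k < N) (pbmd_init N y1).1 k = 1 :> R.
Proof.
rewrite /pbmd_init/= -mulr_sumr.
(* A telescoping sum. *)
have -> : \sum_(k < N) 1 / (k.+1%:R * k.+2%:R) = N%:R / (N%:R + 1) :> R.
  rewrite /N; elim: N'.+1 => [|m IH]; first by rewrite big_ord0 mul0r.
  rewrite big_ord_recr/= IH -!natr1; have m0 : 0 <= m%:R :> R by [].
  by field; rewrite !gt_eqF//; lra.
have n0 : 0 < N%:R :> R by rewrite ltr0n.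
by field; rewrite !gt_eqF//; lra.
Qed.

Lemma pbmd_weights t : (forall k, 0 < (st t).1 k) /\ \sum_(k < N) (st t).1 k = 1.
Proof.
elim: t => [|t [IH1 IH2]].
  split; last exact: init_weight_sum.
  by move=> k; rewrite mulr_gt0 ?divr_gt0 ?mulr_gt0// ?ltr0n// ltr_wpDl.
have Z0 : 0 < \sum_(j < N) ((st t).1 j * expR (- gamma * dotp (g t) ((st t).2 j - y t))).
  rewrite (bigD1 ord0)//= ltr_pwDl ?mulr_gt0 ?expR_gt0//.
  by apply: sumr_ge0 => j _; rewrite mulr_ge0 ?expR_ge0// ltW.
split=> [k|]; first by rewrite [(st _).1 k]/= divr_gt0// mulr_gt0 ?expR_gt0.
by rewrite [LHS]/= -mulr_suml divff// gt_eqF.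
Qed.

Lemma pbmd_point_mem t : Xa (y t).
Proof.
have [w0 w1] := pbmd_weights t.
have := convex_comb vXa w0 (pbmd_mem t).
by rewrite w1 invr1 scale1r.
Qed.

(* The normalizing sums are bounded without a restriction on [gamma], at the
   price of the factor 2 in [expR_le_quad]. *)
Lemma pbmd_weight_ge T k : (st 0).1 k * expR (- gamma * (\sum_(0 <= t < T) dotp (g t) ((st t).2 k - y t))
   - 2 * gamma ^+ 2 * ((4 * rho) ^+ 2 * \sum_(0 <= t < T) dual (g t) ^+ 2)) <= (st T).1 k.
Proof.
elim: T => [|T IH]; first by rewrite !big_nil !mulr0 subr0 expR0 mulr1.
have [w0 w1] := pbmd_weights T.
have wl : \sum_(j < N) (st T).1 j * dotp (g T) ((st T).2 j - y T) = 0.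
  transitivity (dotp (g T) (\sum_(j < N) (st T).1 j *: ((st T).2 j - y T))).
    rewrite /dotp; under [RHS]eq_bigr do rewrite summxE mulr_sumr.
    rewrite exchange_big/=; apply: eq_bigr => j _; rewrite mulr_sumr.
    by apply: eq_bigr => i _; rewrite !mxE; ring.
  under eq_bigr do rewrite scalerBr.
  rewrite sumrB -scaler_suml w1 scale1r /y /pbmd_point subrr.
  by rewrite -(scale0r (0 : 'rV[R]_d)) dotpZr mul0r.
have lb j : `|dotp (g T) ((st T).2 j - y T)| <= dual (g T) * (4 * rho).
  apply: le_trans (hoelder _ _ p1) _; rewrite ler_wpM2l ?lpnorm_ge0//.
  by apply: lpnormB_le => //; apply: Xrho; [exact: pbmd_mem|exact: pbmd_point_mem].
have := expert_step gamma k w0 w1 wl lb; rewrite [(st T.+1).1 k]/=.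
apply: le_trans; move: IH; move: ((st 0).1 k) => w00 IH.
apply: le_trans (ler_wpM2r (expR_ge0 _) IH).
rewrite -[leRHS]mulrA -[X in _ <= _ * X]expRD !(@big_nat_recr _ _ _ T 0)// le_eqVlt.
move: (\sum_(_ <= t < T) _) (\sum_(_ <= t < T) _) => S1 S2; apply/orP; left; apply/eqP; congr (_ * expR _).
by move: (dotp _ _) (dual (g T)) => l b /=; ring.
Qed.

(** The logarithmic cost of an expert is bounded crudely by 2 2^k. This growth is the right one: the
    index k is chosen with 2^k at most the square root of B / A, so that the cost divided by gamma
    fits into the final bound. *)
Lemma init_weight_exp (k : 'I_N) : expR (- (2 * 2 ^+ k)) <= (st 0).1 k.
Proof.
have n0 : 0 < N%:R :> R by rewrite ltr0n.
apply: (@le_trans _ _ (1 / (k.+1%:R * k.+2%:R))); last first.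
  by rewrite ler_peMl ?divr_ge0 ?mulr_ge0// ler_pdivlMr// mul1r lerDl.
have e1 : k.+2%:R <= expR (2 ^+ k) :> R.
  apply: le_trans (expR_ge1Dx _); rewrite -natr1 addrC lerD2l.
  by rewrite -natrX ler_nat ltn_expl.
have e2 : k.+1%:R <= expR (2 ^+ k) :> R by apply: le_trans e1; rewrite ler_nat.
rewrite expRN div1r lef_pV2 ?posrE ?mulr_gt0 ?expR_gt0 ?ltr0n//.
have -> : 2 * 2 ^+ k = 2 ^+ k + 2 ^+ k :> R by ring.
by rewrite expRD ler_pM.
Qed.

(** Comparison of the lower bound for the weight of expert k with its trivial upper bound 1. The
    constant is 32 = 2 4^2, with 4 rho bounding distances in the domain. *)
Lemma expert_regret T k : \sum_(0 <= t < T) dotp (g t) (y t - (st t).2 k) <=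
  2 * 2 ^+ k / gamma + 32 * gamma * rho ^+ 2 * \sum_(0 <= t < T) dual (g t) ^+ 2.
Proof.
have h1 := pbmd_weight_ge T k.
have [w0 w1] := pbmd_weights T.
have h2 : (st T).1 k <= 1.
  rewrite -w1 (bigD1 k)//= lerDl; apply: sumr_ge0 => j _; exact: ltW.
have h3 := le_trans (ler_wpM2r (expR_ge0 _) (init_weight_exp k)) (le_trans h1 h2).
have -> : \sum_(0 <= t < T) dotp (g t) (y t - (st t).2 k) = - \sum_(0 <= t < T) dotp (g t) ((st t).2 k - y t).
  by rewrite -sumrN; apply: eq_bigr => t _; rewrite -dotpNr opprB.
rewrite -expRD -[leRHS]expR0 ler_expR in h3; move: h3.
move: (\sum_(0 <= t < T) dotp _ _) (\sum_(0 <= t < T) _ ^+ 2) => S1 S2 h3.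
rewrite -(ler_pM2l gamma0).
have -> : gamma * (2 * 2 ^+ k / gamma + 32 * gamma * rho ^+ 2 * S2) = 2 * 2 ^+ k + 2 * gamma ^+ 2 * ((4 * rho) ^+ 2 * S2).
  by move: (2 ^+ k) => z; field; rewrite gt_eqF.
lra.
Qed.

Variables (v : nat -> 'rV[R]_d) (Gm Fm Sm : R).
Hypothesis gradle : forall x, Xa x -> dual (grad psi x) <= Gm.
Hypothesis Fle : forall x z, Xa x -> Xa z -> psi x - psi z <= Fm.
Hypothesis Sle : forall x, Xa x -> bregman psi x y1 <= Sm.

Lemma drift_sum T k : (forall t, (t <= T)%N -> Xa (v t)) ->
  \sum_(0 <= t < T.+1) (bregman psi (v t) ((st t).2 k) - bregman psi (v t) ((st t.+1).2 k)) <=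
  bregman psi (v 0) y1 + (psi (v T) - psi (v 0)) + Gm * (\sum_(0 <= t < T) lpnorm p (v t.+1 - v t))
  - bregman psi (v T) ((st T.+1).2 k).
Proof.
elim: T => [|T IH] Xv.
  by rewrite big_nat1 big_nil subrr mulr0 !addr0.
rewrite big_nat_recr//= [X in Gm * X]big_nat_recr//=.
have := IH (fun t h => Xv t (leqW h)).
set z := (st T.+1).2 k; have Xz : Xa z by exact: pbmd_mem.
have : - dotp (grad psi z) (v T.+1 - v T) <= Gm * lpnorm p (v T.+1 - v T).
  apply: le_trans (ler_norm _) _; rewrite normrN; apply: le_trans (hoelder _ _ p1) _.
  by rewrite ler_wpM2r ?lpnorm_ge0// gradle.
have -> : dotp (grad psi z) (v T.+1 - v T) = dotp (grad psi z) (v T.+1 - z) - dotp (grad psi z) (v T - z).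
  by rewrite -dotpBr; congr dotp; rewrite opprB addrA subrK.
rewrite [bregman psi (v T) z]/bregman [bregman psi (v T.+1) z]/bregman mulrDr.
move: (\sum_(0 <= t < T.+1) _) (bregman _ _ _) (bregman _ _ _) (Gm * _) (Gm * _) => a b c e h.
move: (dotp _ _) (dotp _ _) (psi _) (psi _) (psi _) (psi _) => *; lra.
Qed.

Lemma mirror_regret T k : (0 < T)%N -> (forall t, (t < T)%N -> Xa (v t)) ->
  \sum_(0 <= t < T) dotp (g t) ((st t).2 k - v t) <=
  (Sm + Fm + Gm * (\sum_(0 <= t < T.-1) lpnorm p (v t.+1 - v t))) / eta k
  + eta k / (2 * lambda) * \sum_(0 <= t < T) dual (g t) ^+ 2.
Proof.
case: T => // T _ Xv.
apply: (@le_trans _ _ (\sum_(0 <= t < T.+1) ((eta k)^-1 * (bregman psi (v t) ((st t).2 k) - bregman psi (v t) ((st t.+1).2 k))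
    + eta k / (2 * lambda) * dual (g t) ^+ 2))).
  rewrite big_nat_cond [leRHS]big_nat_cond; apply: ler_sum => t /andP[/andP[_ tT] _].
  exact: (mirror_step p1 lambda0 XaD vXa dpsi sc (eta0 k) (pbmd_mem t k) (Xv t tT) (pbmd_argmin t k)).
rewrite big_split/= -!mulr_sumr lerD2r mulrC ler_pM2r ?invr_gt0//.
apply: le_trans (drift_sum k Xv) _.
have h1 := Sle (Xv 0 (ltn0Sn _)); have h2 := Fle (Xv T (ltnSn _)) (Xv 0 (ltn0Sn _)).
have h3 := bregman_ge0 lambda0 sc (XaD (Xv T (ltnSn _))) (XaD (pbmd_mem T.+1 k)).
lra.
Qed.

Lemma pbmd_linear_regret T k : (0 < T)%N -> (forall t, (t < T)%N -> Xa (v t)) ->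
  \sum_(0 <= t < T) dotp (g t) (y t - v t) <=
  (Sm + Fm + Gm * (\sum_(0 <= t < T.-1) lpnorm p (v t.+1 - v t))) / eta k + 2 * 2 ^+ k / gamma
  + \sum_(0 <= t < T) (eta k / (2 * lambda) + 32 * gamma * rho ^+ 2) * dual (g t) ^+ 2.
Proof.
move=> T0 Xv; have h1 := mirror_regret k T0 Xv; have h2 := expert_regret T k.
have -> : \sum_(0 <= t < T) dotp (g t) (y t - v t) =
    \sum_(0 <= t < T) dotp (g t) (y t - (st t).2 k) + \sum_(0 <= t < T) dotp (g t) ((st t).2 k - v t).
  by rewrite -big_split/=; apply: eq_bigr => t _; rewrite -dotpDr; congr dotp; rewrite addrA subrK.
rewrite -mulr_sumr mulrDl; lra.
Qed.

End Pbmd.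

(** * Convexity and the potential *)

Section ConvexFunctions.
Variables (R : realType) (d : nat).

Lemma convE (V : lmodType R) (x y : V) (t : R) (t0 : 0 <= t) (t1 : t <= 1) :
  conv (Itv01 t0 t1 : {i01 R}) (x : convex_lmodType V) y = t *: x + (1 - t) *: y.
Proof. by []. Qed.

Lemma convex_set_segment (V : lmodType R) (X : set V) : convex_set X ->
  forall x y t, X x -> X y -> 0 <= t -> t <= 1 -> X (x + t *: (y - x)).
Proof.
move=> vX x y t Xx Xy t0 t1; have := vX y x (Itv01 t0 t1) (mem_set Xy) (mem_set Xx).
by rewrite convE => /set_mem; congr X; rewrite scalerBr scalerBl scale1r addrCA addrC.
Qed.

Lemma convex_function_segment (f : 'rV[R]_d -> R) : convex_function setT f ->
  forall x y t, 0 <= t -> t <= 1 -> f (x + t *: (y - x)) <= f x + t * (f y - f x).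
Proof.
move=> vf x y t t0 t1; have := vf (Itv01 t0 t1) y x (mem_set I) (mem_set I).
rewrite convE [X in _ <= X]convE => h.
rewrite (_ : x + t *: (y - x) = t *: y + (1 - t) *: x); last first.
  by rewrite scalerBr scalerBl scale1r addrCA addrC.
apply: le_trans h _; rewrite /GRing.scale/= le_eqVlt; apply/orP; left; apply/eqP; ring.
Qed.

Lemma cvg_lipschitz_at (T : topologicalType) (g c : T -> R) (x : T) (delta M : R) :
  c z @[z --> x] --> (0 : R) -> 0 < delta -> 0 <= M ->
  (forall z, c z <= delta -> `|g z - g x| <= c z * M) -> g z @[z --> x] --> g x.
Proof.
move=> cl delta0 M0 lip; have M1 : 0 < M + 1 by rewrite ltr_wpDl.
apply/cvgrPdist_le => eps eps0; near=> z.
have z1 : c z <= delta by apply: ltW; near: z; exact: (cvgr_lt _ cl).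
rewrite distrC; apply: le_trans (lip _ z1) _.
apply: (@le_trans _ _ (eps / (M + 1) * M)).
  rewrite ler_wpM2r//; apply: ltW; near: z; apply: (cvgr_lt _ cl).
  by rewrite divr_gt0.
rewrite -mulrA ler_piMr ?(ltW eps0)// mulrC ler_pdivrMr// mul1r lerDl//.
Unshelve. all: by end_near. Qed.

(** The values at the 2 d points x + e_i and x - e_i bound f along the axes; averaging over the axes
    extends the upper bound to an l1-ball, and reflection in x turns it into a Lipschitz bound at
    x. *)
Lemma convex_continuous (f : 'rV[R]_d -> R) : convex_function setT f -> continuous f.
Proof.
move=> cf; have vf := convex_function_segment cf; move=> x.
case: d f cf vf x => [|n] f cf vf x.
  have -> : f = fun=> f 0 by apply/funext => z; congr f; apply/rowP => -[].
  exact: cst_continuous.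
pose e (i : 'I_n.+1) : 'rV[R]_n.+1 := delta_mx 0 i.
pose M := \sum_(i < n.+1) (`|f (x + e i) - f x| + `|f (x - e i) - f x|).
have M0 : 0 <= M by apply: sumr_ge0 => i _; rewrite addr_ge0.
have one i (t : R) : `|t| <= 1 -> f (x + t *: e i) - f x <= `|t| * M.
  move=> t1; have [t0|t0] := leP 0 t.
    have := vf x (x + e i) t t0; rewrite [x + e i - x]addrC addKr => /(_ (le_trans (ler_norm _) t1)).
    rewrite ger0_norm// -lerBlDl => h; apply: le_trans h _; rewrite ler_wpM2l//.
    apply: le_trans (ler_norm _) _; rewrite /M (bigD1 i)//= -addrA lerDl addr_ge0//.
    by apply: sumr_ge0 => j _; rewrite addr_ge0.
  rewrite ltr0_norm// in t1 *; have t0' : 0 <= - t by rewrite oppr_ge0 ltW.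
  have := vf x (x - e i) (- t) t0' t1; rewrite [x - e i - x]addrC addKr scalerN scaleNr opprK.
  rewrite -lerBlDl => h; apply: le_trans h _; rewrite ler_wpM2l//.
  apply: le_trans (ler_norm _) _; rewrite /M (bigD1 i)//= (addrC `|f (x + e i) - f x|) -addrA lerDl addr_ge0//.
  by apply: sumr_ge0 => j _; rewrite addr_ge0.
(* Jensen's inequality for finitely many points, as convexity of the epigraph. *)
pose E := [set z : ('rV[R]_n.+1 * R^o)%type | f z.1 <= z.2].
have vE : forall a b t, E a -> E b -> 0 <= t -> t <= 1 -> E (a + t *: (b - a)).
  move=> [a1 a2] [b1 b2] t /= Ea Eb t0 t1; apply: le_trans (vf _ _ _ t0 t1) _.
  rewrite /E/= in Ea Eb *.
  have -> : a2 + t *: (b2 - a2) = (1 - t) * a2 + t * b2 by rewrite /GRing.scale/=; ring.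
  have -> : f a1 + t * (f b1 - f a1) = (1 - t) * f a1 + t * f b1 by ring.
  by rewrite lerD// ler_wpM2l// subr_ge0.
have n0 : 0 < n.+1%:R :> R by rewrite ltr0n.
have up h : l1 h <= n.+1%:R^-1 -> f (x + h) - f x <= l1 h * M.
  (* x + h is the average of the n + 1 points x + (n + 1) h_i e_i on the axes; the radius 1 / (n +
     1) keeps them within the bounded range. *)
  move=> hn; pose z i : ('rV[R]_n.+1 * R^o)%type := (x + (n.+1%:R * h 0 i) *: e i, f x + n.+1%:R * `|h 0 i| * M).
  have Ez i : E (z i).
    rewrite /E/= -lerBlDl; have := one i (n.+1%:R * h 0 i).
    rewrite normrM (ger0_norm (ltW n0)); apply.
    rewrite -ler_pdivlMl// mulr1; apply: le_trans hn; rewrite -lpnorm1E.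
    exact: coord_le_lpnorm.
  have := convex_comb vE (fun _ : 'I_n.+1 => ltr01) Ez.
  rewrite (_ : \sum_(k < n.+1) 1 *: z k = \sum_(k < n.+1) z k); last by apply: eq_bigr => i _; rewrite scale1r.
  rewrite sumr_const card_ord /E/=.
  have -> : (\sum_(k < n.+1) z k).1 = \sum_(k < n.+1) (x + (n.+1%:R * h 0 k) *: e k).
    by rewrite (big_morph fst (fun _ _ => erefl) erefl).
  have -> : (\sum_(k < n.+1) z k).2 = \sum_(k < n.+1) (f x + n.+1%:R * `|h 0 k| * M).
    by rewrite (big_morph snd (fun _ _ => erefl) erefl).
  rewrite !big_split/= !sumr_const card_ord -mulr_suml -mulr_sumr -/(l1 h).
  have -> : \sum_(i < n.+1) (n.+1%:R * h 0 i) *: e i = n.+1%:R *: h.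
    by rewrite [in RHS](row_sum_delta h) scaler_sumr; apply: eq_bigr => i _; rewrite scalerA.
  rewrite (_ : n.+1%:R^-1 *: (x *+ n.+1 + n.+1%:R *: h) = x + h); last first.
    rewrite -[x *+ _]scaler_nat; apply/rowP => j; rewrite !mxE.
    by rewrite -mulrDr mulrA mulVf ?mul1r// gt_eqF.
  rewrite /GRing.scale/= -mulr_natl => H; rewrite lerBlDl; apply: le_trans H _.
  by rewrite le_eqVlt; apply/orP; left; apply/eqP; field; rewrite gt_eqF.
(* x is the midpoint of x + h and x - h, so the upper bound at -h is a lower bound at h. *)
have lip h : l1 h <= n.+1%:R^-1 -> `|f (x + h) - f x| <= l1 h * M.
  move=> hn; rewrite ler_norml up// andbT; have := up (- h); rewrite l1N => /(_ hn) h1.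
  have half0 : 0 <= (2^-1 : R) by rewrite invr_ge0.
  have half1 : (2^-1 : R) <= 1 by rewrite invf_le1// ler1n.
  have := vf (x + h) (x - h) 2^-1 half0 half1.
  have -> : x + h + 2^-1 *: (x - h - (x + h)) = x by apply/rowP => j; rewrite !mxE; field.
  lra.
have cl : l1 (z - x) @[z --> x] --> (0 : R).
  have C : continuous (fun z : 'rV[R]_n.+1 => l1 (z - x)).
    move=> z; apply: (@continuous_comp _ _ _ (fun z : 'rV[R]_n.+1 => z - x) (@l1 R n.+1)); last exact: continuous_l1.
    by apply: continuousB => //; exact: cst_continuous.
  by have := C x; rewrite /continuous_at subrr l1_0.
apply: (cvg_lipschitz_at cl (delta := n.+1%:R^-1) (M := M)) => //.
by move=> z /lip; rewrite addrCA subrr addr0.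
Qed.

End ConvexFunctions.

(** * Shrunken copies of the domain *)

Section Geometry.
Variables (R : realType) (n : nat) (X : set 'rV[R]_n.+1) (p : \bar R) (r : R).
Hypotheses (cX : compact X) (p1 : (1 <= p)%E) (r0 : 0 < r).
Hypothesis vX : forall x y t, X x -> X y -> 0 <= t -> t <= 1 -> X (x + t *: (y - x)).
Hypothesis rX : scale_set r (@lp_ball R p n.+1) `<=` X.

Local Notation S c := (scale_set c X).

Lemma ball_mem (u : 'rV[R]_n.+1) : l1 u <= 1 -> X (r *: u).
Proof.
move=> u1; apply: rX; exists u => //; apply: le_trans u1.
by rewrite -lpnorm1E; exact: lpnorm_mono.
Qed.

Lemma scale1 : S 1 = X.
Proof.
apply/seteqP; split=> [_ [x Xx <-]|x Xx]; first by rewrite scale1r.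
by exists x => //; rewrite scale1r.
Qed.

(** Convexity gives c X + e r B_1 inside (c + e) X. With c = 1 - alpha it places the played points
    in X for e = alpha, and leaves room inside the interior for e = alpha / 2. *)
Lemma scale_thick (c e : R) y u : 0 <= c -> 0 <= e -> 0 < c + e -> S c y -> l1 u <= 1 ->
  S (c + e) (y + (e * r) *: u).
Proof.
move=> c0 e0 ce0 [x Xx <-] u1; exists (x + (e / (c + e)) *: (r *: u - x)).
  by apply: vX => //; [exact: ball_mem|rewrite divr_ge0// ltW|rewrite ler_pdivrMr// mul1r lerDr].
rewrite scalerDr scalerA mulrC divfK ?gt_eqF// scalerBr addrCA addrC -scalerA.
by congr (_ + _); rewrite -scalerBl addrK.
Qed.

Lemma scale_interior (b : R) : 0 < b -> b <= 1 -> S (1 - b) `<=` interior X.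
Proof.
move=> b0 b1 y Sy; have br : 0 < b * r by rewrite mulr_gt0.
have cl : l1 ((b * r)^-1 *: (z - y)) @[z --> y] --> (0 : R).
  have C : continuous (fun z : 'rV[R]_n.+1 => l1 ((b * r)^-1 *: (z - y))).
    move=> z; apply: (@continuous_comp _ _ _ (fun z : 'rV[R]_n.+1 => (b * r)^-1 *: (z - y)) (@l1 R n.+1)); last exact: continuous_l1.
    move: z; apply: continuous_scale; first exact: cst_continuous.
    by move=> z; apply: continuousB => //; exact: cst_continuous.
  by have := C y; rewrite /continuous_at subrr scaler0 l1_0.
rewrite /interior /=; near=> z.
have z1 : l1 ((b * r)^-1 *: (z - y)) <= 1.
  by apply: ltW; near: z; exact: (cvgr_lt _ cl).
have := @scale_thick (1 - b) b y _ _ (ltW b0) _ Sy z1.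
rewrite subr_ge0 subrK => /(_ b1 ltr01); rewrite scale1 scalerA mulfV ?gt_eqF// scale1r.
by rewrite addrC subrK.
Unshelve. all: by end_near. Qed.

Lemma scale_compact (c : R) : compact (S c).
Proof.
apply: continuous_compact => //; apply: continuous_subspaceT.
by apply: continuous_scale; [exact: cst_continuous|move=> z; exact: cvg_id].
Qed.

Lemma scale_convex (c : R) x y t : S c x -> S c y -> 0 <= t -> t <= 1 -> S c (x + t *: (y - x)).
Proof.
move=> [a Xa <-] [b Xb <-] t0 t1; exists (a + t *: (b - a)); first exact: vX.
by rewrite scalerDr scalerBr scalerBr !scalerBr !scalerA (mulrC c).
Qed.

End Geometry.

Section Potential.
Variables (R : realType) (n : nat) (X : set 'rV[R]_n.+1) (p : \bar R) (r lambda alpha : R).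
Variable (psi : 'rV[R]_n.+1 -> R).
Hypotheses (cX : compact X) (p1 : (1 <= p)%E) (r0 : 0 < r) (lambda0 : 0 < lambda).
Hypothesis vX : forall x y t, X x -> X y -> 0 <= t -> t <= 1 -> X (x + t *: (y - x)).
Hypothesis rX : scale_set r (@lp_ball R p n.+1) `<=` X.
Hypotheses (alpha0 : 0 < alpha) (alpha1 : alpha <= 1 / 2).
Hypothesis dpsi : forall x, interior X x -> differentiable psi x.
Hypothesis sc : strongly_convex_on p lambda (interior X) psi.

Local Notation S c := (scale_set c X).
Local Notation Xa := (S (1 - alpha)).
Local Notation Xb := (S (1 - alpha / 2)).
Local Notation dual := (lpnorm (hoelder_conjugate p)).

Lemma thick_mem y u : Xa y -> l1 u <= 1 -> X (y + (alpha * r) *: u).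
Proof.
move=> Xy u1; rewrite -(scale1 X) -[X in S X](subrK alpha).
have a1 : 0 <= 1 - alpha by move: alpha1; lra. have a2 : 0 < 1 - alpha + alpha by lra.
exact: (scale_thick p1 vX rX a1 (ltW alpha0) a2 Xy u1).
Qed.

Lemma half_mem y u : Xa y -> l1 u <= 1 -> Xb (y + (alpha / 2 * r) *: u).
Proof.
move=> Xy u1; rewrite (_ : 1 - alpha / 2 = (1 - alpha) + alpha / 2); last by field.
have a1 : 0 <= 1 - alpha by move: alpha1; lra.
have a2 : 0 < 1 - alpha + alpha / 2 by move: alpha0; lra.
have a3 : 0 <= alpha / 2 by move: alpha0; lra.
exact: (scale_thick p1 vX rX a1 a3 a2 Xy u1).
Qed.

Lemma Xa_int : Xa `<=` interior X.
Proof. by move=> y; apply: (scale_interior p1 r0 vX rX); move: alpha0 alpha1; lra. Qed.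

Lemma Xb_int : Xb `<=` interior X.
Proof. by move=> y; apply: (scale_interior p1 r0 vX rX); move: alpha0 alpha1; lra. Qed.

Lemma Xa_Xb y : Xa y -> Xb y.
Proof. by move=> Xy; have := half_mem Xy (u := 0); rewrite scaler0 addr0 l1_0; apply. Qed.

(** [Xb] is a compact buffer between [Xa] and the boundary of X, on which the continuous [psi] is
    bounded. From this it follows that the suprema in [F_psi], [G_psi] and of the divergence are
    genuine upper bounds. *)
Lemma psi_bounded : exists M : R, forall y, Xb y -> `|psi y| <= M.
Proof.
have c : {within Xb, continuous psi}.
  apply: continuous_in_subspaceT => x /set_mem Xx.
  by apply: (psi_continuous dpsi); exact: Xb_int.
have cb := continuous_compact c (@scale_compact R n X cX (1 - alpha / 2)).
have [M [_ HM]] := compact_bounded cb.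
exists (M + 1) => y Xy; apply: (HM (M + 1)); first by rewrite ltrDl.
by exists y.
Qed.

Lemma conjugate_ge1 : (1 <= hoelder_conjugate p)%E.
Proof.
move: p p1; apply: ge1_case => [a|]; last by rewrite /hoelder_conjugate eqxx.
rewrite le_eqVlt => /orP[/eqP <-|a1]; first by rewrite hoelder_conjugate1 leey.
have [b [-> [ab b0]]] := hoelder_conjugate_fin a1.
rewrite lee_fin -[leLHS]invr1 -[leRHS]invrK lef_pV2 ?posrE ?invr_gt0//.
by rewrite -ab lerDr invr_ge0; lra.
Qed.

(** A step of length h along plus or minus e_i stays in [Xb], and nonnegativity of the divergence
    gives h |g_i| <= 2 M for each component of the gradient. *)
Lemma grad_bounded : exists M : R, forall y, Xa y -> dual (grad psi y) <= M.
Proof.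
have [M HM] := psi_bounded; pose h := alpha / 2 * r.
have h0 : 0 < h by rewrite mulr_gt0// divr_gt0.
exists (\sum_(i < n.+1) (2 * M / h)) => y Xy.
apply: (@le_trans _ _ (l1 (grad psi y))).
  by rewrite -lpnorm1E; apply: lpnorm_mono => //; exact: conjugate_ge1.
apply: ler_sum => i _.
have one (e : R) : `|e| = 1 -> h * (e * grad psi y 0 i) <= 2 * M.
  move=> e1; have le1 : l1 (e *: delta_mx 0 i : 'rV[R]_n.+1) <= 1.
    rewrite l1Z e1 mul1r /l1 (bigD1 i)//= big1 ?addr0 => [|j ji].
      by rewrite mxE !eqxx normr1.
    by rewrite mxE (negbTE ji) andbF normr0.
  have Xz := half_mem Xy le1; rewrite -/h in Xz.
  have := bregman_ge0 lambda0 sc (Xb_int Xz) (Xa_int Xy).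
  rewrite /bregman [_ + _ - y]addrC addKr !dotpZr dotp_delta.
  have := HM _ Xz; have := HM _ (Xa_Xb Xy); rewrite !ler_norml.
  move=> /andP[a1 a2] /andP[b1 b2]; lra.
rewrite ler_pdivlMr// mulrC; have [g0|g0] := leP 0 (grad psi y 0 i).
  by rewrite ger0_norm//; have := one 1; rewrite normr1 mul1r; apply.
by rewrite ltr0_norm//; have := one (-1); rewrite normrN1 mulN1r; apply.
Qed.

Lemma G_psi_ge y : Xa y -> dual (grad psi y) <= G_psi p psi Xa.
Proof.
move=> Xy; apply: ub_le_sup; last by exists y.
by have [M HM] := grad_bounded; exists M => _ [z Xz <-]; exact: HM.
Qed.

Lemma F_psi_ge x z : Xa x -> Xa z -> psi x - psi z <= F_psi psi Xa.
Proof.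
have [M HM] := psi_bounded => Xx Xz; rewrite /F_psi lerB//.
  apply: ub_le_sup; last by exists x.
  by exists M => _ [w Xw <-]; apply: le_trans (ler_norm _) _; exact/HM/Xa_Xb.
apply: ge_inf; last by exists z.
exists (- M) => _ [w Xw <-]; rewrite lerNl; apply: le_trans (ler_norm _) _.
by rewrite normrN; exact/HM/Xa_Xb.
Qed.

Lemma sup_bregman_ge y1 x : Xa y1 -> Xa x ->
  bregman psi x y1 <= sup [set bregman psi v y1 | v in Xa].
Proof.
move=> Xy1 Xx; apply: ub_le_sup; last by exists x.
have [M HM] := psi_bounded.
have cb : compact ((fun v => dotp (grad psi y1) v) @` Xa).
  apply: continuous_compact; last exact: scale_compact.
  apply: continuous_subspaceT; apply: (@continuous_dotp R n.+1 _ (fun=> grad psi y1) (fun z : 'rV[R]_n.+1 => z)).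
    exact: cst_continuous.
  by move=> z; exact: cvg_id.
have [K [_ HK]] := compact_bounded cb.
have HK1 v : Xa v -> `|dotp (grad psi y1) v| <= K + 1.
  by move=> Xv; apply: (HK (K + 1)); [rewrite ltrDl|exists v].
exists (2 * M + 2 * (K + 1)) => _ [v Xv <-].
rewrite /bregman dotpBr.
have := HM _ (Xa_Xb Xv); have := HM _ (Xa_Xb Xy1); have := HK1 _ Xv; have := HK1 _ Xy1.
rewrite !ler_norml => /andP[a1 a2] /andP[b1 b2] /andP[c1 c2] /andP[e1 e2]; lra.
Qed.

End Potential.

(** * Measurability and independence *)

(** [psi] is known to be continuous on the interior only; extended by 0 it is Borel on the whole
    space. *)
Lemma measurable_fun_open (R : realType) n (D : set 'rV[R]_n) (psi : 'rV[R]_n -> R) : open D ->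
  (forall x, D x -> {for x, continuous psi}) -> measurable_fun setT (psi \_ D : rVB R n -> R).
Proof.
move=> oD cpsi; have mD : measurable (D : set (rVB R n)) by exact: sub_sigma_algebra.
apply/(measurable_restrictT (T1 := rVB R n) psi mD).
apply: (measurability _ (RGenOpens.measurableE R)).
move=> _ [U [a [b ->]] <-]; apply: sub_sigma_algebra.
rewrite openE => x [Dx Ux]; apply: filterI; first exact: open_nbhs_nbhs.
by apply: cpsi => //; apply: open_nbhs_nbhs; split=> //; exact: interval_open.
Qed.

Lemma argmin_affine (R : realType) d (X : set 'rV[R]_d) (F H : 'rV[R]_d -> R) (c b : R) :
  0 < c -> (forall z, F z = c * H z + b) -> argmin X F = argmin X H.
Proof.
move=> c0 FH; apply/seteqP; split=> y [Xy hy]; split=> // z Xz; have := hy z Xz; rewrite ?FH.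
  by rewrite lerD2r ler_pM2l.
by rewrite lerD2r ler_pM2l.
Qed.

Section MeasurableState.
Variables (R : realType) (n N' : nat) (X : set 'rV[R]_n.+1) (p : \bar R) (r lambda alpha mu gamma : R).
Variables (psi : 'rV[R]_n.+1 -> R) (y1 : 'rV[R]_n.+1).
Let N := N'.+1.
Variables (eta : 'I_N -> R) (f : nat -> 'rV[R]_n.+1 -> R).
Hypotheses (cX : compact X) (p1 : (1 <= p)%E) (r0 : 0 < r) (lambda0 : 0 < lambda).
Hypothesis vX : forall x y t, X x -> X y -> 0 <= t -> t <= 1 -> X (x + t *: (y - x)).
Hypothesis rX : scale_set r (@lp_ball R p n.+1) `<=` X.
Hypotheses (alpha0 : 0 < alpha) (alpha1 : alpha <= 1 / 2).
Hypothesis dpsi : forall x, interior X x -> differentiable psi x.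
Hypothesis sc : strongly_convex_on p lambda (interior X) psi.
Hypothesis eta0 : forall k, 0 < eta k.
Local Notation Xa := (scale_set (1 - alpha) X).
Hypothesis Xy1 : Xa y1.

Let XaD : Xa `<=` interior X := Xa_int p1 r0 vX rX alpha0 alpha1.
Let cXa : compact Xa := @scale_compact R n X cX (1 - alpha).
Let vXa x y t : Xa x -> Xa y -> 0 <= t -> t <= 1 -> Xa (x + t *: (y - x)).
Proof. exact: scale_convex. Qed.
Let Xa0 : Xa !=set0. Proof. by exists y1. Qed.

Section omega.
Variables (dO : measure_display) (Omega : measurableType dO).

(** A partial derivative is the limit of the difference quotients with steps h / (m + 1), whose
    points stay in the interior of X; each quotient is measurable. *)
Lemma measurable_grad (Y : Omega -> 'rV[R]_n.+1) i : measurable_fun setT (Y : Omega -> rVB R n.+1) ->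
  (forall w, Xa (Y w)) -> measurable_fun setT (fun w => grad psi (Y w) 0 i).
Proof.
move=> mY XY; pose h := alpha / 2 * r; have h0 : 0 < h by rewrite mulr_gt0// divr_gt0.
pose t (m : nat) : R := h / m.+1%:R.
have t0 m : 0 < t m by rewrite divr_gt0// ltr0n.
have tc : t m @[m --> \oo] --> (0 : R).
  rewrite -(mulr0 h); apply: cvgM; first exact: cvg_cst.
  exact: cvg_harmonic.
pose psiD := psi \_ (interior X).
have mpsi : measurable_fun setT (psiD : rVB R n.+1 -> R).
  apply: measurable_fun_open; first exact: open_interior.
  by move=> x Dx; exact: (psi_continuous dpsi).
pose e : 'rV[R]_n.+1 := delta_mx 0 i.
pose q m w := (t m)^-1 * (psiD (Y w + t m *: e) - psiD (Y w)).
have mq m : measurable_fun setT (q m).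
  apply: measurable_funM => //; apply: measurable_funB.
    apply: (@measurable_compV _ _ _ _ _ _ psiD) => //.
    apply: measurable_rVP => j; under eq_fun do rewrite mxE.
    by apply: measurable_funD => //; exact: measurable_coordV.
  exact: (@measurable_compV _ _ _ _ _ _ psiD).
apply: (measurable_fun_cvg mq) => w _.
have Dw := XaD (XY w).
have := cvg_dir_derive dpsi (h := e) Dw; rewrite dotp_delta.
move=> /cvg_at_rightP/(_ t) H.
suff E : (fun m => q m w) = fun m => (t m)^-1 * (psi (Y w + t m *: e) - psi (Y w)).
  by rewrite E; exact: H (conj t0 tc).
apply/funext => m.
have Dm : interior X (Y w + t m *: e).
  apply: (Xb_int p1 r0 vX rX alpha0 alpha1).
  have le1 : l1 (m.+1%:R^-1 *: e) <= 1.
    rewrite l1Z ger0_norm ?invr_ge0// /l1 (bigD1 i)//= big1 ?addr0 => [|j ji].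
      by rewrite mxE !eqxx normr1 mulr1 invf_le1 ?ltr0n// ler1n.
    by rewrite mxE (negbTE ji) andbF normr0.
  have := half_mem p1 vX rX alpha0 alpha1 (XY w) le1.
  by rewrite scalerA.
by rewrite /q /psiD !patchE !mem_set.
Qed.

Let A (th : 'rV[R]_n.+1) := xget 0 (argmin Xa (fun z => dotp th z + 1 * bregman psi z y1)).

Let AP th : argmin Xa (fun z => dotp th z + 1 * bregman psi z y1) (A th).
Proof. by apply: xgetPex; exact: (argmin_exists XaD cXa Xa0 dpsi). Qed.

(* Strong convexity makes the minimizer Lipschitz in the linear term [th]; the
   update is this map at [eta k *: g - grad psi y + grad psi y1], hence measurable. *)
Lemma continuous_argmin : continuous A.
Proof.
apply: (@rV_continuousP R n.+1 'rV[R]_n.+1) => i.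
apply: (@cont_sqr_le R 'rV[R]_n.+1 _ (fun x y => (lambda^-1 * l1 (y - x)) ^+ 2)) => [x|x|x y].
- under eq_fun do rewrite expr2.
  have C : continuous (fun y : 'rV[R]_n.+1 => lambda^-1 * l1 (y - x)).
    apply: contM; first exact: contC.
    move=> z; apply: (@continuous_comp _ _ _ (fun z : 'rV[R]_n.+1 => z - x) (@l1 R n.+1)); last exact: continuous_l1.
    by apply: continuousB => //; exact: cst_continuous.
  exact: contM.
- by rewrite subrr l1_0 mulr0 expr2 mul0r.
have [Xx _] := AP x; have [Xy _] := AP y.
have h1 := argmin_first_order XaD vXa dpsi (AP x) Xy.
have h2 := argmin_first_order XaD vXa dpsi (AP y) Xx.
rewrite !mul1r in h1 h2.
have s1 := sc (XaD Xx) (XaD Xy); have s2 := sc (XaD Xy) (XaD Xx).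
have e2 : lpnorm p (A x - A y) = lpnorm p (A y - A x) by rewrite -(opprB (A y)) lpnormN.
rewrite e2 in s1.
have hh : dotp (x - y) (A y - A x) <= l1 (y - x) * lpnorm p (A y - A x).
  apply: le_trans (ler_norm _) _; apply: le_trans (hoelder _ _ p1) _.
  rewrite ler_wpM2r ?lpnorm_ge0//; apply: (@le_trans _ _ (lpnorm 1%E (x - y))).
    by apply: lpnorm_mono => //; exact: conjugate_ge1.
  by rewrite lpnorm1E -(opprB y) l1N.
have key : lambda * lpnorm p (A y - A x) ^+ 2 <= l1 (y - x) * lpnorm p (A y - A x).
  apply: le_trans hh; move: h1 h2 s1 s2; rewrite /bregman -(opprB (A y) (A x)) !dotpBl !dotpNr.
  move: (lpnorm _ _ ^+ 2) (psi _) (psi _) => z u v.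
  move: (dotp _ _) (dotp _ _) (dotp _ _) (dotp _ _) (dotp _ _) => *; lra.
have nb : lpnorm p (A y - A x) <= lambda^-1 * l1 (y - x).
  have [->|n0] := eqVneq (lpnorm p (A y - A x)) 0; first by rewrite mulr_ge0 ?invr_ge0 ?l1_ge0// ltW.
  have n1 : 0 < lpnorm p (A y - A x) by rewrite lt_neqAle eq_sym n0 lpnorm_ge0.
  by rewrite ler_pdivlMl// -(ler_pM2r n1) -mulrA -expr2.
rewrite -real_normK ?num_real// lerXn2r ?nnegrE ?mulr_ge0 ?invr_ge0 ?l1_ge0 ?(ltW lambda0)//.
apply: le_trans nb; have := coord_le_lpnorm (A y - A x) i p1; rewrite !mxE; exact.
Qed.

Variable s : nat -> Omega -> 'rV[R]_n.+1.
Variable T : nat.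
Hypothesis ms : forall t, (t < T)%N -> measurable_fun setT (s t : Omega -> rVB R n.+1).
Hypothesis cf : forall t, (t < T)%N -> continuous (f t).

Let st w := pbmd mu gamma eta psi Xa y1 f (fun t => s t w).

Let measurable_point t : (forall k, measurable_fun setT (fun w => (st w t).1 k)) ->
  (forall k, measurable_fun setT ((fun w => (st w t).2 k) : Omega -> rVB R n.+1)) ->
  measurable_fun setT ((fun w => pbmd_point (st w t)) : Omega -> rVB R n.+1).
Proof.
move=> m1 m2; apply: measurable_rVP => i; rewrite /pbmd_point.
under eq_fun do rewrite summxE.
apply: measurable_sum => k; under eq_fun do rewrite mxE.
by apply: measurable_funM => //; exact: measurable_coordV.
Qed.

Lemma measurable_grad_estimate t (Y : Omega -> 'rV[R]_n.+1) (sg : Omega -> 'rV[R]_n.+1) : (t < T)%N ->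
  measurable_fun setT (Y : Omega -> rVB R n.+1) -> measurable_fun setT (sg : Omega -> rVB R n.+1) ->
  measurable_fun setT ((fun w => grad_estimate mu (f t) (Y w) (sg w)) : Omega -> rVB R n.+1).
Proof.
move=> tT mY mg; have mF (e : R) : measurable_fun setT (fun w => f t (Y w + e *: sg w)).
  apply: (@measurable_compV _ _ _ _ _ _ (f t)); first by apply: continuous_measurable_rV; exact: cf.
  apply: measurable_rVP => i; under eq_fun do rewrite !mxE.
  by apply: measurable_funD; [exact: measurable_coordV|apply: measurable_funM => //; exact: measurable_coordV].
apply: measurable_rVP => i; rewrite /grad_estimate; under eq_fun do rewrite mxE.
apply: measurable_funM.
  apply: measurable_funM => //; apply: measurable_funB; first exact: mF.
  by under eq_fun do rewrite -scaleNr; exact: mF.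
by apply: (@measurable_compV _ _ _ _ _ _ (fun u => signv u 0 i)); [exact: measurable_signv|].
Qed.

(** [Omega] is any measurable space: the result serves for the given sigma-algebra and also for the
    one generated by the directions before a fixed round, with [T] replaced by that round. *)
Lemma pbmd_measurable t : (t <= T)%N ->
  (forall k, measurable_fun setT (fun w => (st w t).1 k)) /\
  (forall k, measurable_fun setT ((fun w => (st w t).2 k) : Omega -> rVB R n.+1)).
Proof.
elim: t => [_|t IH tT].
  by split=> k; exact: measurable_cst.
have [m1 m2] := IH (ltnW tT); have my := measurable_point m1 m2.
have mg := measurable_grad_estimate tT my (ms tT).
have mdot (a b : Omega -> 'rV[R]_n.+1) : measurable_fun setT (a : Omega -> rVB R n.+1) ->
    measurable_fun setT (b : Omega -> rVB R n.+1) -> measurable_fun setT (fun w => dotp (a w) (b w)).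
  move=> ma mb; apply: measurable_sum => i.
  by apply: measurable_funM; exact: measurable_coordV.
split=> k.
- pose l j w := (st w t).1 j * expR (- gamma * dotp (grad_estimate mu (f t) (pbmd_point (st w t)) (s t w)) ((st w t).2 j - pbmd_point (st w t))).
  have ml j : measurable_fun setT (l j).
    apply: measurable_funM => //; apply: measurableT_comp => //; apply: measurable_funM => //.
    apply: mdot => //; apply: measurable_rVP => i; under eq_fun do rewrite !mxE.
    by apply: measurable_funB; exact: measurable_coordV.
  rewrite (_ : (fun w => _) = fun w => l k w * (\sum_(j < N) l j w) `^ (-1)).
    apply: measurable_funM => //; apply: (measurableT_comp (measurable_powR _)).
    exact: measurable_sum.
  apply/funext => w; rewrite powR_inv1//; apply: sumr_ge0 => j _; rewrite mulr_ge0 ?expR_ge0//.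
  have [w0 _] := pbmd_weights Xa psi mu gamma y1 eta f (fun t => s t w) t.
  by apply: ltW; exact: w0.
- pose th w := eta k *: grad_estimate mu (f t) (pbmd_point (st w t)) (s t w) - grad psi ((st w t).2 k) + grad psi y1.
  rewrite (_ : (fun w => _) = fun w => A (th w)).
    apply: (@measurable_compV _ _ _ _ (rVB R n.+1) _ A); first by apply: (@continuous_measurable_rV2 R n.+1 n.+1 A); exact: continuous_argmin.
    apply: measurable_rVP => i.
    rewrite (_ : (fun w => _) = fun w => eta k * grad_estimate mu (f t) (pbmd_point (st w t)) (s t w) 0 i
      - grad psi ((st w t).2 k) 0 i + grad psi y1 0 i); last first.
      by apply/funext => w; rewrite /th !mxE.
    apply: measurable_funD => //; apply: measurable_funB.
      by apply: measurable_funM => //; exact: (measurable_coordV i mg).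
    apply: (@measurable_grad (fun w => (st w t).2 k) i (m2 k)) => w.
    exact: (pbmd_mem mu gamma eta f (fun t => s t w) XaD cXa Xy1 dpsi).
  apply/funext => w; rewrite /A; congr xget; rewrite [LHS]/=.
  apply: (@argmin_affine _ _ _ _ _ (eta k)^-1 ((eta k)^-1 * (psi y1 - dotp (grad psi y1) y1 - psi ((st w t).2 k) + dotp (grad psi ((st w t).2 k)) ((st w t).2 k)))).
    by rewrite invr_gt0.
  move=> z; rewrite /th /bregman !dotpDl !dotpNl !dotpBr dotpZl -/st.
  by move: (dotp _ _) (dotp _ _) (dotp _ _) (dotp _ _) (dotp _ _) (psi _) (psi _) (psi _) => *; field; rewrite gt_eqF.
Qed.

Lemma pbmd_point_measurable t : (t <= T)%N ->
  measurable_fun setT ((fun w => pbmd_point (st w t)) : Omega -> rVB R n.+1).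
Proof. by move=> tT; have [m1 m2] := pbmd_measurable tT; exact: measurable_point. Qed.

End omega.

End MeasurableState.

(** * Independence of the current direction from the past *)

Section ProductLaw.
Variables (R : realType) (dO d1 d2 : measure_display) (Omega : measurableType dO).
Variables (U : measurableType d1) (V : measurableType d2) (P : probability Omega R).

Lemma measurable_comp_pair (Psi : U -> V -> \bar R) (y : U) :
  measurable_fun setT (fun z : U * V => Psi z.1 z.2) -> measurable_fun setT (Psi y).
Proof. by move=> mP; exact: (measurableT_comp mP (measurable_pair1 y)). Qed.

Variables (Y : {mfun Omega >-> U}) (S : {mfun Omega >-> V}).

(** Independence says that the joint law is the product of the marginal laws, to which Tonelli's
    theorem applies. *)
Lemma integral_product_law (Psi : U * V -> \bar R) :
  (forall A B, measurable A -> measurable B -> P (Y @^-1` A `&` S @^-1` B) = P (Y @^-1` A) * P (S @^-1` B))%E ->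
  measurable_fun setT Psi -> (forall z, 0 <= Psi z)%E ->
  (\int[P]_w Psi (Y w, S w) = \int[P]_w \int[P]_w' Psi (Y w, S w'))%E.
Proof.
move=> ind mPsi Psi0.
have mY : measurable_fun setT Y by []. have mS : measurable_fun setT S by [].
have mYS : measurable_fun setT (fun w => (Y w, S w)) by exact: measurable_fun_pair.
have -> : (\int[P]_w Psi (Y w, S w) = \int[pushforward P (fun w => (Y w, S w))]_z Psi z)%E.
  rewrite (ge0_integral_pushforward mYS)//.
pose PY := distribution P Y; pose PS := distribution P S.
have -> : (\int[pushforward P (fun w => (Y w, S w))]_z Psi z = \int[PY \x PS]_z Psi z)%E.
  apply: eq_measure_integral => A mA _.
  apply/esym; apply: (@product_measure_unique _ _ _ _ R PY PS
    (measure_function_pushforward__canonical__measure_function_Measure P mYS)) => // B C mB mC.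
rewrite (fubini_tonelli1 (m1 := PY) (m2 := PS))// /fubini_F.
rewrite (ge0_integral_pushforward mY)//=.
- apply: eq_integral => w _ /=; rewrite (ge0_integral_pushforward mS)//.
  by apply: (measurableT_comp mPsi); exact: measurable_pair1.
- exact: (@measurable_fun_fubini_tonelli_F _ _ _ _ R PS Psi mPsi Psi0).
- by move=> y _; apply: integral_ge0.
Qed.

End ProductLaw.

Section Independence.
Variables (R : realType) (n T : nat) (dO : measure_display) (Omega : measurableType dO).
Variables (P : probability Omega R) (s : nat -> Omega -> 'rV[R]_n.+1).
Hypothesis rs : forall t, (t < T)%N -> random_element (s t).
Hypothesis us : forall t, (t < T)%N -> uniform_on_l1_sphere P (s t).
Hypothesis ind : mutually_independent P T s.

Lemma random_element_measurable t : (t < T)%N -> measurable_fun setT (s t : Omega -> rVB R n.+1).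
Proof. by move=> tT _ A mA; rewrite setTI; exact: rs. Qed.

(** A pi-system generating the past, of the form to which mutual independence applies directly. *)
Definition past_rect (t : nat) : set (set Omega) :=
  [set B | exists A : nat -> set 'rV[R]_n.+1, (forall j, borel_set (A j)) /\
     B = [set w | forall j, (j < t)%N -> A j (s j w)]].

(* [Omega] with the sigma-algebra of s^0, ..., s^(t-1): measurability for [past t]
   expresses that y^t does not depend on later directions. *)
Definition past (t : nat) := g_sigma_algebraType (past_rect t).

Let past_measurable t B : (t < T)%N -> past_rect t B -> measurable B.
Proof.
move=> tT [A [bA ->]].
have -> : [set w | forall j, (j < t)%N -> A j (s j w)] = \bigcap_(j in `I_t) (s j @^-1` A j).
  by apply/seteqP; split=> w H j jt; exact: H.
apply: bigcap_measurableType => j /= jt.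
by apply: rs => //; exact: ltn_trans tT.
Qed.

Let past_id t : (t < T)%N -> measurable_fun setT (id : Omega -> past t).
Proof.
move=> tT; apply: (@measurability _ _ Omega (past t) _ _ (past_rect t)) => //.
by move=> _ [B GB <-]; rewrite setTI; exact: (past_measurable tT).
Qed.

Lemma measurable_past t j : (j < t)%N -> measurable_fun setT (s j : past t -> rVB R n.+1).
Proof.
move=> jt _ B mB; rewrite setTI; apply: sub_sigma_algebra.
exists (fun i => if i == j then B else setT); split.
  by move=> i; case: ifP => _ //; exact: (@measurableT _ (rVB R n.+1)).
by apply/seteqP; split=> w H; [move=> i it; case: eqP => [->|]|have := H j jt; rewrite eqxx].
Qed.

(** Mutual independence for the rounds before t and for the same rounds together with t; the two
    products differ by one factor. *)
Lemma indep_rect t B A : (t < T)%N -> past_rect t B -> borel_set A ->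
  P (B `&` s t @^-1` A) = (P (s t @^-1` A) * P B)%E.
Proof.
move=> tT [A0 [bA0 ->]] bA; pose ti := Ordinal tT.
pose J := [set j : 'I_T | (j < t)%N]%SET.
have tJ : ti \notin J by rewrite inE/= ltnn.
have e0 := ind J (fun i => bA0 i).
pose A1 (i : 'I_T) := if i == ti then A else A0 i.
have bA1 i : borel_set (A1 i) by rewrite /A1; case: ifP.
have e1 := ind (ti |: J) bA1.
rewrite (_ : [set w | forall j, (j < t)%N -> A0 j (s j w)] =
    [set w | forall i : 'I_T, i \in J -> A0 i (s i w)]); last first.
  apply/seteqP; split=> w H j; first by rewrite inE => jt; exact: H.
  by move=> jt; have := H (Ordinal (ltn_trans jt tT)); rewrite inE; apply.
rewrite (_ : _ `&` _ = [set w | forall i : 'I_T, i \in (ti |: J)%SET -> A1 i (s i w)]); last first.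
  apply/seteqP; split=> w.
    move=> [H1 H2] i; rewrite inE /A1 => /orP[|iJ].
      by rewrite inE => /eqP ->; rewrite eqxx.
    by case: eqP => [->//|_]; exact: H1.
  move=> H; split; last by have := H ti; rewrite /A1 eqxx; apply; rewrite !inE eqxx.
  move=> i iJ; have := H i; rewrite /A1; case: eqP => [it|_]; first by rewrite -it iJ in tJ.
  by apply; rewrite inE iJ orbT.
rewrite e1 e0 big_setU1//= /A1 eqxx; congr (_ * _)%E.
by apply: eq_bigr => i iJ; case: eqP => // it; rewrite -it iJ in tJ.
Qed.

Local Notation pfm m mf :=
  (measure_function_pushforward__canonical__measure_function_Measure m mf).

(** For fixed A, both sides are finite measures in B that agree on the generating pi-system. *)
Lemma indep_past t (B : set (past t)) A : (t < T)%N -> measurable B -> borel_set A ->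
  P (B `&` s t @^-1` A) = (P (s t @^-1` A) * P B)%E.
Proof.
move=> tT mB bA; have mC : measurable (s t @^-1` A) by exact: rs.
pose k : {nonneg R} := NngNum (fine_ge0 (measure_ge0 P (s t @^-1` A))).
pose m1 := pfm (mrestr P mC) (past_id tT).
pose m2 := pfm (mscale k P) (past_id tT).
have kE : (k%:num)%:E = P (s t @^-1` A) by rewrite /= fineK// fin_num_measure.
have H : m1 B = m2 B.
  apply: (@measure_unique _ R (past t) (past_rect t) (fun=> setT)) => //.
  - move=> _ _ [A1 [b1 ->]] [A2 [b2 ->]]; exists (fun j => A1 j `&` A2 j); split.
      by move=> j; exact: (@measurableI _ (rVB R n.+1) _ _ (b1 j) (b2 j)).
    by apply/seteqP; split=> [w [H1 H2] j jt|w H]; [split; [exact: H1|exact: H2]|split=> j jt; have [] := H j jt].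
  - move=> _; exists (fun=> setT); split; first by move=> j; exact: (@measurableT _ (rVB R n.+1)).
    by apply/seteqP; split.
  - by rewrite bigcup_const//; exists 0%N.
  - move=> C GC; rewrite /m1 /m2 /= /pushforward /mrestr /mscale !preimage_id kE.
    exact: indep_rect.
  - move=> _; rewrite /m1/= /pushforward /mrestr preimage_id.
    by rewrite (le_lt_trans (probability_le1 P _))// ?ltry//; exact: measurableI.
by move: H; rewrite /m1 /m2 /= /pushforward /mrestr /mscale !preimage_id kE.
Qed.

(** The past point is frozen while the current direction is averaged, and that average is one over
    the Laplace law. Conditional expectation thus becomes an iterated integral. *)
Lemma integral_indep t (Y : Omega -> 'rV[R]_n.+1) (Psi : 'rV[R]_n.+1 -> 'rV[R]_n.+1 -> \bar R) : (t < T)%N ->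
  measurable_fun setT (Y : past t -> rVB R n.+1) ->
  measurable_fun setT (fun z : rVB R n.+1 * rVB R n.+1 => Psi z.1 z.2) ->
  (forall y u, 0 <= Psi y u)%E ->
  (\int[P]_w Psi (Y w) (s t w) = \int[P]_w \int[laplaceV R n.+1]_u Psi (Y w) (l1unit u))%E.
Proof.
move=> tT mY mPsi Psi0.
have mYO : measurable_fun setT (Y : Omega -> rVB R n.+1).
  by move=> _ B mB; have := past_id tT measurableT (mY measurableT _ mB); rewrite !setTI.
have ms := random_element_measurable tT.
pose Yf : {mfun Omega >-> rVB R n.+1} := HB.pack (Y : Omega -> rVB R n.+1) (isMeasurableFun.Build _ _ Omega (rVB R n.+1) Y mYO).
pose Sf : {mfun Omega >-> rVB R n.+1} := HB.pack (s t : Omega -> rVB R n.+1) (isMeasurableFun.Build _ _ Omega (rVB R n.+1) (s t) ms).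
rewrite (integral_product_law (P := P) (Y := Yf) (S := Sf) (Psi := fun z => Psi z.1 z.2))//.
- apply: eq_integral => w _.
  have mPw : measurable_fun setT (Psi (Y w) : rVB R n.+1 -> _).
    exact: (@measurable_comp_pair _ _ _ (rVB R n.+1) (rVB R n.+1) Psi (Y w) mPsi).
  by rewrite -(ge0_integral_uniform (f := Psi (Y w)) (rs tT) (us tT) mPw (Psi0 _)).
- move=> A B mA mB; rewrite muleC; apply: indep_past => //.
  by have := mY measurableT _ mA; rewrite setTI.
Qed.

End Independence.

(** * Tuning *)

Section Constants.
Variable R : realType.

Lemma sqr_le_sqrt (x y : R) : 0 <= x -> x ^+ 2 <= y -> x <= Num.sqrt y.
Proof. by move=> x0 xy; rewrite -(ger0_norm x0) -sqrtr_sqr ler_wsqrtr. Qed.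

Lemma sqrt_le_sqr (x y : R) : 0 <= x -> y <= x ^+ 2 -> Num.sqrt y <= x.
Proof. by move=> x0 xy; rewrite -[leRHS](ger0_norm x0) -sqrtr_sqr ler_wsqrtr. Qed.

(** Each of the five terms is a multiple of W = G sqrt(B x T / lam): at most 18, 42, 24, z and 32 z
    times W, where z = 4^9. Since 84 <= z, the sum is at most 34 z, below 64 z = 4^12. *)
Lemma tuned_regret (rho G x lam A B T mu cm eta gamma k : R) :
  0 < rho -> 0 < G -> 0 < x -> 0 < lam -> 1 <= T -> rho ^+ 2 <= A -> lam * rho ^+ 2 <= A -> A <= B ->
  mu * cm <= rho * Num.sqrt x / Num.sqrt (lam * T) ->
  eta = k * Num.sqrt (A / (6 * (1 + Num.sqrt 2) ^+ 2 * G ^+ 2 * x * T / lam)) ->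
  gamma = 1 / (Num.sqrt 48 * (1 + Num.sqrt 2) * rho * G * Num.sqrt (x * T)) ->
  1 <= k -> k ^+ 2 * A <= B -> B <= 4 * k ^+ 2 * A ->
  B / eta + 2 * k / gamma + T * (24 * G * mu * cm + (eta / (2 * lam) + 32 * gamma * rho ^+ 2) * (4 ^+ 9 * G ^+ 2 * x))
  <= 4 ^+ 12 * G * Num.sqrt (B * x * T / lam).
Proof.
move=> rho0 G0 x0 lam0 T1 rA lrA AB hmu etaE gammaE k1 kA Bk.
have z84 : 84 <= 4 ^+ 9 :> R by rewrite -natrX ler_nat.
have -> : 4 ^+ 12 = 64 * 4 ^+ 9 :> R by rewrite !exprS expr0; ring.
move: (4 ^+ 9) z84 => z z84; have z0 : 0 < z by lra.
have T0 : 0 < T by lra.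
have A0 : 0 < A by apply: lt_le_trans rA; rewrite exprn_gt0.
have B0 : 0 < B by lra.
(* With all roots named, eta and gamma become rational expressions and [field] settles the
   identities. *)
pose a : R := 1 + Num.sqrt 2; pose sl := Num.sqrt lam; pose X := Num.sqrt (x * T).
pose sA := Num.sqrt A; pose sB := Num.sqrt B; pose s6 : R := Num.sqrt 6; pose s48 : R := Num.sqrt 48.
have sl0 : 0 < sl by rewrite sqrtr_gt0.
have X0 : 0 < X by rewrite sqrtr_gt0 mulr_gt0.
have sA0 : 0 < sA by rewrite sqrtr_gt0.
have sB0 : 0 < sB by rewrite sqrtr_gt0.
have a1 : 1 <= a by rewrite lerDl sqrtr_ge0.
have a3 : a <= 3 by have : Num.sqrt 2 <= 2 :> R; [apply: sqrt_le_sqr => //; rewrite expr2; lra|rewrite /a; lra].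
have s61 : 1 <= s6 by apply: sqr_le_sqrt => //; rewrite expr2; lra.
have s63 : s6 <= 3 by apply: sqrt_le_sqr => //; rewrite expr2; lra.
have s481 : 1 <= s48 by apply: sqr_le_sqrt => //; rewrite expr2; lra.
have s487 : s48 <= 7 by apply: sqrt_le_sqr => //; rewrite expr2; lra.
have lE : lam = sl ^+ 2 by rewrite sqr_sqrtr// ltW.
have AE : A = sA ^+ 2 by rewrite sqr_sqrtr// ltW.
have BE : B = sB ^+ 2 by rewrite sqr_sqrtr// ltW.
have XE : x * T = X ^+ 2 by rewrite sqr_sqrtr// mulr_ge0// ltW.
have s6E : 6 = s6 ^+ 2 by rewrite sqr_sqrtr.
have {}etaE : eta = k * (sA * sl / (s6 * a * G * X)).
  rewrite etaE -/a; congr (k * _).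
  rewrite [X in Num.sqrt X](_ : _ = (sA * sl / (s6 * a * G * X)) ^+ 2).
    rewrite sqrtr_sqr ger0_norm// divr_ge0// !mulr_ge0// ?ltW//; lra.
  rewrite -[6 * _ * _ * x * T]mulrA XE AE {1}lE {1}s6E; field.
  by rewrite !gt_eqF//; lra.
have {}gammaE : gamma = 1 / (s48 * a * rho * G * X) by rewrite gammaE.
have WE : Num.sqrt (B * x * T / lam) = sB * X / sl.
  rewrite [X in Num.sqrt X](_ : _ = (sB * X / sl) ^+ 2).
    by rewrite sqrtr_sqr ger0_norm// divr_ge0// ?mulr_ge0// ltW.
  by rewrite -[B * x * T]mulrA XE BE lE; field; rewrite gt_eqF.
(* The step of the chosen expert is within a factor 2 of the optimal one: k sA <= sB <= 2 k sA. *)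
have kAB : k * sA <= sB by apply: sqr_le_sqrt; [rewrite mulr_ge0// ?ltW//; lra|rewrite exprMn -AE].
have BkA : sB <= 2 * k * sA.
  apply: sqrt_le_sqr; first by rewrite !mulr_ge0// ?ltW//; lra.
  by rewrite !exprMn -AE; move: Bk; rewrite expr2; lra.
(* Both parts of max(1, lambda) rho^2 in A are used: rho <= sA for the smoothing term [t3], and rho
   sl <= sA for the terms [t2] and [t5] that contain gamma. *)
have rsA : rho <= sA by apply: sqr_le_sqrt => //; exact: ltW.
have rsl : rho * sl <= sA.
  by apply: sqr_le_sqrt; [rewrite mulr_ge0// ltW|rewrite exprMn -lE mulrC].
have sAB : sA <= sB by rewrite ler_wsqrtr.
pose W := G * (sB * X / sl).
have W0 : 0 < W by rewrite /W mulr_gt0// divr_gt0// mulr_gt0.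
have k0 : 0 < k by lra. have a0 : 0 < a by lra. have s60 : 0 < s6 by lra. have s480 : 0 < s48 by lra.
have t1 : B / eta <= 18 * W.
  rewrite (_ : B / eta = (s6 * a * (sB / (k * sA))) * W); last first.
    by rewrite etaE BE /W; field; rewrite !gt_eqF.
  apply: ler_wpM2r; first exact: ltW.
  have h1 : sB / (k * sA) <= 2 by rewrite ler_pdivrMr ?mulr_gt0// mulrA.
  have h0 : 0 <= sB / (k * sA) by rewrite divr_ge0// ?mulr_ge0// ltW.
  have h2 : s6 * a <= 3 * 3 by rewrite ler_pM//; lra.
  have h3 : 0 <= s6 * a by rewrite mulr_ge0// ltW.
  have -> : 18 = (3 * 3) * 2 :> R by ring.
  by rewrite ler_pM.
have rX : rho * G * X <= G * sA * X / sl.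
  by rewrite ler_pdivlMr// (_ : rho * G * X * sl = G * (rho * sl) * X); [apply: ler_wpM2r; [exact: ltW|apply: ler_wpM2l => //; exact: ltW]|ring].
have t2 : 2 * k / gamma <= 42 * W.
  have -> : 2 * k / gamma = (2 * (s48 * a)) * (k * (rho * G * X)) by rewrite gammaE; field; rewrite !gt_eqF.
  have h1 : k * (rho * G * X) <= W.
    apply: le_trans (ler_wpM2l (ltW k0) rX) _.
    rewrite (_ : k * _ = (k * sA) * (G * X / sl)); last by ring.
    rewrite (_ : W = sB * (G * X / sl)); last by rewrite /W; ring.
    by rewrite ler_wpM2r// divr_ge0// ?mulr_ge0// ltW.
  have h2 : s48 * a <= 7 * 3 by rewrite ler_pM//; lra.
  have h3 : 0 <= s48 * a by rewrite mulr_ge0// ltW.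
  have h4 : 0 <= k * (rho * G * X) by rewrite !mulr_ge0// ltW.
  have -> : 42 = 2 * (7 * 3) :> R by ring.
  apply: ler_pM => //; first by apply: mulr_ge0.
  by apply: ler_wpM2l.
have t3 : T * (24 * G * mu * cm) <= 24 * W.
  have -> : T * (24 * G * mu * cm) = 24 * (G * (T * (mu * cm))) by ring.
  apply: ler_wpM2l => //; apply: ler_wpM2l; first exact: ltW.
  apply: (@le_trans _ _ (T * (rho * Num.sqrt x / Num.sqrt (lam * T)))); first by apply: ler_wpM2l => //; exact: ltW.
  have sT0 : 0 < Num.sqrt T by rewrite sqrtr_gt0.
  have TE : T = Num.sqrt T ^+ 2 by rewrite sqr_sqrtr// ltW.
  have XE2 : X = Num.sqrt x * Num.sqrt T by rewrite /X sqrtrM// ltW.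
  rewrite (_ : T * _ = rho * (X / sl)).
    rewrite -[leRHS]mulrA; apply: ler_wpM2r; first by apply: divr_ge0; exact: ltW.
    exact: le_trans rsA sAB.
  rewrite sqrtrM ?ltW// -/sl XE2 {1}TE; field.
  by rewrite !gt_eqF.
have D0 : 0 < G * X / sl by apply: divr_gt0 => //; exact: mulr_gt0.
have WD : W = sB * (G * X / sl) by rewrite /W; ring.
have kW : (k * sA) * (G * X / sl) <= W by rewrite WD; apply: ler_wpM2r => //; exact: ltW.
have rW : rho * G * X <= W.
  apply: le_trans rX _; rewrite (_ : _ / sl = sA * (G * X / sl)); last by ring.
  by rewrite WD; apply: ler_wpM2r => //; exact: ltW.
have t4 : T * (eta / (2 * lam) * (z * G ^+ 2 * x)) <= z * W.
  rewrite (_ : T * _ = (s6 * a * 2)^-1 * (z * ((k * sA) * (G * X / sl)))).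
    have h1 : (s6 * a * 2)^-1 <= 1 by rewrite invf_le1 ?mulr_gt0//; nra.
    apply: le_trans (ler_wpM2l (ltW z0) kW); apply: ler_piMl => //.
    by apply: mulr_ge0; [exact: ltW|apply: mulr_ge0; apply: ltW => //; exact: mulr_gt0].
  rewrite (_ : T * _ = eta / (2 * lam) * (z * G ^+ 2 * (x * T))); last by ring.
  by rewrite XE etaE lE; field; rewrite !gt_eqF.
have t5 : T * (32 * gamma * rho ^+ 2 * (z * G ^+ 2 * x)) <= 32 * (z * W).
  rewrite (_ : T * _ = (s48 * a)^-1 * (32 * (z * (rho * G * X)))).
    have h1 : (s48 * a)^-1 <= 1 by rewrite invf_le1 ?mulr_gt0//; nra.
    apply: (@le_trans _ _ (32 * (z * (rho * G * X)))); last first.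
      by apply: ler_wpM2l => //; apply: ler_wpM2l => //; exact: ltW.
    apply: ler_piMl => //; apply: mulr_ge0 => //; apply: mulr_ge0; first exact: ltW.
    by apply: mulr_ge0; [apply: mulr_ge0|]; exact: ltW.
  rewrite (_ : T * _ = 32 * gamma * rho ^+ 2 * (z * G ^+ 2 * (x * T))); last by ring.
  by rewrite XE gammaE; field; rewrite !gt_eqF.
rewrite WE (_ : 64 * z * G * (sB * X / sl) = 64 * (z * W)); last by rewrite /W; ring.
rewrite (_ : T * (_ + (_ + _) * _) = T * (24 * G * mu * cm) + T * (eta / (2 * lam) * (z * G ^+ 2 * x)) +
   T * (32 * gamma * rho ^+ 2 * (z * G ^+ 2 * x))); last by ring.
move: (ltW W0) t1 t2 t3 t4 t5 (ler_wpM2r (ltW W0) z84).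
move: (B / eta) (2 * k / gamma) (T * _) (T * _) (T * _) => u1 u2 u3 u4 u5.
by move: (z * W) (W) => w1 w; clear => *; lra.
Qed.

(* [k] is the largest index with 4^k A <= B; the number of experts is such that
   the upper bound also holds when [k] is the last one. *)
Lemma expert_choice (z A B : R) : 0 < A -> 0 <= z -> A <= B -> B <= (1 + 2 * z) * A ->
  let m := absz (Num.ceil (1 / 2 * (ln (1 + z) / ln 2))) in
  exists k : 'I_m.+1, (2 ^+ k) ^+ 2 * A <= B /\ B <= 4 * (2 ^+ k) ^+ 2 * A.
Proof.
move=> A0 z0 AB BA m.
have ln2 : 0 < ln 2 :> R by rewrite ln_gt0// ltr1n.
have z1 : 0 < 1 + z by lra.
have e0 : 0 <= 1 / 2 * (ln (1 + z) / ln 2).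
  by apply: mulr_ge0 => //; apply: divr_ge0; [apply: ln_ge0; rewrite lerDl|exact: ltW].
have mle : 1 / 2 * (ln (1 + z) / ln 2) <= m%:R.
  rewrite /m natr_absz ger0_norm; last by rewrite -(ler_int R) (le_trans e0)// ceil_ge.
  exact: ceil_ge.
have pm : 1 + z <= (2 ^+ m) ^+ 2.
  rewrite -ler_ln ?posrE ?exprn_gt0// -exprM lnXn//.
  rewrite -[ln 2 *+ _]mulr_natr natrM.
  move: mle; rewrite -(@ler_pM2r _ (2 * ln 2)) ?mulr_gt0//.
  rewrite (_ : 1 / 2 * (ln (1 + z) / ln 2) * (2 * ln 2) = ln (1 + z)); last by field; rewrite gt_eqF.
  by rewrite (_ : m%:R * (2 * ln 2) = ln 2 * (m%:R * 2)); last ring.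
clearbody m; pose Pk (k : nat) := (k <= m)%N && ((2 ^+ k) ^+ 2 * A <= B).
have ex0 : exists k, Pk k by exists 0%N; rewrite /Pk/= expr0 expr1n mul1r.
have bd k : Pk k -> (k <= m)%N by case/andP.
have [k /andP[km kB] kmax] := ex_maxnP ex0 bd.
exists (inord k); rewrite inordK//; split=> //.
have [km'|mk] := ltnP k m.
  rewrite leNgt; apply/negP => h; have := kmax k.+1; rewrite /Pk km'/= ltnn.
  suff h1 : (2 ^+ k.+1) ^+ 2 * A <= B by move=> h2; have := h2 h1.
  by apply: le_trans (ltW h); rewrite [2 ^+ k.+1]exprS exprMn (_ : 2 ^+ 2 = 4 :> R)//; ring.
have -> : k = m by apply/eqP; rewrite eqn_leq km mk.
apply: le_trans BA _; apply: ler_wpM2r; first exact: ltW.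
by have := sqr_ge0 (2 ^+ m : R); move: (_ ^+ 2) pm z0; clear => *; lra.
Qed.

End Constants.

(** * Expected regret *)

Lemma l1unit_idem (R : realType) n (u : 'rV[R]_n) : l1unit (l1unit u) = l1unit u.
Proof.
have [l0|l0] := eqVneq (l1 u) 0; first by rewrite /l1unit l0 invr0 !scale0r scaler0.
have -> : l1unit (l1unit u) = (l1 (l1unit u))^-1 *: l1unit u by [].
by rewrite /l1unit l1Z ger0_norm ?invr_ge0 ?l1_ge0// mulVf// invr1 scale1r.
Qed.

Section Round.
Variables (R : realType) (n : nat) (X : set 'rV[R]_n.+1) (p q : \bar R) (r rho alpha G c : R).
Variables (f : 'rV[R]_n.+1 -> R).
Hypotheses (cX : compact X) (p1 : (1 <= p)%E) (q1 : (1 <= q)%E) (r0 : 0 < r) (n2 : (2 <= n)%N).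
Hypothesis vX : forall x y t, X x -> X y -> 0 <= t -> t <= 1 -> X (x + t *: (y - x)).
Hypothesis rX : scale_set r (@lp_ball R p n.+1) `<=` X.
Hypothesis Xrho : forall x, X x -> lpnorm p x <= rho.
Hypotheses (alpha0 : 0 < alpha) (alpha1 : alpha <= 1 / 2).
Hypothesis cf : continuous f.
Hypothesis vf : forall x y t, X x -> X y -> 0 <= t -> t <= 1 ->
  f (x + t *: (y - x)) <= f x + t * (f y - f x).
Hypothesis G0 : 0 < G.
Hypothesis lf : forall x y, X x -> X y -> `|f x - f y| <= G * lpnorm q (x - y).
Hypothesis c0 : 0 <= c.
Let mu := alpha * r.
Local Notation Xa := (scale_set (1 - alpha) X).
Local Notation dual := (lpnorm (hoelder_conjugate p)).
Local Notation L := (laplaceV R n.+1).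

Let mu0 : 0 < mu. Proof. by rewrite /mu mulr_gt0. Qed.

(* The one-round loss at the smoothed points, with the linear surrogate of the
   estimator subtracted and the second-moment penalty added. *)
Definition round_excess (u y s : 'rV[R]_n.+1) : R :=
  (f (y + mu *: s) + f (y - mu *: s)) / 2 - f u
  - dotp (grad_estimate mu f y s) (y - (1 - alpha) *: u)
  + c * dual (grad_estimate mu f y s) ^+ 2.

Variable u : 'rV[R]_n.+1.
Hypothesis Xu : X u.

Let XaX y : Xa y -> X y.
Proof. by move=> /(Xa_int p1 r0 vX rX alpha0 alpha1) /interior_subset. Qed.

Let Xv : Xa ((1 - alpha) *: u). Proof. by exists u. Qed.

Let thick y s : Xa y -> l1 s <= 1 -> X (y + mu *: s).
Proof. exact: (thick_mem p1 vX rX alpha0 alpha1). Qed.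

Let thickN y s : Xa y -> l1 s <= 1 -> X (y - mu *: s).
Proof. by move=> Xy s1; rewrite -scalerN; apply: thick => //; rewrite l1N. Qed.

Let rho0 : 0 <= rho. Proof. exact: le_trans (lpnorm_ge0 _ _) (Xrho Xu). Qed.

(** f is bounded on the compact X and the played points stay in X, so the estimator is bounded too,
    with a bound that may depend on mu since only integrability rests on it. *)
Lemma round_excess_bounded : exists M, forall y s, Xa y -> l1 s <= 1 -> `|round_excess u y s| <= M.
Proof.
have [M0 HM0] : exists M : R, forall x, X x -> `|f x| <= M.
  have cc : compact (f @` X) by apply: continuous_compact => //; exact: continuous_subspaceT.
  have [M [_ HM]] := compact_bounded cc.
  by exists (M + 1) => x Xx; apply: (HM (M + 1)); [rewrite ltrDl|exists x].
have M00 : 0 <= M0 by apply: le_trans (HM0 u Xu).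
pose K := (n.+1%:R / (2 * mu)) * (2 * M0) * n.+1%:R `^ (1 - recip p).
have K0 : 0 <= K by rewrite /K !mulr_ge0 ?powR_ge0 ?invr_ge0 ?mulr_ge0// ltW.
exists (2 * M0 + K * (4 * rho) + c * K ^+ 2) => y s Xy s1.
have h1 := HM0 _ (thick Xy s1); have h2 := HM0 _ (thickN Xy s1); have h3 := HM0 _ Xu.
have hg : dual (grad_estimate mu f y s) <= K.
  rewrite /grad_estimate lpnorm_sign// ler_wpM2r ?powR_ge0// normrM.
  have a0 : 0 <= n.+1%:R / (2 * mu) by rewrite divr_ge0 ?mulr_ge0// ltW.
  rewrite ger0_norm//; apply: ler_wpM2l => //.
  by apply: le_trans (ler_normB _ _) _; move: h1 h2; lra.
have hd : `|dotp (grad_estimate mu f y s) (y - (1 - alpha) *: u)| <= K * (4 * rho).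
  apply: le_trans (hoelder _ _ p1) _; apply: ler_pM; rewrite ?lpnorm_ge0//.
  by apply: lpnormB_le => //; apply: Xrho; apply: XaX.
have hs : dual (grad_estimate mu f y s) ^+ 2 <= K ^+ 2.
  by rewrite lerXn2r ?nnegrE ?lpnorm_ge0.
have hc : `|c * dual (grad_estimate mu f y s) ^+ 2| <= c * K ^+ 2.
  by rewrite ger0_norm; [apply: ler_wpM2l|apply: mulr_ge0 => //; exact: sqr_ge0].
rewrite /round_excess; apply: le_trans (ler_normD _ _) _; apply: lerD => //.
apply: le_trans (ler_normB _ _) _; apply: lerD => //.
apply: le_trans (ler_normB _ _) _.
have -> : 2 * M0 = M0 + M0 by ring.
apply: lerD => //.
rewrite normrM [`|2^-1|]ger0_norm//; apply: le_trans (ler_wpM2r _ (ler_normD _ _)) _ => //.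
by move: h1 h2; lra.
Qed.

(** The terms of [c_mu]: one zeta is the excess of the averaged loss over f(y), the other the bias
    of the estimator, and rho / r times upsilon pays for shrinking the comparator to (1 - alpha) u.
    The value f(y) cancels. *)
Lemma mean_round_excess y : Xa y ->
  bmfun ((fun s => round_excess u y (l1unit s)) : rVB R n.+1 -> R) /\
  mean L (fun s => round_excess u y (l1unit s)) <=
  24 * G * mu * c_mu p q n.+1 r rho + c * (4 ^+ 9 * G ^+ 2 * xi p q n.+1).
Proof.
move=> Xy; have tX z : Xa z -> forall s, l1 s <= 1 -> X (z + mu *: s) by move=> Xz s; exact: thick.
have [b1 e1] := mean_average_le cf G0 mu0 q1 n2 lf (tX _ Xy).
have [b2 e2] := mean_estimate_sqr cX vX cf vf G0 mu0 q1 lf (tX _ Xy) p1.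
have [b3 e3] := mean_estimate_ge cX vX cf vf G0 mu0 q1 n2 lf (tX _ Xy) (tX _ Xv).
have bu : bmfun ((fun=> f u) : rVB R n.+1 -> R) by exact: bmfunC.
have b4 := bmfunB b1 bu; have b5 := bmfunB b4 b3.
have b6 := bmfunM (@bmfunC _ (rVB R n.+1) _ c) b2; split; first exact: bmfunD b5 b6.
rewrite /round_excess (meanD L b5 b6) (meanB L b4 b3) (meanB L b1 bu) meanC (meanZ L c b2).
have hv : f ((1 - alpha) *: u) - f u <= G * (mu * (rho / r * upsilon p q n.+1)).
  apply: le_trans (ler_norm _) _; apply: le_trans (lf (XaX Xv) Xu) _.
  apply: ler_wpM2l; first exact: ltW.
  rewrite scalerBl scale1r addrAC subrr add0r -scaleNr lpnormZ// normrN gtr0_norm//.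
  have -> : mu * (rho / r * upsilon p q n.+1) = alpha * (upsilon p q n.+1 * rho).
    by rewrite /mu; field; rewrite gt_eqF.
  apply: ler_wpM2l; first exact: ltW.
  by apply: le_trans (lpnorm_upsilon _ _ p1 q1) _ => //; apply: ler_wpM2l; [exact: upsilon_ge0|exact: Xrho].
have hc := ler_wpM2l c0 e2.
have z1 : 0 <= G * mu by rewrite mulr_ge0// ltW.
have z2 : 0 <= G * (mu * (rho / r * upsilon p q n.+1)).
  by rewrite !mulr_ge0 ?upsilon_ge0 ?invr_ge0// ltW.
move: e1 e3 hv hc z1 z2; rewrite /c_mu.
move: (mean L _) (mean L _) (mean L _) (upsilon _ _ _) (xi _ _ _) (zeta _ _) => A B C U x z.
move: (f _) (f _) (f _) (4 ^+ 9) => a b d e e1 e3 hv hc z1 z2.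
have -> : 24 * G * mu * (1 + 2 * z + rho / r * U) = 24 * (G * mu) + 48 * (G * mu * z) + 24 * (G * (mu * (rho / r * U))) by ring.
have e24 : 24 * G * mu * z = 24 * (G * mu * z) by ring.
by rewrite e24 in e1 e3; lra.
Qed.

End Round.

Section ExpectedRegret.
Variables (R : realType) (n N' T : nat) (X : set 'rV[R]_n.+1) (p q : \bar R) (r rho lambda alpha gamma G : R).
Variables (psi : 'rV[R]_n.+1 -> R) (y1 : 'rV[R]_n.+1).
Let N := N'.+1.
Variables (eta : 'I_N -> R) (f : nat -> 'rV[R]_n.+1 -> R).
Hypotheses (cX : compact X) (p1 : (1 <= p)%E) (q1 : (1 <= q)%E) (r0 : 0 < r) (lambda0 : 0 < lambda).
Hypotheses (n2 : (2 <= n)%N) (T0 : (0 < T)%N).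
Hypothesis vX : forall x y t, X x -> X y -> 0 <= t -> t <= 1 -> X (x + t *: (y - x)).
Hypothesis rX : scale_set r (@lp_ball R p n.+1) `<=` X.
Hypothesis Xrho : forall x, X x -> lpnorm p x <= rho.
Hypotheses (alpha0 : 0 < alpha) (alpha1 : alpha <= 1 / 2).
Hypothesis dpsi : forall x, interior X x -> differentiable psi x.
Hypothesis sc : strongly_convex_on p lambda (interior X) psi.
Hypothesis gamma0 : 0 < gamma.
Hypothesis eta0 : forall k, 0 < eta k.
Hypothesis cf : forall t, (t < T)%N -> continuous (f t).
Hypothesis vf : forall t, (t < T)%N -> forall x y h, X x -> X y -> 0 <= h -> h <= 1 ->
  f t (x + h *: (y - x)) <= f t x + h * (f t y - f t x).
Hypothesis G0 : 0 < G.
Hypothesis lf : forall t, (t < T)%N -> forall x y, X x -> X y -> `|f t x - f t y| <= G * lpnorm q (x - y).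
Let mu := alpha * r.
Local Notation Xa := (scale_set (1 - alpha) X).
Hypothesis Xy1 : Xa y1.
Variables (dO : measure_display) (Omega : measurableType dO) (P : probability Omega R).
Variable s : nat -> Omega -> 'rV[R]_n.+1.
Hypothesis rs : forall t, (t < T)%N -> random_element (s t).
Hypothesis us : forall t, (t < T)%N -> uniform_on_l1_sphere P (s t).
Hypothesis ind : mutually_independent P T s.
Variable u : nat -> 'rV[R]_n.+1.
Hypothesis Xu : forall t, (t < T)%N -> X (u t).
Local Notation dual := (lpnorm (hoelder_conjugate p)).

Let XaD : Xa `<=` interior X := Xa_int p1 r0 vX rX alpha0 alpha1.
Let cXa : compact Xa := @scale_compact R n X cX (1 - alpha).
Let vXa x y t : Xa x -> Xa y -> 0 <= t -> t <= 1 -> Xa (x + t *: (y - x)).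
Proof. exact: scale_convex. Qed.

(* The directions are normalized, so that the algorithm stays in [X] for every
   outcome and not only almost surely. *)
Let Y t w := pbmd_point (pbmd mu gamma eta psi Xa y1 f (fun j => l1unit (s j w)) t).

Let Yin t w : Xa (Y t w).
Proof. exact: (pbmd_point_mem mu gamma eta f (fun j => l1unit (s j w)) XaD cXa Xy1 vXa dpsi t). Qed.

Let measurable_l1unit_s t : (t < T)%N -> measurable_fun setT ((fun w => l1unit (s t w)) : Omega -> rVB R n.+1).
Proof.
move=> tT; apply: (@measurable_compV _ _ _ _ (rVB R n.+1) _ (@l1unit R n.+1)); first exact: measurable_l1unit.
exact: (random_element_measurable rs).
Qed.

Let measurable_Y t : (t <= T)%N -> measurable_fun setT (Y t : Omega -> rVB R n.+1).
Proof.
move=> tT; exact: (pbmd_point_measurable mu gamma cX p1 r0 lambda0 vX rX alpha0 alpha1 dpsi sc eta0 Xy1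
  measurable_l1unit_s cf tT).
Qed.

Let measurable_past_Y t : (t < T)%N -> measurable_fun setT (Y t : past s t -> rVB R n.+1).
Proof.
move=> tT.
apply: (pbmd_point_measurable mu gamma cX p1 r0 lambda0 vX rX alpha0 alpha1 dpsi sc eta0 Xy1
  (Omega := past s t) (s := fun j w => l1unit (s j w)) (T := t)) => //.
  move=> j jt; apply: (@measurable_compV _ _ _ _ (rVB R n.+1) _ (@l1unit R n.+1)); first exact: measurable_l1unit.
  exact: measurable_past.
by move=> j jt; apply: cf; exact: ltn_trans tT.
Qed.

Let measurable_shift dT (U : measurableType dT) (a b : U -> 'rV[R]_n.+1) t (e : R) : (t < T)%N ->
  measurable_fun setT (a : U -> rVB R n.+1) -> measurable_fun setT (b : U -> rVB R n.+1) ->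
  measurable_fun setT (fun w => f t (a w + e *: b w)).
Proof.
move=> tT ma mb.
apply: (@measurable_compV _ _ _ _ _ _ (f t)); first by apply: continuous_measurable_rV; exact: cf.
apply: measurable_rVP => i; under eq_fun do rewrite !mxE.
by apply: measurable_funD; [exact: measurable_coordV|apply: measurable_funM => //; exact: measurable_coordV].
Qed.

Let measurable_average dT (U : measurableType dT) (a b : U -> 'rV[R]_n.+1) t (z : R) : (t < T)%N ->
  measurable_fun setT (a : U -> rVB R n.+1) -> measurable_fun setT (b : U -> rVB R n.+1) ->
  measurable_fun setT (fun w => (f t (a w + mu *: b w) + f t (a w - mu *: b w)) / 2 - z).
Proof.
move=> tT ma mb; apply: measurable_funB => //; apply: measurable_funM => //.
apply: measurable_funD; first exact: measurable_shift.
by under eq_fun do rewrite -scaleNr; exact: measurable_shift.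
Qed.

Let measurable_excess dT (U : measurableType dT) (a b : U -> 'rV[R]_n.+1) t (c : R) : (t < T)%N ->
  measurable_fun setT (a : U -> rVB R n.+1) -> measurable_fun setT (b : U -> rVB R n.+1) ->
  measurable_fun setT (fun w => round_excess p r alpha c (f t) (u t) (a w) (b w)).
Proof.
move=> tT ma mb; rewrite /round_excess -/mu.
have mg := measurable_grad_estimate mu cf tT ma mb.
apply: measurable_funD.
  apply: measurable_funB; first exact: measurable_average.
  apply: measurable_sum => i; apply: measurable_funM; first exact: (measurable_coordV i mg).
  under eq_fun do rewrite !mxE; apply: measurable_funB => //; exact: measurable_coordV.
apply: measurable_funM => //; under eq_fun do rewrite expr2.
have ml : measurable_fun setT (fun w => dual (grad_estimate mu (f t) (a w) (b w))).
  exact: (measurable_compV (@measurable_lpnorm _ _ n.+1) mg).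
exact: measurable_funM.
Qed.

(** The one-round bound holds for every frozen point of [Xa]; independence carries it over to the
    random point, which depends on earlier directions only. *)
Lemma mean_pbmd_excess t (c : R) : (t < T)%N -> 0 <= c ->
  bmfun (fun w => round_excess p r alpha c (f t) (u t) (Y t w) (l1unit (s t w))) /\
  mean P (fun w => round_excess p r alpha c (f t) (u t) (Y t w) (l1unit (s t w))) <=
  24 * G * mu * c_mu p q n.+1 r rho + c * (4 ^+ 9 * G ^+ 2 * xi p q n.+1).
Proof.
move=> tT c0; pose F y v := round_excess p r alpha c (f t) (u t) y (l1unit v).
have [M HM] := round_excess_bounded cX p1 r0 vX rX Xrho alpha0 alpha1 (cf tT) c0 (Xu tT).
have FM y v : Xa y -> `|F y v| <= M by move=> Xy; apply: HM => //; exact: l1_l1unit_le.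
have bF : bmfun (fun w => F (Y t w) (s t w)).
  split; first by apply: measurable_excess => //; [exact: measurable_Y (ltnW tT)|exact: measurable_l1unit_s].
  by exists M => w; exact: FM.
split=> //; set K := _ + c * _.
(* F + M is nonnegative only for y in [Xa]; the truncation at 0 makes the integrand nonnegative
   everywhere and leaves its values at the iterates unchanged. *)
pose Psi (y v : 'rV[R]_n.+1) : \bar R := (Num.max (F y v + M) 0)%:E.
have Psi0 y v : (0 <= Psi y v)%E by rewrite lee_fin le_max lexx orbT.
have PsiE y v : Xa y -> Psi y v = (F y v + M)%:E.
  move=> Xy; rewrite /Psi max_l//; have := FM y v Xy; rewrite ler_norml => /andP[h _].
  by rewrite -lerBlDr sub0r.
have mF : measurable_fun setT (fun z : rVB R n.+1 * rVB R n.+1 => F z.1 z.2).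
  apply: measurable_excess => //.
  by apply: (@measurable_compV _ _ _ _ (rVB R n.+1) _ (@l1unit R n.+1)); [exact: measurable_l1unit|].
have mPsi : measurable_fun setT (fun z : rVB R n.+1 * rVB R n.+1 => Psi z.1 z.2).
  apply/measurable_EFinP; apply: measurable_maxr => //; exact: measurable_funD.
have mPsin : measurable_fun setT (fun z : rVB R n.+1 * rVB R n.+1 => Psi z.1 (l1unit z.2)).
  have E : (fun z : rVB R n.+1 * rVB R n.+1 => Psi z.1 (l1unit z.2)) = fun z => Psi z.1 z.2.
    by apply/funext => z; rewrite /Psi /F l1unit_idem.
  by rewrite E.
have := integral_indep rs us ind tT (measurable_past_Y tT) mPsi Psi0.
have -> : (\int[P]_w Psi (Y t w) (s t w) = (mean P (fun w => F (Y t w) (s t w)) + M)%:E)%E.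
  under eq_integral do rewrite PsiE//.
  have bM : bmfun ((fun=> M) : Omega -> R) by exact: bmfunC.
  by rewrite (mean_EFin P (bmfunD bF bM)) (meanD P bF bM) meanC.
move=> e; rewrite -(lerD2r M) -lee_fin e.
have -> : ((K + M)%:E = \int[P]_w (cst (K + M)%:E w))%E.
  have bKM : bmfun ((fun=> K + M) : Omega -> R) by exact: bmfunC.
  by rewrite (mean_EFin P bKM) meanC.
have mI : measurable_fun setT (fun y : rVB R n.+1 => \int[laplaceV R n.+1]_v Psi y (l1unit v))%E.
  apply: (@measurable_fun_fubini_tonelli_F _ _ (rVB R n.+1) (rVB R n.+1) R (laplaceV R n.+1)
    (fun z => Psi z.1 (l1unit z.2)) mPsin) => z; exact: Psi0.
apply: ge0_le_integral => //.
- by move=> w _; apply: integral_ge0 => v _; exact: Psi0.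
- exact: (@measurable_compV _ _ _ _ _ _ (fun y => \int[laplaceV R n.+1]_v Psi y (l1unit v))%E _ mI (measurable_Y (ltnW tT))).
move=> w _ /=.
have [b1 e1] := mean_round_excess cX p1 q1 r0 n2 vX rX Xrho alpha0 alpha1 (cf tT) (vf tT) G0 (lf tT) c0 (Xu tT) (Yin t w).
have bM : bmfun ((fun=> M) : rVB R n.+1 -> R) by exact: bmfunC.
under eq_integral do rewrite PsiE// /F l1unit_idem.
by rewrite (mean_EFin (laplaceV R n.+1) (bmfunD b1 bM)) (meanD _ b1 bM) meanC lee_fin lerD2r.
Qed.

(** The law of s^t is that of [l1unit] of a Laplace vector, whose l1-norm is 1 except at the null
    point 0. *)
Lemma uniform_on_l1_sphere_ae : {ae P, forall w, forall t, (t < T)%N -> l1unit (s t w) = s t w}.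
Proof.
apply: ae_foralln => t; case: (ltnP t T) => tT; last by apply: aeW.
pose B := [set v : rVB R n.+1 | l1 v = 1].
have mB : measurable B.
  have := @measurable_l1 R n.+1 measurableT _ (measurable_set1 1); rewrite setTI.
  by congr measurable.
exists (s t @^-1` ~` B); split.
- by apply: rs => //; exact: (@measurableC _ (rVB R n.+1) B mB).
- have mBC := @measurableC _ (rVB R n.+1) B mB.
  apply: (eq_trans (@law_l1unit _ _ _ _ _ _ (~` B : set 'rV[R]_n.+1) (us tT) mBC)).
  apply: (@subset_measure0 _ _ _ (laplaceV R n.+1) _ [set v : rVB R n.+1 | l1 v == 0]) => //.
  + have := @measurable_l1unit R n.+1 measurableT _ mBC; rewrite setTI; exact.
  + have := @measurable_l1 R n.+1 measurableT _ (measurable_set1 0); rewrite setTI.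
    by congr measurable; apply/seteqP; split=> v /=; [move=> ->|move=> /eqP].
  + move=> v /= vB; apply: contrapT => /negP v0; apply: vB.
    rewrite /B/= /l1unit l1Z ger0_norm ?invr_ge0 ?l1_ge0//; exact: mulVf.
  + by apply: laplaceV_l1_eq; rewrite orbT.
- by move=> w /= H; rewrite /B /= => l1w; apply: H => _; rewrite /l1unit l1w invr1 scale1r.
Qed.

Lemma pbmd_ext (s1 s2 : nat -> 'rV[R]_n.+1) t : (forall j, (j < t)%N -> s1 j = s2 j) ->
  pbmd mu gamma eta psi Xa y1 f s1 t = pbmd mu gamma eta psi Xa y1 f s2 t.
Proof.
elim: t => [//|t IH] H /=; rewrite IH ?H// => j jt.
by apply: H; exact: ltn_trans (ltnSn t).
Qed.

Let regret (sg : nat -> Omega -> 'rV[R]_n.+1) w :=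
  pbmd_regret mu gamma eta psi Xa y1 f (fun t => sg t w) T u.

Let measurable_regret (sg : nat -> Omega -> 'rV[R]_n.+1) :
  (forall t, (t < T)%N -> measurable_fun setT (sg t : Omega -> rVB R n.+1)) ->
  measurable_fun setT (regret sg).
Proof.
move=> ms; rewrite /regret /pbmd_regret; under eq_fun do rewrite big_mkord.
apply: measurable_sum => t; apply: measurable_average => //; last exact: ms.
exact: (pbmd_point_measurable mu gamma cX p1 r0 lambda0 vX rX alpha0 alpha1 dpsi sc eta0 Xy1
  ms cf (ltnW (ltn_ord t))).
Qed.

(** c is the coefficient of the squared dual norms in [pbmd_linear_regret], so the penalties in
    [round_excess] cancel them. Shrinking the comparators by 1 - alpha only shortens their path. *)
Lemma normalized_regret_le k w c : c = eta k / (2 * lambda) + 32 * gamma * rho ^+ 2 ->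
  regret (fun t w => l1unit (s t w)) w <=
  (sup [set bregman psi v y1 | v in Xa] + F_psi psi Xa + G_psi p psi Xa * path_length p T u) / eta k
    + 2 * 2 ^+ k / gamma
  + \sum_(t < T) round_excess p r alpha c (f t) (u t) (Y t w) (l1unit (s t w)).
Proof.
move=> cE; pose v t := (1 - alpha) *: u t.
have Xv t : (t < T)%N -> Xa (v t) by move=> tT; exists (u t) => //; exact: Xu.
have XaX y : Xa y -> X y by move=> /XaD /interior_subset.
have := pbmd_linear_regret mu f (fun t => l1unit (s t w)) p1 lambda0 gamma0 eta0 XaD cXa Xy1 vXa dpsi sc
  (fun x Xx => Xrho (XaX x Xx)) (G_psi_ge cX p1 r0 lambda0 vX rX alpha0 alpha1 dpsi sc)
  (F_psi_ge cX p1 r0 vX rX alpha0 alpha1 dpsi)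
  (fun x => @sup_bregman_ge R n X p r alpha psi cX p1 r0 vX rX alpha0 alpha1 dpsi y1 x Xy1) k T0 Xv.
have Gp0 : 0 <= G_psi p psi Xa.
  exact: le_trans (lpnorm_ge0 _ _) (G_psi_ge cX p1 r0 lambda0 vX rX alpha0 alpha1 dpsi sc Xy1).
have pathle : \sum_(0 <= t < T.-1) lpnorm p (v t.+1 - v t) <= path_length p T u.
  apply: ler_sum => t _; rewrite /v -scalerBr lpnormZ//.
  by rewrite ler_piMl ?lpnorm_ge0// ger0_norm; move: alpha0 alpha1; lra.
have le1 : (sup [set bregman psi v y1 | v in Xa] + F_psi psi Xa
      + G_psi p psi Xa * (\sum_(0 <= t < T.-1) lpnorm p (v t.+1 - v t))) / eta k <=
    (sup [set bregman psi v y1 | v in Xa] + F_psi psi Xa + G_psi p psi Xa * path_length p T u) / eta k.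
  by apply: ler_wpM2r; [rewrite invr_ge0 ltW|rewrite lerD2l; apply: ler_wpM2l].
rewrite !big_mkord => lin.
have -> : regret (fun t w => l1unit (s t w)) w = \sum_(t < T) round_excess p r alpha c (f t) (u t) (Y t w) (l1unit (s t w))
    + \sum_(t < T) dotp (grad_estimate mu (f t) (Y t w) (l1unit (s t w))) (Y t w - v t)
    - \sum_(t < T) c * dual (grad_estimate mu (f t) (Y t w) (l1unit (s t w))) ^+ 2.
  rewrite /regret /pbmd_regret big_mkord -big_split -sumrB; apply: eq_bigr => t _ /=.
  rewrite /round_excess -/mu -/(v t) -/(Y t w).
  by move: (dotp _ _) (dual _ ^+ 2) (f _ _) (f _ _) (f _ _) => *; ring.
rewrite big_mkord in le1.
move: lin le1; rewrite -cE.
move: (\sum_(t < T) _) (\sum_(t < T) _) (\sum_(t < T) _) (2 * 2 ^+ k / gamma) => *; lra.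
Qed.

Lemma expected_regret k c : c = eta k / (2 * lambda) + 32 * gamma * rho ^+ 2 ->
  ('E_P[fun w => pbmd_regret mu gamma eta psi Xa y1 f (fun t => s t w) T u] <=
  ((sup [set bregman psi v y1 | v in Xa] + F_psi psi Xa + G_psi p psi Xa * path_length p T u) / eta k
    + 2 * 2 ^+ k / gamma
  + T%:R * (24 * G * mu * c_mu p q n.+1 r rho + c * (4 ^+ 9 * G ^+ 2 * xi p q n.+1)))%:E)%E.
Proof.
move=> cE; have c0 : 0 <= c.
  rewrite cE.
  apply: addr_ge0; first by apply: divr_ge0; [exact: ltW|apply: mulr_ge0 => //; exact: ltW].
  by apply: mulr_ge0; [apply: mulr_ge0 => //; exact: ltW|exact: sqr_ge0].
rewrite unlock.
have ms t : (t < T)%N -> measurable_fun setT (s t : Omega -> rVB R n.+1).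
  exact: (random_element_measurable rs).
(* The given directions are almost surely normalized already, so both runs have the same regret
   outside a null set. *)
rewrite (_ : (\int[P]_w _)%E = (\int[P]_w (regret (fun t w => l1unit (s t w)) w)%:E)%E); last first.
  apply: ae_eq_integral => //.
  - by apply/measurable_EFinP; exact: (measurable_regret ms).
  - by apply/measurable_EFinP; apply: measurable_regret.
  apply: filterS uniform_on_l1_sphere_ae => w H _ /=; congr EFin.
  rewrite /regret /pbmd_regret !big_mkord; apply: eq_bigr => t _.
  rewrite (pbmd_ext (s2 := fun j => l1unit (s j w))) ?H// => j jt.
  by rewrite H//; exact: ltn_trans (ltn_ord t).
pose E (t : 'I_T) w := round_excess p r alpha c (f t) (u t) (Y t w) (l1unit (s t w)).
have bE (t : 'I_T) : bmfun (E t) by have [] := mean_pbmd_excess (ltn_ord t) c0.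
have [bS eS] := mean_sum P bE.
set c1 := _ / eta k + _.
have b1 : bmfun ((fun=> c1) : Omega -> R) by exact: bmfunC.
(* All points played with normalized directions lie in X, where the finitely many f_t are
   bounded. *)
have bR : bmfun (regret (fun t w => l1unit (s t w))).
  split; first exact: measurable_regret.
  pose S0 w := \sum_(t < T) ((f t (Y t w + mu *: l1unit (s t w)) + f t (Y t w - mu *: l1unit (s t w))) / 2 - f t (u t)).
  have cc (t : 'I_T) : exists M : R, forall x, X x -> `|f t x| <= M.
    have ck : compact (f t @` X) by apply: continuous_compact => //; apply: continuous_subspaceT; exact: cf.
    have [M [_ HM]] := compact_bounded ck.
    by exists (M + 1) => x Xx; apply: (HM (M + 1)); [rewrite ltrDl|exists x].
  have [M HM] := choice cc.
  exists (\sum_(t < T) (2 * M t)) => w; rewrite /regret /pbmd_regret big_mkord.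
  apply: le_trans (ler_norm_sum _ _ _) _; apply: ler_sum => t _.
  have h1 : `|f t (Y t w + mu *: l1unit (s t w))| <= M t.
    by apply: HM; apply: (thick_mem p1 vX rX alpha0 alpha1 (Yin t w)); exact: l1_l1unit_le.
  have h2 : `|f t (Y t w - mu *: l1unit (s t w))| <= M t.
    apply: HM; rewrite -scalerN; apply: (thick_mem p1 vX rX alpha0 alpha1 (Yin t w)).
    by rewrite l1N; exact: l1_l1unit_le.
  have h3 : `|f t (u t)| <= M t by apply: HM; exact: Xu.
  rewrite -/(Y t w); move: h1 h2 h3; move: (f _ _) (f _ _) (f _ _) => a b e.
  by rewrite !ler_norml => /andP[? ?] /andP[? ?] /andP[? ?]; apply/andP; split; lra.
rewrite (mean_EFin P bR) lee_fin.
apply: (@le_trans _ _ (mean P (fun w => c1 + \sum_(t < T) E t w))).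
  by apply: mean_le => // [|w]; [exact: bmfunD b1 bS|exact: normalized_regret_le].
rewrite (meanD P b1 bS) meanC lerD2l eS.
apply: (@le_trans _ _ (\sum_(t < T) (24 * G * mu * c_mu p q n.+1 r rho + c * (4 ^+ 9 * G ^+ 2 * xi p q n.+1)))).
  by apply: ler_sum => t _; have [_] := mean_pbmd_excess (ltn_ord t) c0.
by rewrite sumr_const card_ord -[_ *+ T]mulr_natl.
Qed.

End ExpectedRegret.

Theorem theorem3p1 (R : realType) :
  exists C : R,
  forall (d T : nat) (p q : \bar R) (X : set 'rV[R]_d) (r rho : R)
    (f : nat -> 'rV[R]_d -> R) (G : R)
    (psi : 'rV[R]_d -> R) (lambda : R),
  (3 <= d)%N -> (1 <= T)%N -> (1 <= p)%E -> (1 <= q)%E ->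
  compact X -> convex_set X -> 0 < r -> r <= rho ->
  scale_set r (@lp_ball R p d) `<=` X ->
  X `<=` scale_set rho (@lp_ball R p d) ->
  (forall t, (t < T)%N -> convex_function setT (f t)) ->
  0 < G ->
  (forall t, (t < T)%N -> forall x y, X x -> X y ->
     `|f t x - f t y| <= G * lpnorm q (x - y)) ->
  (forall x, interior X x -> differentiable psi x) ->
  0 < lambda -> strongly_convex_on p lambda (interior X) psi ->
  let mu := Num.min (rho * Num.sqrt (xi p q d)
                     / (Num.sqrt (lambda * T%:R) * c_mu p q d r rho))
                    (r / 2) in
  let alpha := mu / r in
  let gamma := 1 / (Num.sqrt 48 * (1 + Num.sqrt 2) * rho * G
                    * Num.sqrt (xi p q d * T%:R)) in
  let Xa := scale_set (1 - alpha) X in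
  forall (y1 : 'rV[R]_d) (A : R),
  Xa y1 ->
  F_psi psi Xa + sup [set bregman psi v y1 | v in Xa]
    + Num.max 1 lambda * rho ^+ 2 <= A ->
  let N := (absz (Num.ceil
    (1 / 2 * (ln (1 + 2 * rho * G_psi p psi Xa * T%:R / A) / ln 2)))).+1 in
  let eta := fun k : 'I_N => 2 ^+ k * Num.sqrt
    (A / (6 * (1 + Num.sqrt 2) ^+ 2 * G ^+ 2 * xi p q d * T%:R / lambda)) in
  forall (dO : measure_display) (Omega : measurableType dO)
    (P : probability Omega R) (s : nat -> Omega -> 'rV[R]_d),
  (forall t, (t < T)%N -> random_element (s t)) ->
  (forall t, (t < T)%N -> uniform_on_l1_sphere P (s t)) ->
  mutually_independent P T s ->
  forall u : nat -> 'rV[R]_d,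
  (forall t, (t < T)%N -> X (u t)) ->
  ('E_P[fun w => pbmd_regret mu gamma eta psi Xa y1 f (fun t => s t w) T u]
   <= (C * G * Num.sqrt ((A + G_psi p psi Xa * path_length p T u)
                         * xi p q d * T%:R / lambda))%:E)%E.
Proof.
exists (4 ^+ 12) => d T p q X r rho f G psi lambda d3 T1 p1 q1 cX cvX r0 rrho rX Xr cvf G0 lf dpsi lambda0 sc.
case: d d3 X f psi cX cvX rX Xr cvf lf dpsi sc => // n n2 X f psi cX cvX rX Xr cvf lf dpsi sc.
move=> mu alpha gamma Xa y1 A Xy1 FA N eta dO Omega P s rs us ind u Xu.
have rho0 : 0 < rho by exact: lt_le_trans rrho.
have vX := convex_set_segment cvX.
have Xrho x : X x -> lpnorm p x <= rho.
  move=> /Xr [z z1 <-]; rewrite lpnormZ// gtr0_norm// ler_piMr// ltW//.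
have x0 : 0 < xi p q n.+1 by rewrite /xi powR_gt0.
have T0 : 0 < T%:R :> R by rewrite ltr0n.
have c1 : 0 < c_mu p q n.+1 r rho.
  have z0 : 0 <= zeta q n.+1 :> R.
    rewrite /zeta; case: ifP => _; apply: divr_ge0; rewrite ?addr_ge0// mulr_ge0 ?powR_ge0 ?expR_ge0//.
      by apply: fine_ge0; exact: le_trans q1.
    by apply: ln_ge0; rewrite ler1n.
  rewrite /c_mu -addrA ltr_pwDl// addr_ge0 ?mulr_ge0 ?invr_ge0 ?upsilon_ge0// ltW//.
have mu0 : 0 < mu.
  rewrite /mu lt_min divr_gt0 ?divr_gt0//; first by rewrite mulr_gt0// sqrtr_gt0.
  by rewrite mulr_gt0// sqrtr_gt0 mulr_gt0.
have alpha0 : 0 < alpha by rewrite /alpha divr_gt0.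
(* This is the purpose of the cap r / 2 in the choice of mu. *)
have alpha1 : alpha <= 1 / 2.
  rewrite /alpha ler_pdivrMr// [leRHS](_ : _ = r / 2); last by field.
  by rewrite /mu ge_min lexx orbT.
have gamma0 : 0 < gamma by rewrite /gamma divr_gt0// !mulr_gt0 ?sqrtr_gt0 ?mulr_gt0// ltr_pwDl// sqrtr_ge0.
have muE : mu = alpha * r by rewrite /alpha divfK// gt_eqF.
have Gp0 : 0 <= G_psi p psi Xa.
  exact: le_trans (lpnorm_ge0 _ _) (G_psi_ge cX p1 r0 lambda0 vX rX alpha0 alpha1 dpsi sc Xy1).
have F0 : 0 <= F_psi psi Xa.
  have := F_psi_ge cX p1 r0 vX rX alpha0 alpha1 dpsi Xy1 Xy1; rewrite subrr; exact.
have S0 : 0 <= sup [set bregman psi v y1 | v in Xa].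
  have := sup_bregman_ge cX p1 r0 vX rX alpha0 alpha1 dpsi Xy1 Xy1; apply: le_trans.
  by rewrite /bregman !subrr sub0r -(scale0r (0 : 'rV[R]_n.+1)) dotpZr mul0r oppr0.
have rA : rho ^+ 2 <= A.
  apply: le_trans FA; apply: (@le_trans _ _ (Num.max 1 lambda * rho ^+ 2)); last by rewrite lerDr addr_ge0.
  by rewrite ler_peMl ?sqr_ge0// le_max lexx.
have lrA : lambda * rho ^+ 2 <= A.
  apply: le_trans FA; apply: (@le_trans _ _ (Num.max 1 lambda * rho ^+ 2)); last by rewrite lerDr addr_ge0.
  by apply: ler_wpM2r; [exact: sqr_ge0|rewrite le_max lexx orbT].
have A0 : 0 < A by apply: lt_le_trans rA; rewrite exprn_gt0.
have sq0 : 0 < Num.sqrt (A / (6 * (1 + Num.sqrt 2) ^+ 2 * G ^+ 2 * xi p q n.+1 * T%:R / lambda)).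
  by rewrite sqrtr_gt0 !(divr_gt0, mulr_gt0)// exprn_gt0// ltr_pwDl// sqrtr_ge0.
have eta0 k : 0 < eta k by rewrite /eta mulr_gt0// exprn_gt0.
pose B := A + G_psi p psi Xa * path_length p T u.
have path0 : 0 <= path_length p T u by apply: sumr_ge0 => t _; exact: lpnorm_ge0.
have AB : A <= B by rewrite lerDl mulr_ge0.
(* The longest possible path limits the range of steps that the experts must cover. *)
have pathle : path_length p T u <= 4 * rho * T%:R.
  apply: (@le_trans _ _ (\sum_(0 <= t < T.-1) 4 * rho)).
    rewrite /path_length big_nat_cond [leRHS]big_nat_cond; apply: ler_sum => t /andP[/andP[_ tT] _].
    rewrite ltn_predRL in tT.
    by apply: lpnormB_le => //; apply: Xrho; apply: Xu => //; exact: ltn_trans tT.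
  rewrite big_const_nat iter_addr_0 subn0 -[_ *+ T.-1]mulr_natr.
  by apply: ler_wpM2l; [apply: mulr_ge0 => //; exact: ltW|rewrite ler_nat leq_pred].
have z0 : 0 <= 2 * rho * G_psi p psi Xa * T%:R / A by rewrite !(divr_ge0, mulr_ge0)// ltW.
(* The 4 rho per step from [lpnormB_le] is twice the 2 rho in the definition of N; [expert_choice]
   allows for this factor 2. *)
have BA : B <= (1 + 2 * (2 * rho * G_psi p psi Xa * T%:R / A)) * A.
  rewrite mulrDl mul1r lerD2l; apply: le_trans (ler_wpM2l Gp0 pathle) _.
  by rewrite le_eqVlt; apply/orP; left; apply/eqP; field; rewrite gt_eqF.
have [k [kA Bk]] := expert_choice A0 z0 AB BA.
have cf t : (t < T)%N -> continuous (f t) by move=> tT; apply: convex_continuous; exact: cvf.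
have vf t : (t < T)%N -> forall x y h, X x -> X y -> 0 <= h -> h <= 1 ->
    f t (x + h *: (y - x)) <= f t x + h * (f t y - f t x).
  by move=> tT x y h _ _; apply: convex_function_segment; exact: cvf.
have := expected_regret cX p1 q1 r0 lambda0 n2 T1 vX rX Xrho alpha0 alpha1 dpsi sc gamma0 eta0 cf vf G0 lf Xy1
  rs us ind Xu (k := k) erefl.
rewrite -muE => /le_trans; apply; rewrite lee_fin.
(* The supremum of the divergence and [F_psi] are replaced by A, which turns the numerator into
   B. *)
apply: (@le_trans _ _ (B / eta k + 2 * 2 ^+ k / gamma + T%:R * (24 * G * mu * c_mu p q n.+1 r rho
    + (eta k / (2 * lambda) + 32 * gamma * rho ^+ 2) * (4 ^+ 9 * G ^+ 2 * xi p q n.+1)))).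
  rewrite 2!lerD2r; apply: ler_wpM2r; first by rewrite invr_ge0 ltW.
  rewrite lerD2r addrC; apply: le_trans FA.
  by rewrite lerDl mulr_ge0 ?sqr_ge0// le_max ler01.
apply: (tuned_regret (A := A)) => //.
- by rewrite ler1n.
- have h : mu <= rho * Num.sqrt (xi p q n.+1) / (Num.sqrt (lambda * T%:R) * c_mu p q n.+1 r rho).
    by rewrite /mu ge_min lexx.
  apply: le_trans (ler_wpM2r (ltW c1) h) _.
  by rewrite invfM mulrA divfK// gt_eqF.
- by rewrite -natrX ler1n expn_gt0.
Qed.
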